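(* Let $q\in(2,\infty)$, $\varepsilon>0$, and let $u^0\in W_q^2(I)$, $I=(-1,1)$, satisfy $u^0(\pm1)=0$ and $0\ge u^0(x)>-1$ for $x\in I$. If $\lambda>1/\varepsilon$ and $(u,\psi)$ denotes the maximal solution to the free boundary problem (FBP) (stated in the context) with parameters $\varepsilon,\lambda$ and initial value $u^0$, defined on its maximal interval of existence $[0,T_m^\varepsilon)$, then $T_m^\varepsilon<\infty$.
   Context: Let $I=(-1,1)$. For a function $v:[-1,1]\to(-1,\infty)$ put $\Omega(v)=\{(x,z)\in I\times(-1,\infty): -1<z<v(x)\}$. For $\varepsilon>0$, $\lambda>0$ and an initial value $u^0$, the free boundary problem (FBP) for $u=u(t,x)$ and $\psi=\psi(t,x,z)$ is: $$\partial_t u-\partial_x\left(\frac{\partial_x u}{\sqrt{1+\varepsilon^2(\partial_x u)^2}}\right)=-\lambda\left(\varepsilon^2|\partial_x\psi(t,x,u(t,x))|^2+|\partial_z\psi(t,x,u(t,x))|^2\right),\quad t>0,\ x\in I,$$ $$u(t,\pm1)=0,\ t>0,\qquad u(0,x)=u^0(x),\ x\in I,$$ $$\varepsilon^2\partial_x^2\psi+\partial_z^2\psi=0,\quad (x,z)\in\Omega(u(t)),\ t>0,$$ $$\psi(t,x,z)=\frac{1+z}{1+u(t,x)},\quad (x,z)\in\partial\Omega(u(t)),\ t>0.$$ (So $\psi=0$ on the bottom $z=-1$, $\psi=1$ on the top $z=u(t,x)$, and $\psi=1+z$ on the lateral sides $x=\pm1$.) Boundary values of first derivatives of $\psi(t)\in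 W_2^2(\Omega(u(t)))$ are understood as traces. Local well-posedness (known from earlier work, and serving to define the maximal solution): for $q\in(2,\infty)$, $\varepsilon>0$, $\lambda>0$ and $u^0\in W_q^2(I)$ with $u^0(\pm1)=0$ and $0\ge u^0>-1$ in $I$, there is a unique maximal solution $(u,\psi)$ to (FBP) on a maximal interval of existence $[0,T_m^\varepsilon)$, in the sense that $u\in C^1([0,T_m^\varepsilon),L_q(I))\cap C([0,T_m^\varepsilon),W_q^2(I))$ satisfies the evolution equation, boundary conditions and initial condition for $u$, $0\ge u(t,x)>-1$ for $(t,x)\in[0,T_m^\varepsilon)\times I$, and $\psi(t)\in W_2^2(\Omega(u(t)))$ solves the elliptic boundary value problem for each $t\in[0,T_m^\varepsilon)$. *)

(* Defs.v *)
From HB Require Import structures.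
From mathcomp Require Import all_boot all_order all_algebra.
From mathcomp Require Import all_classical all_reals all_analysis.
Set Implicit Arguments.
Unset Strict Implicit.
Unset Printing Implicit Defensive.
Import Order.TTheory GRing.Theory Num.Theory.
Import numFieldNormedType.Exports.
Local Open Scope classical_set_scope.
Local Open Scope ring_scope.

Section test_functions.
Context {R : realType} {V : normedModType R}.

Definition smooth (f : V -> R) : Prop :=
  forall (s : seq V) (x : V),
    differentiable (foldr (fun v g => 'D_v g) f s) x.

Definition test_function (D : set V) (f : V -> R) : Prop :=
  smooth f /\
  exists2 K : set V, compact K /\ K `<=` D & forall x, ~ K x -> f x = 0.

End test_functions.

Section free_boundary_problem.
Context {R : realType}.
Implicit Types (q eps lam t x : R) (T : \bar R) (f g v : R -> R).

Local Notation mu := (@lebesgue_measure R).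
Local Notation mu2 := (mu \x mu)%E.

Definition itvI : set R := `]-1, 1[.

(* An element of L_p(D) is a function known up to null sets of D; its values
   outside D are irrelevant, since only its extension by 0 is used. *)

Definition Lp_on d (X : measurableType d) (m : {measure set X -> \bar R})
    (D : set X) (p : R) (f : X -> R) : Prop :=
  f \_ D \in Lfun m p%:E.

Definition norm_on d (X : measurableType d) (m : {measure set X -> \bar R})
    (D : set X) (p : R) (f : X -> R) : \bar R :=
  'N[m]_(p%:E)[EFin \o (f \_ D)].

(* f is in W^1_p(-1, 1) and g is its weak derivative. *)
Definition weak_deriv p f g : Prop :=
  [/\ Lp_on mu itvI p f, Lp_on mu itvI p g &
      forall phi : R -> R, test_function itvI phi ->
        \int[mu]_(x in itvI) (f x * 'D_1 phi x) =
        - \int[mu]_(x in itvI) (g x * phi x)].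

(* f and g are in L_p(D) and g is the weak derivative of f in direction e. *)
Definition weak_partial (D : set (R * R)) (p : R) (e : R * R)
    (f g : R * R -> R) : Prop :=
  [/\ Lp_on mu2 D p f, Lp_on mu2 D p g &
      forall phi : R * R -> R, test_function D phi ->
        \int[mu2]_(y in D) (f y * 'D_e phi y) =
        - \int[mu2]_(y in D) (g y * phi y)].

Definition e_x : R * R := (1, 0).
Definition e_z : R * R := (0, 1).

(* W^2_q(-1, 1), each class being represented by its representative that is
   continuous on [-1, 1]. *)
Definition W2 q f : Prop :=
  {within `[-1, 1], continuous f} /\
  exists g h, weak_deriv q f g /\ weak_deriv q g h.

Definition Omega v : set (R * R) :=
  [set y | itvI y.1 /\ -1 < y.2 < v y.1].

(* h is the trace of f on the top {z = v x} of Omega v, as a function of x in (-1, 1):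
   the restriction operator on smooth functions, extended by density to
   W^1_2(Omega v). *)
Definition top_trace v (f : R * R -> R) (h : R -> R) : Prop :=
  exists fx fz : R * R -> R,
  [/\ weak_partial (Omega v) 2 e_x f fx,
      weak_partial (Omega v) 2 e_z f fz,
      Lp_on mu itvI 2 h &
      exists phi : nat -> R * R -> R,
      [/\ forall n, smooth (phi n),
          norm_on mu2 (Omega v) 2 (phi n \- f) @[n --> \oo] --> 0%E,
          norm_on mu2 (Omega v) 2 ('D_e_x (phi n) \- fx) @[n --> \oo] --> 0%E,
          norm_on mu2 (Omega v) 2 ('D_e_z (phi n) \- fz) @[n --> \oo] --> 0%E &
          norm_on mu itvI 2 (fun x => phi n (x, v x) - h x) @[n --> \oo]
            --> 0%E]].

(* hx and hz are the traces of the first derivatives of psi on {z = v x}. *)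
Definition top_grad_trace v (psi : R * R -> R) (hx hz : R -> R) : Prop :=
  exists px pz : R * R -> R,
  [/\ weak_partial (Omega v) 2 e_x psi px, weak_partial (Omega v) 2 e_z psi pz,
      top_trace v px hx & top_trace v pz hz].

(* psi is in W^2_2(Omega v) and solves the elliptic problem there; psi is the
   representative that is continuous on the closure of Omega v. *)
Definition elliptic_solution eps v (psi : R * R -> R) : Prop :=
  [/\ {within closure (Omega v), continuous psi},
      exists px pz pxx pxz pzz : R * R -> R,
      [/\ weak_partial (Omega v) 2 e_x psi px /\
          weak_partial (Omega v) 2 e_z psi pz,
          weak_partial (Omega v) 2 e_x px pxx /\
          weak_partial (Omega v) 2 e_z px pxz,
          weak_partial (Omega v) 2 e_x pz pxz /\
          weak_partial (Omega v) 2 e_z pz pzz &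
          {ae mu2, forall y, Omega v y -> eps ^+ 2 * pxx y + pzz y = 0}] &
      forall y, (closure (Omega v) `\` (Omega v)°) y ->
        psi y = (1 + y.2) / (1 + v y.1)].

Definition time_interval T : set R := [set t | 0 <= t /\ (t%:E < T)%E].

(* f is in C([0, T), L_q(-1, 1)) *)
Definition continuous_Lq q T (f : R -> R -> R) : Prop :=
  forall t, time_interval T t ->
    Lp_on mu itvI q (f t) /\
    norm_on mu itvI q (f s \- f t) @[s --> within (time_interval T) (nbhs t)]
      --> 0%E.

(* f : [0, T) -> L_q(-1, 1) is differentiable with derivative g, one-sided at 0. *)
Definition derivative_Lq q T (f g : R -> R -> R) : Prop :=
  forall t, time_interval T t ->
    norm_on mu itvI q (fun x => (f s x - f t x) / (s - t) - g t x)
      @[s --> within (time_interval T) t^'] --> 0%E.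

Definition is_solution q eps lam (u0 : R -> R) T
    (u : R -> R -> R) (psi : R -> R * R -> R) : Prop :=
  (forall t, time_interval T t ->
    [/\ W2 q (u t),
        forall x, itvI x -> -1 < u t x <= 0 &
        elliptic_solution eps (u t) (psi t)]) /\
  (forall x, itvI x -> u 0 x = u0 x) /\
  (forall t, 0 < t -> time_interval T t -> u t (-1) = 0 /\ u t 1 = 0) /\
  exists ut ux uxx : R -> R -> R,
  [/\ continuous_Lq q T u /\ (derivative_Lq q T u ut /\ continuous_Lq q T ut),
      forall t, time_interval T t ->
        weak_deriv q (u t) (ux t) /\ weak_deriv q (ux t) (uxx t),
      continuous_Lq q T ux /\ continuous_Lq q T uxx &
      forall t, 0 < t -> time_interval T t ->
      exists flux' hx hz : R -> R,
      [/\ weak_deriv q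
            (fun x => ux t x / Num.sqrt (1 + eps ^+ 2 * ux t x ^+ 2)) flux',
          top_grad_trace (u t) (psi t) hx hz &
          {ae mu, forall x, itvI x ->
            ut t x - flux' x = - lam * (eps ^+ 2 * hx x ^+ 2 + hz x ^+ 2)}]].

Definition is_maximal_solution q eps lam (u0 : R -> R) T
    (u : R -> R -> R) (psi : R -> R * R -> R) : Prop :=
  [/\ (0 < T)%E, is_solution q eps lam u0 T u psi &
      forall (T' : \bar R) (u' : R -> R -> R) (psi' : R -> R * R -> R),
        (T <= T')%E -> is_solution q eps lam u0 T' u' psi' ->
        (forall t, time_interval T t ->
          (forall x, `[-1, 1]%classic x -> u' t x = u t x) /\
          (forall y, closure (Omega (u t)) y -> psi' t y = psi t y)) ->
        T' = T].

End free_boundary_problem.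

(* Main.v *)
(* If the solution were global, its mass m(t), the integral of u(t), would stay in
   [-2, 0] while m' <= 2 / eps - 2 lam < 0. Indeed the curvature flux is bounded by
   1 / eps, so all that is needed is that the integral over (-1, 1) of
   eps^2 psi_x^2 + psi_z^2, taken on the top, is at least 2, at each fixed time.
   Write v = u(t), G = 1 + eps^2 v'^2, and gamma for the trace of psi_z; since
   psi = 1 on the top, psi_x = - v' gamma there and the integrand is G gamma^2.
   The excess w = psi - (1 + z) vanishes on the bottom and the sides and equals
   - v >= 0 on the top, hence w >= 0 by the maximum principle. Testing the equation
   for w with 1 (approximated by concave cutoffs, as w >= 0) gives that the integral
   of G gamma - 1 is nonnegative; testing it with w_z (Rellich) gives that the
   integral of G gamma^2 - 2 G gamma + 1 is nonnegative. Hence the integral of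
   G gamma^2 is at least that of 2 G gamma - 1, which is at least 2. *)
Require Import Defs.
From mathcomp Require Import all_boot all_order all_algebra.
From mathcomp Require Import all_classical all_reals all_analysis.
From mathcomp Require Import measurable_realfun ring lra.
Set Implicit Arguments.
Unset Strict Implicit.
Unset Printing Implicit Defensive.
Import Order.TTheory GRing.Theory Num.Theory.
Import numFieldNormedType.Exports.
Local Open Scope classical_set_scope.
Local Open Scope ring_scope.

(** * Smooth functions *)

(** The difficulty is low regularity. The first derivatives of [psi] lie only in [W^1_2], and their
    traces are given on the top alone, as mean-square limits of smooth functions. The weights put on
    these derivatives therefore vanish at the bottom and on the sides, and the boundary layers
    created in this way are removed with barriers: the excess [w] is at most a constant times the
    distance to the bottom and to each side, which compensates cutoff slopes of the order of the
    inverse width. At the sides this linear decay rests on [v] being [C^1] up to the endpoints.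
    Rellich's method yields an inequality because the bottom contributes a layer term in [w_z^2],
    which is nonnegative and dropped. The other layer terms vanish in the limit, since [w_x] is
    tangential at the bottom and [w_z] on the sides. Boundary values of [w] are pointwise, those of
    its gradient are mean-square limits; the two are linked by integrating along almost every
    vertical line. The maximum principle uses only continuity up to the boundary and the equation in
    the sense of distributions. *)

Section algebra_of_smooth_functions.
Context {R : realType} {V : normedModType R}.
Implicit Types (f g : V -> R) (x v : V).

(** [smooth] quantifies over all iterated directional derivatives, so it is proved by exhibiting a
    class of differentiable functions stable under derivation. The algebra generated by a few
    functions is such a class as soon as the derivatives of the generators fall back into it. *)
Inductive alg_span (G : (V -> R) -> Prop) : (V -> R) -> Prop :=
| alg_gen f : G f -> alg_span G f
| alg_cst c : alg_span G (fun=> c)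
| alg_add f g : alg_span G f -> alg_span G g -> alg_span G (fun x => f x + g x)
| alg_mul f g : alg_span G f -> alg_span G g -> alg_span G (fun x => f x * g x).

Lemma smooth_differentiable f x : smooth f -> differentiable f x.
Proof. by move=> /(_ [::] x). Qed.

Lemma smooth_derive v f : smooth f -> smooth ('D_v f).
Proof. by move=> sf s x; have := sf (rcons s v) x; rewrite foldr_rcons. Qed.

Lemma smooth_is_derive x v f : smooth f -> is_derive x v f ('D_v f x).
Proof.
by move=> sf; apply: derivableP; apply: diff_derivable; exact: smooth_differentiable.
Qed.

Lemma coinductive_smooth (S : (V -> R) -> Prop) :
  (forall f, S f -> (forall x, differentiable f x) /\ forall v, S ('D_v f)) ->
  forall f, S f -> smooth f.
Proof.
move=> HS f Sf s x; suff: S (foldr (fun v g => 'D_v g) f s) by move=> /HS[].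
by elim: s => //= v s; move=> /HS[_]; exact.
Qed.

(** Linearity and Leibniz's rule settle constants, sums and products once and for all; only the
    generators remain to be examined. *)
Lemma alg_span_smooth (G : (V -> R) -> Prop) :
  (forall f, G f ->
    (forall x, differentiable f x) /\ forall v, alg_span G ('D_v f)) ->
  forall f, alg_span G f -> smooth f.
Proof.
move=> HG; apply: coinductive_smooth => f; elim.
- by move=> {}f Gf; exact: HG.
- move=> c; split=> [x|v]; first exact: differentiable_cst.
  have -> : 'D_v (fun=> c) = fun _ : V => 0 :> R.
    by apply/funext => x; exact: derive_cst.
  exact: alg_cst.
- move=> {}f g fG [df Df] gG [dg Dg]; split=> [x|v].
    exact: differentiableD.
  have -> : 'D_v (fun x => f x + g x) = fun x => 'D_v f x + 'D_v g x.
    by apply/funext => x; apply: deriveD; exact: diff_derivable.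
  exact: alg_add.
- move=> {}f g fG [df Df] gG [dg Dg]; split=> [x|v].
    exact: differentiableM.
  have -> : 'D_v (fun x => f x * g x) = fun x => f x * 'D_v g x + g x * 'D_v f x.
    by apply/funext => x; apply: deriveM; exact: diff_derivable.
  by apply: alg_add; apply: alg_mul.
Qed.

Lemma smooth_alg f : alg_span smooth f -> smooth f.
Proof.
apply: alg_span_smooth => {}f sf; split=> [x|v].
  exact: smooth_differentiable.
by apply: alg_gen; exact: smooth_derive.
Qed.

Lemma smooth_cst (c : R) : smooth (fun _ : V => c).
Proof. by apply: smooth_alg; exact: alg_cst. Qed.

Lemma smoothD f g : smooth f -> smooth g -> smooth (fun x => f x + g x).
Proof. by move=> sf sg; apply: smooth_alg; apply: alg_add; exact: alg_gen. Qed.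

Lemma smoothM f g : smooth f -> smooth g -> smooth (fun x => f x * g x).
Proof. by move=> sf sg; apply: smooth_alg; apply: alg_mul; exact: alg_gen. Qed.

Lemma smoothZ c f : smooth f -> smooth (fun x => c * f x).
Proof. by move=> sf; apply: smoothM => //; exact: smooth_cst. Qed.

Lemma smoothN f : smooth f -> smooth (fun x => - f x).
Proof.
by move=> sf; rewrite (_ : (fun x => _) = fun x => -1 * f x);
  [exact: smoothZ|apply/funext => x; rewrite mulN1r].
Qed.

Lemma smoothB f g : smooth f -> smooth g -> smooth (fun x => f x - g x).
Proof. by move=> sf sg; apply: smoothD => //; exact: smoothN. Qed.

Lemma smoothX f n : smooth f -> smooth (fun x => f x ^+ n).
Proof.
move=> sf; elim: n => [|n ih].
  by under eq_fun do rewrite expr0; exact: smooth_cst.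
by under eq_fun do rewrite exprS; exact: smoothM.
Qed.

Lemma is_derive_comp1 (F : R -> R) (p : V -> R) x v dF dp :
  is_derive (p x) 1 F dF -> differentiable p x -> is_derive x v p dp ->
  is_derive x v (fun y => F (p y)) (dF * dp).
Proof.
move=> [dF1 dF2] dfp [_ dp2].
have dfF : differentiable F (p x) by exact/derivable1_diffP.
split; first exact/diff_derivable/differentiable_comp.
rewrite deriveE; last exact: differentiable_comp.
rewrite diff_comp//= -(deriveE _ dfp) dp2.
rewrite -[in LHS](mulr1 dp) -[dp * 1]/(dp *: 1) linearZ /=.
by rewrite -deriveE// dF2 mulrC.
Qed.

End algebra_of_smooth_functions.

Section composition_of_smooth_functions.
Context {R : realType} {V : normedModType R}.
Implicit Types (f g : V -> R) (x v : V).

Lemma smooth_comp (F : R -> R) (p : V -> R) :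
  smooth F -> smooth p -> smooth (fun y => F (p y)).
Proof.
move=> sF sp.
(* All compositions with [p] are generators, since by the chain rule the derivative of one is
   another, built on ['D_1 H], times the smooth function ['D_v p]. *)
pose G f := smooth f \/ exists2 H, smooth H & f = fun y => H (p y).
apply: (@alg_span_smooth _ _ G); last by apply: alg_gen; right; exists F.
move=> f [sf|[H sH ->]].
  split=> [x|v]; first exact: smooth_differentiable.
  by apply: alg_gen; left; exact: smooth_derive.
split=> [x|v].
  apply: differentiable_comp; first exact: smooth_differentiable.
  exact: smooth_differentiable.
have -> : 'D_v (fun y => H (p y)) = fun y => 'D_1 H (p y) * 'D_v p y.
  apply/funext => x; have [_ ->//] := is_derive_comp1
    (smooth_is_derive (p x) 1 sH) (smooth_differentiable x sp)
    (smooth_is_derive x v sp).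
apply: alg_mul; apply: alg_gen.
  by right; exists ('D_1 H) => //; exact: smooth_derive.
by left; exact: smooth_derive.
Qed.

Lemma smoothV (p : V -> R) : smooth p -> (forall y, p y != 0) ->
  smooth (fun y => (p y)^-1).
Proof.
move=> sp p0.
pose G f := smooth f \/ f = fun y => (p y)^-1.
apply: (@alg_span_smooth _ _ G); last by apply: alg_gen; right.
move=> f [sf|->].
  split=> [x|v]; first exact: smooth_differentiable.
  by apply: alg_gen; left; exact: smooth_derive.
split=> [x|v].
  by apply: differentiableV => //; exact: smooth_differentiable.
have -> : 'D_v (fun y => (p y)^-1) = fun y => -1 * ((p y)^-1 * (p y)^-1 * 'D_v p y).
  apply/funext => x; rewrite deriveV//; last by have [] := smooth_is_derive x v sp.
  by rewrite mulN1r -exprVn expr2 scaleNr.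
apply: alg_mul; first exact: alg_cst.
apply: alg_mul; last by apply: alg_gen; left; exact: smooth_derive.
by apply: alg_mul; apply: alg_gen; right.
Qed.

Lemma smooth_ln (p : V -> R) : smooth p -> (forall y, 0 < p y) ->
  smooth (fun y => ln (p y)).
Proof.
move=> sp p0.
pose G f := smooth f \/ f = fun y => ln (p y).
apply: (@alg_span_smooth _ _ G); last by apply: alg_gen; right.
move=> f [sf|->].
  split=> [x|v]; first exact: smooth_differentiable.
  by apply: alg_gen; left; exact: smooth_derive.
have dln x v := is_derive_comp1 (is_derive1_ln (p0 x)) (smooth_differentiable x sp)
    (smooth_is_derive x v sp).
split=> [x|v].
  apply: differentiable_comp; first exact: smooth_differentiable.
  by apply/derivable1_diffP; have [] := is_derive1_ln (p0 x).
have -> : 'D_v (fun y => ln (p y)) = fun y => (p y)^-1 * 'D_v p y.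
  by apply/funext => x; have [_ ->] := dln x v.
apply: alg_mul; apply: alg_gen; left; last exact: smooth_derive.
by apply: smoothV => // y; rewrite gt_eqF.
Qed.

Lemma smooth_lin (l : V -> R) (d : V -> R) :
  (forall x v, is_derive x v l (d v)) -> (forall x, differentiable l x) ->
  smooth l.
Proof.
move=> dl dfl; pose G f := f = l.
apply: (@alg_span_smooth _ _ G); last exact: alg_gen.
move=> f ->; split=> // v.
have -> : 'D_v l = fun=> d v by apply/funext => x; have [_ ->] := dl x v.
exact: alg_cst.
Qed.

Lemma smooth_continuous f : smooth f -> continuous f.
Proof.
by move=> sf x; apply: differentiable_continuous; exact: smooth_differentiable.
Qed.

End composition_of_smooth_functions.

Section plane.
Context {R : realType}.

Lemma is_diff_fst (x : R * R) : is_diff x (fst : R * R -> R) (fst : R * R -> R).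
Proof.
apply: DiffDef.
  by apply: (@linear_differentiable _ _ _ fst) => z; exact: cvg_fst.
by rewrite (@diff_lin _ _ _ fst) // => z; exact: cvg_fst.
Qed.

Lemma is_diff_snd (x : R * R) : is_diff x (snd : R * R -> R) (snd : R * R -> R).
Proof.
apply: DiffDef.
  by apply: (@linear_differentiable _ _ _ snd) => z; exact: cvg_snd.
by rewrite (@diff_lin _ _ _ snd) // => z; exact: cvg_snd.
Qed.

Lemma differentiable_fst (x : R * R) : differentiable (fst : R * R -> R) x.
Proof. by have [] := is_diff_fst x. Qed.

Lemma differentiable_snd (x : R * R) : differentiable (snd : R * R -> R) x.
Proof. by have [] := is_diff_snd x. Qed.

Lemma is_derive_fst (x v : R * R) : is_derive x v (fst : R * R -> R) v.1.
Proof.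
have [df dv] := is_diff_fst x; split; first exact: diff_derivable.
by rewrite deriveE// dv.
Qed.

Lemma is_derive_snd (x v : R * R) : is_derive x v (snd : R * R -> R) v.2.
Proof.
have [df dv] := is_diff_snd x; split; first exact: diff_derivable.
by rewrite deriveE// dv.
Qed.

Lemma smooth_fst : smooth (fst : R * R -> R).
Proof.
apply: (@smooth_lin _ _ _ fst) => [x v|x].
  exact: is_derive_fst.
exact: differentiable_fst.
Qed.

Lemma smooth_snd : smooth (snd : R * R -> R).
Proof.
apply: (@smooth_lin _ _ _ snd) => [x v|x].
  exact: is_derive_snd.
exact: differentiable_snd.
Qed.

Lemma smooth_id : smooth (id : R -> R).
Proof.
have dl (x v : R) : is_derive x v (id : R -> R) (id v) by exact: is_derive_id.
have df (x : R) : differentiable (id : R -> R) x by have [] := is_diff_id x.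
exact: (smooth_lin dl df).
Qed.

End plane.

(** * Functions flat at the origin *)

Section exp_inv.
Context {R : realType}.
Implicit Types t : R.

(** The index [k] is carried along because differentiation maps member [k] to a combination of
    members [k.+1] and [k.+2]: the whole family is proved smooth at once. *)
Definition expinv k t : R := if 0 < t then t ^- k * expR (- t^-1) else 0.

Lemma expR_Ninv_le n t : 0 < t -> expR (- t^-1) <= n.+1`!%:R * t ^+ n.+1.
Proof.
move=> t0; rewrite expRN -[leRHS]invrK lef_pV2 ?posrE ?expR_gt0//; last first.
  by rewrite invr_gt0 mulr_gt0 ?exprn_gt0// ltr0n fact_gt0.
have := @expR_ge1Dxn _ t^-1 n; rewrite invr_ge0 => /(_ (ltW t0)).
apply: le_trans; rewrite invfM exprVn mulrC.
by rewrite lerDr.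
Qed.

Lemma expinv_le k n t : `|expinv k t| <= (k + n).+1`!%:R * `|t| ^+ n.+1.
Proof.
rewrite /expinv; case: ifPn => [t0|_]; last first.
  by rewrite normr0 mulr_ge0 ?ler0n ?exprn_ge0.
rewrite !gtr0_norm ?mulr_gt0 ?invr_gt0 ?exprn_gt0 ?expR_gt0//.
rewrite ler_pdivrMl ?exprn_gt0// (le_trans (expR_Ninv_le (k + n) t0))//.
by rewrite mulrCA -exprD addnS.
Qed.

Lemma is_derive_expinv k t :
  is_derive t 1 (expinv k) (expinv k.+2 t - k%:R * expinv k.+1 t).
Proof.
have [t0|t0|->] := ltgtP t 0.
- have -> : expinv k.+2 t - k%:R * expinv k.+1 t = 0.
    by rewrite /expinv ltNge (ltW t0)/= mulr0 subr0.
  have nE : \forall s \near t, (fun=> 0) s = expinv k s.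
    near=> s; rewrite /expinv ltNge ifF//.
    by apply/negbTE; rewrite negbK ltW//; near: s; exact: lt_nbhsl.
  exact: near_eq_is_derive nE (is_derive_cst _ _ _).
- have -> : expinv k.+2 t - k%:R * expinv k.+1 t =
     t ^- k * (expR (- t^-1) * (t ^- 2)) + expR (- t^-1) * (- (k%:R * t ^- k.+1)).
    rewrite /expinv t0 -(addn2 k) exprD invfM; ring.
  have nE : \forall s \near t, (fun s => s ^- k * expR (- s^-1)) s = expinv k s.
    by near=> s; rewrite /expinv ifT//; near: s; exact: lt_nbhsr.
  apply: near_eq_is_derive nE _.
  have tn0 : t != 0 by rewrite gt_eqF.
  have d1 : is_derive t 1 (fun s : R => s^-1) (- t ^- 2).
    split; first by apply: derivableV => //; exact: derivable_id.
    by rewrite deriveV// derive_id scaler1.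
  have dk : is_derive t 1 (fun s : R => s ^- k) (- (k%:R * t ^- k.+1)).
    have -> : (fun s : R => s ^- k) = (fun s : R => s^-1) ^+ k.
      by apply/funext => s; rewrite -exprVn; elim: (k) => // n ih; rewrite !exprS ih.
    apply: is_derive_eq (is_deriveX k d1) _.
    case: (k) => [|n]; first by rewrite !mul0r scale0r oppr0.
    rewrite /= scalerN; congr (- _); rewrite -[LHS]mulrA; congr (_ * _).
    by rewrite exprVn -invfM -exprD addn2.
  have dN : is_derive t 1 (fun s : R => - s^-1) (t ^- 2).
    by have := is_deriveN d1; rewrite opprK.
  have dE : is_derive t 1 (fun s : R => expR (- s^-1)) (expR (- t^-1) * t ^- 2).
    apply: (@is_derive_comp1 _ _ expR _ t 1 _ _ _ _ dN).
    by apply/derivable1_diffP; have [] := dN.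
  exact: is_deriveM dk dE.
- have -> : expinv k.+2 0 - k%:R * expinv k.+1 0 = 0 :> R.
    by rewrite /expinv ltxx mulr0 subr0.
  have e0 : expinv k 0 = 0 :> R by rewrite /expinv ltxx.
  have cv : (fun h => h^-1 *: ((expinv k \o shift 0) (h *: 1) - expinv k 0)) @ 0^' --> (0 : R).
    apply/cvgr0Pnorm_le => e e0'; near=> h.
    rewrite e0 subr0 /= scaler1 addr0 normrM normfV.
    have h0 : h != 0 by near: h; exact: nbhs_dnbhs_neq.
    rewrite ler_pdivrMl ?normr_gt0//.
    (* Flatness of order two, that is [n = 1], leaves a factor [|h|] after division by [h]. *)
    apply: (le_trans (expinv_le k 1 h)); rewrite expr2 mulrA mulrC ler_pM2l ?normr_gt0//.
    rewrite -ler_pdivlMl ?ltr0n ?fact_gt0//; near: h.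
    apply: cvgr0_norm_le; last by rewrite mulr_gt0// invr_gt0 ltr0n fact_gt0.
    exact: nbhs_dnbhs.
  by split; [apply/cvg_ex; exists 0|exact/cvg_lim].
Unshelve. all: by end_near. Qed.

Lemma smooth_expinv k : smooth (expinv k).
Proof.
pose G f := exists k, f = expinv k.
apply: (@alg_span_smooth _ _ G); last by apply: alg_gen; exists k.
move=> _ [j ->]; split=> [x|v].
  by apply/derivable1_diffP; have [] := is_derive_expinv j x.
have -> : 'D_v (expinv j) = fun t => v * (expinv j.+2 t + (- j%:R) * expinv j.+1 t).
  apply/funext => x.
  have [d1 d2] := is_derive_expinv j x.
  have df : differentiable (expinv j) x by exact/derivable1_diffP.
  rewrite mulNr -d2 !deriveE// -[in LHS](mulr1 v) -[v * 1]/(v *: 1).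
  by rewrite linearZ.
apply: alg_mul; first exact: alg_cst.
apply: alg_add; first by apply: alg_gen; exists j.+2.
by apply: alg_mul; [exact: alg_cst|apply: alg_gen; exists j.+1].
Qed.

End exp_inv.

Section bumps.
Context {R : realType}.
Implicit Types s t x : R.

Lemma expinv_ge0 k t : 0 <= expinv k t.
Proof.
rewrite /expinv; case: ifPn => // t0.
by rewrite mulr_ge0 ?expR_ge0// invr_ge0 exprn_ge0// ltW.
Qed.

Lemma expinv_le0 k t : t <= 0 -> expinv k t = 0.
Proof. by move=> t0; rewrite /expinv ltNge t0. Qed.

Lemma expinv0_gt0 t : (0 < expinv 0 t) = (0 < t).
Proof.
have [t0|t0] := ltP 0 t; last by rewrite expinv_le0// ltxx.
by rewrite /expinv t0 expr0 invr1 mul1r expR_gt0.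
Qed.

Lemma expinv0_homo s t : s <= t -> expinv 0 s <= expinv 0 t.
Proof.
move=> st; have [s0|s0] := ltP 0 s; last by rewrite expinv_le0// expinv_ge0.
rewrite /expinv s0 (lt_le_trans s0 st) !expr0 invr1 !mul1r ler_expR lerN2.
by rewrite lef_pV2 ?posrE// (lt_le_trans s0).
Qed.

Definition step t := expinv 0 t / (expinv 0 t + expinv 0 (1 - t)).

Lemma step_den t : 0 < expinv 0 t + expinv 0 (1 - t).
Proof.
have [t0|t0] := ltP 0 t.
  by rewrite ltr_pwDl ?expinv0_gt0// expinv_ge0.
by rewrite ltr_wpDl ?expinv_ge0// expinv0_gt0; lra.
Qed.

Lemma smooth_onem : smooth (fun t : R => 1 - t).
Proof. by apply: smoothB; [exact: smooth_cst|exact: smooth_id]. Qed.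

Lemma smooth_step : smooth step.
Proof.
apply: smoothM; first exact: smooth_expinv.
apply: smoothV => [|t]; last by rewrite gt_eqF// step_den.
apply: smoothD; first exact: smooth_expinv.
exact: (smooth_comp (smooth_expinv 0) smooth_onem).
Qed.

Lemma step_ge0 t : 0 <= step t.
Proof. by rewrite divr_ge0 ?expinv_ge0// ltW// step_den. Qed.

Lemma step_le1 t : step t <= 1.
Proof. by rewrite ler_pdivrMr ?step_den// mul1r lerDl expinv_ge0. Qed.

Lemma step_le0 t : t <= 0 -> step t = 0.
Proof. by move=> t0; rewrite /step expinv_le0// mul0r. Qed.

Lemma step_ge1 t : 1 <= t -> step t = 1.
Proof.
move=> t1; rewrite /step (@expinv_le0 _ (1 - t)) ?subr_le0// addr0 divff//.
by rewrite gt_eqF// expinv0_gt0 (lt_le_trans _ t1).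
Qed.

(** The reflection [1 - t] turns the minus sign of the quotient rule into a plus, so the numerator
    is a sum of two nonnegative products, both vanishing outside [(0, 1)]. Sign and support of the
    derivative are read off this form. *)
Lemma derive_step t : 'D_1 step t =
  (expinv 2 t * expinv 0 (1 - t) + expinv 0 t * expinv 2 (1 - t)) /
  (expinv 0 t + expinv 0 (1 - t)) ^+ 2.
Proof.
have d1 : is_derive t 1 (expinv 0) (expinv 2 t).
  by have := is_derive_expinv 0 t; rewrite mul0r subr0.
have dB : is_derive t 1 (fun s : R => 1 - s) (- 1).
  have := is_deriveB (is_derive_cst (1 : R) t 1) (is_derive_id t 1).
  by rewrite sub0r.
have d2 : is_derive t 1 (fun s => expinv 0 (1 - s)) (expinv 2 (1 - t) * -1).
  apply: (is_derive_comp1 _ _ dB).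
    by have := is_derive_expinv 0 (1 - t); rewrite mul0r subr0.
  exact: (smooth_differentiable _ smooth_onem).
have d3 := is_deriveD d1 d2.
have n0 : expinv 0 t + expinv 0 (1 - t) != 0 by rewrite gt_eqF// step_den.
have d4 : is_derive t 1 (fun s => (expinv 0 s + expinv 0 (1 - s))^-1)
    (- (expinv 0 t + expinv 0 (1 - t)) ^- 2 * (expinv 2 t + expinv 2 (1 - t) * -1)).
  case: d3 => d31 d32; split; first exact: derivableV.
  by rewrite deriveV// -d32.
have [_ ->] := is_deriveM d1 d4.
rewrite /GRing.scale /=; field.
by [].
Qed.

Lemma derive_step_ge0 t : 0 <= 'D_1 step t.
Proof.
by rewrite derive_step divr_ge0 ?sqr_ge0// addr_ge0// mulr_ge0// expinv_ge0.
Qed.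

Lemma derive_step_le0 t : t <= 0 -> 'D_1 step t = 0.
Proof.
by move=> t0; rewrite derive_step !(@expinv_le0 _ t)// !mul0r add0r mul0r.
Qed.

Lemma derive_step_ge1 t : 1 <= t -> 'D_1 step t = 0.
Proof.
move=> t1.
by rewrite derive_step !(@expinv_le0 _ (1 - t)) ?subr_le0// !mulr0 addr0 mul0r.
Qed.

End bumps.

Section smooth_bounded.
Context {R : realType} {V : normedModType R}.

Lemma smooth_bounded (f : V -> R) (K : set V) : smooth f -> compact K ->
  exists2 M : R, 0 < M & forall x, K x -> `|f x| <= M.
Proof.
move=> sf cK.
have := continuous_compact (continuous_subspaceT (smooth_continuous sf)) cK.
move=> /compact_bounded[M [_ HM]]; exists (Num.max M 0 + 1).
  by rewrite ltr_wpDl// le_max lexx orbT.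
move=> x Kx; apply: (HM (Num.max M 0 + 1)); last by exists x.
by rewrite ltr_pwDr// le_max lexx.
Qed.

End smooth_bounded.

Lemma derive_step_bounded (R : realType) :
  exists2 M : R, 0 < M & forall t : R, `|'D_1 step t| <= M.
Proof.
have [M M0 HM] := smooth_bounded (smooth_derive (1 : R) smooth_step) (@segment_compact R 0 1).
exists M => // t.
have [t0|t0] := leP t 0; first by rewrite derive_step_le0// normr0 ltW.
have [t1|t1] := leP 1 t; first by rewrite derive_step_ge1// normr0 ltW.
by apply: HM => /=; rewrite in_itv/= !ltW.
Qed.

(** * Borel measurability in the plane *)

Section plane_measurability.
Context {R : realType}.

(** The product sigma-algebra is generated by rectangles, so the open set is written as a countable
    union of rectangles with rational corners: any ball around a point contains one that surrounds
    the point. *)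
Lemma open_measurable_plane (A : set (R * R)) : open A -> measurable A.
Proof.
move=> oA.
pose rect (q : (rat * rat) * (rat * rat)) : set (R * R) :=
  `]ratr q.1.1, ratr q.1.2[%classic `*` `]ratr q.2.1, ratr q.2.2[%classic.
pose F n := if unpickle n is Some q then
  if pselect (rect q `<=` A) then rect q else set0 else set0.
have -> : A = \bigcup_n F n.
  apply/seteqP; split => [[x z] Axz|y [n _]]; last first.
    by rewrite /F; case: (unpickle n) => // q; case: pselect => // sA; exact: sA.
  have /nbhs_ballP[e /= e0 eA] := open_nbhs_nbhs (conj oA Axz).
  have rat_near (r : R) : exists p q : rat,
      r - e < ratr p < r /\ r < ratr q < r + e.
    have /rat_in_itvoo[p pr] : r - e < r by rewrite ltrBlDr ltrDl.
    have /rat_in_itvoo[q qr] : r < r + e by rewrite ltrDl.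
    by exists p, q; move: pr qr; rewrite !in_itv.
  have [p1 [q1 [/andP[a1 a2] /andP[a3 a4]]]] := rat_near x.
  have [p2 [q2 [/andP[b1 b2] /andP[b3 b4]]]] := rat_near z.
  exists (pickle ((p1, q1), (p2, q2))); [exact: I|]; rewrite /F pickleK.
  case: pselect => [sA|]; first by split; rewrite /= in_itv/= ?a2 ?b2.
  case=> -[x' z'] [/=]; rewrite !in_itv/= => /andP[c1 c2] /andP[d1 d2].
  by apply: eA; split => /=; rewrite /ball/= ltr_norml; apply/andP; split; lra.
apply: bigcupT_measurable => n; rewrite /F; case: (unpickle n) => // q.
by case: pselect => [sA|nA]; [apply: measurableX; exact: measurable_itv|exact: measurable0].
Qed.

Lemma open_continuous_measurable_plane (D : set (R * R)) (f : R * R -> R) :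
  open D -> {in D, continuous f} -> measurable_fun D f.
Proof.
move=> oD cf; apply: (measurability _ (RGenOpens.measurableE R)).
move=> _ [_ [a [b ->] <-]]; apply: open_measurable_plane.
rewrite openE => y [Dy fy]; rewrite /interior.
apply: filterI; first exact: open_nbhs_nbhs.
by apply: cf; [exact/mem_set|apply: open_nbhs_nbhs; split => //; exact: interval_open].
Qed.

Lemma smooth_measurable_plane (f : R * R -> R) : smooth f -> measurable_fun setT f.
Proof.
move=> sf; apply: open_continuous_measurable_plane; first exact: openT.
by move=> y _; exact: smooth_continuous.
Qed.

Lemma smooth_measurable (f : R -> R) : smooth f -> measurable_fun setT f.
Proof. by move=> sf; apply: continuous_measurable_fun; exact: smooth_continuous. Qed.

End plane_measurability.

(** * Integrable and square-integrable functions *)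

Section square_integrable.
Context d (X : measurableType d) (R : realType) (m : {measure set X -> \bar R}).
Variable (D : set X).
Hypothesis mD : measurable D.
Implicit Types (f g h : X -> R).

Local Notation intg f := (m.-integrable D (EFin \o f)).
Local Notation L2 := (Lp_on m D 2).

Lemma integrable_restrict_setT f : intg f <-> m.-integrable setT (EFin \o (f \_ D)).
Proof. by rewrite (integrable_mkcond _ mD) restrict_EFin. Qed.

Lemma Lp_measurable p f : Lp_on m D p f -> measurable_fun D f.
Proof.
rewrite /Lp_on inE => /andP[]; rewrite inE /= => mf _.
exact/(measurable_restrictT _ mD).
Qed.

Lemma intg_le f g : measurable_fun D f -> (forall x, D x -> `|f x| <= g x) ->
  intg g -> intg f.
Proof.
move=> mf fg; apply: le_integrable => //; first exact/measurable_EFinP.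
move=> x Dx; by rewrite /= lee_fin (le_trans (fg _ Dx))// ler_norm.
Qed.

Lemma intg_measurable f : intg f -> measurable_fun D f.
Proof. by move/(measurable_int m)/measurable_EFinP. Qed.

Lemma intgD f g : intg f -> intg g -> intg (fun x => f x + g x).
Proof. by move=> fi gi; have := integrableD mD fi gi. Qed.

Lemma intgN f : intg f -> intg (fun x => - f x).
Proof. by move=> fi; have := integrableN fi. Qed.

Lemma intgB f g : intg f -> intg g -> intg (fun x => f x - g x).
Proof. by move=> fi gi; apply: intgD => //; exact: intgN. Qed.

Lemma intgZ c f : intg f -> intg (fun x => c * f x).
Proof. by move=> fi; have := integrableZl mD c fi. Qed.

Lemma intg_norm f : intg f -> intg (fun x => `|f x|).
Proof. exact: integrable_norm. Qed.

Lemma intg_eq f g : (forall x, D x -> f x = g x) -> intg f -> intg g.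
Proof.
move=> fg; apply: eq_integrable => // x; rewrite inE => Dx.
by rewrite /= fg.
Qed.

Lemma intg_bndM (M : R) f g : measurable_fun D g -> (forall x, D x -> `|g x| <= M) ->
  intg f -> intg (fun x => g x * f x).
Proof.
move=> mg gM fi; apply: (@intg_le _ (fun x => M * `|f x|)).
- by apply: measurable_funM => //; exact: intg_measurable.
- by move=> x Dx; rewrite normrM ler_wpM2r// gM.
- by apply: intgZ; exact: intg_norm.
Qed.

Lemma intg_bnd (M : R) g : (m D < +oo)%E -> measurable_fun D g ->
  (forall x, D x -> `|g x| <= M) -> intg g.
Proof.
move=> mDoo mg gM; apply: measurable_bounded_integrable => //.
exists M; split; first exact: num_real.
by move=> M' MM' x Dx /=; rewrite (le_trans (gM _ Dx))// ltW.
Qed.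

Lemma norm_on_powR p h : 0 < p ->
  (norm_on m D p h `^ p = \int[m]_(x in D) (`|h x| `^ p)%:E)%E.
Proof.
move=> p0; rewrite /norm_on (powR_Lnorm _ _ (lt0r_neq0 p0)).
rewrite [RHS]integral_mkcond; apply: eq_integral => x _.
rewrite /= !patchE; case: ifPn => //= _.
by rewrite normr0 powR0// gt_eqF.
Qed.

Lemma L2P f : L2 f <-> measurable_fun D f /\ intg (fun x => f x ^+ 2).
Proof.
split.
  move=> lf; split; first exact: Lp_measurable lf.
  have := Lfun2_integrable_sqr lf; rewrite integrable_restrict_setT.
  apply: eq_integrable => // x _ /=; rewrite /patch.
  by case: ifPn => // _; rewrite expr0n.
move=> [mf fi]; rewrite /Lp_on inE; apply/andP; split; rewrite inE/=.
  exact/(measurable_restrictT _ mD).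
rewrite /finite_norm.
have H := @norm_on_powR 2 f (ltr0Sn _ _).
have : (norm_on m D 2 f `^ 2 < +oo)%E.
  rewrite H; move/integrableP : fi => [_]; apply: le_lt_trans.
  under [leRHS]eq_integral do rewrite /= ger0_norm ?sqr_ge0//.
  under eq_integral do rewrite powR_mulrn// real_normK ?num_real//.
  by [].
by apply: lty_poweRy; rewrite gt_eqF.
Qed.

Lemma L2_sqr f : L2 f -> intg (fun x => f x ^+ 2). Proof. by case/L2P. Qed.

Lemma L2_intgM f g : L2 f -> L2 g -> intg (fun x => f x * g x).
Proof.
move=> /L2P[mf fi] /L2P[mg gi].
apply: (@intg_le _ (fun x => f x ^+ 2 + g x ^+ 2)); last exact: intgD.
  exact: measurable_funM.
move=> x _; rewrite normrM -(real_normK (num_real (f x))).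
rewrite -(real_normK (num_real (g x))); nra.
Qed.

Lemma L2_bndM (M : R) f g : measurable_fun D g -> (forall x, D x -> `|g x| <= M) ->
  L2 f -> L2 (fun x => g x * f x).
Proof.
move=> mg gM /L2P[mf fi]; apply/L2P; split; first exact: measurable_funM.
apply: (@intg_eq (fun x => g x ^+ 2 * f x ^+ 2)).
  by move=> x _; rewrite exprMn.
apply: (@intg_bndM (M ^+ 2)) => //; first exact: measurable_funX.
by move=> x Dx; rewrite normrX lerXn2r ?nnegrE ?normr_ge0 ?gM// (le_trans _ (gM _ Dx)).
Qed.

Lemma L2_bnd (M : R) g : (m D < +oo)%E -> measurable_fun D g ->
  (forall x, D x -> `|g x| <= M) -> L2 g.
Proof.
move=> mDoo mg gM; apply/L2P; split=> //; apply: (@intg_bnd (M ^+ 2)) => //.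
  exact: measurable_funX.
by move=> x Dx; rewrite normrX lerXn2r ?nnegrE ?normr_ge0 ?gM// (le_trans _ (gM _ Dx)).
Qed.

Lemma L2D f g : L2 f -> L2 g -> L2 (fun x => f x + g x).
Proof.
move=> lf lg; have /L2P[mf fi] := lf; have /L2P[mg gi] := lg.
apply/L2P; split; first exact: measurable_funD.
apply: (@intg_eq (fun x => f x ^+ 2 + g x ^+ 2 + 2 * (f x * g x))).
  by move=> x _; ring.
by apply: intgD; [exact: intgD|apply: intgZ; exact: L2_intgM].
Qed.

Lemma L2Z c f : L2 f -> L2 (fun x => c * f x).
Proof. by apply: (@L2_bndM `|c|) => //; exact: measurable_cst. Qed.

Lemma L2N f : L2 f -> L2 (fun x => - f x).
Proof.
move=> lf; have := L2Z (-1) lf; congr (Lp_on _ _ _ _).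
by apply/funext => x; rewrite mulN1r.
Qed.

Lemma L2B f g : L2 f -> L2 g -> L2 (fun x => f x - g x).
Proof. by move=> lf lg; apply: L2D => //; exact: L2N. Qed.

Lemma L2_intg f : (m D < +oo)%E -> L2 f -> intg f.
Proof.
move=> mDoo lf; apply: (@intg_eq (fun x => 1 * f x)).
  by move=> x _; rewrite mul1r.
apply: L2_intgM => //; apply: (@L2_bnd 1) => //.
by move=> x _; rewrite normr1.
Qed.

Lemma cvg_norm_on (p : R) (T : Type) (F : set_system T) {FF : Filter F}
    (h : T -> X -> R) (e : R) : 0 < p ->
  norm_on m D p (h s) @[s --> F] --> 0%E -> 0 < e ->
  \forall s \near F, (\int[m]_(x in D) (`|h s x| `^ p)%:E <= e%:E)%E.
Proof.
move=> p0 h0 e0.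
have e'0 : 0 < e `^ p^-1 by rewrite powR_gt0.
have : \forall s \near F, (norm_on m D p (h s) < (e `^ p^-1)%:E)%E.
  by apply: (h0 [set y | (y < (e `^ p^-1)%:E)%E]); apply: open_ereal_lt'; rewrite lte_fin.
apply: filterS => s /ltW hs; rewrite -norm_on_powR//.
have -> : (e%:E = (e `^ p^-1)%:E `^ p)%E.
  by rewrite poweR_EFin -powRrM mulVf ?gt_eqF// powRr1// ltW.
apply: gt0_ler_poweR => //; first exact: ltW.
  by rewrite in_itv/= Lnorm_ge0 leey.
by rewrite in_itv/= leey lee_fin powR_ge0.
Qed.

(** On a set of finite measure [|f| <= 1 + |f|^p] is an integrable bound. *)
Lemma Lp_intg p f : (m D < +oo)%E -> 1 <= p -> Lp_on m D p f -> intg f.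
Proof.
move=> mDoo p1 lf; have mf := Lp_measurable lf.
have p0 : p != 0 by rewrite gt_eqF// (lt_le_trans _ p1).
have fi : intg (fun x => `|f x| `^ p).
  apply/integrable_restrict_setT.
  have := Lfun_integrable p1 lf; apply: eq_integrable => // x _ /=.
  by rewrite /patch; case: ifPn => // _; rewrite normr0 powR0.
apply: (@intg_le _ (fun x => 1 + `|f x| `^ p)) => //; last first.
  by apply: intgD => //; apply: (@intg_bnd 1) => // x _; rewrite normr1.
move=> x _; have [f1|f1] := leP `|f x| 1.
  by rewrite (le_trans f1)// lerDl powR_ge0.
by rewrite (le_trans (le1r_powR (ltW f1) p1))// lerDr.
Qed.

(** Pointwise [|h| <= t + t^(1-p) |h|^p], by cases on [|h| <= t]. The level [t] makes the first term
    contribute at most [e / 2] over [D]; the convergence in [L_p] brings the second one below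
    [e / 2]. *)
Lemma cvg_norm_on1 (p : R) (T : Type) (F : set_system T) {FF : Filter F}
    (h : T -> X -> R) (e : R) : (m D < +oo)%E -> 1 <= p ->
  (forall s, measurable_fun D (h s)) ->
  norm_on m D p (h s) @[s --> F] --> 0%E -> 0 < e ->
  \forall s \near F, \int[m]_(x in D) `|h s x| <= e.
Proof.
move=> mDoo p1 mh h0 e0; have p0 : 0 < p by rewrite (lt_le_trans _ p1).
set c := fine (m D); have c0 : 0 <= c by exact: fine_ge0.
have mDc : m D = c%:E by rewrite fineK// ge0_fin_numE.
pose t := e / (2 * (c + 1)).
have t0 : 0 < t by rewrite divr_gt0// mulr_gt0// ltr_wpDl.
pose k := t `^ (p - 1); have k0 : 0 < k by rewrite powR_gt0.
have ek0 : 0 < k * e / 2 by rewrite divr_gt0// mulr_gt0.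
have hev := @cvg_norm_on p T F FF h _ p0 h0 ek0.
move: hev; apply: filterS => s hs.
have mhp : measurable_fun D (fun x => `|h s x| `^ p).
  apply: (@measurableT_comp _ _ _ _ _ _ (fun x : R => x `^ p)).
    exact: measurable_powR.
  exact: measurableT_comp.
have : (\int[m]_(x in D) (`|h s x|)%:E <=
        \int[m]_(x in D) (t + k^-1 * `|h s x| `^ p)%:E)%E.
  apply: ge0_le_integral => //.
  - by apply/measurable_EFinP; exact: measurableT_comp.
  - by apply/measurable_EFinP; apply: measurable_funD => //; exact: measurable_funM.
  move=> x _; rewrite lee_fin; have [ht|ht] := leP `|h s x| t.
    by rewrite (le_trans ht)// lerDl mulr_ge0 ?powR_ge0// invr_ge0 ltW.
  rewrite (@le_trans _ _ (k^-1 * `|h s x| `^ p))//; last by rewrite lerDr ltW.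
  rewrite ler_pdivlMl// -[in leRHS](mulr_powRB1 (normr_ge0 _) p0) mulrC.
  rewrite ler_wpM2l//; apply: ge0_ler_powR; rewrite ?nnegrE ?subr_ge0//; exact: ltW.
have -> : (\int[m]_(x in D) (t + k^-1 * `|h s x| `^ p)%:E =
    (t * c)%:E + k^-1%:E * \int[m]_(x in D) (`|h s x| `^ p)%:E)%E.
  transitivity (\int[m]_(x in D) (t%:E + (k^-1 * `|h s x| `^ p)%:E))%E.
    by apply: eq_integral.
  have kp x : 0 <= k^-1 * `|h s x| `^ p.
    by rewrite mulr_ge0 ?powR_ge0// invr_ge0 ltW.
  have mkp : measurable_fun D (fun x => (k^-1 * `|h s x| `^ p)%:E).
    by apply/measurable_EFinP; exact: measurable_funM.
  have t0' : forall x : X, D x -> (0 <= t%:E)%E by move=> x _; rewrite lee_fin ltW.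
  have kp' : forall x : X, D x -> (0 <= (k^-1 * `|h s x| `^ p)%:E)%E.
    by move=> x _; rewrite lee_fin.
  rewrite (ge0_integralD m mD t0' (measurable_cst _) kp' mkp).
  rewrite integral_cst// mDc; congr (_ + _)%E.
  have hp' : forall x : X, D x -> (0 <= (`|h s x| `^ p)%:E)%E.
    by move=> x _; rewrite lee_fin powR_ge0.
  have kp0 : 0 <= k^-1 by rewrite invr_ge0 ltW.
  have mhp' : measurable_fun D (fun x => (`|h s x| `^ p)%:E) by exact/measurable_EFinP.
  rewrite -(ge0_integralZl_EFin m mD hp' mhp' kp0).
  by apply: eq_integral => x _; rewrite EFinM.
move=> hle.
have : (\int[m]_(x in D) (`|h s x|)%:E <= e%:E)%E.
  apply: (le_trans hle).
  apply: (@le_trans _ _ ((t * c)%:E + k^-1%:E * (k * e / 2)%:E)%E).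
    by rewrite leeD2l// lee_wpmul2l// lee_fin invr_ge0 ltW.
  rewrite -EFinM -EFinD lee_fin.
  have -> : k^-1 * (k * e / 2) = e / 2 by field; rewrite gt_eqF.
  have : t * c <= e / 2.
    rewrite /t mulrAC ler_pdivrMr; last by rewrite mulr_gt0// ltr_wpDl.
    have -> : e / 2 * (2 * (c + 1)) = e * c + e by field.
    by rewrite lerDl ltW.
  lra.
move=> {}hle; rewrite -lee_fin /Rintegral fineK// ge0_fin_numE.
  by rewrite (le_lt_trans hle)// ltry.
by apply: integral_ge0 => x _; rewrite lee_fin.
Qed.

(** Mean-square convergence, phrased with real integrals of squares so that later limits involve
    neither roots nor extended values. *)
Definition cvg2 (f_ : nat -> X -> R) f : Prop :=
  forall e, 0 < e -> \forall n \near \oo, \int[m]_(x in D) (f_ n x - f x) ^+ 2 <= e.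

Lemma norm_on_cvg2 (f_ : nat -> X -> R) f :
  norm_on m D 2 (f_ n \- f) @[n --> \oo] --> 0%E -> cvg2 f_ f.
Proof.
move=> h0 e e0; have hev := @cvg_norm_on 2 _ \oo eventually_filter _ e (ltr0Sn _ _) h0 e0.
move: hev; apply: filterS => n hn; rewrite -lee_fin /Rintegral.
have hE : (\int[m]_(x in D) ((f_ n x - f x) ^+ 2)%:E =
    \int[m]_(x in D) (`|(f_ n \- f) x| `^ 2)%:E)%E.
  apply: eq_integral => x _; rewrite powR_mulrn// real_normK// ?num_real//.
rewrite hE fineK// ge0_fin_numE.
  by rewrite (le_lt_trans hn)// ltry.
by apply: integral_ge0 => x _; rewrite lee_fin powR_ge0.
Qed.

(** A weighted mean inequality in the role of Cauchy-Schwarz: the free weight [t] makes the fixed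
    factor small, after which the varying one is small by convergence. *)
Lemma Rintegral_AMGM f g (t : R) : 0 < t -> L2 f -> L2 g ->
  `|\int[m]_(x in D) (f x * g x)| <=
  t^-1 * \int[m]_(x in D) (f x ^+ 2) + t * \int[m]_(x in D) (g x ^+ 2).
Proof.
move=> t0 lf lg; have fg := L2_intgM lf lg.
apply: (le_trans (le_normr_Rintegral mD fg)).
rewrite -!RintegralZl//; [|exact: L2_sqr..].
rewrite -RintegralD//; [|by apply: intgZ; exact: L2_sqr..].
apply: le_Rintegral => //.
- exact: intg_norm.
- by apply: intgD; apply: intgZ; exact: L2_sqr.
move=> x _; rewrite normrM.
rewrite -(real_normK (num_real (f x))) -(real_normK (num_real (g x))).
have a0 := normr_ge0 (f x); have b0 := normr_ge0 (g x).
have -> : t^-1 * `|f x| ^+ 2 + t * `|g x| ^+ 2 =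
  t^-1 * (`|f x| ^+ 2 + (t * `|g x|) ^+ 2) by field; rewrite gt_eqF.
rewrite ler_pdivlMl//; have := sqr_ge0 (`|f x| - t * `|g x|); nra.
Qed.

Lemma cvg2_intM (f_ : nat -> X -> R) f g : (forall n, L2 (f_ n)) -> L2 f -> L2 g ->
  cvg2 f_ f ->
  \int[m]_(x in D) (f_ n x * g x) @[n --> \oo] --> \int[m]_(x in D) (f x * g x).
Proof.
move=> lf_ lf lg cf; apply/cvgrPdist_le => e e0.
set G := \int[m]_(x in D) (g x ^+ 2).
have G0 : 0 <= G by apply: Rintegral_ge0 => x _; exact: sqr_ge0.
pose t := e / (2 * (G + 1)).
have t0 : 0 < t by rewrite divr_gt0// mulr_gt0// ltr_wpDl.
have := cf _ (mulr_gt0 (mulr_gt0 t0 e0) (divr_gt0 ltr01 (ltr0Sn _ 1))).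
apply: filterS => n fn.
rewrite distrC -RintegralB//; [|exact: L2_intgM..].
under eq_Rintegral do rewrite -mulrBl.
apply: (le_trans (Rintegral_AMGM t0 (L2B (lf_ n) lf) lg)).
rewrite -/G; apply: (@le_trans _ _ (e / 2 + e / 2)); last lra.
apply: lerD.
  by rewrite ler_pdivrMl// (le_trans fn)//; lra.
rewrite /t mulrAC ler_pdivrMr; last by rewrite mulr_gt0// ltr_wpDl.
nra.
Qed.

Lemma cvg2_intMM (f_ g_ : nat -> X -> R) f g :
  (forall n, L2 (f_ n)) -> (forall n, L2 (g_ n)) -> L2 f -> L2 g ->
  cvg2 f_ f -> cvg2 g_ g ->
  \int[m]_(x in D) (f_ n x * g_ n x) @[n --> \oo] --> \int[m]_(x in D) (f x * g x).
Proof.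
move=> lf_ lg_ lf lg cf cg.
(* Bilinear expansion around the limits: two terms with a fixed factor, a constant, and a remainder
   that is a product of two differences. *)
have -> : (fun n => \int[m]_(x in D) (f_ n x * g_ n x)) = fun n =>
    \int[m]_(x in D) (f_ n x * g x) + \int[m]_(x in D) (g_ n x * f x)
    - \int[m]_(x in D) (f x * g x) +
    \int[m]_(x in D) ((f_ n x - f x) * (g_ n x - g x)).
  apply/funext => n.
  rewrite -RintegralD//; [|exact: L2_intgM..].
  rewrite -RintegralB//; [|by [apply: intgD; exact: L2_intgM]|exact: L2_intgM].
  rewrite -RintegralD//; last 2 first.
  - by apply: intgB; [apply: intgD|]; exact: L2_intgM.
  - by apply: L2_intgM; exact: L2B.
  by apply: eq_Rintegral => x _; ring.
rewrite -[X in _ --> X]addr0; apply: cvgD.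
  rewrite -[X in _ --> X](addrK (\int[m]_(x in D) (f x * g x))).
  apply: cvgB; last exact: cvg_cst.
  apply: cvgD; first exact: cvg2_intM.
  by under [X in _ --> X]eq_Rintegral do rewrite mulrC; exact: cvg2_intM.
apply/cvgr0Pnorm_le => e e0.
have e20 : 0 < e / 2 by rewrite divr_gt0.
near=> n.
have := Rintegral_AMGM ltr01 (L2B (lf_ n) lf) (L2B (lg_ n) lg).
move=> /le_trans; apply; rewrite invr1 !mul1r (splitr e); apply: lerD; near: n.
  exact: cf.
exact: cg.
Unshelve. all: by end_near. Qed.

Lemma cvg2_bndM (M : R) (k : X -> R) (f_ : nat -> X -> R) f :
  measurable_fun D k -> (forall x, D x -> `|k x| <= M) ->
  (forall n, L2 (f_ n)) -> L2 f -> cvg2 f_ f ->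
  cvg2 (fun n x => k x * f_ n x) (fun x => k x * f x).
Proof.
move=> mk kM lf_ lf cf e e0.
have M1 : 0 < M ^+ 2 + 1 by rewrite ltr_wpDl// sqr_ge0.
have := cf _ (divr_gt0 e0 M1); apply: filterS => n; rewrite ler_pdivlMr//.
apply: le_trans; rewrite -RintegralZr//; last by apply: L2_sqr; exact: L2B.
apply: le_Rintegral => //.
- apply: (@intg_eq (fun x => (k x * (f_ n x - f x)) ^+ 2)).
    by move=> x _; rewrite mulrBr.
  by apply: L2_sqr; apply: (L2_bndM mk kM); exact: L2B.
- apply: (@intg_eq (fun x => (M ^+ 2 + 1) * (f_ n x - f x) ^+ 2)).
    by move=> x _; rewrite mulrC.
  by apply: intgZ; apply: L2_sqr; exact: L2B.
move=> x Dx; rewrite -mulrBr exprMn mulrC ler_wpM2l ?sqr_ge0//.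
have : `|k x| ^+ 2 <= M ^+ 2.
  by rewrite lerXn2r ?nnegrE ?kM// (le_trans _ (kM _ Dx)).
by rewrite real_normK ?num_real// => /le_trans; apply; rewrite lerDl.
Qed.

End square_integrable.

Arguments intg_le [d] [X R] m  [D] mD [f g]  _ _ _.
Arguments intgD [d] [X R] m  [D] mD [f g]  _ _.
Arguments intgN [d] [X R] m  [D] [f] _.
Arguments intgB [d] [X R] m  [D] mD [f g]  _ _.
Arguments intgZ [d] [X R] m  [D] mD c [f]  _.
Arguments intg_norm [d] [X R] m [D] [f] _.
Arguments intg_eq [d] [X R] m  [D] mD [f g]  _ _.
Arguments intg_bndM [d] [X R] m [D] mD [M] [f g]  _ _ _.
Arguments intg_bnd [d] [X R] m [D] mD [M] [g]  _ _ _.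
Arguments L2_sqr [d] [X R] m  [D] mD [f]  _.
Arguments L2_intgM [d] [X R] m [D] mD [f g]  _ _.
Arguments L2_bndM [d] [X R] m  [D] mD [M] [f g]  _ _ _.
Arguments L2_bnd [d] [X R] m  [D] mD [M] [g]  _ _ _.
Arguments L2D [d] [X R] m [D]  mD [f g] _ _.
Arguments L2Z [d] [X R] m [D]  mD c [f] _.
Arguments L2N [d] [X R] m [D]  mD [f] _.
Arguments L2B [d] [X R] m [D]  mD [f g] _ _.
Arguments L2_intg [d] [X R] m  [D] mD [f]  _ _.
Arguments cvg_norm_on [d] [X R] m [D] [p] [T]  [F] {FF} [h] [e] _ _  _.
Arguments Lp_intg [d] [X R] m  [D] mD [p] [f]  _ _ _.
Arguments cvg_norm_on1 [d]  [X R] m [D] mD [p]  [T] [F] {FF} [h] [e]  _ _ _ _ _.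
Arguments Rintegral_AMGM [d]  [X R] m [D] mD [f g]  [t] _ _ _.
Arguments cvg2_intM [d] [X R] m [D] mD [f_ f g] _ _ _ _.
Arguments cvg2_intMM [d] [X R] m [D] mD [f_ g_ f g] _ _ _ _ _ _.
Arguments cvg2_bndM [d] [X R] m [D] mD [M] [k f_ f] _ _ _ _ _.
Arguments intg_measurable [d] [X R] m [D] [f] _.
Arguments norm_on_cvg2 [d] [X R] m [D] [f_ f] _.
Arguments Lp_measurable [d] [X R] m [D] mD [p] [f] _.

Section dominated_real.
Context d (X : measurableType d) (R : realType) (m : {measure set X -> \bar R}).
Variable (D : set X).
Hypothesis mD : measurable D.

Lemma Rintegral_dominated (f_ : nat -> X -> R) (f g : X -> R) :
  (forall n, measurable_fun D (f_ n)) -> measurable_fun D f ->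
  {ae m, forall x, D x -> f_ n x @[n --> \oo] --> f x} ->
  m.-integrable D (EFin \o g) ->
  (forall n x, D x -> `|f_ n x| <= g x) ->
  \int[m]_(x in D) f_ n x @[n --> \oo] --> \int[m]_(x in D) f x.
Proof.
move=> mf_ mf ff gi fg.
have mf_' n : measurable_fun D (fun x => (f_ n x)%:E) by exact/measurable_EFinP.
have mf' : measurable_fun D (EFin \o f) by exact/measurable_EFinP.
have ff' : {ae m, forall x, D x -> (f_ n x)%:E @[n --> \oo] --> (EFin \o f) x}.
  by move: ff; apply: filterS => x h Dx; apply: cvg_EFin; [exact: nearW|exact: h].
have fg' : {ae m, forall x n, D x -> (`|(f_ n x)%:E| <= (EFin \o g) x)%E}.
  by apply: aeW => x n Dx; rewrite lee_fin fg.
have [fi _ cv] := dominated_convergence mD mf_' mf' ff' gi fg'.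
have fin := integrable_fin_num mD fi.
apply: fine_cvg; rewrite fineK//; exact: cv.
Qed.

Lemma Rintegral_subset (A : set X) (f : X -> R) :
  measurable A -> D `<=` A -> (forall x, A x -> 0 <= f x) ->
  m.-integrable A (EFin \o f) ->
  \int[m]_(x in D) f x <= \int[m]_(x in A) f x.
Proof.
move=> mA DA f0 fi; rewrite -lee_fin /Rintegral !fineK//; last 2 first.
- exact: integrable_fin_num.
- by apply: integrable_fin_num => //; exact: integrableS fi.
apply: ge0_subset_integral => //; exact: (measurable_int m fi).
Qed.

End dominated_real.
Arguments Rintegral_dominated [d X R] m [D] mD [f_ f g] _ _ _ _ _.
Arguments Rintegral_subset [d X R] m [D] mD [A f] _ _ _ _.

Section primitive.
Context {R : realType}.
Notation mu := (@lebesgue_measure R).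

Lemma Rintegral_FTC2 (F f : R -> R) (a b : R) : a <= b ->
  (forall x : R, `]a, b[%classic x -> is_derive x 1 F (f x)) ->
  {within `[a, b], continuous F} -> {within `[a, b], continuous f} ->
  \int[mu]_(x in `[a, b]) f x = F b - F a.
Proof.
rewrite le_eqVlt => /predU1P[<- _ _ _|ab dF cF cf].
  by rewrite set_itv1 Rintegral_set1 subrr.
rewrite /Rintegral (@continuous_FTC2 _ f F)//.
- have [c1 c2 c3] := (continuous_within_itvP F ab).1 cF.
  by split=> // x xab; have [] := dF x xab.
- by move=> x xab; rewrite derive1E; have [_ ->] := dF x xab.
Qed.

Lemma smooth_FTC2 (F : R -> R) (a b : R) : a <= b -> smooth F ->
  \int[mu]_(x in `[a, b]) 'D_1 F x = F b - F a.
Proof.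
move=> ab sF; apply: Rintegral_FTC2 => //.
- by move=> x _; exact: smooth_is_derive.
- by apply: continuous_subspaceT; exact: smooth_continuous.
- by apply: continuous_subspaceT; apply: smooth_continuous; exact: smooth_derive.
Qed.

End primitive.

(** * Mollification and weak derivatives *)

Section kernel.
Context {R : realType}.
Notation mu := (@lebesgue_measure R).
Implicit Types a b r x : R.

Definition stp a r x : R := step (r^-1 * (x - a)).
(** A one-sided mollifier of mass 1 on [[a, a + r]]. Being the derivative of [stp a r], it makes the
    difference of two steps a test function whose derivative is a difference of two mollifiers. *)
Definition kern a r x : R := r^-1 * 'D_1 step (r^-1 * (x - a)).

Lemma smooth_aff a r : smooth (fun x : R => r * (x - a)).
Proof.
by apply: smoothZ; apply: smoothB; [exact: smooth_id|exact: smooth_cst].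
Qed.

Lemma smooth_stp a r : smooth (stp a r).
Proof. exact: (smooth_comp smooth_step (smooth_aff a r^-1)). Qed.

Lemma is_derive_aff a r x : is_derive x 1 (fun x : R => r * (x - a)) r.
Proof.
have d1 : is_derive x 1 (fun x : R => x - a) 1.
  have := is_deriveB (is_derive_id x 1) (is_derive_cst a x 1).
  by rewrite subr0.
by have := is_deriveZ r d1; rewrite /GRing.scale/= mulr1.
Qed.

Lemma is_derive_stp a r x : is_derive x 1 (stp a r) (kern a r x).
Proof.
rewrite /kern mulrC.
exact: (@is_derive_comp1 _ _ step (fun x : R => r^-1 * (x - a)) x 1 _ _
  (smooth_is_derive (r^-1 * (x - a)) (1 : R) smooth_step)
  (smooth_differentiable x (smooth_aff a r^-1)) (is_derive_aff a r^-1 x)).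
Qed.

Lemma derive_stp a r x : 'D_1 (stp a r) x = kern a r x.
Proof. by have [_ ->] := is_derive_stp a r x. Qed.

Lemma smooth_kern a r : smooth (kern a r).
Proof.
rewrite (_ : kern a r = 'D_1 (stp a r)).
  exact: smooth_derive (smooth_stp a r).
by apply/funext => x; rewrite derive_stp.
Qed.

Lemma stp_ge0 a r x : 0 <= stp a r x. Proof. exact: step_ge0. Qed.
Lemma stp_le1 a r x : stp a r x <= 1. Proof. exact: step_le1. Qed.

Lemma stp_out0 a r x : 0 < r -> x <= a -> stp a r x = 0.
Proof.
by move=> r0 xa; rewrite /stp step_le0// mulr_ge0_le0 ?subr_le0// invr_ge0 ltW.
Qed.

Lemma stp_out1 a r x : 0 < r -> a + r <= x -> stp a r x = 1.
Proof.
by move=> r0 xa; rewrite /stp step_ge1// ler_pdivlMl// mulr1 lerBrDl.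
Qed.

Lemma kern_ge0 a r x : 0 < r -> 0 <= kern a r x.
Proof. by move=> r0; rewrite mulr_ge0 ?derive_step_ge0// invr_ge0 ltW. Qed.

Lemma kern_out0 a r x : 0 < r -> x <= a -> kern a r x = 0.
Proof.
move=> r0 xa; rewrite /kern derive_step_le0 ?mulr0//.
by rewrite mulr_ge0_le0 ?subr_le0// invr_ge0 ltW.
Qed.

Lemma kern_out1 a r x : 0 < r -> a + r <= x -> kern a r x = 0.
Proof.
move=> r0 xa; rewrite /kern derive_step_ge1 ?mulr0//.
by rewrite ler_pdivlMl// mulr1 lerBrDl.
Qed.

Lemma kern_eq0 a r x : 0 < r -> ~ `[a, a + r]%classic x -> kern a r x = 0.
Proof.
move=> r0 /= /negP; rewrite in_itv/= negb_and -!ltNge => /orP[] h.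
  by rewrite kern_out0// ltW.
by rewrite kern_out1// ltW.
Qed.

Lemma kern_bounded : exists2 M : R, 0 < M &
  forall a r x, 0 < r -> `|kern a r x| <= M / r.
Proof.
have [M M0 HM] := @derive_step_bounded R; exists M => // a r x r0.
by rewrite normrM gtr0_norm ?invr_gt0// mulrC ler_pM2r ?invr_gt0.
Qed.

Lemma integral_kern a r : 0 < r -> \int[mu]_(x in `[a, a + r]) kern a r x = 1.
Proof.
move=> r0; have ar : a <= a + r by rewrite lerDl ltW.
under eq_Rintegral do rewrite -derive_stp.
rewrite (smooth_FTC2 ar (smooth_stp a r)) stp_out1// stp_out0// subr0//.
Qed.

Lemma test_stpB (D : set R) a b r : 0 < r -> a <= b -> `[a, b + r] `<=` D ->
  test_function D (fun x => stp a r x - stp b r x).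
Proof.
move=> r0 ab aD; split; first by apply: smoothB; exact: smooth_stp.
exists `[a, b + r]%classic; first by split => //; exact: segment_compact.
move=> x /=; rewrite in_itv/= => /negP; rewrite negb_and -!ltNge => /orP[] h.
  by rewrite !stp_out0 ?subrr// ltW// (lt_le_trans h).
by rewrite !stp_out1 ?subrr//; [exact: ltW|rewrite (le_trans _ (ltW h))// lerD2r].
Qed.

(** The kernel has mass 1, so the error is the kernel integral of [f - f a]. The kernel has height
    at most [M / r] on an interval inside the ball of radius [2 * r], so the error is controlled by
    the mean deviation over that ball, which vanishes at a Lebesgue point. *)
Lemma lebesgue_pt_kern (f : R -> R) a : mu.-integrable setT (EFin \o f) ->
  lebesgue_pt f a ->
  \int[mu]_x (f x * kern a (n.+1%:R^-1) x) @[n --> \oo] --> f a.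
Proof.
move=> fi la; have [M M0 HM] := kern_bounded.
apply/cvgrPdist_le => e e0.
(* Height [M / r] times the length [4 * r] of the ball gives the factor [4 * M]. *)
have e4 : 0 < e / (4 * M) by rewrite divr_gt0// mulr_gt0.
have := la _ (@open_ereal_lt' R 0%E (e / (4 * M))%:E e4).
move=> /nbhs_ballP[d /= d0 Hd].
near=> n.
have : n.+1%:R^-1 < d / 2.
  by near: n; apply: (near_infty_natSinv_lt (PosNum (divr_gt0 d0 (ltr0Sn _ 1)))).
have : 0 < n.+1%:R^-1 :> R by rewrite invr_gt0.
move: (n.+1%:R^-1) => r r0 rd.
have r20 : 0 < 2 * r by rewrite mulr_gt0.
have : (davg f a (2 * r) < (e / (4 * M))%:E)%E.
  by apply: Hd => //; rewrite /ball/= sub0r normrN gtr0_norm//; lra.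
have muball := lebesgue_measure_ball a (ltW r20).
rewrite /davg /iavg muball => hav.
have arball : `[a, a + r] `<=` ball a (2 * r).
  move=> x /=; rewrite in_itv/= => /andP[ax xr].
  by rewrite /ball/= distrC ger0_norm ?subr_ge0//; lra.
have mab : measurable `[a, a + r]%classic by exact: measurable_itv.
have fia : mu.-integrable `[a, a + r] (EFin \o f).
  by apply: integrableS fi.
have fia2 : mu.-integrable (ball a (2 * r)) (EFin \o f).
  by apply: integrableS fi => //; exact: measurable_ball.
have muar : (mu `[a, (a + r)%R]%classic < +oo)%E.
  by rewrite lebesgue_measure_itv/=; case: ifPn => // _; rewrite ltry.
have mubr : (mu (ball a (2 * r)) < +oo)%E.
  by rewrite muball ltry.
have mk : measurable_fun `[a, a + r] (kern a r).
  by apply: measurable_funTS; apply: smooth_measurable; exact: smooth_kern.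
have kM x : `[a, a + r]%classic x -> `|kern a r x| <= M / r by move=> _; exact: HM.
have fafi (A : set R) : measurable A -> (mu A < +oo)%E ->
    mu.-integrable A (EFin \o (fun x => f x - f a)).
  move=> mA Aoo; apply: (intgB mu mA) => //; first by apply: integrableS fi.
  exact: (intg_bnd mu mA (g := fun=> f a) (M := `|f a|) Aoo (measurable_cst _) (fun _ _ => lexx _)).
have fkE : \int[mu]_x (f x * kern a r x) = \int[mu]_(x in `[a, a + r]) (f x * kern a r x).
  rewrite [RHS]Rintegral_mkcond; apply: eq_Rintegral => x _.
  rewrite patchE; case: ifPn => // /negP; rewrite inE /= in_itv/= => /negP.
  rewrite negb_and -!ltNge => /orP[] h.
    by rewrite kern_out0 ?mulr0// ltW.
  by rewrite kern_out1 ?mulr0// ltW.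
have fkB : \int[mu]_(x in `[a, a + r]) (f x * kern a r x) - f a =
    \int[mu]_(x in `[a, a + r]) (kern a r x * (f x - f a)).
  rewrite -[X in _ - X]mulr1 -(integral_kern a r0) -RintegralZl//; last first.
    exact: (intg_bnd mu mab muar mk kM).
  rewrite -RintegralB//.
  - by apply: eq_Rintegral => x _; ring.
  - apply: (intg_eq mu mab (f := fun x => kern a r x * f x)).
      by move=> x _; rewrite mulrC.
    exact: (intg_bndM mu mab mk kM fia).
  - by apply: (intgZ mu mab); exact: (intg_bnd mu mab muar mk kM).
rewrite distrC fkE fkB.
have kint := intg_bndM mu mab mk kM (fafi _ mab muar).
apply: (le_trans (le_normr_Rintegral (mu := mu) mab kint)).
have nint : mu.-integrable (ball a (2 * r)) (EFin \o (fun x => `|f x - f a|)).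
  by apply: (intg_norm mu); apply: fafi => //; exact: measurable_ball.
apply: (@le_trans _ _ (M / r * \int[mu]_(x in ball a (2 * r)) `|f x - f a|)).
  apply: (@le_trans _ _ (\int[mu]_(x in `[a, a + r]) (M / r * `|f x - f a|))).
    apply: le_Rintegral => //.
    + exact: (intg_norm mu).
    + by apply: (intgZ mu mab); apply: (intg_norm mu); exact: fafi.
    by move=> x xa; rewrite normrM ler_wpM2r// kM.
  rewrite RintegralZl//; last by apply: (intg_norm mu); exact: fafi.
  rewrite ler_wpM2l//; first by rewrite divr_ge0// ltW.
  exact: (Rintegral_subset mu mab (measurable_ball _ _) arball _ nint).
set J := \int[mu]_(x in ball a (2 * r)) `|f x - f a|.
have JE : (\int[mu]_(y in ball a (2 * r)) `|((center (f a) \o f) y)%:E|)%E = J%:E.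
  by rewrite /J /Rintegral fineK//; apply: integrable_fin_num => //; exact: measurable_ball.
move: hav; rewrite JE inver mulrn_eq0/= gt_eqF// -EFinM lte_fin => hav.
have {}hav : J < e / (4 * M) * (2 * r *+ 2).
  by rewrite -ltr_pdivrMr ?mulrn_wgt0// mulrC.
have -> : e = M / r * (e / (4 * M) * (2 * r *+ 2)).
  by rewrite -mulr_natr; field; rewrite !gt_eqF.
by rewrite ler_pM2l ?divr_gt0// ltW.
Unshelve. all: by end_near. Qed.

End kernel.

Section du_bois_reymond.
Context {R : realType}.
Notation mu := (@lebesgue_measure R).
Implicit Types (f g h : R -> R) (a b r x : R).

Lemma ae_imp (P Q : R -> Prop) : {ae mu, forall x, P x} -> (forall x, P x -> Q x) ->
  {ae mu, forall x, Q x}.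
Proof.
by move=> aP PQ; apply: filterS aP => //; exact: (ae_filter_ringOfSetsType mu).
Qed.

Lemma measurable_itvI : measurable (@itvI R).
Proof. exact: measurable_itv. Qed.

Lemma itvIE x : itvI x <-> -1 < x < 1.
Proof. by rewrite /itvI /= in_itv. Qed.

Lemma mu_itvI : mu (@itvI R) = 2%:E.
Proof.
rewrite /itvI lebesgue_measure_itv/= lte_fin gtrN// -EFinD opprK.
by congr EFin; lra.
Qed.

Lemma mu_itvI_fin : (mu (@itvI R) < +oo)%E.
Proof. by rewrite mu_itvI ltry. Qed.

Lemma open_itvI : open (@itvI R). Proof. exact: interval_open. Qed.

Lemma Rintegral_restrictM (D : set R) f k :
  \int[mu]_x ((f \_ D) x * k x) = \int[mu]_(x in D) (f x * k x).
Proof.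
rewrite [RHS]Rintegral_mkcond; apply: eq_Rintegral => x _.
by rewrite !patchE; case: ifPn => // _; rewrite mul0r.
Qed.

Lemma integrable_lebesgue_pt f : mu.-integrable setT (EFin \o f) ->
  {ae mu, forall x, lebesgue_pt f x}.
Proof.
move=> fi; apply: lebesgue_differentiation.
by apply: open_integrable_locally => //; exact: openT.
Qed.

Lemma near_kern_sub (D : set R) a : open D -> D a ->
  \forall n \near \oo, `[a, a + n.+1%:R^-1] `<=` D.
Proof.
move=> oD Da; have /nbhs_ballP[e /= e0 eD] := open_nbhs_nbhs (conj oD Da).
near=> n; move=> x /=; rewrite in_itv/= => /andP[ax xa]; apply: eD.
rewrite /ball/= distrC ger0_norm ?subr_ge0//.
rewrite ltrBlDl (le_lt_trans xa)// ltrD2l.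
by near: n; exact: (near_infty_natSinv_lt (PosNum e0)).
Unshelve. all: by end_near. Qed.

(** At a Lebesgue point the kernel averages of [f] converge to its value, and they are eventually
    among those assumed to vanish, because [D] is open. *)
Lemma du_bois_reymond (D : set R) f : open D -> mu.-integrable D (EFin \o f) ->
  (forall a r, 0 < r -> `[a, a + r] `<=` D ->
    \int[mu]_(x in D) (f x * kern a r x) = 0) ->
  {ae mu, forall x, D x -> f x = 0}.
Proof.
move=> oD fi f0; have mD := open_measurable oD.
have fDi : mu.-integrable setT (EFin \o (f \_ D)).
  exact/(integrable_restrict_setT mu mD).
apply: (ae_imp (integrable_lebesgue_pt fDi)) => x lx Dx.
have fDx : (f \_ D) x = f x by rewrite patchE mem_set.
rewrite -fDx; have cv := lebesgue_pt_kern fDi lx.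
apply/esym; apply: (cvg_unique _ _ cv) => //.
apply: cvg_near_cst; near=> n.
rewrite Rintegral_restrictM f0// ?invr_gt0//.
by near: n; exact: near_kern_sub.
Unshelve. all: by end_near. Qed.

(* Test with the difference of two smoothed steps at a and b, and let their width tend to 0. *)
Lemma weak_deriv_lebesgue_pt f h a b : a < b -> itvI a -> itvI b ->
  mu.-integrable itvI (EFin \o f) -> mu.-integrable itvI (EFin \o h) ->
  (forall phi, test_function itvI phi ->
    \int[mu]_(x in itvI) (f x * 'D_1 phi x) = - \int[mu]_(x in itvI) (h x * phi x)) ->
  lebesgue_pt (f \_ itvI) a -> lebesgue_pt (f \_ itvI) b ->
  f b - f a = \int[mu]_(x in `]a, b]) h x.
Proof.
move=> ab /[dup] Ia /itvIE/andP[a1 a2] /[dup] Ib /itvIE/andP[b1 b2] fi hi fh la lb.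
have mI := measurable_itvI.
have fDi : mu.-integrable setT (EFin \o (f \_ itvI)).
  exact/(integrable_restrict_setT mu mI).
have fx x : itvI x -> (f \_ itvI) x = f x by move=> Dx; rewrite patchE mem_set.
have cva := lebesgue_pt_kern fDi la; have cvb := lebesgue_pt_kern fDi lb.
rewrite fx// in cva; rewrite fx// in cvb.
pose rr n : R := n.+1%:R^-1.
have rr0 n : 0 < rr n by rewrite invr_gt0.
have cvh : \int[mu]_(x in itvI) (h x * (stp a (rr n) x - stp b (rr n) x)) @[n --> \oo]
    --> \int[mu]_(x in itvI) (h x * \1_(`]a, b]) x).
  apply: (@Rintegral_dominated _ _ _ mu _ mI _ _ (fun x => `|h x|)).
  - move=> n; apply: measurable_funM; first exact: (intg_measurable mu hi).
    apply: measurable_funTS; apply: smooth_measurable; apply: smoothB; exact: smooth_stp.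
  - apply: measurable_funM; first exact: (intg_measurable mu hi).
    by apply: measurable_funTS; exact: measurable_indic.
  - apply: aeW => x _; apply: cvgMl_tmp.
    have ev c : \forall n \near \oo, stp c (rr n) x = (c < x)%R%:R.
      have [xc|cx] := leP x c; first by near=> n; rewrite stp_out0.
      have xc0 : 0 < x - c by rewrite subr_gt0.
      near=> n; rewrite stp_out1// -lerBrDl ltW//.
      by near: n; exact: (near_infty_natSinv_lt (PosNum xc0)).
    apply: cvg_near_cst; near=> n.
    have -> : stp a (rr n) x = (a < x)%R%:R by near: n; exact: ev.
    have -> : stp b (rr n) x = (b < x)%R%:R by near: n; exact: ev.
    rewrite indicE; have [ax|xa] := ltP a x; have [bx|xb] := ltP b x.
    + by rewrite subrr memNset//= in_itv/= ax/= leNgt bx.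
    + by rewrite subr0 mem_set//= in_itv/= ax xb.
    + by have := lt_le_trans bx xa; rewrite ltNge (ltW ab).
    + by rewrite subrr memNset//= in_itv/= ltNge xa.
  - exact: (intg_norm mu hi).
  - move=> n x _; rewrite normrM ler_piMr// ler_norml.
    have := stp_ge0 a (rr n) x; have := stp_ge0 b (rr n) x.
    have := stp_le1 a (rr n) x; have := stp_le1 b (rr n) x; lra.
have -> : \int[mu]_(x in `]a, b]) h x = \int[mu]_(x in itvI) (h x * \1_(`]a, b]) x).
  have abI : itvI `&` `]a, b] = `]a, b]%classic.
    apply/setIidr => x /=; rewrite in_itv/= => /andP[ax xb].
    by apply/itvIE; rewrite (lt_trans a1 ax) (le_lt_trans xb b2).
  rewrite -[in LHS]abI Rintegral_mkcondr; apply: eq_Rintegral => x _.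
  by rewrite patchE indicE; case: (x \in _); rewrite ?mulr1 ?mulr0.
apply: (cvg_unique _ _ cvh) => //.
have cvf : - (\int[mu]_x ((f \_ itvI) x * kern a (rr n) x) -
    \int[mu]_x ((f \_ itvI) x * kern b (rr n) x)) @[n --> \oo] --> f b - f a.
  by rewrite -opprB; apply: cvgN; exact: cvgB.
apply: cvg_trans cvf; apply: near_eq_cvg; near=> n.
apply: (etrans (congr2 (fun p q : R => - (p - q))
  (Rintegral_restrictM itvI f (kern a (rr n))) (Rintegral_restrictM itvI f (kern b (rr n))))).
rewrite /=.
have ar : `[a, a + rr n] `<=` itvI by near: n; exact: (near_kern_sub open_itvI).
have br : `[b, b + rr n] `<=` itvI by near: n; exact: (near_kern_sub open_itvI).
have abr : `[a, b + rr n] `<=` itvI.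
  move=> x /=; rewrite in_itv/= => /andP[ax xb]; have [bx|bx] := leP b x.
    by apply: br; rewrite /= in_itv/= bx.
  by apply/itvIE; rewrite (lt_le_trans a1 ax) (lt_trans bx b2).
rewrite -[RHS]opprK -fh; last exact: (test_stpB _ (ltW ab)).
have ik c : mu.-integrable itvI (EFin \o (fun x => f x * kern c (rr n) x)).
  have [M M0 HM] := @kern_bounded R.
  apply: (intg_eq mu mI (f := fun x => kern c (rr n) x * f x)).
    by move=> x _; rewrite mulrC.
  apply: (intg_bndM mu mI _ (fun x _ => HM c _ x (rr0 n))) => //.
  by apply: measurable_funTS; apply: smooth_measurable; exact: smooth_kern.
rewrite -RintegralB//; congr (- _); apply: eq_Rintegral => x _.
rewrite -mulrBr; congr (_ * _).
have [_ ->//] := is_deriveB (is_derive_stp a (rr n) x) (is_derive_stp b (rr n) x).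
Unshelve. all: by end_near. Qed.

Lemma ex_ae_itvI (P : R -> Prop) : {ae mu, forall x, P x} -> exists2 x, itvI x & P x.
Proof.
move=> aP; apply: contrapT => nP.
have : mu.-negligible (@itvI R).
  by apply: negligibleS aP => x Ix Px; apply: nP; exists x.
move/negligibleP => /(_ measurable_itvI).
by move/eqP; rewrite [X in X == _](mu_itvI) eqe pnatr_eq0.
Qed.

(** Comparing Lebesgue points shows that [g] is almost everywhere an antiderivative of [h] up to a
    constant, hence has a representative continuous up to the endpoints. As [v] is continuous, every
    point of the interval is a Lebesgue point of [v], so [v] is an antiderivative of [g] at every
    pair of points and the fundamental theorem gives a classical derivative. *)
Lemma W2_C1 q v : 1 <= q -> W2 q v -> exists v1 : R -> R,
  [/\ {within `[-1, 1], continuous v1},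
      (forall x, itvI x -> is_derive x 1 v (v1 x)) &
      exists M, forall x, itvI x -> `|v1 x| <= M].
Proof.
move=> q1 [cv [g [h [[vq gq vg] [_ hq gh]]]]].
have mI := measurable_itvI; have muI := mu_itvI_fin.
have vi := Lp_intg mu mI muI q1 vq.
have gi := Lp_intg mu mI muI q1 gq.
have hi := Lp_intg mu mI muI q1 hq.
have cvx x : itvI x -> {for x, continuous v}.
  move=> Ix.
  have cvI : {within itvI, continuous v}.
    by apply: continuous_subspaceW cv; exact: subset_itv_oo_cc.
  by move: cvI; rewrite (continuous_open_subspace _ open_itvI); apply; exact/mem_set.
have lv x : itvI x -> lebesgue_pt (v \_ itvI) x.
  move=> Ix; apply: (@continuous_lebesgue_pt _ _ _ itvI) => //.
  - by apply/(measurable_restrict _ mI mI); rewrite setIid; exact: (intg_measurable mu vi).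
  - rewrite /prop_for /continuous_at patchE mem_set//.
    have cvxx : v @ x --> v x by exact: cvx.
    apply: cvg_trans cvxx; apply: near_eq_cvg.
    near=> y; rewrite patchE mem_set//; near: y.
    exact: (open_nbhs_nbhs (conj open_itvI Ix)).
have vE a b : a < b -> itvI a -> itvI b -> v b - v a = \int[mu]_(x in `]a, b]) g x.
  by move=> ab Ia Ib; apply: (weak_deriv_lebesgue_pt ab) => //; exact: lv.
have gDi : mu.-integrable setT (EFin \o (g \_ itvI)).
  exact/(integrable_restrict_setT mu mI).
(* An arbitrary Lebesgue point of [g], which fixes the constant of integration in [v1]. *)
have [a0 Ia0 la0] := ex_ae_itvI (integrable_lebesgue_pt gDi).
have hDi : mu.-integrable `[-1, 1] (EFin \o (h \_ itvI)).
  have := (integrable_restrict_setT mu mI h).1 hi.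
  by apply: integrableS => //; exact: measurable_itv.
pose H x := \int[mu]_(t in `[-1, x]) (h \_ itvI) t.
have cH : {within `[-1, 1], continuous H}.
  apply: parameterized_integral_continuous => //; lra.
have HE a b : a < b -> itvI a -> itvI b -> H b - H a = \int[mu]_(x in `]a, b]) h x.
  move=> ab /itvIE/andP[a1 a2] /itvIE/andP[b1 b2].
  rewrite /H Rintegral_itvB.
  - apply: eq_Rintegral => x; rewrite inE/= in_itv/= => /andP[ax xb].
    by rewrite patchE mem_set//; apply/itvIE; rewrite (lt_trans a1)// (le_lt_trans xb).
  - apply: integrableS hDi; [exact: measurable_itv..|].
    by apply: subset_itvl; rewrite bnd_simp ltW.
  - by rewrite bnd_simp ltW.
  - by rewrite bnd_simp ltW.
pose v1 x := g a0 - H a0 + H x.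
have gv1 : {ae mu, forall x, itvI x -> g x = v1 x}.
  apply: (ae_imp (integrable_lebesgue_pt gDi)) => x lx Ix.
  have [ax|xa|<-] := ltgtP a0 x.
  - have := weak_deriv_lebesgue_pt ax Ia0 Ix gi hi gh la0 lx.
    by rewrite -HE// /v1; lra.
  - have := weak_deriv_lebesgue_pt xa Ix Ia0 gi hi gh lx la0.
    by rewrite -HE// /v1; lra.
  - by rewrite /v1; lra.
have cv1 : {within `[-1, 1], continuous v1}.
  by move=> x; apply: cvgD; [exact: cvg_cst|exact: cH].
have cv1x x : itvI x -> {for x, continuous v1}.
  move=> Ix.
  have cvI : {within itvI, continuous v1}.
    by apply: continuous_subspaceW cv1; exact: subset_itv_oo_cc.
  by move: cvI; rewrite (continuous_open_subspace _ open_itvI); apply; exact/mem_set.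
exists v1; split=> //; last first.
  have := continuous_compact cv1 (@segment_compact _ _ _).
  move=> /compact_bounded[M [_ HM]]; exists (M + 1) => x Ix.
  apply: (HM (M + 1)); first by rewrite ltrDl.
  by exists x => //; exact: subset_itv_oo_cc.
move=> x /[dup] Ix /itvIE/andP[x1 x2].
pose a := (-1 + x) / 2; pose b := (1 + x) / 2.
have Ia : itvI a by apply/itvIE; rewrite /a; lra.
have ax : a < x by rewrite /a; lra.
have xb : x < b by rewrite /b; lra.
have b1 : b < 1 by rewrite /b; lra.
have abI : `[a, b] `<=` itvI.
  move=> y /=; rewrite in_itv/= => /andP[ay yb]; apply/itvIE.
  by rewrite (lt_le_trans _ ay) ?(le_lt_trans yb)// /a; lra.
have v1i : mu.-integrable `[a, b] (EFin \o v1).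
  apply: continuous_compact_integrable; first exact: segment_compact.
  by apply: continuous_subspaceW cv1; exact: subset_trans abI (@subset_itv_oo_cc _ _ _ _).
have [d1 d2] := continuous_FTC1_closed xb v1i ax (cv1x x Ix).
rewrite derive1E in d2.
have dF : is_derive x 1 (fun y => v a + \int[mu]_(t in `[a, y]) v1 t) (v1 x).
  have := is_deriveD (is_derive_cst (v a) x 1) (DeriveDef d1 d2).
  by rewrite add0r.
apply: near_eq_is_derive dF.
near=> y.
have ay : a < y by near: y; exact: lt_nbhsr.
have yb : y < b by near: y; exact: lt_nbhsl.
have Iy : itvI y by apply: abI; rewrite /= in_itv/= !ltW.
rewrite -[RHS](subrK (v a)) addrC; congr (_ + _); rewrite vE//.
rewrite -Rintegral_itv_obnd_cbnd; last first.
  apply: integrableS v1i; [exact: measurable_itv..|].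
  by apply: subset_itvScc; rewrite bnd_simp// ltW.
have ayI : `]a, y] `<=` itvI.
  apply: subset_trans abI; move=> z /=; rewrite !in_itv/= => /andP[az zy].
  by rewrite ltW//= (le_trans zy)// ltW.
have may : measurable `]a, y]%classic by exact: measurable_itv.
have v1i' : mu.-integrable `]a, y] (EFin \o v1).
  apply: integrableS v1i; [exact: measurable_itv..|].
  by apply: subset_itvScc; rewrite bnd_simp// ltW.
have gi' : mu.-integrable `]a, y] (EFin \o g) by exact: integrableS gi.
congr fine; apply: ae_eq_integral => //=.
- exact: (measurable_int mu v1i').
- exact: (measurable_int mu gi').
- by apply: (ae_imp gv1) => z gz az; rewrite gz//; exact: ayI.
Unshelve. all: by end_near. Qed.

End du_bois_reymond.

(** * Fubini's theorem for real-valued integrals *)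

Section fubini_real.
Context {R : realType}.
Notation mu := (@lebesgue_measure R).
Notation mu2 := (mu \x mu)%E.
Implicit Types f : R * R -> R.

(** Inner integrals in Fubini's theorem are extended reals, finite only almost everywhere; this
    passes to their real parts inside the outer integral. *)
Lemma Rintegral_fine (g : R -> \bar R) : mu.-integrable setT g ->
  mu.-integrable setT (EFin \o (fine \o g)) /\
  (\int[mu]_x (fine (g x)) = fine (\int[mu]_x g x)).
Proof.
move=> gi.
have gE : {ae mu, forall x, [set: R] x -> g x = (EFin \o (fine \o g)) x}.
  by apply: (ae_imp (integrable_ae measurableT gi)) => x gx Tx; rewrite /= fineK// gx.
have mg : measurable_fun setT (EFin \o (fine \o g)).
  apply/measurable_EFinP; apply: measurableT_comp => //; exact: (measurable_int mu gi).
split.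
  move/integrableP : (gi) => [mg1 goo]; apply/integrableP; split=> //.
  rewrite [X in (X < _)%E](_ : _ = \int[mu]_x `|g x|)%E//.
  apply: ae_eq_integral => //.
  - exact: measurableT_comp.
  - exact: measurableT_comp.
  - by apply: (ae_imp gE) => x gx Tx /=; rewrite {2}gx.
rewrite /Rintegral; congr fine; apply: ae_eq_integral => //.
- exact: (measurable_int mu gi).
- by apply: (ae_imp gE) => x gx Tx; rewrite gx.
Qed.

Lemma Rfubini f : mu2.-integrable setT (EFin \o f) ->
  [/\ {ae mu, forall x, mu.-integrable setT (EFin \o (fun z => f (x, z)))},
      mu.-integrable setT (EFin \o (fun x => \int[mu]_z f (x, z))) &
      \int[mu2]_y f y = \int[mu]_x \int[mu]_z f (x, z)].
Proof.
move=> fi; have [i1 i2] := Rintegral_fine (integrable_fubini_F fi).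
split; first exact: (ae_integrable1 fi).
- exact: i1.
- transitivity (fine (\int[mu]_x fubini_F mu (EFin \o f) x)).
    by rewrite integral12_prod_meas1.
  by rewrite -i2.
Qed.

Lemma Rfubini2 f : mu2.-integrable setT (EFin \o f) ->
  [/\ {ae mu, forall z, mu.-integrable setT (EFin \o (fun x => f (x, z)))},
      mu.-integrable setT (EFin \o (fun z => \int[mu]_x f (x, z))) &
      \int[mu2]_y f y = \int[mu]_z \int[mu]_x f (x, z)].
Proof.
move=> fi.
have Gi : mu.-integrable setT (fubini_G mu (EFin \o f)).
  have mf := measurable_int _ fi.
  apply/integrableP; split; first exact: (measurable_fubini_G fi).
  apply: le_lt_trans ((integrable21ltyP _ _ mf).1 fi).
  apply: ge0_le_integral => //.
  - by apply: measurableT_comp => //; exact: (measurable_fubini_G fi).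
  - have mabs : measurable_fun setT (abse \o (EFin \o f)) by exact: measurableT_comp.
    exact: (measurable_fun_fubini_tonelli_G (m1 := mu) _ mabs (fun y => abse_ge0 _)).
  - move=> z _; apply: le_abse_integral => //.
    exact: (measurableT_comp mf).
have [i1 i2] := Rintegral_fine Gi.
split; first exact: (ae_integrable2 fi).
- exact: i1.
- transitivity (fine (\int[mu]_z fubini_G mu (EFin \o f) z)).
    by rewrite integral21_prod_meas1.
  by rewrite -i2.
Qed.

End fubini_real.

Section rational_kernels.
Context {R : realType}.
Notation mu := (@lebesgue_measure R).

Lemma kern_cvg (b_ s_ : nat -> R) (b s z : R) : 0 < s ->
  b_ n @[n --> \oo] --> b -> s_ n @[n --> \oo] --> s ->
  kern (b_ n) (s_ n) z @[n --> \oo] --> kern b s z.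
Proof.
move=> s0 cb cs.
have cV : (s_ n)^-1 @[n --> \oo] --> s^-1 by apply: cvgV => //; rewrite gt_eqF.
have ca : (s_ n)^-1 * (z - b_ n) @[n --> \oo] --> s^-1 * (z - b).
  by apply: cvgM => //; apply: cvgB => //; exact: cvg_cst.
have cS : 'D_1 (@step R) y @[y --> s^-1 * (z - b)] --> 'D_1 step (s^-1 * (z - b)).
  exact: (smooth_continuous (smooth_derive (1 : R) (@smooth_step R))).
exact: (cvgM cV (cvg_comp _ _ ca cS)).
Qed.

(** Approximation strictly from above: applied to a width it keeps the approximating kernels under
    the bound [M / s] of the limiting one, and applied to a left end it keeps the kernel to the
    right of [c]. *)
Lemma rat_seq (t : R) : exists2 p : nat -> rat,
  (forall n, t < ratr (p n)) & (ratr (p n) : R) @[n --> \oo] --> t.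
Proof.
have h : forall n : nat, exists p : rat, t < ratr p < t + n.+1%:R^-1.
  move=> n; have /rat_in_itvoo[p] : t < t + n.+1%:R^-1 by rewrite ltrDl invr_gt0.
  by rewrite in_itv/=; exists p.
have hp n := svalP (cid (h n)).
exists (fun n => sval (cid (h n))); first by move=> n; have /andP[] := hp n.
apply: (@squeeze_cvgr _ _ _ _ (cst t) (fun n => t + n.+1%:R^-1)).
- by apply: nearW => n; have /andP[h1 h2] := hp n; rewrite /cst !ltW.
- exact: cvg_cst.
- rewrite -[X in _ --> X]addr0; apply: cvgD; first exact: cvg_cst.
  exact: cvg_harmonic.
Qed.

(* Only countably many test functions are used, so that the hypothesis can be obtained
   by uniting null sets. *)
Lemma du_bois_reymond_rat (c d : R) (f : R -> R) : mu.-integrable `]c, d[ (EFin \o f) ->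
  (forall p q : rat, 0 < ratr q :> R -> c < ratr p -> ratr p + ratr q < d ->
    \int[mu]_(x in `]c, d[) (f x * kern (ratr p) (ratr q) x) = 0) ->
  {ae mu, forall x, `]c, d[%classic x -> f x = 0}.
Proof.
move=> fi f0.
have oD : open `]c, d[%classic by exact: interval_open.
apply: (du_bois_reymond oD fi).
move=> b s s0 bsD.
have [cb bd] : c < b /\ b + s < d.
  have bs : b <= b + s by rewrite lerDl ltW.
  have /bsD : `[b, b + s]%classic b by rewrite /= in_itv/= lexx bs.
  have /bsD : `[b, b + s]%classic (b + s) by rewrite /= in_itv/= lexx bs.
  by rewrite /= !in_itv/= => /andP[_ ->] /andP[->].
have [p hp cp] := rat_seq b; have [q hq cq] := rat_seq s.
have [M M0 HM] := @kern_bounded R.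
have mD : measurable `]c, d[%classic by exact: measurable_itv.
have mf := intg_measurable mu fi.
pose b_ n : R := ratr (p n); pose s_ n : R := ratr (q n).
have s_0 n : 0 < s_ n by exact: lt_trans (hq n).
have mk a r : measurable_fun `]c, d[ (kern a r).
  by apply: measurable_funTS; apply: smooth_measurable; exact: smooth_kern.
have cvI : \int[mu]_(x in `]c, d[) (f x * kern (b_ n) (s_ n) x) @[n --> \oo] -->
    \int[mu]_(x in `]c, d[) (f x * kern b s x).
  apply: (Rintegral_dominated mu mD (g := fun x => M / s * `|f x|)).
  - by move=> n; exact: (measurable_funM mf (mk _ _)).
  - exact: (measurable_funM mf (mk _ _)).
  - apply: aeW => x _; apply: cvgM; first exact: cvg_cst.
    exact: kern_cvg.
  - by apply: (intgZ mu mD); exact: (intg_norm mu fi).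
  - move=> n x _; rewrite normrM mulrC ler_wpM2r// (le_trans (HM _ _ _ (s_0 n)))//.
    by rewrite ler_pM2l// lef_pV2 ?posrE// ltW// hq.
apply/esym; apply: (cvg_unique _ _ cvI) => //.
apply: cvg_near_cst.
have cpq : b_ n + s_ n @[n --> \oo] --> b + s by exact: cvgD.
apply: filterS (cvgr_lt (b + s) cpq d bd) => n hn.
exact: (f0 (p n) (q n) (s_0 n) (lt_trans cb (hp n)) hn).
Qed.

End rational_kernels.

(** * The domain under a graph *)

Section omega.
Context {R : realType}.
Notation mu := (@lebesgue_measure R).
Notation mu2 := (mu \x mu)%E.
Variable v : R -> R.
Hypothesis cv : {within `[-1, 1], continuous v}.
Hypothesis v0 : forall x, itvI x -> -1 < v x <= 0.

Lemma graph_continuous x : itvI x -> {for x, continuous v}.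
Proof.
move=> Ix.
have cvI : {within itvI, continuous v}.
  by apply: continuous_subspaceW cv; exact: subset_itv_oo_cc.
by move: cvI; rewrite (continuous_open_subspace _ open_itvI); apply; exact/mem_set.
Qed.

Lemma open_superlevel c : open [set x | itvI x /\ c < v x].
Proof.
rewrite openE => x [Ix cx]; rewrite /interior; near=> y; split.
  by near: y; exact: (open_nbhs_nbhs (conj open_itvI Ix)).
by near: y; apply: (cvgr_gt (v x)) => //; exact: graph_continuous.
Unshelve. all: by end_near. Qed.

Lemma open_Omega : open (Omega v).
Proof.
rewrite openE => -[x z] [/= Ix /andP[z1 zv]]; rewrite /interior.
pose c := (z + v x) / 2.
have xc : [set x | itvI x /\ c < v x] x by split => //; rewrite /c; lra.
have := open_nbhs_nbhs (conj (open_superlevel (c := c)) xc) => /nbhs_ballP[e1 /= e10 H1].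
apply/nbhs_ballP; exists (Num.min e1 (Num.min (z + 1) (c - z))) => /=.
  by rewrite !lt_min e10/= /c; apply/andP; split; lra.
move=> [x' z'] [/= bx]; rewrite /ball/= ltr_norml !lt_min => /andP[/= z'1 z'2].
rewrite {1}/ball /= lt_min in bx; move/andP: bx => [bx _].
have [Ix' cv'] := H1 x' bx.
split=> //=; apply/andP; split.
  move: z'2 => /and3P[]; lra.
move: z'1; rewrite ltrNl; rewrite !lt_min => /and3P[]; lra.
Qed.

Lemma measurable_Omega : measurable (Omega v).
Proof. by apply: open_measurable_plane; exact: open_Omega. Qed.

Lemma Omega_sub_square : Omega v `<=` `]-1, 1[%classic `*` `]-1, 1[%classic.
Proof.
move=> [x z] [/= Ix /andP[z1 zv]]; split => //=.
by rewrite in_itv/= z1 (lt_le_trans zv)//; have := v0 Ix; lra.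
Qed.

Lemma mu2_Omega : (mu2 (Omega v) < +oo)%E.
Proof.
have m1 := @measurable_itvI R.
apply: (@le_lt_trans _ _ (mu2 (`]-1, 1[%classic `*` `]-1, 1[%classic))).
  apply: le_measure; rewrite ?inE.
  - exact: measurable_Omega.
  - exact: measurableX.
  - exact: Omega_sub_square.
by rewrite product_measure1E// ![X in (X * _)%E]mu_itvI ![X in (_ * X)%E]mu_itvI -EFinM ltry.
Qed.

Lemma Rfubini_Omega (F : R * R -> R) : mu2.-integrable (Omega v) (EFin \o F) ->
  [/\ {ae mu, forall x, itvI x ->
        mu.-integrable `]-1, v x[ (EFin \o (fun z => F (x, z)))},
      mu.-integrable itvI (EFin \o (fun x => \int[mu]_(z in `]-1, v x[) F (x, z))) &
      \int[mu2]_(y in Omega v) F y =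
      \int[mu]_(x in itvI) \int[mu]_(z in `]-1, v x[) F (x, z)].
Proof.
move=> Fi.
have FOi : mu2.-integrable setT (EFin \o (F \_ (Omega v))).
  exact/(integrable_restrict_setT mu2 measurable_Omega).
have secE x z : itvI x -> (F \_ (Omega v)) (x, z) = ((fun z => F (x, z)) \_ `]-1, v x[) z.
  move=> Ix; rewrite !patchE; have [h|h] := boolP (z \in `]-1, v x[%classic).
    by rewrite mem_set//; split => //=; move: h; rewrite inE/= in_itv.
  rewrite memNset// => -[/= _ h']; move/negP: h; apply.
  by rewrite inE/= in_itv.
have intE x : (fun x => \int[mu]_z (F \_ (Omega v)) (x, z)) x =
    ((fun x => \int[mu]_(z in `]-1, v x[) F (x, z)) \_ itvI) x.
  rewrite [RHS]patchE; case: ifPn => [|/negP]; rewrite inE => Ix.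
    by rewrite [RHS]Rintegral_mkcond; apply: eq_Rintegral => z _; rewrite secE.
  transitivity (\int[mu]_(z in setT) (0 : R)); last by rewrite Rintegral_cst// mul0r.
  by apply: eq_Rintegral => z _; rewrite patchE memNset// => -[].
have [h1 h2 h3] := Rfubini FOi; split.
- apply: (ae_imp h1) => x hx Ix; apply/(integrable_restrict_setT mu).
    exact: measurable_itv.
  by apply: (intg_eq mu _ _ hx) => // z _; rewrite secE.
- apply/(integrable_restrict_setT mu); first exact: measurable_itvI.
  by apply: (intg_eq mu _ _ h2) => // x _; exact: intE.
- rewrite Rintegral_mkcond h3 [RHS]Rintegral_mkcond.
  by apply: eq_Rintegral => x _; exact: intE.
Qed.

(** The support lies in the compact rectangle [[a, a + r] x [b, c]], which fits into the domain
    because the graph stays above height [c] over all of [[a, a + r]]. *)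
Lemma test_kern_plane (k : R * R -> R) a r b c : 0 < r -> smooth k ->
  (forall y, y.2 < b \/ c < y.2 -> k y = 0) -> -1 < b ->
  `[a, a + r] `<=` [set x | itvI x /\ c < v x] ->
  test_function (Omega v) (fun y => kern a r y.1 * k y).
Proof.
move=> r0 sk k0 b1 aV; split.
  by apply: smoothM => //; exact: (smooth_comp (smooth_kern a r) smooth_fst).
exists (`[a, a + r]%classic `*` `[b, c]%classic).
  split; first by apply: compact_setX; exact: segment_compact.
  move=> [x z] [/= xa]; rewrite in_itv/= => /andP[bz zc].
  by have [Ix cx] := aV x xa; split => //=; rewrite (lt_le_trans b1 bz) (le_lt_trans zc cx).
move=> [x z] /= /not_andP[h|h].
  move/negP: h; rewrite in_itv/= negb_and -!ltNge => /orP[] h.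
    by rewrite kern_out0 ?mul0r// ltW.
  by rewrite kern_out1 ?mul0r// ltW.
rewrite k0 ?mulr0//=; move/negP: h; rewrite in_itv/= negb_and -!ltNge => /orP[]; [by left|by right].
Qed.

(** Two reductions to one variable. Products of a horizontal and a vertical kernel are test
    functions; removing the horizontal one shows that almost every vertical section is orthogonal to
    the vertical one. On such a section the one-dimensional result applies, and Fubini assembles the
    null sets. *)
Lemma du_bois_reymond_plane (f : R * R -> R) :
  mu2.-integrable (Omega v) (EFin \o f) ->
  (forall phi, test_function (Omega v) phi ->
    \int[mu2]_(y in Omega v) (f y * phi y) = 0) ->
  {ae mu2, forall y, Omega v y -> f y = 0}.
Proof.
move=> fi f0.
have mO := measurable_Omega.
have fOi : mu2.-integrable setT (EFin \o (f \_ (Omega v))).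
  exact/(integrable_restrict_setT mu2 mO).
set fO := f \_ (Omega v) in fOi.
have [M M0 HM] := @kern_bounded R.
have claim b s : 0 < s -> -1 < b ->
    {ae mu, forall x, [set x | itvI x /\ b + s < v x] x ->
       \int[mu]_z (kern b s z * fO (x, z)) = 0}.
  move=> s0 b1.
  have oD := open_superlevel (c := b + s).
  have mD := open_measurable oD.
  have ki : mu2.-integrable setT (EFin \o (fun y => kern b s y.2 * fO y)).
    apply: (intg_bndM mu2 measurableT _ (fun y _ => HM b s y.2 s0)) => //.
    apply: smooth_measurable_plane; exact: (smooth_comp (smooth_kern b s) smooth_snd).
  have [_ Pi _] := Rfubini ki.
  apply: (du_bois_reymond oD).
    by apply: integrableS Pi => //.
  move=> a r r0 aD.
  have ki2 : mu2.-integrable setT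
      (EFin \o (fun y => kern a r y.1 * (kern b s y.2 * fO y))).
    apply: (intg_bndM mu2 measurableT _ (fun y _ => HM a r y.1 r0)) => //.
    apply: smooth_measurable_plane; exact: (smooth_comp (smooth_kern a r) smooth_fst).
  have [_ _ F3] := Rfubini ki2.
  transitivity (\int[mu]_x (\int[mu]_z (kern b s z * fO (x, z)) * kern a r x)).
    rewrite Rintegral_mkcond; apply: eq_Rintegral => x _.
    rewrite patchE; case: ifPn => // /negP xD; rewrite kern_eq0 ?mulr0// => xa.
    by apply: xD; rewrite inE; exact: aD.
  transitivity (\int[mu2]_y (kern a r y.1 * (kern b s y.2 * fO y))).
    have [ae1 _ _] := Rfubini ki.
    rewrite F3 /Rintegral; congr fine; apply: ae_eq_integral => //.
    - apply/measurable_EFinP; apply: measurable_funM.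
        exact: (intg_measurable mu Pi).
      by apply: smooth_measurable; exact: smooth_kern.
    - by have [_ Qi _] := Rfubini ki2; exact: (measurable_int mu Qi).
    - apply: (ae_imp ae1) => x hx _; congr EFin.
      by rewrite mulrC -RintegralZl.
  transitivity (\int[mu2]_(y in Omega v) (f y * (kern a r y.1 * kern b s y.2))).
    rewrite [RHS]Rintegral_mkcond; apply: eq_Rintegral => y _.
    have [Oy|nOy] := pselect (Omega v y); last by rewrite /fO !patchE (memNset nOy) !mulr0.
    by rewrite /fO !patchE !mem_set//= mulrA mulrC.
  apply: f0; apply: (@test_kern_plane (fun y => kern b s y.2) a r b (b + s)) => //.
    exact: (smooth_comp (smooth_kern b s) smooth_snd).
  by move=> y [h|h]; [rewrite kern_out0// ltW|rewrite kern_out1// ltW].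
(* Rational vertical kernels, coded by natural numbers, produce countably many null sets of
   abscissae; off their union a section is orthogonal to all admissible rational kernels at once. *)
pose PQ n x : Prop := if unpickle n is Some (p, q) then
  (0 < ratr q :> R) -> (-1 < ratr p :> R) -> itvI x -> ratr p + ratr q < v x ->
  \int[mu]_z (kern (ratr p) (ratr q) z * fO (x, z)) = 0 else True.
have aePQ : {ae mu, forall x, forall n, PQ n x}.
  apply: ae_foralln => n; rewrite /PQ; case: (unpickle n) => [[p q]|]; last exact: aeW.
  have [q0|/negP q0] := boolP (0 < ratr q :> R); last by apply: aeW.
  have [p0|/negP p0] := boolP (-1 < ratr p :> R); last by apply: aeW.
  by apply: (ae_imp (claim _ _ q0 p0)) => x hx _ _ Ix xv; exact: hx.
have [aeO _ _] := Rfubini fOi.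
have secf x z : itvI x -> `]-1, v x[%classic z -> fO (x, z) = f (x, z).
  by move=> Ix zv; rewrite /fO patchE mem_set//; split => //=; move: zv; rewrite /= in_itv.
have aesec : {ae mu, forall x, itvI x ->
    {ae mu, forall z, `]-1, v x[%classic z -> f (x, z) = 0}}.
  have aeb : {ae mu, forall x, (forall n, PQ n x) /\
      mu.-integrable setT (EFin \o (fun z => fO (x, z)))}.
    by apply: filterS2 aePQ aeO => //; exact: (ae_filter_ringOfSetsType mu).
  apply: (ae_imp aeb) => x [hPQ hO] Ix.
  apply: du_bois_reymond_rat.
    apply: (intg_eq mu _ (f := fun z => fO (x, z))); first exact: measurable_itv.
      by move=> z; exact: secf.
    by apply: integrableS hO => //; exact: measurable_itv.
  move=> p q q0 p1 pq.
  transitivity (\int[mu]_z (kern (ratr p) (ratr q) z * fO (x, z))).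
    rewrite Rintegral_mkcond; apply: eq_Rintegral => z _; rewrite patchE.
    case: ifPn => [|/negP]; rewrite inE => zD; first by rewrite secf// mulrC.
    rewrite kern_eq0 ?mul0r// => zb; apply: zD; move: zb; rewrite /= !in_itv/=.
    by move=> /andP[pz zq]; rewrite (lt_le_trans p1 pz) (le_lt_trans zq pq).
  by have := hPQ (pickle (p, q)); rewrite /PQ pickleK; apply.
pose N := Omega v `&` [set y | f y != 0].
have mN : measurable N.
  have mf := intg_measurable mu2 fi.
  rewrite (_ : N = Omega v `&` f @^-1` (~` [set 0])).
    by apply: mf => //; apply: measurableC; exact: measurable_set1.
  by apply/seteqP; split => y [Oy /= /eqP fy].
exists N; split => //; last first.
  by move=> y /= /not_implyP[Oy /eqP fy].
rewrite /product_measure1 /=.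
rewrite (ae_eq_integral (cst 0%E)) ?integral0//.
- exact: measurable_fun_xsection.
- apply: (ae_imp aesec) => x hx _ /=.
  have mx : measurable (xsection N x) by exact: measurable_xsection.
  have [Ix|nIx] := pselect (itvI x).
    apply: measure_negligible => //.
    apply: negligibleS (hx Ix) => z /=; rewrite /xsection /= inE => -[[_ /= zv] /eqP fz].
    by move=> /(_ _); apply: contra_not fz; apply; rewrite in_itv.
  rewrite (_ : xsection N x = set0) ?measure0//.
  by apply/seteqP; split => z //; rewrite /xsection/= inE => -[[]].
Unshelve. all: by end_near. Qed.

End omega.

Section open_intervals.
Context {R : realType}.
Notation mu := (@lebesgue_measure R).

Lemma Rintegral_oo_cc (f : R -> R) (a b : R) : {within `[a, b], continuous f} ->
  \int[mu]_(x in `]a, b[) f x = \int[mu]_(x in `[a, b]) f x.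
Proof.
move=> cf; have fi : mu.-integrable `[a, b] (EFin \o f).
  by apply: continuous_compact_integrable => //; exact: segment_compact.
rewrite -Rintegral_itv_bndo_bndc; last first.
  by apply: integrableS fi => //; exact: subset_itv_co_cc.
rewrite -Rintegral_itv_obnd_cbnd//.
by apply: integrableS fi => //; exact: subset_itv_oo_cc.
Qed.

Lemma Rintegral_FTC_oo (F f : R -> R) (a b : R) : a < b ->
  (forall x : R, `]a, b[%classic x -> is_derive x 1 F (f x)) ->
  {within `[a, b], continuous F} -> {within `[a, b], continuous f} ->
  \int[mu]_(x in `]a, b[) f x = F b - F a.
Proof. by move=> ab dF cF cf; rewrite Rintegral_oo_cc//; apply: Rintegral_FTC2 => //; exact: ltW. Qed.

Lemma Rintegral_flatten (G : R -> R) (a b : R) : a < b ->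
  {within `[a, b], continuous G} ->
  \int[mu]_(x in `]a, b[) G x =
  \int[mu]_(s in `]0, 1[) ((b - a) * G (a + (b - a) * s)).
Proof.
move=> ab cG.
pose F s := a + (b - a) * s.
have dF (s : R) : is_derive s (1 : R) F (b - a).
  rewrite /F; have := is_deriveD (is_derive_cst a s 1) (is_deriveM (is_derive_cst (b - a) s 1) (is_derive_id s (1 : R))).
  by rewrite add0r scaler0 addr0 /GRing.scale/= mulr1.
have F'E : derive1 F = cst (b - a).
  by apply/funext => s; rewrite derive1E; have [_ ->] := dF s.
have cF : continuous F by move=> s; apply/differentiable_continuous/derivable1_diffP; have [] := dF s.
have F0 : F 0 = a by rewrite /F mulr0 addr0.
have F1 : F 1 = b by rewrite /F; lra.
have cGF : {within `[0, 1], continuous (G \o F)}.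
  apply/subspace_continuousP => s s01.
  have Fs : `[a, b]%classic (F s).
    by move: s01; rewrite /= !in_itv/= /F => /andP[s0 s1]; apply/andP; split; nra.
  have := (subspace_continuousP _ _).1 cG (F s) Fs; apply: cvg_comp.
  move=> B h.
  have h' : \forall t \near s, `[a, b]%classic (F t) -> B (F t) := cF s _ h.
  change (\forall t \near s, `[0, 1]%classic t -> B (F t)).
  apply: filterS h' => t ht t01; apply: ht.
  by move: t01; rewrite /= !in_itv/= /F => /andP[t0 t1]; apply/andP; split; nra.
rewrite Rintegral_oo_cc// Rintegral_oo_cc; last first.
  by move=> s; apply: cvgM; [exact: cvg_cst|exact: cGF].
rewrite /Rintegral; have := @integration_by_substitution_increasing R F G 0 1 ler01.
rewrite F0 F1 => -> //.
- by congr fine; apply: eq_integral => s _; rewrite F'E /= mulrC.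
- by move=> s t _ _ st; rewrite /F; nra.
- by rewrite F'E => s _; exact: cvg_cst.
- by rewrite F'E; exact: is_cvg_cst.
- by rewrite F'E; exact: is_cvg_cst.
- split.
  + by move=> s _; have [] := dF s.
  + by apply: cvg_at_right_filter; exact: cF.
  + by apply: cvg_at_left_filter; exact: cF.
Qed.

End open_intervals.

Section curves.
Context {R : realType}.
Implicit Types (F : R * R -> R).

Lemma is_derive_curve F (p1 p2 : R -> R) (t d1 d2 : R) : smooth F ->
  is_derive t 1 p1 d1 -> is_derive t 1 p2 d2 ->
  is_derive t 1 (fun s => F (p1 s, p2 s))
    (d1 * 'D_e_x F (p1 t, p2 t) + d2 * 'D_e_z F (p1 t, p2 t)).
Proof.
move=> sF [e1 <-] [e2 <-].
have g1 : differentiable p1 t := (derivable1_diffP _ _).1 e1.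
have g2 : differentiable p2 t := (derivable1_diffP _ _).1 e2.
have gp : differentiable (fun s => (p1 s, p2 s)) t by exact: differentiable_pair.
have gF : differentiable F (p1 t, p2 t) by exact: smooth_differentiable.
have gc : differentiable (F \o (fun s => (p1 s, p2 s))) t by exact: differentiable_comp.
apply: DeriveDef; first exact/derivable1_diffP.
rewrite [LHS]deriveE// diff_comp//= diff_pair//= -!deriveE//.
have lin (a b : R) : 'D_(a, b) F (p1 t, p2 t) =
    a * 'D_e_x F (p1 t, p2 t) + b * 'D_e_z F (p1 t, p2 t); last exact: lin.
rewrite !deriveE//.
have -> : (a, b) = a *: (e_x : R * R) + b *: (e_z : R * R).
  transitivity (a * 1 + b * 0, a * 0 + b * 1) => //.
  by rewrite !mulr0 !mulr1 addr0 add0r.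
by rewrite linearD !linearZ.
Qed.

Lemma is_derive_vert F (x z : R) : smooth F ->
  is_derive z 1 (fun s => F (x, s)) ('D_e_z F (x, z)).
Proof.
move=> sF; have := is_derive_curve sF (is_derive_cst x z 1) (is_derive_id z 1).
by rewrite mul1r mul0r add0r.
Qed.

Lemma continuous_curve F (p1 p2 : R -> R) (A : set R) : continuous F ->
  {within A, continuous p1} -> {within A, continuous p2} ->
  {within A, continuous (fun t => F (p1 t, p2 t))}.
Proof.
move=> cF /subspace_continuousP c1 /subspace_continuousP c2.
apply/subspace_continuousP => t At.
have cp : (p1 s, p2 s) @[s --> within A (nbhs t)] --> (p1 t, p2 t).
  exact: (cvg_pair (c1 t At) (c2 t At)).
exact: (cvg_comp _ _ cp (cF (p1 t, p2 t))).
Qed.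

End curves.

(** * Green's formulas for smooth functions below a graph *)

Section geometry.
Context {R : realType}.
Notation mu := (@lebesgue_measure R).
Notation mu2 := (mu \x mu)%E.
Variable v : R -> R.
Hypothesis cv : {within `[-1, 1], continuous v}.
Hypothesis v0 : forall x, itvI x -> -1 < v x <= 0.
Hypothesis vm1 : v (-1) = 0.
Hypothesis vp1 : v 1 = 0.

Lemma v0_cc x : `[-1, 1]%classic x -> -1 < v x <= 0.
Proof.
rewrite /= in_itv/= => /andP[]; rewrite le_eqVlt => /predU1P[<- _|x1].
  by rewrite vm1 lexx andbT ltrN10.
rewrite le_eqVlt => /predU1P[->|x2]; first by rewrite vp1 lexx andbT ltrN10.
by apply: v0; apply/itvIE; rewrite x1.
Qed.

Lemma closure_Omega_sub : closure (Omega v) `<=`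
  [set y | `[-1, 1]%classic y.1 /\ -1 <= y.2 <= v y.1].
Proof.
move=> [x z] cl.
have near_pt e : 0 < e -> exists x' z', [/\ Omega v (x', z'), `|x - x'| < e & `|z - z'| < e].
  move=> e0; have [[x' z'] [Oxz [/= b1 b2]]] := cl _ (nbhsx_ballx (x, z) e e0).
  by exists x', z'.
have Ix : `[-1, 1]%classic x.
  rewrite /= in_itv/=; apply/andP; split; rewrite leNgt; apply/negP => h.
    have [x' [z' [[/itvIE /= hx _]]]] := near_pt (-1 - x) ltac:(lra).
    by rewrite ltr_norml; lra.
  have [x' [z' [[/itvIE /= hx _]]]] := near_pt (x - 1) ltac:(lra).
  by rewrite ltr_norml; lra.
split => //=; apply/andP; split; rewrite leNgt; apply/negP => h.
  have [x' [z' [[_ /= hz]] _]] := near_pt (-1 - z) ltac:(lra).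
  by rewrite ltr_norml; lra.
pose c := (z + v x) / 2.
have vc : v x < c by rewrite /c; lra.
have := (subspace_continuousP _ _).1 cv x Ix => /(_ _ (lt_nbhsl vc)).
rewrite /nbhs/= /within/= => /nbhs_ballP[e /= e0 He].
have zc : 0 < z - c by rewrite /c; lra.
have [x' [z' [[/= Ix' /andP[_ zv']]]]] := near_pt (Num.min e (z - c)) ltac:(by rewrite lt_min e0).
rewrite !lt_min => /andP[xe _] /andP[_]; rewrite ltr_norml.
have Icc : x' \in `[-1, 1] by apply: subset_itv_oo_cc.
have vxc : v x' < c := He x' xe Icc.
by lra.
Qed.

Lemma closure_Omega_vert x z : itvI x -> -1 <= z <= v x -> closure (Omega v) (x, z).
Proof.
move=> Ix /andP[z1 zv] B /nbhs_ballP[e /= e0 eB].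
have /andP[vx _] := v0 Ix.
pose s := Num.min (1 / 2) (e / 2).
have s0 : 0 < s by rewrite lt_min; apply/andP; split; lra.
have s1 : s <= 1 / 2 by rewrite ge_min lexx.
have se : s <= e / 2 by rewrite ge_min lexx orbT.
(* The point is moved by a small fraction [s] towards the midpoint [(v x - 1) / 2] of its vertical
   segment, hence into the open domain. *)
exists (x, z + s * ((v x - 1) / 2 - z)); split.
  by split => //=; apply/andP; split; nra.
apply: eB; split; first exact: ballxx.
have /andP[_ v0'] := v0 Ix.
by rewrite /ball/= ltr_norml; apply/andP; split; nra.
Qed.

Lemma closed_bdy y : closure (Omega v) y -> ~ Omega v y ->
  (closure (Omega v) `\` (Omega v)°) y.
Proof. by move=> cy nO; split => //; have /interior_id -> := open_Omega cv. Qed.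

Lemma compact_closure_Omega : compact (closure (Omega v)).
Proof.
apply: (@subclosed_compact (R * R)%type _ (`[-1, 1]%classic `*` `[-1, 1]%classic)).
- exact: closed_closure.
- by apply: compact_setX; exact: segment_compact.
- move=> [x z] /closure_Omega_sub[/= Ix /andP[h1 h2]]; split => //=.
  by have := v0_cc Ix; rewrite in_itv/=; lra.
Qed.

Lemma smooth_integrable_Omega (F : R * R -> R) : smooth F ->
  mu2.-integrable (Omega v) (EFin \o F).
Proof.
move=> sF; have [M M0 HM] := smooth_bounded sF compact_closure_Omega.
apply: (intg_bnd mu2 (measurable_Omega cv) (M := M)).
- exact: mu2_Omega.
- by apply: measurable_funTS; exact: smooth_measurable_plane.
- by move=> y Oy; apply: HM; exact: subset_closure.
Qed.

Lemma green_z (F : R * R -> R) : smooth F ->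
  \int[mu2]_(y in Omega v) 'D_e_z F y = \int[mu]_(x in itvI) (F (x, v x) - F (x, -1)).
Proof.
move=> sF.
have Fi := smooth_integrable_Omega (smooth_derive (e_z : R * R) sF).
have [_ _ ->] := Rfubini_Omega cv Fi.
apply: eq_Rintegral => x; rewrite inE => Ix.
have /andP[vx _] := v0 Ix.
apply: (@Rintegral_FTC_oo _ (fun z => F (x, z)) (fun z => 'D_e_z F (x, z)) _ _ vx).
- by move=> z _; exact: is_derive_vert.
- apply: (continuous_curve (p1 := cst x) (p2 := id)).
  - exact: smooth_continuous.
  - by apply: continuous_subspaceT => ?; exact: cvg_cst.
  - by apply: continuous_subspaceT => ?; exact: cvg_id.
- apply: (continuous_curve (F := 'D_e_z F) (p1 := cst x) (p2 := id)).
  - by apply: smooth_continuous; exact: smooth_derive.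
  - by apply: continuous_subspaceT => ?; exact: cvg_cst.
  - by apply: continuous_subspaceT => ?; exact: cvg_id.
Qed.

Variable v1 : R -> R.
Hypothesis cv1 : {within `[-1, 1], continuous v1}.
Hypothesis dv : forall x, itvI x -> is_derive x 1 v (v1 x).

Lemma v1_continuous x : itvI x -> {for x, continuous v1}.
Proof.
move=> Ix.
have cvI : {within itvI, continuous v1}.
  by apply: continuous_subspaceW cv1; exact: subset_itv_oo_cc.
by move: cvI; rewrite (continuous_open_subspace _ (@open_itvI R)); apply; exact/mem_set.
Qed.

Lemma v1_bounded : exists2 M, 0 < M & forall x, itvI x -> `|v1 x| <= M.
Proof.
have := continuous_compact cv1 (@segment_compact _ _ _).
move=> /compact_bounded[M [_ HM]]; exists (Num.max M 0 + 1).
  by rewrite ltr_wpDl// le_max lexx orbT.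
move=> x Ix; apply: (HM (Num.max M 0 + 1)).
  by rewrite ltr_pwDr// le_max lexx.
by exists x => //; exact: subset_itv_oo_cc.
Qed.

Lemma v1_measurable : measurable_fun itvI v1.
Proof.
apply: open_continuous_measurable_fun; first exact: open_itvI.
by move=> x; rewrite inE => Ix; exact: v1_continuous.
Qed.

Lemma v_measurable : measurable_fun itvI v.
Proof.
apply: open_continuous_measurable_fun; first exact: open_itvI.
by move=> x; rewrite inE => Ix; exact: (graph_continuous cv).
Qed.

Lemma smooth_graph_measurable (F : R * R -> R) : smooth F ->
  measurable_fun itvI (fun x => F (x, v x)).
Proof.
move=> sF; apply: open_continuous_measurable_fun; first exact: open_itvI.
move=> x; rewrite inE => Ix.
have c1 : (y, v y) @[y --> x] --> (x, v x).
  exact: (cvg_pair (@cvg_id _ (nbhs x)) (graph_continuous cv Ix)).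
have c2 : F y @[y --> (x, v x)] --> F (x, v x) by exact: smooth_continuous.
exact: (cvg_comp _ _ c1 c2).
Qed.

Lemma smooth_graph_intg (F : R * R -> R) : smooth F ->
  mu.-integrable itvI (EFin \o (fun x => F (x, v x))).
Proof.
move=> sF; have [M M0 HM] := smooth_bounded sF compact_closure_Omega.
apply: (intg_bnd mu (@measurable_itvI R) (M := M)).
- exact: mu_itvI_fin.
- exact: smooth_graph_measurable.
- move=> x Ix; apply: HM; apply: closure_Omega_vert => //.
  by have /andP[/ltW -> _] := v0 Ix; rewrite lexx.
Qed.

(* The graph is flattened by z = -1 + (1 + v x) s; the integrand then has an
   explicit primitive both in x and, up to the term 'D_e_x F, in s. *)
Lemma green_x (F : R * R -> R) : smooth F ->
  (forall z, F (-1, z) = 0) -> (forall z, F (1, z) = 0) ->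
  \int[mu2]_(y in Omega v) 'D_e_x F y = - \int[mu]_(x in itvI) (F (x, v x) * v1 x).
Proof.
move=> sF Fm1 Fp1.
pose p x s := (x, -1 + (1 + v x) * s).
have sFx := smooth_derive (e_x : R * R) sF.
have sFz := smooth_derive (e_z : R * R) sF.
(* This is the derivative in [x] of [(1 + v x) * F (p x s)], where [1 + v x] is the Jacobian of the
   flattening. As [F] vanishes on the sides, the integral of [E] over the square is zero;
   integrating in the other order gives the formula. *)
pose E x s := v1 x * F (p x s) +
  (1 + v x) * ('D_e_x F (p x s) + v1 x * s * 'D_e_z F (p x s)).
pose Q : set (R * R) := itvI `*` `]0, 1[%classic.
have oQ : open Q.
  rewrite openE => -[x s] [/= Ix Is]; exists (itvI, `]0, 1[%classic) => //.
  split; first by apply: open_nbhs_nbhs; split; [exact: open_itvI|].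
  by apply: open_nbhs_nbhs; split; [exact: interval_open|].
have mQ : measurable Q := open_measurable_plane oQ.
have cp y : Q y -> {for y, continuous (fun y => p y.1 y.2)}.
  move=> [Iy1 _].
  have h1 : z.1 @[z --> y] --> y.1 by exact: cvg_fst.
  have h2 : z.2 @[z --> y] --> y.2 by exact: cvg_snd.
  have h3 : v z.1 @[z --> y] --> v y.1 by exact: (cvg_comp _ _ h1 (graph_continuous cv Iy1)).
  have h4 : -1 + (1 + v z.1) * z.2 @[z --> y] --> -1 + (1 + v y.1) * y.2.
    apply: cvgD; first exact: cvg_cst.
    by apply: cvgM => //; apply: cvgD => //; exact: cvg_cst.
  exact: (cvg_pair h1 h4).
have cG (G : R * R -> R) y : smooth G -> Q y -> {for y, continuous (fun y => G (p y.1 y.2))}.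
  move=> sG Qy; have h1 : p z.1 z.2 @[z --> y] --> p y.1 y.2 := cp y Qy.
  have h2 : G z @[z --> p y.1 y.2] --> G (p y.1 y.2) by exact: smooth_continuous.
  exact: (cvg_comp _ _ h1 h2).
have cE y : Q y -> {for y, continuous (fun y => E y.1 y.2)}.
  move=> Qy; have [Iy1 _] := Qy.
  have h1 : z.1 @[z --> y] --> y.1 by exact: cvg_fst.
  have c1 : v1 z.1 @[z --> y] --> v1 y.1 by exact: (cvg_comp _ _ h1 (v1_continuous Iy1)).
  have c2 : v z.1 @[z --> y] --> v y.1 by exact: (cvg_comp _ _ h1 (graph_continuous cv Iy1)).
  have h2 : z.2 @[z --> y] --> y.2 by exact: cvg_snd.
  have g0 : F (p z.1 z.2) @[z --> y] --> F (p y.1 y.2) by exact: cG.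
  have g1 : 'D_e_x F (p z.1 z.2) @[z --> y] --> 'D_e_x F (p y.1 y.2) by exact: (cG _ _ sFx).
  have g2 : 'D_e_z F (p z.1 z.2) @[z --> y] --> 'D_e_z F (p y.1 y.2) by exact: (cG _ _ sFz).
  have k1 : 1 + v z.1 @[z --> y] --> 1 + v y.1 by apply: cvgD => //; exact: cvg_cst.
  exact: (cvgD (cvgM c1 g0) (cvgM k1 (cvgD g1 (cvgM (cvgM c1 h2) g2)))).
have mE : measurable_fun Q (fun y => E y.1 y.2).
  by apply: open_continuous_measurable_plane => // y /set_mem Qy; exact: cE.
have pK x s : itvI x -> `[0, 1]%classic s -> closure (Omega v) (p x s).
  move=> Ix; rewrite /= in_itv/= => /andP[s0 s1].
  have /andP[vx0 vx1] := v0 Ix.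
  by apply: closure_Omega_vert => //; apply/andP; split; nra.
have [M M0 HM] := smooth_bounded sF compact_closure_Omega.
have [Mx Mx0 HMx] := smooth_bounded sFx compact_closure_Omega.
have [Mz Mz0 HMz] := smooth_bounded sFz compact_closure_Omega.
have [N N0 HN] := v1_bounded.
have muQ : (mu2 Q < +oo)%E.
  have m1 := @measurable_itvI R.
  have m2 : measurable (`]0, 1[%classic : set R) by exact: measurable_itv.
  have mu01 : mu (`]0, 1[%classic : set R) = 1%:E.
    by rewrite lebesgue_measure_itv /= lte_fin ltr01 -EFinB subr0.
  by rewrite product_measure1E// ![X in (X * _)%E]mu_itvI ![X in (_ * X)%E]mu01 -EFinM ltry.
have Ei : mu2.-integrable Q (EFin \o (fun y => E y.1 y.2)).
  apply: (intg_bnd mu2 mQ (M := N * M + (Mx + N * Mz)) muQ mE).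
  move=> [x s] [/= Ix s01].
  have s01' : `[0, 1]%classic s by exact: subset_itv_oo_cc.
  have := HM _ (pK x s Ix s01'); have := HMx _ (pK x s Ix s01').
  have := HMz _ (pK x s Ix s01'); have := HN x Ix.
  rewrite /E; move: (F _) ('D_e_x F _) ('D_e_z F _) (v1 x) => a b c d hd hc hb ha.
  have /andP[vx0 vx1] := v0 Ix.
  move: s01; rewrite in_itv/= => /andP[s0 s1].
  apply: (le_trans (ler_normD _ _)); apply: lerD.
    by rewrite normrM ler_pM.
  rewrite normrM -[leRHS]mul1r ler_pM//.
    by rewrite ger0_norm; lra.
  apply: (le_trans (ler_normD _ _)); apply: lerD => //.
  rewrite !normrM ler_pM// -[leRHS]mulr1 ler_pM// ger0_norm ltW//.
have EQi : mu2.-integrable setT (EFin \o ((fun y => E y.1 y.2) \_ Q)).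
  exact/(integrable_restrict_setT mu2 mQ).
have EQE x s : ((fun y => E y.1 y.2) \_ Q) (x, s) =
    ((fun x => (E x \_ `]0, 1[) s) \_ itvI) x.
  rewrite !patchE; have [h1|h1] := pselect (itvI x); last first.
    by rewrite !memNset// => -[].
  have [h2|h2] := pselect (`]0, 1[%classic s); last first.
    by rewrite (memNset h2) (mem_set h1) memNset// => -[].
  by rewrite !mem_set.
have [_ _ F1] := Rfubini EQi.
have [_ _ F2] := Rfubini2 EQi.
have int0 : \int[mu]_s \int[mu]_x ((fun y => E y.1 y.2) \_ Q) (x, s) = 0.
  transitivity (\int[mu]_(s in setT) (0 : R)); last by rewrite Rintegral_cst// mul0r.
  apply: eq_Rintegral => s _.
  under eq_Rintegral do rewrite EQE.
  rewrite -Rintegral_mkcond.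
  have [s01|s01] := pselect (`]0, 1[%classic s); last first.
    transitivity (\int[mu]_(x in itvI) (0 : R)); last by rewrite Rintegral_cst// ?mul0r//; exact: measurable_itvI.
    by apply: eq_Rintegral => x _; rewrite patchE memNset.
  have cps : {within `[-1, 1], continuous (fun x => -1 + (1 + v x) * s)}.
    move=> x; apply: cvgD; first exact: cvg_cst.
    apply: cvgM; last exact: cvg_cst.
    by apply: cvgD; [exact: cvg_cst|exact: cv].
  have cid' : {within `[-1, 1], continuous (@id R)}.
    by apply: continuous_subspaceT => ?; exact: cvg_id.
  have cGs (G : R * R -> R) : smooth G -> {within `[-1, 1], continuous (fun x => G (p x s))}.
    by move=> sG; apply: (continuous_curve (p1 := id)) => //; exact: smooth_continuous.
  transitivity (\int[mu]_(x in itvI) E x s).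
    by apply: eq_Rintegral => x _; rewrite patchE mem_set.
  transitivity ((1 + v 1) * F (p 1 s) - (1 + v (-1)) * F (p (-1) s)); last first.
    by rewrite /p Fm1 Fp1 !mulr0 subr0.
  apply: (@Rintegral_FTC_oo _ (fun x => (1 + v x) * F (p x s)) (fun x => E x s) (-1) 1).
  - exact: (lt_trans (ltrN10 R) ltr01).
  - move=> x Ix; have dvx := dv Ix.
    have d1 : is_derive x 1 (fun x => 1 + v x) (v1 x).
      by have := is_deriveD (is_derive_cst (1 : R) x 1) dvx; rewrite add0r.
    have d2 : is_derive x 1 (fun x => -1 + (1 + v x) * s) (v1 x * s).
      have := is_deriveD (is_derive_cst (-1 : R) x 1) (is_deriveM d1 (is_derive_cst s x 1)).
      by move=> h; apply: (is_derive_eq h); rewrite /cst /GRing.scale/=; ring.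
    have := is_deriveM d1 (is_derive_curve sF (is_derive_id x 1) d2).
    move=> h; apply: (is_derive_eq h); rewrite /E /GRing.scale/=.
    rewrite -/(p x s) mul1r; ring.
  - move=> x; apply: cvgM; last exact: cGs.
    by apply: cvgD; [exact: cvg_cst|exact: cv].
  - move=> x; apply: cvgD; first by apply: cvgM; [exact: cv1|exact: cGs].
    apply: cvgM; first by apply: cvgD; [exact: cvg_cst|exact: cv].
    apply: cvgD; first exact: (cGs _ sFx).
    apply: cvgM; last exact: (cGs _ sFz).
    by apply: cvgM; [exact: cv1|exact: cvg_cst].
have Fxi := smooth_integrable_Omega sFx.
have [_ Ii ->] := Rfubini_Omega cv Fxi.
have gi : mu.-integrable itvI (EFin \o (fun x => F (x, v x) * v1 x)).
  apply: (intg_eq mu _ (f := fun x => v1 x * F (x, v x))); first exact: measurable_itvI.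
    by move=> x _; rewrite mulrC.
  apply: (intg_bndM mu (@measurable_itvI R) v1_measurable HN).
  exact: smooth_graph_intg.
apply/eqP; rewrite -addr_eq0; apply/eqP; rewrite -RintegralD//; last exact: measurable_itvI.
rewrite -int0 -F2 F1 Rintegral_mkcond; apply: eq_Rintegral => x _.
under [RHS]eq_Rintegral do rewrite EQE.
rewrite patchE; case: ifPn => [/set_mem Ix|/negP nIx]; last first.
  rewrite (_ : (fun s => _) = cst 0) ?Rintegral_cst// ?mul0r//.
  by apply/funext => s; rewrite patchE; case: ifPn.
transitivity (\int[mu]_(s in `]0, 1[) E x s); last first.
  by rewrite Rintegral_mkcond; apply: eq_Rintegral => s _; rewrite [RHS]patchE mem_set.
have /andP[vx _] := v0 Ix.
have cvert (G : R * R -> R) : smooth G -> {within `[-1, v x], continuous (fun z => G (x, z))}.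
  move=> sG; apply: (continuous_curve (p1 := cst x) (p2 := id)).
  - exact: smooth_continuous.
  - by apply: continuous_subspaceT => ?; exact: cvg_cst.
  - by apply: continuous_subspaceT => ?; exact: cvg_id.
have cps (G : R * R -> R) : smooth G -> {within `[0, 1], continuous (fun s => G (p x s))}.
  move=> sG; apply: (continuous_curve (p1 := cst x)); first exact: smooth_continuous.
    by apply: continuous_subspaceT => ?; exact: cvg_cst.
  apply: continuous_subspaceT => s; apply: cvgD; first exact: cvg_cst.
  by apply: cvgM; [exact: cvg_cst|exact: cvg_id].
rewrite (Rintegral_flatten vx (cvert _ sFx)) opprK (addrC (v x)).
have cint (f : R -> R) : {within `[0, 1], continuous f} ->
    mu.-integrable `]0, 1[ (EFin \o f).
  move=> cf; have fi : mu.-integrable `[0, 1] (EFin \o f).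
    by apply: continuous_compact_integrable => //; exact: segment_compact.
  by apply: integrableS fi => //; exact: subset_itv_oo_cc.
pose f1 s := (1 + v x) * 'D_e_x F (p x s).
(* What [E x] contains besides the flattened ['D_e_x F] is the derivative in [s] of
   [v1 x * (s * F (p x s))]; it produces the top term at [s = 1] and nothing at [s = 0]. *)
pose f2 s := v1 x * (F (p x s) + s * ((1 + v x) * 'D_e_z F (p x s))).
have c1 : {within `[0, 1], continuous f1}.
  by move=> s; apply: cvgM; [exact: cvg_cst|exact: (cps _ sFx)].
have c2 : {within `[0, 1], continuous f2}.
  move=> s; apply: cvgM; first exact: cvg_cst.
  apply: cvgD; first exact: cps.
  apply: cvgM; first by apply: (@continuous_subspaceT _ _ _ (@id R)) => ?; exact: cvg_id.
  by apply: cvgM; [exact: cvg_cst|exact: (cps _ sFz)].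
transitivity (\int[mu]_(s in `]0, 1[) (f1 s + f2 s)); last first.
  by apply: eq_Rintegral => s _; rewrite /f1 /f2 /E; ring.
rewrite RintegralD//; [|exact: cint|exact: cint].
congr (_ + _).
pose G0 s := v1 x * (s * F (p x s)).
transitivity (G0 1 - G0 0).
  by rewrite /G0 mul0r mulr0 subr0 mul1r /p mulr1 addrA addNr add0r mulrC.
have dG0 (s : R) : `]0, 1[%classic s -> is_derive s 1 G0 (f2 s).
  move=> _.
  have d2 : is_derive s 1 (fun s => -1 + (1 + v x) * s) (1 + v x).
    have := is_deriveD (is_derive_cst (-1 : R) s 1) (is_deriveM (is_derive_cst (1 + v x) s 1) (is_derive_id s 1)).
    by move=> h; apply: (is_derive_eq h); rewrite /cst /GRing.scale/=; ring.
  have d3 := is_derive_curve sF (is_derive_cst x s 1) d2.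
  have := is_deriveM (is_derive_cst (v1 x) s 1) (is_deriveM (is_derive_id s 1) d3).
  by move=> h; apply: (is_derive_eq h); rewrite /f2 /cst /GRing.scale/= -/(p x s); ring.
have cG0 : {within `[0, 1], continuous G0}.
  move=> s; apply: cvgM; first exact: cvg_cst.
  apply: cvgM; first by apply: (@continuous_subspaceT _ _ _ (@id R)) => ?; exact: cvg_id.
  exact: cps.
exact/esym/(Rintegral_FTC_oo ltr01 dG0 cG0 c2).
Qed.

End geometry.

(** * A weak maximum principle *)

Section subharmonic_core.
Context {R : realType}.
Implicit Types (c t : R).

Lemma mul_expinv k t : t * expinv k.+1 t = expinv k t.
Proof.
rewrite /expinv; case: ifPn => [t0|_]; last by rewrite mulr0.
by rewrite mulrA exprS invfM mulrA mulfV ?mul1r// gt_eqF.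
Qed.

(** A smooth, nondecreasing and convex substitute for [max(t, 0)]: its second derivative is
    [t^-3 exp(-1/t)] for positive [t]. *)
Definition hinge t : R := t * expinv 0 t.

Lemma smooth_hinge : smooth hinge.
Proof. by apply: smoothM; [exact: smooth_id|exact: smooth_expinv]. Qed.

Lemma is_derive_hinge t : is_derive t 1 hinge (expinv 0 t + expinv 1 t).
Proof.
have := is_deriveM (is_derive_id t 1) (is_derive_expinv 0 t).
move=> h; apply: (is_derive_eq h); rewrite mul0r subr0 /GRing.scale/= mulr1 mul_expinv.
by rewrite addrC.
Qed.

Lemma derive_hinge t : 'D_1 hinge t = expinv 0 t + expinv 1 t.
Proof. by have [_ ->] := is_derive_hinge t. Qed.

Lemma derive2_hinge t : 'D_1 ('D_1 hinge) t = expinv 3 t.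
Proof.
rewrite (_ : 'D_1 hinge = (fun t => expinv 0 t + expinv 1 t)); last first.
  by apply/funext => s; exact: derive_hinge.
have [_ ->] := is_deriveD (is_derive_expinv 0 t) (is_derive_expinv 1 t).
by rewrite mul0r subr0 mul1r addrCA subrr addr0.
Qed.

Lemma derive_hinge_ge0 t : 0 <= 'D_1 hinge t.
Proof. by rewrite derive_hinge addr_ge0// expinv_ge0. Qed.

(** For positive [t] this is [(1 + 1/t) exp(-1/t) <= 1], an instance of [1 + s <= exp s]. *)
Lemma derive_hinge_le1 t : 'D_1 hinge t <= 1.
Proof.
rewrite derive_hinge /expinv; case: ifPn => [t0|_]; last by rewrite addr0.
rewrite expr0 invr1 mul1r expr1 -{1}(mul1r (expR _)) -mulrDl expRN ler_pdivrMr ?expR_gt0// mul1r.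
exact: expR_ge1Dx.
Qed.

Lemma hinge_ge0 t : 0 <= hinge t.
Proof.
rewrite /hinge /expinv; case: ifPn => [t0|_]; last by rewrite mulr0.
by rewrite expr0 invr1 mul1r mulr_ge0 ?expR_ge0// ltW.
Qed.

Lemma hinge_le0 t : t <= 0 -> hinge t = 0.
Proof. by move=> t0; rewrite /hinge expinv_le0// mulr0. Qed.

Lemma hinge_homo s t : s <= t -> hinge s <= hinge t.
Proof.
move=> st; have [s0|s0] := leP s 0; first by rewrite (hinge_le0 s0) hinge_ge0.
by rewrite ler_pM ?expinv_ge0 ?expinv0_homo// ltW.
Qed.

Lemma hinge_gt0 t : 0 < t -> 0 < hinge t.
Proof. by move=> t0; rewrite mulr_gt0// expinv0_gt0. Qed.

(** The function [- ln t] for [t >= 1], made smooth on the whole line by sliding the argument of the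
    logarithm from 1 to [t] while [t] runs through [[0, 1]]. *)
Definition lnreg t : R := - ln (t * step t + (1 - step t)).

Lemma lnreg_arg t : 0 < t * step t + (1 - step t).
Proof.
have [t0|t0] := leP t 0; first by rewrite step_le0// mulr0 subr0 add0r.
have := step_le1 t; rewrite le_eqVlt => /predU1P[->|s1].
  by rewrite subrr addr0 mulr1.
by rewrite ltr_wpDl// ?subr_gt0// mulr_ge0 ?step_ge0// ltW.
Qed.

Lemma smooth_lnreg : smooth lnreg.
Proof.
apply: smoothN; apply: smooth_ln lnreg_arg.
by apply: smoothD; [apply: smoothM; [exact: smooth_id|exact: smooth_step]|
  apply: smoothB; [exact: smooth_cst|exact: smooth_step]].
Qed.

Lemma lnreg_ge1 t : 1 <= t -> lnreg t = - ln t.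
Proof. by move=> t1; rewrite /lnreg step_ge1// subrr addr0 mulr1. Qed.

Lemma lnreg_le1 t : t <= 1 -> 0 <= lnreg t.
Proof.
move=> t1; rewrite oppr_ge0 ln_le0//.
by have := step_ge0 t; nra.
Qed.

Lemma derive_lnreg t : 1 < t -> 'D_1 lnreg t = - t^-1.
Proof.
move=> t1; have t0 : 0 < t by exact: lt_trans t1.
have [_ h] := is_deriveN (is_derive1_ln t0).
rewrite -h; apply: near_eq_derive.
by near=> s; rewrite lnreg_ge1// ltW//; near: s; exact: lt_nbhsr.
Unshelve. all: by end_near. Qed.

Lemma derive2_lnreg t : 1 < t -> 'D_1 ('D_1 lnreg) t = t ^- 2.
Proof.
move=> t1; have t0 : t != 0 by rewrite gt_eqF// (lt_trans _ t1).
have [_ h] := is_deriveN (is_deriveV t0 (is_derive_id t (1 : R))).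
transitivity ('D_1 (\- (fun y : R => y^-1)) t).
  apply: near_eq_derive.
  by near=> s; rewrite derive_lnreg//; near: s; exact: lt_nbhsr.
by rewrite h /GRing.scale/= mulr1 opprK.
Unshelve. all: by end_near. Qed.

(* With t the squared distance to a point, a truncated and smoothed fundamental solution
   of the planar Laplacian; the Laplacian is then 4 times [radial_lap]. *)
Definition core c t : R := hinge (c + lnreg t).

Lemma smooth_core c : smooth (core c).
Proof.
apply: smooth_comp; first exact: smooth_hinge.
by apply: smoothD; [exact: smooth_cst|exact: smooth_lnreg].
Qed.

Lemma derive_core c t : 'D_1 (core c) t = 'D_1 hinge (c + lnreg t) * 'D_1 lnreg t.
Proof.
have dl : is_derive t 1 (fun t => c + lnreg t) ('D_1 lnreg t).
  have := is_deriveD (is_derive_cst c t 1) (smooth_is_derive t 1 smooth_lnreg).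
  by rewrite add0r.
have sl : smooth (fun t => c + lnreg t) by apply: smoothD; [exact: smooth_cst|exact: smooth_lnreg].
have sh : is_derive (c + lnreg t) 1 hinge _ := smooth_is_derive _ _ smooth_hinge.
have := is_derive_comp1 (p := fun t => c + lnreg t) sh (smooth_differentiable t sl) dl.
by case.
Qed.

Lemma derive2_core c t : 'D_1 ('D_1 (core c)) t =
  expinv 3 (c + lnreg t) * 'D_1 lnreg t ^+ 2 + 'D_1 hinge (c + lnreg t) * 'D_1 ('D_1 lnreg) t.
Proof.
rewrite (_ : 'D_1 (core c) = (fun t => 'D_1 hinge (c + lnreg t) * 'D_1 lnreg t)); last first.
  by apply/funext => s; exact: derive_core.
have dl : is_derive t 1 (fun t => c + lnreg t) ('D_1 lnreg t).
  have := is_deriveD (is_derive_cst c t 1) (smooth_is_derive t 1 smooth_lnreg).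
  by rewrite add0r.
have sl : smooth (fun t => c + lnreg t) by apply: smoothD; [exact: smooth_cst|exact: smooth_lnreg].
have sh' := smooth_derive (1 : R) smooth_hinge.
have sl' := smooth_derive (1 : R) smooth_lnreg.
have sh : is_derive (c + lnreg t) 1 ('D_1 hinge) _ := smooth_is_derive _ _ sh'.
have d1 := is_derive_comp1 (p := fun t => c + lnreg t) sh (smooth_differentiable t sl) dl.
have [_ ->] := is_deriveM d1 (smooth_is_derive t 1 sl').
by rewrite derive2_hinge /GRing.scale/=; ring.
Qed.

Definition radial_lap c t : R := 'D_1 (core c) t + t * 'D_1 ('D_1 (core c)) t.

(** For [t > 1] the inner function [- ln t] satisfies [f' + t f'' = 0], so only the convexity of
    [hinge] contributes. *)
Lemma radial_lap_ge0 c t : 1 < t -> 0 <= radial_lap c t.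
Proof.
move=> t1; have t0 : 0 < t by exact: lt_trans t1.
rewrite /radial_lap derive_core derive2_core derive_lnreg// derive2_lnreg//.
move: ('D_1 hinge _) (expinv_ge0 3 (c + lnreg t)) => a; move: (expinv 3 _) => b b0.
have E (p q : R) : p * - t^-1 + t * (q * (- t^-1) ^+ 2 + p / t ^+ 2) = q / t.
  by field; rewrite gt_eqF.
by rewrite E divr_ge0// ltW.
Qed.

(** The bound is uniform in the level [c], which enters only through the first derivative of
    [hinge], confined to [[0, 1]], and the second, which appears with a nonnegative factor. The rest
    is bounded on [[0, 1]]. *)
Lemma radial_lap_ge : exists2 M, 0 < M & forall c t, 0 <= t <= 1 -> - M <= radial_lap c t.
Proof.
have sl' := smooth_derive (1 : R) (smooth_lnreg).
have [M M0 HM] := smooth_bounded sl' (@segment_compact R 0 1).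
have [N N0 HN] := smooth_bounded (smooth_derive (1 : R) sl') (@segment_compact R 0 1).
exists (M + N) => [|c t t01]; first exact: addr_gt0.
have tI : `[0, 1]%classic t by rewrite /= in_itv.
have := HM t tI; have := HN t tI; move/andP: t01 => [t0 t1].
rewrite /radial_lap derive_core derive2_core.
have := derive_hinge_le1 (c + lnreg t); have := derive_hinge_ge0 (c + lnreg t).
have := expinv_ge0 3 (c + lnreg t).
move: ('D_1 hinge _) (expinv 3 _) ('D_1 lnreg t) ('D_1 ('D_1 lnreg) t) => a b p q b0 a0 a1.
move=> /ler_normlP[q1 q2] /ler_normlP[p1 p2].
have h1 : 0 <= t * (b * p ^+ 2) := mulr_ge0 t0 (mulr_ge0 b0 (sqr_ge0 p)).
have h2 : - M <= a * p by nra.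
have h3 : - N <= a * q by nra.
have h4 : - N <= t * (a * q) by nra.
by rewrite mulrDr; lra.
Qed.

Lemma core_ge0 c t : 0 <= core c t. Proof. exact: hinge_ge0. Qed.

Lemma core_out r c t : 0 < r -> 1 <= r / c ^+ 2 -> 0 < c -> r / c ^+ 2 <= t ->
  core (ln (r / c ^+ 2)) t = 0.
Proof.
move=> r0 rc c0 rt; have t1 : 1 <= t by exact: le_trans rt.
rewrite /core hinge_le0// lnreg_ge1// subr_le0 ler_ln// posrE.
  exact: lt_le_trans rc.
exact: lt_le_trans t1.
Qed.

(** At most half way to the truncation radius, in squared distance, the argument of [hinge] is at
    least [ln m - ln (m / 2) = ln 2]. *)
Lemma core_ge m t : 2 <= m -> 0 <= t <= m / 2 -> hinge (ln 2) <= core (ln m) t.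
Proof.
move=> m2 /andP[t0 tm]; apply: hinge_homo.
have m0 : 0 < m by exact: lt_le_trans m2.
have l2 : ln 2 <= ln m by rewrite ler_ln ?posrE.
have [t1|t1] := leP t 1; first by have := lnreg_le1 t1; lra.
have tp : 0 < t by exact: lt_trans t1.
rewrite (lnreg_ge1 (ltW t1)) -ln_div// ler_ln ?posrE// ?divr_gt0//.
by rewrite ler_pdivlMr//; lra.
Qed.

End subharmonic_core.

Section plane_core.
Context {R : realType}.
Variables (eps x0 z0 : R).
Hypothesis e0 : 0 < eps.

(** Dividing the horizontal distance by [eps] turns the operator [eps^2 d_x^2 + d_z^2] into the
    Laplacian, so functions of this quantity behave as radial ones. *)
Definition sqdist (y : R * R) : R := ((y.1 - x0) / eps) ^+ 2 + (y.2 - z0) ^+ 2.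

Lemma smooth_sqdist : smooth sqdist.
Proof.
apply: smoothD; apply: smoothX.
  have := smoothZ eps^-1 (smoothB smooth_fst (smooth_cst x0)).
  by under eq_fun do rewrite mulrC.
exact: (smoothB smooth_snd (smooth_cst z0)).
Qed.

Lemma sqdist_ge0 y : 0 <= sqdist y.
Proof. by rewrite addr_ge0// sqr_ge0. Qed.

Lemma derive_sqdist_x y : 'D_e_x sqdist y = 2 / eps ^+ 2 * (y.1 - x0).
Proof.
have d := is_deriveB (is_derive_fst y e_x) (is_derive_cst x0 y e_x).
have d1 := is_deriveM d (is_derive_cst eps^-1 y e_x).
have d2 := is_deriveX 2 d1.
have d3 := is_deriveB (is_derive_snd y e_x) (is_derive_cst z0 y e_x).
have [_ ->] := is_deriveD d2 (is_deriveX 2 d3).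
transitivity (2 * ((y.1 - x0) * eps^-1) ^+ 1 * ((y.1 - x0) * 0 + eps^-1 * (1 - 0)) +
  2 * (y.2 - z0) ^+ 1 * (0 - 0)) => //.
by field; rewrite gt_eqF.
Qed.

Lemma derive_sqdist_z y : 'D_e_z sqdist y = 2 * (y.2 - z0).
Proof.
have d := is_deriveB (is_derive_fst y e_z) (is_derive_cst x0 y e_z).
have d1 := is_deriveM d (is_derive_cst eps^-1 y e_z).
have d2 := is_deriveX 2 d1.
have d3 := is_deriveB (is_derive_snd y e_z) (is_derive_cst z0 y e_z).
have [_ ->] := is_deriveD d2 (is_deriveX 2 d3).
transitivity (2 * ((y.1 - x0) * eps^-1) ^+ 1 * ((y.1 - x0) * 0 + eps^-1 * (0 - 0)) +
  2 * (y.2 - z0) ^+ 1 * (1 - 0)) => //.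
by ring.
Qed.

Definition lap (phi : R * R -> R) y : R :=
  eps ^+ 2 * 'D_e_x ('D_e_x phi) y + 'D_e_z ('D_e_z phi) y.

Definition bump_core (c s : R) y : R := core c (s ^- 2 * sqdist y).

Lemma smooth_bump_core c s : smooth (bump_core c s).
Proof.
apply: (@smooth_comp _ _ (core c) (fun y => s ^- 2 * sqdist y)); first exact: smooth_core.
by apply: smoothZ; exact: smooth_sqdist.
Qed.

Lemma derive_bump_core (G : R -> R) (s : R) e y : smooth G ->
  is_derive y e (fun y => G (s ^- 2 * sqdist y))
    ('D_1 G (s ^- 2 * sqdist y) * (s ^- 2 * 'D_e sqdist y)).
Proof.
move=> sG.
have sp : smooth (fun y => s ^- 2 * sqdist y) by apply: smoothZ; exact: smooth_sqdist.
have dG : is_derive (s ^- 2 * sqdist y) 1 G _ := smooth_is_derive _ _ sG.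
apply: (is_derive_comp1 (p := fun y => s ^- 2 * sqdist y) dG (smooth_differentiable y sp)).
have := is_deriveM (is_derive_cst (s ^- 2) y e) (smooth_is_derive y e smooth_sqdist).
by move=> h; apply: (is_derive_eq h); rewrite /cst /GRing.scale/= mulr0 addr0.
Qed.

Lemma lap_bump_core c s y : 0 < s ->
  lap (bump_core c s) y = 4 / s ^+ 2 * radial_lap c (s ^- 2 * sqdist y).
Proof.
move=> s0.
have sC := @smooth_core R c; have sC' := smooth_derive (1 : R) sC.
pose T y := s ^- 2 * sqdist y.
have ex : 'D_e_x (bump_core c s) = fun y =>
    'D_1 (core c) (T y) * (s ^- 2 * (2 / eps ^+ 2 * (y.1 - x0))).
  by apply/funext => u; have [_ ->] := derive_bump_core s e_x u sC; rewrite derive_sqdist_x.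
have ez : 'D_e_z (bump_core c s) = fun y =>
    'D_1 (core c) (T y) * (s ^- 2 * (2 * (y.2 - z0))).
  by apply/funext => u; have [_ ->] := derive_bump_core s e_z u sC; rewrite derive_sqdist_z.
have dx := is_deriveB (is_derive_fst y e_x) (is_derive_cst x0 y e_x).
have dx1 := is_deriveM (is_derive_cst (s ^- 2 * (2 / eps ^+ 2)) y e_x) dx.
have dx2 := is_deriveM (derive_bump_core s e_x y sC') dx1.
have dz := is_deriveB (is_derive_snd y e_z) (is_derive_cst z0 y e_z).
have dz1 := is_deriveM (is_derive_cst (s ^- 2 * 2) y e_z) dz.
have dz2 := is_deriveM (derive_bump_core s e_z y sC') dz1.
have lx : 'D_e_x ('D_e_x (bump_core c s)) y =
    'D_1 (core c) (T y) * (s ^- 2 * (2 / eps ^+ 2)) +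
    s ^- 2 * (2 / eps ^+ 2) * (y.1 - x0) *
      ('D_1 ('D_1 (core c)) (T y) * (s ^- 2 * (2 / eps ^+ 2 * (y.1 - x0)))).
  have [_ h] := dx2.
  have ex' : 'D_e_x (bump_core c s) = (fun y => 'D_1 (core c) (T y)) *
      (cst (s ^- 2 * (2 / eps ^+ 2)) * (fst - cst x0)).
    apply: (etrans ex); apply/funext => u.
    exact: (congr1 (fun k => 'D_1 (core c) (T u) * k) (mulrA _ _ _)).
  apply: (etrans (congr1 (fun f => 'D_e_x f y) ex')); apply: (etrans h).
  rewrite derive_sqdist_x.
  transitivity ('D_1 (core c) (T y) * (s ^- 2 * (2 / eps ^+ 2) * (1 - 0) + (y.1 - x0) * 0) +
    s ^- 2 * (2 / eps ^+ 2) * (y.1 - x0) *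
      ('D_1 ('D_1 (core c)) (T y) * (s ^- 2 * (2 / eps ^+ 2 * (y.1 - x0))))) => //.
  by rewrite mulr0 addr0 subr0 mulr1.
have lz : 'D_e_z ('D_e_z (bump_core c s)) y =
    'D_1 (core c) (T y) * (s ^- 2 * 2) +
    s ^- 2 * 2 * (y.2 - z0) *
      ('D_1 ('D_1 (core c)) (T y) * (s ^- 2 * (2 * (y.2 - z0)))).
  have [_ h] := dz2.
  have ez' : 'D_e_z (bump_core c s) = (fun y => 'D_1 (core c) (T y)) *
      (cst (s ^- 2 * 2) * (snd - cst z0)).
    apply: (etrans ez); apply/funext => u.
    exact: (congr1 (fun k => 'D_1 (core c) (T u) * k) (mulrA _ _ _)).
  apply: (etrans (congr1 (fun f => 'D_e_z f y) ez')); apply: (etrans h).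
  rewrite derive_sqdist_z.
  transitivity ('D_1 (core c) (T y) * (s ^- 2 * 2 * (1 - 0) + (y.2 - z0) * 0) +
    s ^- 2 * 2 * (y.2 - z0) *
      ('D_1 ('D_1 (core c)) (T y) * (s ^- 2 * (2 * (y.2 - z0))))) => //.
  by rewrite mulr0 addr0 subr0 mulr1.
apply: (etrans (congr2 (fun a b => eps ^+ 2 * a + b) lx lz)).
have E (k1 k2 t a b : R) : t = s ^- 2 * ((a / eps) ^+ 2 + b ^+ 2) ->
    eps ^+ 2 * (k1 * (s ^- 2 * (2 / eps ^+ 2)) +
      s ^- 2 * (2 / eps ^+ 2) * a * (k2 * (s ^- 2 * (2 / eps ^+ 2 * a)))) +
    (k1 * (s ^- 2 * 2) + s ^- 2 * 2 * b * (k2 * (s ^- 2 * (2 * b)))) =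
    4 / s ^+ 2 * (k1 + t * k2).
  by move=> ->; field; rewrite !gt_eqF.
exact: (E ('D_1 (core c) (T y)) ('D_1 ('D_1 (core c)) (T y)) (T y) (y.1 - x0) (y.2 - z0)).
Qed.

End plane_core.

(** * Integration by parts against test functions *)

Section test_calculus.
Context {R : realType}.
Notation mu := (@lebesgue_measure R).
Notation mu2 := (mu \x mu)%E.

Lemma test_derive (D : set (R * R)) (phi : R * R -> R) e :
  test_function D phi -> test_function D ('D_e phi).
Proof.
move=> [sp [K [cK KD] pK]]; split; first exact: smooth_derive.
exists K => // y nKy.
have oC : open (~` K) by apply: closed_openC; apply: compact_closed => //; exact: norm_hausdorff.
have nE : \forall z \near y, phi z = cst 0 z.
  by apply: filterS (open_nbhs_nbhs (conj oC nKy)) => z; exact: pK.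
by rewrite (near_eq_derive _ nE) derive_cst.
Qed.

Lemma test_out (D : set (R * R)) (phi : R * R -> R) y :
  test_function D phi -> ~ D y -> phi y = 0.
Proof. by move=> [_ [K [_ KD] pK]] nD; apply: pK => /KD. Qed.

Lemma test_smooth (D : set (R * R)) (phi : R * R -> R) : test_function D phi -> smooth phi.
Proof. by case. Qed.

Lemma derive_mul (f g : R * R -> R) e y : smooth f -> smooth g ->
  'D_e (fun y => f y * g y) y = f y * 'D_e g y + g y * 'D_e f y.
Proof.
move=> sf sg; have [_ h] := is_deriveM (smooth_is_derive y e sf) (smooth_is_derive y e sg).
exact: h.
Qed.

Variable v : R -> R.
Hypothesis cv : {within `[-1, 1], continuous v}.
Hypothesis v0 : forall x, itvI x -> -1 < v x <= 0.
Hypothesis vm1 : v (-1) = 0.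
Hypothesis vp1 : v 1 = 0.
Variable v1 : R -> R.
Hypothesis cv1 : {within `[-1, 1], continuous v1}.
Hypothesis dv : forall x, itvI x -> is_derive x 1 v (v1 x).
Variable eps : R.
Hypothesis e0 : 0 < eps.

Let mO := measurable_Omega cv.
Let intO (F : R * R -> R) (sF : smooth F) := smooth_integrable_Omega cv v0 vm1 vp1 sF.

Lemma test_ibp (f phi : R * R -> R) e : e = e_x \/ e = e_z ->
  smooth f -> test_function (Omega v) phi ->
  \int[mu2]_(y in Omega v) (f y * 'D_e phi y) = - \int[mu2]_(y in Omega v) ('D_e f y * phi y).
Proof.
move=> he sf tp; have sp := test_smooth tp.
have sF := smoothM sf sp.
have i1 := intO (smoothM sf (smooth_derive e sp)).
have i2 := intO (smoothM (smooth_derive e sf) sp).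
have gr : \int[mu2]_(y in Omega v) 'D_e (fun y => f y * phi y) y = 0.
  have p0 x z : ~ Omega v (x, z) -> f (x, z) * phi (x, z) = 0.
    by move=> nO; rewrite (test_out tp nO) mulr0.
  have zz : \int[mu]_(x in itvI) (0 : R) = 0.
    by rewrite Rintegral_cst// ?mul0r//; exact: measurable_itvI.
  case: he => ->.
    rewrite (green_x cv v0 vm1 vp1 cv1 dv sF).
    - rewrite -[RHS]oppr0 -zz; congr (- _); apply: eq_Rintegral => x _.
      by rewrite p0 ?mul0r// => -[_ /= /andP[_]]; rewrite ltxx.
    - by move=> z; apply: p0 => -[/itvIE /=]; rewrite ltxx.
    - by move=> z; apply: p0 => -[/itvIE /=]; rewrite ltxx andbF.
  rewrite (green_z cv v0 vm1 vp1 sF) -[RHS]zz; apply: eq_Rintegral => x _.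
  rewrite !p0 ?subr0// => -[_ /=]; first by rewrite ltxx.
  by rewrite ltxx andbF.
apply/eqP; rewrite -addr_eq0 -RintegralD//; apply/eqP; rewrite -[RHS]gr.
by apply: eq_Rintegral => y _; rewrite derive_mul// (mulrC (phi y)).
Qed.

Lemma test_lap (f phi : R * R -> R) : smooth f -> test_function (Omega v) phi ->
  \int[mu2]_(y in Omega v) (f y * lap eps phi y) = \int[mu2]_(y in Omega v) (lap eps f y * phi y).
Proof.
move=> sf tp; have sp := test_smooth tp.
have sd e g : smooth g -> smooth ('D_e ('D_e g) : R * R -> R).
  by move=> sg; apply: smooth_derive; exact: smooth_derive.
have twice e : e = e_x \/ e = e_z ->
    \int[mu2]_(y in Omega v) (f y * 'D_e ('D_e phi) y) =
    \int[mu2]_(y in Omega v) ('D_e ('D_e f) y * phi y).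
  move=> he; rewrite (test_ibp he sf (test_derive e tp)).
  by rewrite (test_ibp he (smooth_derive e sf) tp) opprK.
have split_ (a b c d : R * R -> R) : smooth a -> smooth b -> smooth c -> smooth d ->
    \int[mu2]_(y in Omega v) (a y * b y) = \int[mu2]_(y in Omega v) (c y * d y) ->
    \int[mu2]_(y in Omega v) (eps ^+ 2 * (a y * b y)) =
    \int[mu2]_(y in Omega v) (eps ^+ 2 * (c y * d y)).
  by move=> sa sb sc sd' h; rewrite !RintegralZl//; [rewrite h|exact: (intO (smoothM sc sd'))|exact: (intO (smoothM sa sb))].
transitivity (\int[mu2]_(y in Omega v) (eps ^+ 2 * (f y * 'D_e_x ('D_e_x phi) y) +
   f y * 'D_e_z ('D_e_z phi) y)).
  have E (k a b c : R) : k * (a * b + c) = a * (k * b) + k * c by ring.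
  by apply: eq_Rintegral => y _; exact: E.
transitivity (\int[mu2]_(y in Omega v) (eps ^+ 2 * ('D_e_x ('D_e_x f) y * phi y) +
   'D_e_z ('D_e_z f) y * phi y)); last first.
  have E (k a b c : R) : a * (b * k) + c * k = (a * b + c) * k by ring.
  by apply: eq_Rintegral => y _; exact: E.
have sx := sd e_x _ sp; have sz := sd e_z _ sp.
have fx := sd e_x _ sf; have fz := sd e_z _ sf.
rewrite !RintegralD//; last 4 first.
- exact: (intO (smoothZ _ (smoothM fx sp))).
- exact: (intO (smoothM fz sp)).
- exact: (intO (smoothZ _ (smoothM sf sx))).
- exact: (intO (smoothM sf sz)).
congr (_ + _); last by apply: twice; right.
by apply: (split_ f ('D_e_x ('D_e_x phi)) ('D_e_x ('D_e_x f)) phi) => //; apply: twice; left.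
Qed.

End test_calculus.

Lemma mul_lower_bound (R : realType) (A B C M del : R) :
  0 < C -> 0 < M -> B <= del -> - M <= A -> 0 <= B -> - (C * M * del) <= B * (C * A).
Proof.
move=> C0 M0 Bd MA B0.
have X1 : - (M * B) <= A * B by nra.
have X2 : - (M * del) <= - (M * B) by nra.
have : C * (- (M * del)) <= C * (A * B) by rewrite ler_pM2l//; lra.
by nra.
Qed.

Lemma half_scale (R : realType) (eps s rho : R) : 0 <= eps -> 0 < s ->
  s * (2 * (1 + eps)) <= rho -> eps * s < rho /\ s < rho.
Proof. by move=> e0 s0 h; split; nra. Qed.

Lemma half_sqrD (R : realType) (r p q : R) : p <= (r / 2) ^+ 2 -> q <= (r / 2) ^+ 2 ->
  p + q <= r ^+ 2 / 2.
Proof.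
have -> : r ^+ 2 / 2 = (r / 2) ^+ 2 + (r / 2) ^+ 2 by field.
exact: lerD.
Qed.

Section maximum_principle.
Context {R : realType}.
Notation mu := (@lebesgue_measure R).
Notation mu2 := (mu \x mu)%E.

Lemma mu2_box (a b c d : R) : a <= b -> c <= d ->
  mu2 (`[a, b] `*` `[c, d]) = ((b - a) * (d - c))%:E.
Proof.
move=> ab cd.
have itvE (x y : R) : x <= y -> mu (`[x, y]%classic : set R) = (y - x)%:E.
  move=> xy; rewrite lebesgue_measure_itv /= lte_fin.
  by move: xy; rewrite le_eqVlt => /predU1P[->|->]; rewrite ?ltxx ?subrr// EFinB.
have m1 : measurable (`[a, b]%classic : set R) by exact: measurable_itv.
have m2 : measurable (`[c, d]%classic : set R) by exact: measurable_itv.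
by rewrite product_measure1E// ![X in (X * _)%E]itvE// ![X in (_ * X)%E]itvE.
Qed.

Lemma Rintegral_box_le (D : set (R * R)) (F : R * R -> R) (k a b c d : R) :
  measurable D -> mu2.-integrable D (EFin \o F) -> a <= b -> c <= d ->
  `[a, b] `*` `[c, d] `<=` D ->
  (forall y, D y -> k * \1_(`[a, b] `*` `[c, d]) y <= F y) ->
  k * ((b - a) * (d - c)) <= \int[mu2]_(y in D) F y.
Proof.
move=> mD Fi ab cd BD kF.
set B := _ `*` _ in BD kF *.
have mB : measurable B by apply: measurableX; exact: measurable_itv.
have BE : (\int[mu2]_(y in D) (\1_B y)%:E = ((b - a) * (d - c))%:E)%E.
  by rewrite integral_indic// setIidl//; exact: mu2_box.
have Bi : mu2.-integrable D (EFin \o \1_B).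
  apply/integrableP; split; first exact/measurable_EFinP.
  rewrite (_ : (\int[mu2]_(y in D) _)%E = ((b - a) * (d - c))%:E) ?ltry// -BE.
  by apply: eq_integral => y _; rewrite gee0_abs// lee_fin.
have -> : k * ((b - a) * (d - c)) = \int[mu2]_(y in D) (k * \1_B y).
  by rewrite RintegralZl// /Rintegral BE.
by apply: le_Rintegral => //; exact: (intgZ mu2).
Qed.

Variable v : R -> R.
Hypothesis cv : {within `[-1, 1], continuous v}.
Hypothesis v0 : forall x, itvI x -> -1 < v x <= 0.
Hypothesis vm1 : v (-1) = 0.
Hypothesis vp1 : v 1 = 0.

Section continuous_on_closure.
Variable g : R * R -> R.
Hypothesis cg : {within closure (Omega v), continuous g}.

Lemma closure_continuous y : Omega v y -> {for y, continuous g}.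
Proof.
move=> Oy.
have cO : {within Omega v, continuous g}.
  by apply: continuous_subspaceW cg; exact: subset_closure.
by move: cO; rewrite (continuous_open_subspace _ (open_Omega cv)); apply; exact/mem_set.
Qed.

Lemma closure_measurable : measurable_fun (Omega v) g.
Proof.
apply: open_continuous_measurable_plane; first exact: open_Omega.
by move=> y /set_mem; exact: closure_continuous.
Qed.

Lemma closure_bounded : exists2 M, 0 < M & forall y, closure (Omega v) y -> `|g y| <= M.
Proof.
have := continuous_compact cg (compact_closure_Omega cv v0 vm1 vp1).
move=> /compact_bounded[M [_ HM]]; exists (Num.max M 0 + 1).
  by rewrite ltr_wpDl// le_max lexx orbT.
move=> y cy; apply: (HM (Num.max M 0 + 1)).
  by rewrite ltr_pwDr// le_max lexx.
by exists y.
Qed.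

Lemma closure_intg : mu2.-integrable (Omega v) (EFin \o g).
Proof.
have [M M0 HM] := closure_bounded.
apply: (intg_bnd mu2 (measurable_Omega cv) (mu2_Omega cv v0) closure_measurable (M := M)).
by move=> y Oy; apply: HM; exact: subset_closure.
Qed.

End continuous_on_closure.

Variable v1 : R -> R.
Hypothesis cv1 : {within `[-1, 1], continuous v1}.
Hypothesis dv : forall x, itvI x -> is_derive x 1 v (v1 x).
Variable eps : R.
Hypothesis e0 : 0 < eps.

Lemma smooth_lap (f : R * R -> R) : smooth f -> smooth (lap eps f).
Proof.
move=> sf; apply: smoothD; last by apply: smooth_derive; exact: smooth_derive.
by apply: smoothZ; apply: smooth_derive; exact: smooth_derive.
Qed.

Lemma lap_sqr (a b : R) y : lap eps (fun y => a * y.1 ^+ 2 + b) y = eps ^+ 2 * (2 * a).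
Proof.
have h e u : 'D_e (fun y : R * R => a * y.1 ^+ 2 + b) u = 2 * a * e.1 * u.1.
  have d := is_deriveM (is_derive_cst a u e) (is_deriveX 2 (is_derive_fst u e)).
  have [_ ->] := is_deriveD d (is_derive_cst b u e).
  transitivity (a * (2 * u.1 ^+ 1 * e.1) + u.1 ^+ 2 * 0 + 0) => //.
  by ring.
have h2 e u : 'D_e ('D_e (fun y : R * R => a * y.1 ^+ 2 + b)) u = 2 * a * e.1 * e.1.
  have -> : 'D_e (fun y : R * R => a * y.1 ^+ 2 + b) = (fun u : R * R => 2 * a * e.1 * u.1).
    by apply/funext => w; exact: h.
  have [_ ->] := is_deriveM (is_derive_cst (2 * a * e.1) u e) (is_derive_fst u e).
  transitivity (2 * a * e.1 * e.1 + u.1 * 0) => //.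
  by ring.
rewrite /lap !h2 /e_x /e_z/=; ring.
Qed.

(* If g is negative somewhere, g - eta x^2 has an interior minimum y0 for small eta.
   Testing with a truncated fundamental solution centred at y0, whose Laplacian is
   nonnegative off a small disc, contradicts that minimality. *)
Lemma weak_max (g : R * R -> R) : {within closure (Omega v), continuous g} ->
  (forall y, closure (Omega v) y -> ~ Omega v y -> 0 <= g y) ->
  (forall phi, test_function (Omega v) phi ->
     \int[mu2]_(y in Omega v) (g y * lap eps phi y) = 0) ->
  forall y, Omega v y -> 0 <= g y.
Proof.
move=> cg bg hg y1 Oy1; rewrite leNgt; apply/negP => gy1.
have mO := measurable_Omega cv.
(* On the boundary [gt >= - eta], because [g] is nonnegative there and [|x| <= 1]; at [y1] one has
   [gt <= - 2 * eta]. Hence the minimum is interior. *)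
pose eta := - g y1 / 2.
have eta0 : 0 < eta by rewrite /eta; lra.
pose gt y := g y - eta * y.1 ^+ 2.
have cgt : {within closure (Omega v), continuous gt}.
  move=> y; apply: cvgB; first exact: cg.
  have c2 : continuous (fun y : R * R => eta * y.1 ^+ 2).
    by apply: smooth_continuous; apply: smoothZ; apply: smoothX; exact: smooth_fst.
  exact: (continuous_subspaceT c2).
have clO y : Omega v y -> closure (Omega v) y by exact: subset_closure.
have [|y0 /set_mem cy0 miny0] := compact_EVT_min _ (compact_closure_Omega cv v0 vm1 vp1) cgt.
  by exists y1; exact: clO.
have {}miny0 y : closure (Omega v) y -> gt y0 <= gt y by move=> cy; apply: miny0; exact/mem_set.
have Oy0 : Omega v y0.
  apply: contrapT => nO; have := bg _ cy0 nO; have := miny0 _ (clO _ Oy1).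
  have [/= I0 _] := closure_Omega_sub cv cy0.
  have : y0.1 ^+ 2 <= 1 by move: I0; rewrite in_itv/=; nra.
  have := sqr_ge0 y1.1; rewrite /gt /eta; nra.
pose h y := gt y - gt y0.
have h0 y : Omega v y -> 0 <= h y by move=> Oy; rewrite subr_ge0; apply: miny0; exact: clO.
move: y0 cy0 miny0 Oy0 @h h0 => [x0 z0] cy0 miny0 Oy0 h h0.
have /nbhs_ballP[r1 /= r10 Hr1] := open_nbhs_nbhs (conj (open_Omega cv) Oy0).
(* The factor [1 + eps] makes both half-sides [eps * r] and [r] of the box smaller than [r1]. *)
pose r := r1 / (2 * (1 + eps)).
have e1 : 0 < 2 * (1 + eps) by rewrite mulr_gt0// addr_gt0.
have r0 : 0 < r by rewrite divr_gt0.
have rE : r * (2 * (1 + eps)) = r1 by rewrite /r divfK// gt_eqF.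
pose box s : set (R * R) :=
  `[x0 - eps * s, x0 + eps * s] `*` `[z0 - s, z0 + s].
have boxP s y : box s y <-> `|y.1 - x0| <= eps * s /\ `|y.2 - z0| <= s.
  by rewrite /box /= !in_itv/= !ler_distl.
have boxO s : s <= r -> box s `<=` Omega v.
  move=> sr [x z] /boxP[/= b1 b2].
  have rE' : r * (2 * (1 + eps)) <= r1 by rewrite rE.
  have [er1 rr1] := half_scale (ltW e0) r0 rE'.
  apply: Hr1; split; rewrite /ball/= distrC; first by apply: le_lt_trans b1 (le_lt_trans _ er1); rewrite ler_pM2l.
  exact: le_lt_trans b2 (le_lt_trans sr rr1).
have [M M0 HM] := @radial_lap_ge R.
pose a0 : R := hinge (ln 2).
have a00 : 0 < a0 by rewrite hinge_gt0// ln_gt0// ltr1n.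
(* The negative part of the Laplacian, at least [- 4 M / s^2], acts on a box of area [4 eps s^2], so
   [s] cancels and the loss is at most [16 eps M del]. This [del] makes the loss half of the
   guaranteed gain, and it can be fixed before [s]. *)
pose del := eta * eps ^+ 2 * a0 * r ^+ 2 / (16 * M).
have e20 : 0 < eps ^+ 2 by exact: exprn_gt0.
have e30 : 0 < eps ^+ 3 by exact: exprn_gt0.
have r20 : 0 < r ^+ 2 by exact: exprn_gt0.
have del0 : 0 < del.
  apply: divr_gt0; last exact: mulr_gt0.
  exact: (mulr_gt0 (mulr_gt0 (mulr_gt0 eta0 e20) a00) r20).
have [rho rho0 Hrho] : exists2 rho, 0 < rho & forall y, Omega v y -> ball (x0, z0) rho y -> h y <= del.
  have gtd : gt (x0, z0) < gt (x0, z0) + del by rewrite ltrDl.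
  have : \forall y \near (x0, z0), gt y < gt (x0, z0) + del.
    have cc : gt y @[y --> (x0, z0)] --> gt (x0, z0) by exact: (closure_continuous cgt).
    exact: (cvgr_lt (gt (x0, z0)) cc _ gtd).
  move=> /nbhs_ballP[rho /= rho0 Hrho]; exists rho => // y Oy by0.
  by have := Hrho y by0; rewrite /h lerBlDl => /ltW.
(* The inner scale is at most [r / 2], whence [m >= 4], and small enough for [box s] to lie in the
   ball where [h <= del]. *)
pose s := Num.min (r / 2) (rho / (2 * (1 + eps))).
have s0 : 0 < s by rewrite lt_min !divr_gt0.
have sr : s <= r / 2 by rewrite ge_min lexx.
have [esrho srho] : eps * s < rho /\ s < rho.
  apply: half_scale => //; first exact: ltW.
  by rewrite -ler_pdivlMr// ge_min lexx orbT.
pose m := r ^+ 2 / s ^+ 2.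
have s20 : 0 < s ^+ 2 by exact: exprn_gt0.
have m4 : 4 <= m by rewrite ler_pdivlMr//; nra.
have m2 : 2 <= m by apply: le_trans m4; rewrite ler_nat.
have hr0 : 0 <= r / 2 by rewrite divr_ge0 ?ler0n// ltW.
have hrr : r / 2 <= r by rewrite ler_pdivrMr// ler_peMr ?ler1n// ltW.
have sr1 : s <= r := le_trans sr hrr.
(* At level [ln m] with [m = r^2 / s^2] the bump vanishes outside [box r], is at least [a0] on
   [box (r / 2)], and has a nonnegative Laplacian outside [box s]. *)
pose phi := bump_core eps x0 z0 (ln m) s.
have sphi : smooth phi by exact: smooth_bump_core.
have sqout t y : 0 < t -> ~ box t y -> t ^+ 2 < sqdist eps x0 z0 y.
  move=> t0 /boxP/not_andP nb; rewrite /sqdist.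
  have sq1 := sqr_ge0 ((y.1 - x0) / eps); have sq2 := sqr_ge0 (y.2 - z0).
  case: nb => /negP; rewrite -ltNge => nb.
    suff : t ^+ 2 < ((y.1 - x0) / eps) ^+ 2 by lra.
    rewrite -(real_normK (num_real (_ / eps))) ltr_pXn2r// ?nnegrE ?(ltW t0)//.
    by rewrite normrM normfV (gtr0_norm e0) ltr_pdivlMr// mulrC.
  suff : t ^+ 2 < (y.2 - z0) ^+ 2 by lra.
  by rewrite -(real_normK (num_real (_ - z0))) ltr_pXn2r// ?nnegrE ?(ltW t0).
have tphi : test_function (Omega v) phi.
  split=> //; exists (box r); first split.
  - by apply: compact_setX; exact: segment_compact.
  - exact: boxO.
  move=> y nb; apply: core_out => //.
  - by rewrite -/m (le_trans _ m2)// ler1n.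
  - by rewrite mulrC ler_pM2l ?invr_gt0//; apply: ltW; exact: sqout.
have slap := smooth_lap sphi.
have intO (F : R * R -> R) (sF : smooth F) := smooth_integrable_Omega cv v0 vm1 vp1 sF.
have [N N0 HN] := smooth_bounded slap (compact_closure_Omega cv v0 vm1 vp1).
have mlap : measurable_fun (Omega v) (lap eps phi).
  by apply: measurable_funTS; exact: smooth_measurable_plane.
have glap : mu2.-integrable (Omega v) (EFin \o (fun y => g y * lap eps phi y)).
  apply: (intg_eq mu2 mO (f := fun y => lap eps phi y * g y)) => [y _|]; first by rewrite mulrC.
  apply: (intg_bndM mu2 mO mlap (fun y Oy => HN y (clO y Oy))).
  exact: closure_intg.
pose f (y : R * R) := eta * y.1 ^+ 2 + gt (x0, z0).
have sf : smooth f.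
  by apply: smoothD (smooth_cst _); apply: smoothZ; apply: smoothX; exact: smooth_fst.
have hE y : h y * lap eps phi y = g y * lap eps phi y - f y * lap eps phi y.
  by rewrite /h /f /gt -mulrBl; congr (_ * _); ring.
have hi : mu2.-integrable (Omega v) (EFin \o (fun y => h y * lap eps phi y)).
  apply: (intg_eq mu2 mO (f := fun y => g y * lap eps phi y - f y * lap eps phi y)) => [y _|].
    by rewrite hE.
  exact: (intgB mu2 mO glap (intO _ (smoothM sf slap))).
(* The functions [h] and [g] differ by [f], whose image under the operator is the constant
   [2 eta eps^2], and [g] itself integrates to zero against the Laplacian of [phi]. So the
   subtraction of [eta x^2] gives the integral a definite sign. *)
have inth : \int[mu2]_(y in Omega v) (h y * lap eps phi y) =
    - (eps ^+ 2 * (2 * eta)) * \int[mu2]_(y in Omega v) phi y.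
  transitivity (\int[mu2]_(y in Omega v) (g y * lap eps phi y - f y * lap eps phi y)).
    by apply: eq_Rintegral => y _; rewrite hE.
  rewrite RintegralB//; last exact: (intO _ (smoothM sf slap)).
  rewrite hg// sub0r mulNr; congr (- _).
  rewrite (test_lap cv v0 vm1 vp1 cv1 dv eps sf tphi) -RintegralZl//; last exact: intO.
  by apply: eq_Rintegral => y _; rewrite lap_sqr.
have box_le t : 0 <= t -> x0 - eps * t <= x0 + eps * t /\ z0 - t <= z0 + t.
  by move=> t0; rewrite !lerBlDr -!addrA -!mulr2n !lerDl !mulrn_wge0// mulr_ge0// ltW.
have phi_ge : a0 * ((x0 + eps * (r / 2) - (x0 - eps * (r / 2))) * (z0 + r / 2 - (z0 - r / 2))) <=
    \int[mu2]_(y in Omega v) phi y.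
  have [b1 b2] := box_le (r / 2) hr0.
  apply: Rintegral_box_le => //; [exact: intO|exact: boxO|].
  move=> y Oy; rewrite -/(box (r / 2)) indicE.
  have [yb|nyb] := pselect (box (r / 2) y); last by rewrite memNset// mulr0; exact: core_ge0.
  rewrite mem_set// mulr1; apply: core_ge => //.
  have q0 := sqdist_ge0 eps x0 z0 y.
  rewrite mulr_ge0 ?invr_ge0 ?(ltW s20)//= mulrC /m mulrAC ler_pM2r ?invr_gt0//.
  move/boxP : yb => [yb1 yb2]; rewrite /sqdist.
  have q1 : ((y.1 - x0) / eps) ^+ 2 <= (r / 2) ^+ 2.
    rewrite -(real_normK (num_real (_ / eps))) lerXn2r// ?nnegrE//.
    by rewrite normrM normfV (gtr0_norm e0) ler_pdivrMr// mulrC.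
  have q2 : (y.2 - z0) ^+ 2 <= (r / 2) ^+ 2.
    by rewrite -(real_normK (num_real (_ - z0))) lerXn2r// ?nnegrE.
  exact: half_sqrD.
have h_ge : - (4 / s ^+ 2 * M * del) * ((x0 + eps * s - (x0 - eps * s)) * (z0 + s - (z0 - s))) <=
    \int[mu2]_(y in Omega v) (h y * lap eps phi y).
  have [b1 b2] := box_le s (ltW s0).
  apply: Rintegral_box_le => //; first exact: (boxO _ sr1).
  move=> y Oy; rewrite -/(box s) indicE (lap_bump_core x0 z0 e0 (ln m) y s0).
  set Tt := s ^- 2 * _.
  have k0 : 0 < 4 / s ^+ 2 by rewrite divr_gt0.
  have [yb|nyb] := pselect (box s y); last first.
    rewrite memNset// mulr0 mulr_ge0 ?h0// mulr_ge0 ?(ltW k0)// radial_lap_ge0//.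
    by rewrite /Tt mulrC ltr_pdivlMr// mul1r; exact: sqout.
  have hd : h y <= del.
    move/boxP : yb => [yb1 yb2].
    apply: Hrho => //; split; rewrite /ball/= distrC; first exact: le_lt_trans yb1 _.
    exact: le_lt_trans yb2 _.
  have T0 : 0 <= Tt by rewrite mulr_ge0 ?sqdist_ge0// invr_ge0 ltW.
  have Tlap : - M <= radial_lap (ln m) Tt.
    have [T1|T1] := leP Tt 1; first by apply: HM; rewrite T0.
    by rewrite (le_trans _ (radial_lap_ge0 (ln m) T1))// oppr_le0 ltW.
  rewrite mem_set// mulr1; have := h0 _ Oy.
  move: (radial_lap _ _) (h y) (4 / s ^+ 2) k0 hd Tlap => A B C C0 Bd MA B0.
  exact: mul_lower_bound.
move: h_ge; rewrite inth => h_ge.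
have E1 : - (4 / s ^+ 2 * M * del) * ((x0 + eps * s - (x0 - eps * s)) * (z0 + s - (z0 - s))) =
    - (eta * eps ^+ 3 * a0 * r ^+ 2).
  by rewrite /del; field; rewrite !gt_eqF.
have E2 : a0 * ((x0 + eps * (r / 2) - (x0 - eps * (r / 2))) * (z0 + r / 2 - (z0 - r / 2))) =
   a0 * (eps * r ^+ 2) by field.
rewrite E1 in h_ge; rewrite E2 in phi_ge.
have E3 : (eps ^+ 2 * (2 * eta)) * (a0 * (eps * r ^+ 2)) <=
  (eps ^+ 2 * (2 * eta)) * \int[mu2]_(y in Omega v) phi y.
  by rewrite ler_pM2l//; apply: mulr_gt0 => //; exact: mulr_gt0.
have E4 : 0 < eta * eps ^+ 3 * a0 * r ^+ 2.
  exact: (mulr_gt0 (mulr_gt0 (mulr_gt0 eta0 e30) a00) r20).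
have E5 : (eps ^+ 2 * (2 * eta)) * (a0 * (eps * r ^+ 2)) = 2 * (eta * eps ^+ 3 * a0 * r ^+ 2) by ring.
move: h_ge; rewrite mulNr lerN2 => /(le_trans E3).
by rewrite E5 leNgt ltr_pMl// ltr1n.
Qed.

End maximum_principle.

(** * The excess and its traces *)

Section barriers.
Context {R : realType}.
Notation mu := (@lebesgue_measure R).
Notation mu2 := (mu \x mu)%E.

Lemma ae_imp2 (P Q : R * R -> Prop) : {ae mu2, forall y, P y} ->
  (forall y, P y -> Q y) -> {ae mu2, forall y, Q y}.
Proof. by move=> [N [mN N0 PN]] PQ; exists N; split => // y /= nQ; apply: PN => /= /PQ. Qed.

Lemma Rintegral_ae_eq (D : set (R * R)) (f g : R * R -> R) : measurable D ->
  mu2.-integrable D (EFin \o f) -> mu2.-integrable D (EFin \o g) ->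
  {ae mu2, forall y, D y -> f y = g y} ->
  \int[mu2]_(y in D) f y = \int[mu2]_(y in D) g y.
Proof.
move=> mD fi gi fg; rewrite /Rintegral; congr fine; apply: ae_eq_integral => //.
- exact: (measurable_int mu2 fi).
- exact: (measurable_int mu2 gi).
- by apply: (ae_imp2 fg) => y h Dy; congr EFin; exact: h.
Qed.

Lemma RintegralZD (D : set (R * R)) (k : R) (f g : R * R -> R) : measurable D ->
  mu2.-integrable D (EFin \o f) -> mu2.-integrable D (EFin \o g) ->
  \int[mu2]_(y in D) (k * f y + g y) =
  k * \int[mu2]_(y in D) f y + \int[mu2]_(y in D) g y.
Proof. by move=> mD fi gi; rewrite RintegralD ?RintegralZl//; exact: (intgZ mu2). Qed.

Lemma lap_affine (eps a b c : R) y :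
  lap eps (fun y : R * R => a * y.1 + b * y.2 + c) y = 0.
Proof.
have h e u : 'D_e (fun y : R * R => a * y.1 + b * y.2 + c) u = a * e.1 + b * e.2.
  have d1 := is_deriveM (is_derive_cst a u e) (is_derive_fst u e).
  have d2 := is_deriveM (is_derive_cst b u e) (is_derive_snd u e).
  have [_ ->] := is_deriveD (is_deriveD d1 d2) (is_derive_cst c u e).
  transitivity (a * e.1 + u.1 * 0 + (b * e.2 + u.2 * 0) + 0) => //.
  by ring.
have h2 e u : 'D_e ('D_e (fun y : R * R => a * y.1 + b * y.2 + c)) u = 0.
  have -> : 'D_e (fun y : R * R => a * y.1 + b * y.2 + c) = cst (a * e.1 + b * e.2).
    by apply/funext => w; exact: h.
  exact: derive_cst.
by rewrite /lap !h2 mulr0 addr0.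
Qed.

Lemma smooth_affine (a b c : R) : smooth (fun y : R * R => a * y.1 + b * y.2 + c).
Proof.
apply: smoothD (smooth_cst _); apply: smoothD; apply: smoothZ.
  exact: smooth_fst.
exact: smooth_snd.
Qed.

Variable v : R -> R.
Hypothesis cv : {within `[-1, 1], continuous v}.
Hypothesis v0 : forall x, itvI x -> -1 < v x <= 0.
Hypothesis vm1 : v (-1) = 0.
Hypothesis vp1 : v 1 = 0.
Variable v1 : R -> R.
Hypothesis cv1 : {within `[-1, 1], continuous v1}.
Hypothesis dv : forall x, itvI x -> is_derive x 1 v (v1 x).
Variable eps : R.
Hypothesis e0 : 0 < eps.

Let mO := measurable_Omega cv.
Let muO := mu2_Omega cv v0.
Let intO (F : R * R -> R) (sF : smooth F) := smooth_integrable_Omega cv v0 vm1 vp1 sF.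

Lemma smooth_bounded_Omega (k : R * R -> R) : smooth k ->
  exists2 M, 0 < M & forall y, Omega v y -> `|k y| <= M.
Proof.
move=> sk; have [M M0 HM] := smooth_bounded sk (compact_closure_Omega cv v0 vm1 vp1).
by exists M => // y Oy; apply: HM; exact: subset_closure.
Qed.

Lemma smooth_measurable_Omega (k : R * R -> R) : smooth k -> measurable_fun (Omega v) k.
Proof. by move=> sk; apply: measurable_funTS; exact: smooth_measurable_plane. Qed.

Lemma intg_smoothM (f k : R * R -> R) : mu2.-integrable (Omega v) (EFin \o f) ->
  smooth k -> mu2.-integrable (Omega v) (EFin \o (fun y => f y * k y)).
Proof.
move=> fi sk; have [M M0 HM] := smooth_bounded_Omega sk.
apply: (intg_eq mu2 mO (f := fun y => k y * f y)) => [y _|]; first by rewrite mulrC.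
exact: (intg_bndM mu2 mO (smooth_measurable_Omega sk) HM).
Qed.

Lemma depth : exists2 d, 0 < d & forall x, `[-1, 1]%classic x -> d <= 1 + v x.
Proof.
have lt11 : -1 <= 1 :> R by lra.
have [c cI hc] := EVT_min lt11 cv.
exists (1 + v c).
  have : `[-1, 1]%classic c by [].
  by move=> /(v0_cc v0 vm1 vp1); lra.
by move=> x Ix; rewrite lerD2l; apply: hc.
Qed.

(** The mean value theorem on [[x, 1]] and on [[-1, x]], with zero values at the endpoints. This
    decay of the top data feeds the lateral barriers. *)
Lemma graph_lipschitz : exists2 N, 0 < N &
  forall x, `[-1, 1]%classic x -> - v x <= N * (1 - x) /\ - v x <= N * (1 + x).
Proof.
have [N N0 HN] := v1_bounded cv1; exists N => // x; rewrite /= in_itv/= => /andP[x1 x2].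
have mvt a b : -1 <= a -> b <= 1 -> a < b -> `|v b - v a| <= N * (b - a).
  move=> a1 b1 ab.
  have sub : `]a, b[ `<=` (@itvI R).
    by move=> y; rewrite /= in_itv/= => /andP[ay yb]; apply/itvIE; lra.
  have cab : {within `[a, b], continuous v}.
    apply: continuous_subspaceW cv => y; rewrite /= !in_itv/= => /andP[ay yb].
    by apply/andP; split; lra.
  have dab (y : R) : y \in `]a, b[ -> is_derive y 1 v (v1 y) by move=> yab; apply: dv; exact: sub.
  have [c cab' ->] := MVT ab dab cab.
  by rewrite normrM (gtr0_norm (x := b - a)) ?subr_gt0// ler_wpM2r ?HN ?subr_ge0 ?(ltW ab)//; exact: sub.
split.
  move: x2; rewrite le_eqVlt => /predU1P[->|x2]; first by rewrite vp1; lra.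
  by have := mvt x 1 x1 (lexx _) x2; rewrite vp1 ler_norml; lra.
move: x1; rewrite le_eqVlt => /predU1P[<-|x1]; first by rewrite vm1; lra.
by have := mvt (-1) x (lexx _) x2 x1; rewrite vm1 ler_norml; lra.
Qed.

Variable psi : R * R -> R.
Hypothesis epsi : elliptic_solution eps v psi.

Definition excess (y : R * R) : R := psi y - (1 + y.2).

Lemma excess_continuous : {within closure (Omega v), continuous excess}.
Proof.
have [cpsi _ _] := epsi; move=> y; apply: cvgB; first exact: cpsi.
have sl : smooth (fun y : R * R => 1 + y.2) := smoothD (smooth_cst _) smooth_snd.
exact: (continuous_subspaceT (smooth_continuous sl)).
Qed.

(** One formula for the whole boundary: the factor [1 + z] vanishes on the bottom, [v] on the sides,
    and on the top the quotient is 1. *)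
Lemma excess_bdy y : closure (Omega v) y -> ~ Omega v y ->
  excess y = - v y.1 * ((1 + y.2) / (1 + v y.1)).
Proof.
move=> cy nO; have [_ _ /(_ _ (closed_bdy cv cy nO)) psiE] := epsi.
have [/(v0_cc v0 vm1 vp1)/andP[h1 _] _] := closure_Omega_sub cv cy.
rewrite /excess psiE; field; rewrite gt_eqF//; lra.
Qed.

(** Both derivatives are moved from the test function to [psi], whose second weak derivatives
    satisfy the equation almost everywhere; [1 + z] is affine and contributes nothing. *)
Lemma excess_harmonic phi : test_function (Omega v) phi ->
  \int[mu2]_(y in Omega v) (excess y * lap eps phi y) = 0.
Proof.
move=> tp; have sp := test_smooth tp.
have [cpsi [px [pz [pxx [pxz [pzz [[wx wz] [wxx _] [_ wzz] eq0]]]]]] _] := epsi.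
have psii := closure_intg cv v0 vm1 vp1 cpsi.
have sl : smooth (fun y : R * R => 1 + y.2) := smoothD (smooth_cst _) smooth_snd.
have slp := smooth_lap eps sp.
transitivity (\int[mu2]_(y in Omega v) (psi y * lap eps phi y - (1 + y.2) * lap eps phi y)).
  by apply: eq_Rintegral => y _; rewrite mulrBl.
rewrite RintegralB//; [|exact: (intg_smoothM psii slp)|exact: (intO (smoothM sl slp))].
have -> : \int[mu2]_(y in Omega v) ((1 + y.2) * lap eps phi y) = 0.
  rewrite (test_lap cv v0 vm1 vp1 cv1 dv eps sl tp).
  have lE : lap eps (fun y : R * R => 1 + y.2) = fun=> 0.
    apply/funext => y; rewrite -(lap_affine eps 0 1 1 y); congr (lap eps _ y).
    by apply/funext => u; rewrite mul0r mul1r add0r addrC.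
  rewrite lE; transitivity (\int[mu2]_(y in Omega v) (0 : R)); last by rewrite Rintegral_cst// mul0r.
  by apply: eq_Rintegral => y _; rewrite mul0r.
have sxx := smooth_derive (e_x : R * R) (smooth_derive (e_x : R * R) sp).
have szz := smooth_derive (e_z : R * R) (smooth_derive (e_z : R * R) sp).
transitivity (\int[mu2]_(y in Omega v) (eps ^+ 2 * (psi y * 'D_e_x ('D_e_x phi) y) +
    psi y * 'D_e_z ('D_e_z phi) y) - 0).
  congr (_ - _); apply: eq_Rintegral => y _.
  have E (k a b c : R) : k * (a * b + c) = a * (k * b) + k * c by ring.
  exact: E.
have i1 := intg_smoothM psii sxx; have i2 := intg_smoothM psii szz.
apply: (etrans (congr1 (fun k => k - 0) (RintegralZD (eps ^+ 2) mO i1 i2))).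
have [_ _ h1] := wx; have [_ _ h2] := wz; have [_ lxx h3] := wxx; have [_ lzz h4] := wzz.
have Ex := etrans (h1 _ (test_derive e_x tp)) (etrans (congr1 -%R (h3 _ tp)) (opprK _)).
have Ez := etrans (h2 _ (test_derive e_z tp)) (etrans (congr1 -%R (h4 _ tp)) (opprK _)).
apply: (etrans (congr2 (fun a b => eps ^+ 2 * a + b - 0) Ex Ez)); rewrite subr0.
have ixx := intg_smoothM (L2_intg mu2 mO muO lxx) sp.
have izz := intg_smoothM (L2_intg mu2 mO muO lzz) sp.
rewrite -(RintegralZD _ mO ixx izz).
transitivity (\int[mu2]_(y in Omega v) (0 : R)); last by rewrite Rintegral_cst// mul0r.
apply: Rintegral_ae_eq => //.
- by apply: (intgD mu2 mO) => //; exact: (intgZ mu2 mO).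
- by have := intO (smooth_cst 0).
- by apply: (ae_imp2 eq0) => y h Oy; rewrite mulrA -mulrDl h// mul0r.
Qed.

(** Affine functions solve the equation, so the maximum principle applies to the difference. *)
Lemma excess_le_affine (a b c : R) :
  (forall y, closure (Omega v) y -> ~ Omega v y -> excess y <= a * y.1 + b * y.2 + c) ->
  forall y, Omega v y -> excess y <= a * y.1 + b * y.2 + c.
Proof.
move=> bg y Oy; rewrite -subr_ge0.
have sl := smooth_affine a b c.
apply: (weak_max cv v0 vm1 vp1 cv1 dv e0 (g := fun y => a * y.1 + b * y.2 + c - excess y)) Oy.
- move=> u; apply: cvgB; last exact: excess_continuous.
  exact: (continuous_subspaceT (smooth_continuous sl)).
- by move=> u cu nO; rewrite subr_ge0; exact: bg.
move=> phi tp; have slp := smooth_lap eps (test_smooth tp).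
transitivity (\int[mu2]_(y in Omega v) ((a * y.1 + b * y.2 + c) * lap eps phi y - excess y * lap eps phi y)).
  by apply: eq_Rintegral => u _; rewrite mulrBl.
rewrite RintegralB//.
- rewrite excess_harmonic// subr0 (test_lap cv v0 vm1 vp1 cv1 dv eps sl tp).
  transitivity (\int[mu2]_(y in Omega v) (0 : R)); last by rewrite Rintegral_cst// mul0r.
  by apply: eq_Rintegral => u _; rewrite lap_affine mul0r.
- exact: (intO (smoothM sl slp)).
- exact: (intg_smoothM (closure_intg cv v0 vm1 vp1 excess_continuous) slp).
Qed.

Lemma excess_ge_affine (a b c : R) :
  (forall y, closure (Omega v) y -> ~ Omega v y -> a * y.1 + b * y.2 + c <= excess y) ->
  forall y, Omega v y -> a * y.1 + b * y.2 + c <= excess y.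
Proof.
move=> bg y Oy; rewrite -subr_ge0.
have sl := smooth_affine a b c.
apply: (weak_max cv v0 vm1 vp1 cv1 dv e0 (g := fun y => excess y - (a * y.1 + b * y.2 + c))) Oy.
- move=> u; apply: cvgB; first exact: excess_continuous.
  exact: (continuous_subspaceT (smooth_continuous sl)).
- by move=> u cu nO; rewrite subr_ge0; exact: bg.
move=> phi tp; have slp := smooth_lap eps (test_smooth tp).
transitivity (\int[mu2]_(y in Omega v) (excess y * lap eps phi y - (a * y.1 + b * y.2 + c) * lap eps phi y)).
  by apply: eq_Rintegral => u _; rewrite mulrBl.
rewrite RintegralB//.
- rewrite excess_harmonic// sub0r (test_lap cv v0 vm1 vp1 cv1 dv eps sl tp) -[RHS]oppr0; congr (- _).
  transitivity (\int[mu2]_(y in Omega v) (0 : R)); last by rewrite Rintegral_cst// mul0r.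
  by apply: eq_Rintegral => u _; rewrite lap_affine mul0r.
- exact: (intg_smoothM (closure_intg cv v0 vm1 vp1 excess_continuous) slp).
- exact: (intO (smoothM sl slp)).
Qed.

Lemma excess_bdy_bounds y : closure (Omega v) y -> ~ Omega v y ->
  [/\ `[-1, 1]%classic y.1, -1 <= y.2, 0 <= excess y & excess y <= - v y.1].
Proof.
move=> cy nO; rewrite excess_bdy//.
have [Iy /andP[y1 yv]] := closure_Omega_sub cv cy.
have /andP[h1 h2] := v0_cc v0 vm1 vp1 Iy.
have p0 : 0 < 1 + v y.1 by lra.
have q0 : 0 <= (1 + y.2) / (1 + v y.1) by rewrite divr_ge0// ?(ltW p0)//; lra.
have q1 : (1 + y.2) / (1 + v y.1) <= 1 by rewrite ler_pdivrMr//; lra.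
by split=> //; [rewrite mulr_ge0//; lra|rewrite ler_piMr//; lra].
Qed.

Lemma excess_ge0 y : Omega v y -> 0 <= excess y.
Proof.
move=> Oy; have h := excess_ge_affine (a := 0) (b := 0) (c := 0).
have : 0 * y.1 + 0 * y.2 + 0 <= excess y; last by rewrite !mul0r !addr0.
apply: h Oy => u cu nO.
by have [_ _ hu _] := excess_bdy_bounds cu nO; rewrite !mul0r !addr0.
Qed.

(** Comparison with the affine functions [C (1 + z)], [C (1 - x)] and [C (1 + x)]. At the bottom [C]
    has to dominate the inverse of the least depth, since the boundary data carry the factor
    [1 / (1 + v)]; at the sides it has to dominate the Lipschitz constant of the graph. These linear
    bounds remove the layers of all cutoffs used later. *)
Lemma excess_barriers : exists2 C, 0 < C & forall y, Omega v y ->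
  [/\ excess y <= C * (1 + y.2), excess y <= C * (1 - y.1) & excess y <= C * (1 + y.1)].
Proof.
have [d d0 hd] := depth; have [N N0 HN] := graph_lipschitz.
have [C C0 [Cd CN]] : exists2 C, 0 < C & d^-1 <= C /\ N <= C.
  exists (d^-1 + N); first by rewrite addr_gt0// invr_gt0.
  by rewrite lerDl lerDr (ltW N0) invr_ge0 (ltW d0).
exists C => // y Oy; split.
- have h := excess_le_affine (a := 0) (b := C) (c := C).
  have : excess y <= 0 * y.1 + C * y.2 + C; last by lra.
  apply: h Oy => u cu nO; rewrite mul0r add0r excess_bdy//.
  have [Iu u1 _ _] := excess_bdy_bounds cu nO.
  have /andP[h1 h2] := v0_cc v0 vm1 vp1 Iu.
  have p0 : 0 < 1 + v u.1 by lra.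
  have i1 : (1 + v u.1)^-1 <= C.
    by apply: le_trans Cd; rewrite lef_pV2 ?posrE// hd.
  have i0 : 0 < (1 + v u.1)^-1 by rewrite invr_gt0.
  have q : - v u.1 * (1 + u.2) <= 1 + u.2 by rewrite ler_piMl//; lra.
  rewrite mulrA; apply: (le_trans (ler_wpM2r (ltW i0) q)).
  by apply: (le_trans (ler_wpM2l _ i1)); lra.
- have h := excess_le_affine (a := - C) (b := 0) (c := C).
  have : excess y <= - C * y.1 + 0 * y.2 + C; last by lra.
  apply: h Oy => u cu nO; have [Iu u1 _ uv] := excess_bdy_bounds cu nO.
  have [h1 _] := HN _ Iu; move: Iu; rewrite /= in_itv/= => /andP[Iu1 Iu2].
  apply: (le_trans uv); apply: (le_trans h1).
  by apply: (le_trans (ler_wpM2r _ CN)); lra.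
- have h := excess_le_affine (a := C) (b := 0) (c := C).
  have : excess y <= C * y.1 + 0 * y.2 + C; last by lra.
  apply: h Oy => u cu nO; have [Iu u1 _ uv] := excess_bdy_bounds cu nO.
  have [_ h1] := HN _ Iu; move: Iu; rewrite /= in_itv/= => /andP[Iu1 Iu2].
  apply: (le_trans uv); apply: (le_trans h1).
  by apply: (le_trans (ler_wpM2r _ CN)); lra.
Qed.

End barriers.

Lemma RintegralD_plane (R : realType) (D : set (R * R)) (f g : R * R -> R) :
  let mu2 := ((@lebesgue_measure R) \x (@lebesgue_measure R))%E in measurable D ->
  mu2.-integrable D (EFin \o f) -> mu2.-integrable D (EFin \o g) ->
  \int[mu2]_(y in D) (f y + g y) = \int[mu2]_(y in D) f y + \int[mu2]_(y in D) g y.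
Proof. by move=> mu2 mD fi gi; rewrite RintegralD. Qed.

(** * Green's formulas for products of functions with a trace on the top *)

Section sobolev_traces.
Context {R : realType}.
Notation mu := (@lebesgue_measure R).
Notation mu2 := (mu \x mu)%E.
Variable v : R -> R.

(** What passages to the limit use: a single smooth sequence that approximates the function, both
    derivatives and the top trace simultaneously, all in mean square. *)
Definition H1_trace (f fx fz : R * R -> R) (h : R -> R) : Prop :=
  exists F_ : nat -> R * R -> R,
  [/\ [/\ Lp_on mu2 (Omega v) 2 f, Lp_on mu2 (Omega v) 2 fx, Lp_on mu2 (Omega v) 2 fz &
          Lp_on mu itvI 2 h],
      forall n, smooth (F_ n) &
      [/\ cvg2 mu2 (Omega v) F_ f, cvg2 mu2 (Omega v) (fun n => 'D_e_x (F_ n)) fx,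
          cvg2 mu2 (Omega v) (fun n => 'D_e_z (F_ n)) fz &
          cvg2 mu itvI (fun n x => F_ n (x, v x)) h]].

Hypothesis cv : {within `[-1, 1], continuous v}.
Hypothesis v0 : forall x, itvI x -> -1 < v x <= 0.
Hypothesis vm1 : v (-1) = 0.
Hypothesis vp1 : v 1 = 0.
Variable v1 : R -> R.
Hypothesis cv1 : {within `[-1, 1], continuous v1}.
Hypothesis dv : forall x, itvI x -> is_derive x 1 v (v1 x).

Let mO := measurable_Omega cv.
Let muO := mu2_Omega cv v0.
Let mI := @measurable_itvI R.
Let muI := @mu_itvI_fin R.
Let intO (F : R * R -> R) (sF : smooth F) := smooth_integrable_Omega cv v0 vm1 vp1 sF.

Lemma smooth_L2 (k : R * R -> R) : smooth k -> Lp_on mu2 (Omega v) 2 k.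
Proof.
move=> sk; have [M M0 HM] := smooth_bounded_Omega cv v0 vm1 vp1 sk.
exact: (L2_bnd mu2 mO muO (smooth_measurable_Omega sk) HM).
Qed.

Lemma smooth_graph_bounded (k : R * R -> R) : smooth k ->
  exists2 M, 0 < M & forall x, itvI x -> `|k (x, v x)| <= M.
Proof.
move=> sk; have [M M0 HM] := smooth_bounded sk (compact_closure_Omega cv v0 vm1 vp1).
exists M => // x Ix; apply: HM; apply: (closure_Omega_vert v0) => //.
by have /andP[/ltW -> _] := v0 Ix; rewrite lexx.
Qed.

Lemma smooth_graph_L2 (k : R * R -> R) : smooth k ->
  Lp_on mu itvI 2 (fun x => k (x, v x)).
Proof.
move=> sk; have [M M0 HM] := smooth_graph_bounded sk.
exact: (L2_bnd mu mI muI (smooth_graph_measurable cv sk) HM).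
Qed.

Lemma L2_smoothM (k f : R * R -> R) : smooth k -> Lp_on mu2 (Omega v) 2 f ->
  Lp_on mu2 (Omega v) 2 (fun y => k y * f y).
Proof.
move=> sk lf; have [M M0 HM] := smooth_bounded_Omega cv v0 vm1 vp1 sk.
exact: (L2_bndM mu2 mO (smooth_measurable_Omega sk) HM).
Qed.

(** With the constant 1 as one factor, the product formulas specialise to a single function. *)
Lemma H1_trace_cst (c : R) : H1_trace (fun=> c) (fun=> 0) (fun=> 0) (fun=> c).
Proof.
have z2 (e : R) : 0 < e -> \forall n \near \oo, \int[mu2]_(y in Omega v) (0 : R) ^+ 2 <= e.
  by move=> e0; apply: nearW => n; rewrite expr0n/= Rintegral_cst// mul0r ltW.
have d0 (e y : R * R) : 'D_e (fun _ : R * R => c) y = 0 by exact: derive_cst.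
exists (fun _ _ => c); split.
- split; [exact: smooth_L2 (smooth_cst _)|exact: smooth_L2 (smooth_cst _)|exact: smooth_L2 (smooth_cst _)|].
  exact: (smooth_graph_L2 (smooth_cst c)).
- by move=> n; exact: smooth_cst.
- split=> e e0; apply: nearW => n.
  + under eq_Rintegral do rewrite subrr expr0n/=.
    by rewrite Rintegral_cst// mul0r ltW.
  + under eq_Rintegral do rewrite d0 subrr expr0n/=.
    by rewrite Rintegral_cst// mul0r ltW.
  + under eq_Rintegral do rewrite d0 subrr expr0n/=.
    by rewrite Rintegral_cst// mul0r ltW.
  + under eq_Rintegral do rewrite subrr expr0n/=.
    by rewrite Rintegral_cst// mul0r ltW.
Qed.

Lemma derive_mul3 (k f g : R * R -> R) e y : smooth k -> smooth f -> smooth g ->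
  'D_e (fun y => k y * f y * g y) y =
  'D_e k y * f y * g y + k y * 'D_e f y * g y + k y * f y * 'D_e g y.
Proof.
move=> sk sf sg; rewrite (derive_mul e y (smoothM sk sf) sg) (derive_mul e y sk sf).
move: ('D_e k y) ('D_e f y) ('D_e g y) => a b c; ring.
Qed.

Lemma smooth_int3 (k f g : R * R -> R) e : smooth k -> smooth f -> smooth g ->
  \int[mu2]_(y in Omega v) ('D_e k y * f y * g y) +
  \int[mu2]_(y in Omega v) (k y * 'D_e f y * g y) +
  \int[mu2]_(y in Omega v) (k y * f y * 'D_e g y) =
  \int[mu2]_(y in Omega v) 'D_e (fun y => k y * f y * g y) y.
Proof.
move=> sk sf sg.
have sk' := smooth_derive e sk; have sf' := smooth_derive e sf; have sg' := smooth_derive e sg.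
have i1 := intO (smoothM (smoothM sk' sf) sg).
have i2 := intO (smoothM (smoothM sk sf') sg).
have i3 := intO (smoothM (smoothM sk sf) sg').
have h1 := RintegralD_plane mO i1 i2.
have h2 := RintegralD_plane mO (intgD mu2 mO i1 i2) i3.
rewrite -h1 -h2; apply: eq_Rintegral => y _.
by rewrite (derive_mul3 e y sk sf sg).
Qed.

Section product.
Variables (f fx fz g gx gz : R * R -> R) (h l : R -> R) (k : R * R -> R).
Hypothesis Hf : H1_trace f fx fz h.
Hypothesis Hg : H1_trace g gx gz l.
Hypothesis sk : smooth k.

Lemma cvg_int3 (K : R * R -> R) (F_ G_ : nat -> R * R -> R) (F G : R * R -> R) : smooth K ->
  (forall n, smooth (F_ n)) -> (forall n, smooth (G_ n)) ->
  Lp_on mu2 (Omega v) 2 F -> Lp_on mu2 (Omega v) 2 G ->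
  cvg2 mu2 (Omega v) F_ F -> cvg2 mu2 (Omega v) G_ G ->
  \int[mu2]_(y in Omega v) (K y * F_ n y * G_ n y) @[n --> \oo] -->
  \int[mu2]_(y in Omega v) (K y * F y * G y).
Proof.
move=> sK sF sG lF lG cF cG.
have [M M0 HM] := smooth_bounded_Omega cv v0 vm1 vp1 sK.
have lF_ n := smooth_L2 (sF n).
apply: (cvg2_intMM mu2 mO) cG => //.
- by move=> n; exact: L2_smoothM.
- by move=> n; exact: smooth_L2.
- exact: L2_smoothM.
- exact: (cvg2_bndM mu2 mO (smooth_measurable_Omega sK) HM).
Qed.

Lemma cvg_graph3 (K : R -> R) (M : R) (F_ G_ : nat -> R * R -> R) (F G : R -> R) :
  measurable_fun itvI K -> (forall x, itvI x -> `|K x| <= M) ->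
  (forall n, smooth (F_ n)) -> (forall n, smooth (G_ n)) ->
  Lp_on mu itvI 2 F -> Lp_on mu itvI 2 G ->
  cvg2 mu itvI (fun n x => F_ n (x, v x)) F -> cvg2 mu itvI (fun n x => G_ n (x, v x)) G ->
  \int[mu]_(x in itvI) (K x * F_ n (x, v x) * G_ n (x, v x)) @[n --> \oo] -->
  \int[mu]_(x in itvI) (K x * F x * G x).
Proof.
move=> mK HM sF sG lF lG cF cG.
have lF_ n := smooth_graph_L2 (sF n).
have lG_ n := smooth_graph_L2 (sG n).
have lKF_ n := L2_bndM mu mI mK HM (lF_ n).
exact: (cvg2_intMM mu mI lKF_ lG_ (L2_bndM mu mI mK HM lF) lG (cvg2_bndM mu mI mK HM lF_ lF cF) cG).
Qed.

(** The formula holds for the smooth approximants, and each integral is a product of two mean-square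
    convergent factors with a bounded weight. The weight vanishes on the bottom because limits of
    boundary values are available on the top only. *)
Lemma green_H1_z : (forall x, k (x, -1) = 0) ->
  \int[mu2]_(y in Omega v) ('D_e_z k y * f y * g y) +
  \int[mu2]_(y in Omega v) (k y * fz y * g y) +
  \int[mu2]_(y in Omega v) (k y * f y * gz y) =
  \int[mu]_(x in itvI) (k (x, v x) * h x * l x).
Proof.
move=> kb.
have [F_ [[lf lfx lfz lh] sF [cF cFx cFz ch]]] := Hf.
have [G_ [[lg lgx lgz ll] sG [cG cGx cGz cl]]] := Hg.
have sk' := smooth_derive (e_z : R * R) sk.
have sF' n := smooth_derive (e_z : R * R) (sF n).
have sG' n := smooth_derive (e_z : R * R) (sG n).
have c1 := cvg_int3 sk' sF sG lf lg cF cG.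
have c2 := cvg_int3 sk sF' sG lfz lg cFz cG.
have c3 := cvg_int3 sk sF sG' lf lgz cF cGz.
have [M M0 HM] := smooth_graph_bounded sk.
have c4 := cvg_graph3 (smooth_graph_measurable cv sk) HM sF sG lh ll ch cl.
apply: (cvg_unique _ (cvgD (cvgD c1 c2) c3)) => //.
set S := (X in X @ \oo); set G := (X in X @ \oo) in c4.
have -> : S = G; last exact: c4.
apply/funext => n; apply: (etrans (smooth_int3 e_z sk (sF n) (sG n))).
rewrite (green_z cv v0 vm1 vp1 (smoothM (smoothM sk (sF n)) (sG n))).
by apply: eq_Rintegral => x _; rewrite kb !mul0r subr0.
Qed.

(** The normal to the graph is proportional to [(- v1, 1)], whence the factor [- v1] on the top; the
    weight [k] removes the sides. *)
Lemma green_H1_x : (forall z, k (-1, z) = 0) -> (forall z, k (1, z) = 0) ->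
  \int[mu2]_(y in Omega v) ('D_e_x k y * f y * g y) +
  \int[mu2]_(y in Omega v) (k y * fx y * g y) +
  \int[mu2]_(y in Omega v) (k y * f y * gx y) =
  - \int[mu]_(x in itvI) (v1 x * k (x, v x) * h x * l x).
Proof.
move=> km kp.
have [F_ [[lf lfx lfz lh] sF [cF cFx cFz ch]]] := Hf.
have [G_ [[lg lgx lgz ll] sG [cG cGx cGz cl]]] := Hg.
have sk' := smooth_derive (e_x : R * R) sk.
have sF' n := smooth_derive (e_x : R * R) (sF n).
have sG' n := smooth_derive (e_x : R * R) (sG n).
have c1 := cvg_int3 sk' sF sG lf lg cF cG.
have c2 := cvg_int3 sk sF' sG lfx lg cFx cG.
have c3 := cvg_int3 sk sF sG' lf lgx cF cGx.
have [M M0 HM] := smooth_graph_bounded sk; have [N N0 HN] := v1_bounded cv1.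
have mK : measurable_fun itvI (fun x => v1 x * k (x, v x)).
  by apply: measurable_funM; [exact: v1_measurable|exact: smooth_graph_measurable].
have HK x : itvI x -> `|v1 x * k (x, v x)| <= N * M.
  by move=> Ix; rewrite normrM ler_pM ?HN ?HM.
have c4 := cvgN (cvg_graph3 mK HK sF sG lh ll ch cl).
apply: (cvg_unique _ (cvgD (cvgD c1 c2) c3)) => //.
set S := (X in X @ \oo); set G := (X in X @ \oo) in c4.
have -> : S = G; last exact: c4.
apply/funext => n; apply: (etrans (smooth_int3 e_x sk (sF n) (sG n))).
rewrite (green_x cv v0 vm1 vp1 cv1 dv (smoothM (smoothM sk (sF n)) (sG n))).
- by congr (- _); apply: eq_Rintegral => x _; rewrite mulrC !mulrA.
- by move=> z; rewrite km !mul0r.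
- by move=> z; rewrite kp !mul0r.
Qed.

End product.

End sobolev_traces.

(** * The derivatives of the excess and their traces *)

Section traces_of_the_potential.
Context {R : realType}.
Notation mu := (@lebesgue_measure R).
Notation mu2 := (mu \x mu)%E.
Variable v : R -> R.
Hypothesis cv : {within `[-1, 1], continuous v}.
Hypothesis v0 : forall x, itvI x -> -1 < v x <= 0.
Hypothesis vm1 : v (-1) = 0.
Hypothesis vp1 : v 1 = 0.
Variable v1 : R -> R.
Hypothesis cv1 : {within `[-1, 1], continuous v1}.
Hypothesis dv : forall x, itvI x -> is_derive x 1 v (v1 x).

Let mO := measurable_Omega cv.
Let muO := mu2_Omega cv v0.

Lemma ae_and2 (P Q : R * R -> Prop) : {ae mu2, forall y, P y} -> {ae mu2, forall y, Q y} ->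
  {ae mu2, forall y, P y /\ Q y}.
Proof.
move=> [A [mA A0 PA]] [B [mB B0 QB]]; exists (A `|` B); split.
- exact: measurableU.
- by rewrite measureU0.
- by move=> y /= /not_andP[nP|nQ]; [left; exact: PA|right; exact: QB].
Qed.

(** Uniqueness of weak derivatives: the difference of two candidates integrates to zero against
    every test function. *)
Lemma weak_partial_ae_eq e (f f' g g' : R * R -> R) :
  weak_partial (Omega v) 2 e f g -> weak_partial (Omega v) 2 e f' g' ->
  {ae mu2, forall y, Omega v y -> f y = f' y} ->
  {ae mu2, forall y, Omega v y -> g y = g' y}.
Proof.
move=> [lf lg hg] [lf' lg' hg'] ff'.
have fi := L2_intg mu2 mO muO lf; have f'i := L2_intg mu2 mO muO lf'.
have gi := L2_intg mu2 mO muO lg; have g'i := L2_intg mu2 mO muO lg'.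
have H : {ae mu2, forall y, Omega v y -> g y - g' y = 0}.
  apply: (du_bois_reymond_plane cv); first exact: (intgB mu2 mO gi g'i).
  move=> phi tp; have sp := test_smooth tp.
  have i1 := intg_smoothM cv v0 vm1 vp1 gi sp.
  have i2 := intg_smoothM cv v0 vm1 vp1 g'i sp.
  have j1 := intg_smoothM cv v0 vm1 vp1 fi (smooth_derive e sp).
  have j2 := intg_smoothM cv v0 vm1 vp1 f'i (smooth_derive e sp).
  transitivity (\int[mu2]_(y in Omega v) (-1 * (g' y * phi y) + g y * phi y)).
    by apply: eq_Rintegral => y _; ring.
  rewrite (RintegralZD (-1) mO i2 i1) mulN1r; apply/eqP; rewrite addrC subr_eq0; apply/eqP.
  apply: oppr_inj; apply: (etrans (esym (hg _ tp))); apply: (etrans _ (hg' _ tp)).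
  apply: Rintegral_ae_eq => //.
  by apply: (ae_imp2 ff') => y h Oy; rewrite h.
by apply: (ae_imp2 H) => y h Oy; apply/eqP; rewrite -subr_eq0 h.
Qed.

Lemma cvg2_ae_eq (F_ : nat -> R * R -> R) (f g : R * R -> R) :
  (forall n, Lp_on mu2 (Omega v) 2 (F_ n)) ->
  Lp_on mu2 (Omega v) 2 f -> Lp_on mu2 (Omega v) 2 g ->
  {ae mu2, forall y, Omega v y -> f y = g y} ->
  cvg2 mu2 (Omega v) F_ f -> cvg2 mu2 (Omega v) F_ g.
Proof.
move=> lF lf lg fg cf e e0; apply: filterS (cf e e0) => n.
rewrite (@Rintegral_ae_eq _ (Omega v) (fun y => (F_ n y - f y) ^+ 2) (fun y => (F_ n y - g y) ^+ 2))//.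
- exact: (L2_sqr mu2 mO (L2B mu2 mO (lF n) lf)).
- exact: (L2_sqr mu2 mO (L2B mu2 mO (lF n) lg)).
- by apply: (ae_imp2 fg) => y h Oy; rewrite h.
Qed.

Variable eps : R.
Variable psi : R * R -> R.
Hypothesis epsi : elliptic_solution eps v psi.
Variables (hx hz : R -> R).
Hypothesis tr : top_grad_trace v psi hx hz.

(** The solution property and the trace property each come with their own weak derivatives, which
    uniqueness identifies almost everywhere. The gain is that one function [q] serves both as the
    [z]-derivative of [a] and as the [x]-derivative of [b]. Subtracting [1 + z] from [psi] shifts
    the vertical trace by 1. *)
Lemma excess_H1_traces : exists a b ax q bz : R * R -> R,
  [/\ H1_trace v a ax q hx, H1_trace v b q bz (fun x => hz x - 1),
      forall phi, test_function (Omega v) phi ->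
        \int[mu2]_(y in Omega v) (excess psi y * 'D_e_x phi y) =
        - \int[mu2]_(y in Omega v) (a y * phi y),
      forall phi, test_function (Omega v) phi ->
        \int[mu2]_(y in Omega v) (excess psi y * 'D_e_z phi y) =
        - \int[mu2]_(y in Omega v) (b y * phi y) &
      {ae mu2, forall y, Omega v y -> eps ^+ 2 * ax y + bz y = 0}].
Proof.
have [cpsi [px [pz [pxx [pxz [pzz [[wx wz] [wxx wxz] [wzx wzz] eq0]]]]]] _] := epsi.
have [a [p [wx' wz' [ax [q [wax wq lhx [F_ [sF cF cFx cFz ch]]]]]
  [gx [bz [wgx wbz lhz [G_ [sG cG cGx cGz cl]]]]]]]] := tr.
have rfl (f : R * R -> R) : {ae mu2, forall y, Omega v y -> f y = f y} by exact: aeW.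
have ea := weak_partial_ae_eq wx' wx (rfl psi).
have ep := weak_partial_ae_eq wz' wz (rfl psi).
have eax := weak_partial_ae_eq wax wxx ea.
have eq := weak_partial_ae_eq wq wxz ea.
have egx := weak_partial_ae_eq wgx wzx ep.
have ebz := weak_partial_ae_eq wbz wzz ep.
have gq : {ae mu2, forall y, Omega v y -> gx y = q y}.
  by apply: (ae_imp2 (ae_and2 egx eq)) => y [h1 h2] Oy; rewrite h1// h2.
have [lp lgx _] := wgx; have [_ lbz _] := wbz.
have [la lax _] := wax; have [_ lq _] := wq.
have sl : smooth (fun y : R * R => 1 + y.2) := smoothD (smooth_cst _) smooth_snd.
have psii := closure_intg cv v0 vm1 vp1 cpsi.
have wE phi e : test_function (Omega v) phi -> e = e_x \/ e = e_z ->
    \int[mu2]_(y in Omega v) (excess psi y * 'D_e phi y) =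
    \int[mu2]_(y in Omega v) ('D_e (fun y : R * R => 1 + y.2) y * phi y) +
    \int[mu2]_(y in Omega v) (psi y * 'D_e phi y).
  move=> tp he; have sp' := smooth_derive e (test_smooth tp).
  rewrite -[X in X + _]opprK -(test_ibp cv v0 vm1 vp1 cv1 dv he sl tp) -mulN1r.
  have i1 := smooth_integrable_Omega cv v0 vm1 vp1 (smoothM sl sp').
  rewrite -(RintegralZD (-1) mO i1 (intg_smoothM cv v0 vm1 vp1 psii sp')).
  by apply: eq_Rintegral => y _; rewrite /excess; move: ('D_e phi y) => d; ring.
have dl e u : 'D_e (fun y : R * R => 1 + y.2) u = e.2.
  have [_ ->] := is_deriveD (is_derive_cst (1 : R) u e) (is_derive_snd u e).
  by rewrite add0r.
exists a, (fun y => p y - 1), ax, q, bz; split.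
- by exists F_; split=> //; split=> //; exact: norm_on_cvg2.
- exists (fun n y => G_ n y - 1); split.
  + split=> //; first exact: (L2B mu2 mO lp (smooth_L2 cv v0 vm1 vp1 (smooth_cst 1))).
    exact: (L2B mu (@measurable_itvI R) lhz (smooth_graph_L2 cv v0 vm1 vp1 (smooth_cst 1))).
  + by move=> n; apply: smoothB => //; exact: smooth_cst.
  + have dG n e : 'D_e (fun y => G_ n y - 1) = 'D_e (G_ n).
      apply/funext => u.
      have [_ h] := is_deriveB (smooth_is_derive u e (sG n)) (is_derive_cst (1 : R) u e).
      by apply: (etrans h); rewrite subr0.
    split.
    * move=> e e0; apply: filterS (norm_on_cvg2 mu2 cG e e0) => n.
      move=> hn; apply: le_trans hn; rewrite le_eqVlt; apply/orP; left; apply/eqP.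
      by apply: eq_Rintegral => y _; congr (_ ^+ 2); ring.
    * have -> : (fun n => 'D_e_x (fun y => G_ n y - 1)) = (fun n => 'D_e_x (G_ n)).
        by apply/funext => n; exact: dG.
      apply: (cvg2_ae_eq _ lgx lq gq); last exact: norm_on_cvg2.
      by move=> n; apply: (smooth_L2 cv v0 vm1 vp1); exact: smooth_derive.
    * have -> : (fun n => 'D_e_z (fun y => G_ n y - 1)) = (fun n => 'D_e_z (G_ n)).
        by apply/funext => n; exact: dG.
      exact: norm_on_cvg2.
    * move=> e e0; apply: filterS (norm_on_cvg2 mu cl e e0) => n.
      move=> hn; apply: le_trans hn; rewrite le_eqVlt; apply/orP; left; apply/eqP.
      by apply: eq_Rintegral => y _; congr (_ ^+ 2); ring.
- move=> phi tp; rewrite (wE phi e_x tp (or_introl erefl)).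
  have [_ _ h] := wx'; rewrite (h _ tp) -[RHS]add0r; congr (_ + _).
  transitivity (\int[mu2]_(y in Omega v) (0 : R)); last by rewrite Rintegral_cst// mul0r.
  by apply: eq_Rintegral => y _; rewrite dl /= mul0r.
- move=> phi tp; rewrite (wE phi e_z tp (or_intror erefl)).
  have [_ _ h] := wz'; rewrite (h _ tp).
  have i1 := intg_smoothM cv v0 vm1 vp1 (L2_intg mu2 mO muO lp) (test_smooth tp).
  have i2 := smooth_integrable_Omega cv v0 vm1 vp1 (test_smooth tp).
  rewrite -[RHS]mulN1r.
  transitivity (-1 * \int[mu2]_(y in Omega v) (-1 * phi y + p y * phi y)); last first.
    by congr (_ * _); apply: eq_Rintegral => y _; rewrite mulrBl mul1r mulN1r addrC.
  rewrite (RintegralZD (-1) mO i2 i1) mulrDr mulrA mulrNN !mul1r mulN1r; congr (_ - _).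
  by apply: eq_Rintegral => y _; rewrite dl /= mul1r.
- by apply: (ae_imp2 (ae_and2 eq0 (ae_and2 eax ebz))) => y [h0 [h1 h2]] Oy; rewrite h1// h2// h0.
Qed.

End traces_of_the_potential.

(** * Green's formulas for the excess *)

Section kern_limits.
Context {R : realType}.
Notation mu := (@lebesgue_measure R).

Lemma Rintegral_ae_eq1 (D : set R) (f g : R -> R) : measurable D ->
  mu.-integrable D (EFin \o f) -> mu.-integrable D (EFin \o g) ->
  {ae mu, forall y, D y -> f y = g y} ->
  \int[mu]_(y in D) f y = \int[mu]_(y in D) g y.
Proof.
move=> mD fi gi fg; rewrite /Rintegral; congr fine; apply: ae_eq_integral => //.
- exact: (measurable_int mu fi).
- exact: (measurable_int mu gi).
- by apply: (ae_imp fg) => y h Dy; congr EFin; exact: h.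
Qed.

Lemma RintegralB1 (D : set R) (f g : R -> R) : measurable D ->
  mu.-integrable D (EFin \o f) -> mu.-integrable D (EFin \o g) ->
  \int[mu]_(x in D) (f x - g x) = \int[mu]_(x in D) f x - \int[mu]_(x in D) g x.
Proof. by move=> mD fi gi; rewrite RintegralB. Qed.

Lemma integral_kern_sub (D : set R) a r : measurable D -> 0 < r -> `[a, a + r] `<=` D ->
  \int[mu]_(x in D) kern a r x = 1.
Proof.
move=> mD r0 aD; rewrite -(integral_kern a r0) [RHS]Rintegral_mkcond [LHS]Rintegral_mkcond.
apply: eq_Rintegral => x _; rewrite !patchE.
have [xa|xa] := pselect (`[a, a + r]%classic x); first by rewrite !mem_set//; exact: aD.
by rewrite (memNset xa) kern_eq0//; case: ifP.
Qed.

Lemma kern_intg (D : set R) a r : measurable D -> (mu D < +oo)%E -> 0 < r ->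
  mu.-integrable D (EFin \o kern a r).
Proof.
move=> mD muD r0; have [M M0 HM] := @kern_bounded R.
apply: (intg_bnd mu mD muD (M := M / r)) => [|x _]; last exact: HM.
by apply: measurable_funTS; apply: smooth_measurable; exact: smooth_kern.
Qed.

(** The kernels have mass 1 inside the open interval and concentrate at [c], which may be an
    endpoint: continuity up to the closed interval lets the integral pick up a boundary value. *)
Lemma cvg_int_kern (V c : R) (h : R -> R) (b_ r_ : nat -> R) : -1 < V ->
  {within `[-1, V], continuous h} -> `[-1, V]%classic c ->
  (forall n, 0 < r_ n) -> (forall n, `[b_ n, b_ n + r_ n] `<=` `]-1, V[) ->
  b_ n @[n --> \oo] --> c -> r_ n @[n --> \oo] --> (0 : R) ->
  \int[mu]_(z in `]-1, V[) (h z * kern (b_ n) (r_ n) z) @[n --> \oo] --> h c.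
Proof.
move=> V1 ch Ic r0 brV cb cr.
have mD : measurable (`]-1, V[%classic : set R) by exact: measurable_itv.
have muD : (mu `](-1)%R, V[%classic < +oo)%E.
  by rewrite lebesgue_measure_itv /= lte_fin V1 -EFinB ltry.
have hi : mu.-integrable `]-1, V[ (EFin \o h).
  have hcc : mu.-integrable `[-1, V] (EFin \o h).
    by apply: continuous_compact_integrable => //; exact: segment_compact.
  by apply: integrableS hcc => //; exact: subset_itv_oo_cc.
have hki n : mu.-integrable `]-1, V[ (EFin \o (fun z => h z * kern (b_ n) (r_ n) z)).
  have [M M0 HM] := @kern_bounded R.
  apply: (intg_eq mu mD (f := fun z => kern (b_ n) (r_ n) z * h z)) => [z _|]; first by rewrite mulrC.
  apply: (intg_bndM mu mD _ (fun z _ => HM (b_ n) (r_ n) z (r0 n))) => //.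
  by apply: measurable_funTS; apply: smooth_measurable; exact: smooth_kern.
apply/cvgrPdist_le => e e0.
have := (subspace_continuousP _ _).1 ch c Ic => /cvgrPdist_le /(_ e e0) => nh.
have [d d0 Hd] : exists2 d, 0 < d & forall z, `[-1, V]%classic z -> `|c - z| < d -> `|h c - h z| <= e.
  move: nh => /nbhs_ballP[d /= d0 Hd]; exists d => // z Iz cz; exact: Hd.
have d20 : 0 < d / 2 by rewrite divr_gt0.
have n1 := (cvgrPdist_lt _ _).1 cb _ d20; have n2 := (cvgrPdist_lt _ _).1 cr _ d20.
near=> n.
have h1 : `|c - b_ n| < d / 2 by near: n; exact: n1.
have h2 : `|0 - r_ n| < d / 2 by near: n; exact: n2.
have ki := kern_intg (b_ n) mD muD (r0 n).
have kE k : k = \int[mu]_(z in `]-1, V[) (k * kern (b_ n) (r_ n) z).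
  by rewrite RintegralZl// (integral_kern_sub mD (r0 n) (brV n)) mulr1.
rewrite [X in X - _]kE -RintegralB//; last exact: (intgZ mu mD).
have i1 := intgB mu mD (intgZ mu mD (h c) ki) (hki n).
apply: (le_trans (le_normr_Rintegral (mu := mu) mD i1)).
rewrite [leRHS]kE.
apply: le_Rintegral => //.
- exact: (intg_norm mu i1).
- exact: (intgZ mu mD).
move=> z; rewrite /= in_itv/= => /andP[z1 z2].
rewrite -mulrBl normrM (ger0_norm (kern_ge0 _ _ (r0 n))).
have [zb|zb] := pselect (`[b_ n, b_ n + r_ n]%classic z); last by rewrite kern_eq0// !mulr0.
apply: ler_wpM2r; first exact: kern_ge0.
apply: Hd; first by rewrite /= in_itv/= !ltW.
move: zb; rewrite /= in_itv/= => /andP[zb1 zb2].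
have r0n := r0 n.
move: h2; rewrite sub0r normrN gtr0_norm// => h2.
by move: h1; rewrite !ltr_norml; lra.
Unshelve. all: by end_near. Qed.

End kern_limits.

(** * Integration of the excess along vertical lines *)

Section vertical_integration.
Context {R : realType}.
Notation mu := (@lebesgue_measure R).
Notation mu2 := (mu \x mu)%E.
Variable v : R -> R.
Hypothesis cv : {within `[-1, 1], continuous v}.
Hypothesis v0 : forall x, itvI x -> -1 < v x <= 0.
Hypothesis vm1 : v (-1) = 0.
Hypothesis vp1 : v 1 = 0.
Variables (w b : R * R -> R).
Hypothesis cw : {within closure (Omega v), continuous w}.
Hypothesis w_bottom : forall x, itvI x -> w (x, -1) = 0.
Hypothesis w_top : forall x, itvI x -> w (x, v x) = - v x.
Hypothesis lb : Lp_on mu2 (Omega v) 2 b.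
Hypothesis wb : forall phi, test_function (Omega v) phi ->
  \int[mu2]_(y in Omega v) (w y * 'D_e_z phi y) = - \int[mu2]_(y in Omega v) (b y * phi y).

Let mO := measurable_Omega cv.
Let muO := mu2_Omega cv v0.
Let mI := @measurable_itvI R.
Let bi := L2_intg mu2 mO muO lb.
Let wi := closure_intg cv v0 vm1 vp1 cw.

Lemma smooth_horizontal (f : R -> R) : smooth f -> smooth (fun y : R * R => f y.1).
Proof. by move=> sf; exact: (smooth_comp sf smooth_fst). Qed.

Lemma smooth_vertical (f : R -> R) : smooth f -> smooth (fun y : R * R => f y.2).
Proof. by move=> sf; exact: (smooth_comp sf smooth_snd). Qed.

Lemma derive_horizontal (f : R -> R) e (y : R * R) : smooth f ->
  'D_e (fun y : R * R => f y.1) y = 'D_1 f y.1 * e.1.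
Proof.
move=> sf; have sf1 : is_derive y.1 1 f _ := smooth_is_derive _ _ sf.
by have [_ ->] := is_derive_comp1 sf1 (differentiable_fst y) (is_derive_fst y e).
Qed.

Lemma derive_vertical (f : R -> R) e (y : R * R) : smooth f ->
  'D_e (fun y : R * R => f y.2) y = 'D_1 f y.2 * e.2.
Proof.
move=> sf; have sf1 : is_derive y.2 1 f _ := smooth_is_derive _ _ sf.
by have [_ ->] := is_derive_comp1 sf1 (differentiable_snd y) (is_derive_snd y e).
Qed.

(** The relation between [w] and [b] is localised to single vertical lines: multiplied by a
    horizontal kernel, [k] becomes a test function, and the one-dimensional lemma removes the
    kernel. *)
Lemma vertical_test (k : R * R -> R) (al be : R) : smooth k ->
  (forall y, y.2 < al \/ be < y.2 -> k y = 0) -> -1 < al ->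
  {ae mu, forall x, [set x | itvI x /\ be < v x] x ->
    \int[mu]_(z in `]-1, v x[) (b (x, z) * k (x, z) + w (x, z) * 'D_e_z k (x, z)) = 0}.
Proof.
move=> sk k0 al1.
have oD := open_superlevel cv (c := be).
have mD := open_measurable oD.
have sk' := smooth_derive (e_z : R * R) sk.
pose F (y : R * R) := b y * k y + w y * 'D_e_z k y.
have i1 := intg_smoothM cv v0 vm1 vp1 bi sk.
have i2 := intg_smoothM cv v0 vm1 vp1 wi sk'.
have Fi : mu2.-integrable (Omega v) (EFin \o F) := intgD mu2 mO i1 i2.
have [_ Ji _] := Rfubini_Omega cv Fi.
apply: (du_bois_reymond oD).
  by apply: integrableS Ji => //; move=> x [].
move=> a r r0 aD.
have tk := test_kern_plane r0 sk k0 al1 aD.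
have skr := smooth_horizontal (smooth_kern a r).
have dk y : 'D_e_z (fun y : R * R => kern a r y.1 * k y) y = kern a r y.1 * 'D_e_z k y.
  rewrite (derive_mul e_z y skr sk) (derive_horizontal _ _ (smooth_kern a r)) /= mulr0 mulr0 addr0.
  by [].
have i3 := intg_smoothM cv v0 vm1 vp1 bi (smoothM skr sk).
have i4 := intg_smoothM cv v0 vm1 vp1 wi (smoothM skr sk').
have tot : \int[mu2]_(y in Omega v) (F y * kern a r y.1) = 0.
  transitivity (\int[mu2]_(y in Omega v) (b y * (kern a r y.1 * k y)
      + w y * (kern a r y.1 * 'D_e_z k y))).
    have E (p q s t u : R) : (p * q + s * t) * u = p * (u * q) + s * (u * t) by ring.
    by apply: eq_Rintegral => y _; exact: E.
  apply: (etrans (RintegralD_plane mO i3 i4)).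
  have h : \int[mu2]_(y in Omega v) (w y * (kern a r y.1 * 'D_e_z k y)) =
      \int[mu2]_(y in Omega v) (w y * 'D_e_z (fun y : R * R => kern a r y.1 * k y) y).
    by apply: eq_Rintegral => y _; rewrite dk.
  by rewrite h (wb tk) subrr.
have [aeF _ FE] := Rfubini_Omega cv (intg_smoothM cv v0 vm1 vp1 Fi skr).
rewrite -[RHS]tot FE Rintegral_mkcond [RHS]Rintegral_mkcond.
apply: Rintegral_ae_eq1 => //.
- have J1 : mu.-integrable [set x | itvI x /\ be < v x]
     (EFin \o (fun x => \int[mu]_(z in `]-1, v x[) F (x, z) * kern a r x)).
    have [M M0 HM] := @kern_bounded R.
    apply: (intg_eq mu mD (f := fun x => kern a r x * \int[mu]_(z in `]-1, v x[) F (x, z))) => [x _|].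
      by rewrite mulrC.
    apply: (intg_bndM mu mD _ (fun x _ => HM a r x r0)).
      by apply: measurable_funTS; apply: smooth_measurable; exact: smooth_kern.
    by apply: integrableS Ji => //; move=> x [].
  exact/(integrable_restrict_setT mu mD).
- have [_ J2 _] := Rfubini_Omega cv (intg_smoothM cv v0 vm1 vp1 Fi skr).
  exact/(integrable_restrict_setT mu mI).
have [aeF1 _ _] := Rfubini_Omega cv Fi.
apply: (ae_imp aeF1) => x hx _; rewrite !patchE.
have [Ix|nIx] := pselect (itvI x); last by rewrite !memNset// => -[].
rewrite (mem_set Ix).
have [xD|nxD] := pselect ([set x | itvI x /\ be < v x] x).
  by rewrite mem_set// -RintegralZr//; exact: hx.
rewrite memNset//.
transitivity (\int[mu]_(z in `]-1, v x[) (0 : R)); first by rewrite Rintegral_cst// mul0r.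
by apply: eq_Rintegral => z _; rewrite /= kern_eq0 ?mulr0// => /aD.
Qed.

Lemma excess_vert x (k : R * R -> R) : itvI x -> continuous k ->
  {within `[-1, v x], continuous (fun z => w (x, z) * k (x, z))}.
Proof.
move=> Ix ck; apply/subspace_continuousP => z Iz.
have cc : closure (Omega v) (x, z).
  by apply: (closure_Omega_vert v0) => //; move: Iz; rewrite /= in_itv.
have cx (A : set R) : (x, t) @[t --> within A (nbhs z)] --> (x, z).
  have c1 : (fun _ : R => x) t @[t --> within A (nbhs z)] --> x by exact: cvg_cst.
  have c2 : id t @[t --> within A (nbhs z)] --> z by exact: cvg_within.
  exact: (cvg_pair c1 c2).
apply: cvgM; last exact: (cvg_comp _ _ (cx _) (ck (x, z))).
move=> B hB.
have hB' : \forall y \near (x, z), closure (Omega v) y -> B (w y).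
  exact: ((subspace_continuousP _ _).1 cw (x, z) cc B hB).
have h2 : \forall t \near within `[-1, v x] (nbhs z), closure (Omega v) (x, t) -> B (w (x, t)).
  exact: (cx _ _ hB').
change (\forall t \near z, `[-1, v x]%classic t -> B (w (x, t))).
have h3 : \forall t \near z, `[-1, v x]%classic t -> closure (Omega v) (x, t) -> B (w (x, t)) := h2.
apply: filterS h3 => t ht It; apply: (ht It).
by apply: (closure_Omega_vert v0) => //; move: It; rewrite /= in_itv.
Qed.

(** The weight is cut off near both ends of the vertical segment by [zeta]; as the cutoff tends to
    1, the two kernels in its derivative pick out the boundary values of [w], namely 0 at the bottom
    and [- v x] at the top. *)
Lemma vertical_identity (k : R * R -> R) : smooth k ->
  {ae mu, forall x, itvI x ->
    \int[mu]_(z in `]-1, v x[) (b (x, z) * k (x, z) + w (x, z) * 'D_e_z k (x, z)) =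
    - v x * k (x, v x)}.
Proof.
move=> sk; have sk' := smooth_derive (e_z : R * R) sk.
pose zeta al be r z : R := stp al r z - stp be r z.
have szeta al be r : smooth (zeta al be r) by apply: smoothB; exact: smooth_stp.
pose K al be r (y : R * R) := k y * zeta al be r y.2.
have sK al be r : smooth (K al be r) by apply: smoothM => //; exact: (smooth_vertical (szeta al be r)).
have dK al be r y : 'D_e_z (K al be r) y =
    k y * (kern al r y.2 - kern be r y.2) + zeta al be r y.2 * 'D_e_z k y.
  rewrite (derive_mul e_z y sk (smooth_vertical (szeta al be r))).
  rewrite (derive_vertical _ _ (szeta al be r)) /= mulr1; congr (_ * _ + _).
  by have [_ ->] := is_deriveB (is_derive_stp al r y.2) (is_derive_stp be r y.2).
(* The cutoffs have rational parameters, so that a single null set of abscissae is excluded before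
   the sequence adapted to a given [x] is chosen. *)
pose PQ n x : Prop := if unpickle n is Some (p, q, s) then
  (0 < ratr s :> R) -> (-1 < ratr p :> R) -> (ratr p <= ratr q :> R) ->
  itvI x -> ratr q + ratr s < v x ->
  \int[mu]_(z in `]-1, v x[) (b (x, z) * K (ratr p) (ratr q) (ratr s) (x, z) +
    w (x, z) * 'D_e_z (K (ratr p) (ratr q) (ratr s)) (x, z)) = 0 else True.
have aePQ : {ae mu, forall x, forall n, PQ n x}.
  apply: ae_foralln => n; rewrite /PQ; case: (unpickle n) => [[[p q] s]|]; last exact: aeW.
  have [s0|/negP s0] := boolP (0 < ratr s :> R); last by apply: aeW.
  have [p0|/negP p0] := boolP (-1 < ratr p :> R); last by apply: aeW.
  have [pq|/negP pq] := boolP (ratr p <= ratr q :> R); last by apply: aeW.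
  have vt : forall y : R * R, y.2 < ratr p \/ ratr q + ratr s < y.2 ->
      K (ratr p) (ratr q) (ratr s) y = 0.
    move=> y [h|h]; rewrite /K /zeta.
      by rewrite !stp_out0 ?subrr ?mulr0// ltW// (lt_le_trans h).
    rewrite !stp_out1 ?subrr ?mulr0//; first exact: ltW.
    by apply: le_trans (ltW h); rewrite lerD2r.
  by apply: (ae_imp (vertical_test (sK _ _ _) vt p0)) => x hx _ _ _ Ix xv; exact: hx.
pose F (y : R * R) := b y * k y + w y * 'D_e_z k y.
have i1 := intg_smoothM cv v0 vm1 vp1 bi sk.
have i2 := intg_smoothM cv v0 vm1 vp1 wi sk'.
have Fi : mu2.-integrable (Omega v) (EFin \o F) := intgD mu2 mO i1 i2.
have [aeF _ _] := Rfubini_Omega cv Fi.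
have aeb : {ae mu, forall x, (forall n, PQ n x) /\
    (itvI x -> mu.-integrable `]-1, v x[ (EFin \o (fun z => F (x, z))))}.
  by apply: filterS2 aePQ aeF => //; exact: (ae_filter_ringOfSetsType mu).
apply: (ae_imp aeb) => x [hPQ hF] Ix.
have {}hF := hF Ix; have /andP[V1 V0] := v0 Ix.
set V := v x in V1 V0 hF *.
have mD : measurable (`]-1, V[%classic : set R) by exact: measurable_itv.
(* At most an eighth of the depth [V + 1]: both transition layers of the cutoff then lie inside
   []-1, V[], the lower one below the upper one. *)
pose t_ (n : nat) : R := (V + 1) / 8 * n.+1%:R^-1.
have t0 n : 0 < t_ n by rewrite mulr_gt0 ?invr_gt0// divr_gt0//; lra.
have t1 n : t_ n <= (V + 1) / 8.
  rewrite /t_ ler_piMr//; first by rewrite divr_ge0//; lra.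
  by rewrite invf_le1// ler1n.
have tc : t_ n @[n --> \oo] --> (0 : R).
  have : (V + 1) / 8 * n.+1%:R^-1 @[n --> \oo] --> (V + 1) / 8 * 0.
    by apply: cvgM; [exact: cvg_cst|exact: cvg_harmonic].
  by rewrite mulr0.
have hp n : exists p : rat, (-1 : R) < ratr p < -1 + t_ n.
  have /rat_in_itvoo[p] : (-1 : R) < -1 + t_ n by rewrite ltrDl.
  by rewrite in_itv/=; exists p.
have hq n : exists p : rat, V - 2 * t_ n < ratr p < V - t_ n.
  have /rat_in_itvoo[p] : V - 2 * t_ n < V - t_ n by have := t0 n; lra.
  by rewrite in_itv/=; exists p.
have hs n : exists p : rat, (0 : R) < ratr p < t_ n.
  have /rat_in_itvoo[p] : (0 : R) < t_ n by exact: t0.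
  by rewrite in_itv/=; exists p.
pose p n := sval (cid (hp n)); pose q n := sval (cid (hq n)); pose s n := sval (cid (hs n)).
pose al n : R := ratr (p n); pose be n : R := ratr (q n); pose rr n : R := ratr (s n).
have pP n : (-1 : R) < al n < -1 + t_ n := svalP (cid (hp n)).
have qP n : V - 2 * t_ n < be n < V - t_ n := svalP (cid (hq n)).
have sP n : (0 : R) < rr n < t_ n := svalP (cid (hs n)).
have rr0 n : 0 < rr n by have /andP[] := sP n.
have calp : al n @[n --> \oo] --> (-1 : R).
  apply: (@squeeze_cvgr _ _ _ _ (cst (-1)) (fun n => -1 + t_ n)).
  - by apply: nearW => n; have /andP[h1 h2] := pP n; rewrite /cst !ltW.
  - exact: cvg_cst.
  - by rewrite -[X in _ --> X]addr0; apply: cvgD => //; exact: cvg_cst.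
have cbet : be n @[n --> \oo] --> V.
  apply: (@squeeze_cvgr _ _ _ _ (fun n => V - 2 * t_ n) (cst V)).
  - by apply: nearW => n; have /andP[h1 h2] := qP n; have := t0 n; rewrite /cst; lra.
  - rewrite -[X in _ --> X]subr0 -[X in _ - X](mulr0 2); apply: cvgB; first exact: cvg_cst.
    by apply: cvgM => //; exact: cvg_cst.
  - exact: cvg_cst.
have crr : rr n @[n --> \oo] --> (0 : R).
  apply: (@squeeze_cvgr _ _ _ _ (cst 0) t_) => //; last exact: cvg_cst.
  by apply: nearW => n; have /andP[h1 h2] := sP n; rewrite /cst !ltW.
pose h z := w (x, z) * k (x, z).
have ch : {within `[-1, V], continuous h}.
  by apply: excess_vert => //; exact: smooth_continuous.
have alV n : `[al n, al n + rr n] `<=` `]-1, V[.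
  move=> z; rewrite /= !in_itv/=; have := pP n; have := sP n; have := t1 n; lra.
have beV n : `[be n, be n + rr n] `<=` `]-1, V[.
  move=> z; rewrite /= !in_itv/=; have := qP n; have := sP n; have := t1 n; lra.
have I1 : `[-1, V]%classic (-1) by rewrite /= in_itv/= lexx ltW.
have I2 : `[-1, V]%classic V by rewrite /= in_itv/= lexx ltW.
have lima := cvg_int_kern V1 ch I1 rr0 alV calp crr.
have limb := cvg_int_kern V1 ch I2 rr0 beV cbet crr.
have hcc : mu.-integrable `[-1, V] (EFin \o h).
  by apply: continuous_compact_integrable => //; exact: segment_compact.
have hi : mu.-integrable `]-1, V[ (EFin \o h).
  by apply: integrableS hcc => //; exact: subset_itv_oo_cc.
have hki a n : mu.-integrable `]-1, V[ (EFin \o (fun z => h z * kern a (rr n) z)).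
  have [M M0 HM] := @kern_bounded R.
  apply: (intg_eq mu mD (f := fun z => kern a (rr n) z * h z)) => [z _|]; first by rewrite mulrC.
  apply: (intg_bndM mu mD _ (fun z _ => HM a (rr n) z (rr0 n))) => //.
  by apply: measurable_funTS; apply: smooth_measurable; exact: smooth_kern.
have ze1 n z : `|zeta (al n) (be n) (rr n) z| <= 1.
  have := stp_ge0 (al n) (rr n) z; have := stp_le1 (al n) (rr n) z.
  have := stp_ge0 (be n) (rr n) z; have := stp_le1 (be n) (rr n) z.
  by rewrite ler_norml /zeta; lra.
have mz n : measurable_fun `]-1, V[ (zeta (al n) (be n) (rr n)).
  by apply: measurable_funTS; apply: smooth_measurable; exact: szeta.
have Fzi n : mu.-integrable `]-1, V[ (EFin \o (fun z => zeta (al n) (be n) (rr n) z * F (x, z))).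
  exact: (intg_bndM mu mD (mz n) (fun z _ => ze1 n z) hF).
have limF : \int[mu]_(z in `]-1, V[) (zeta (al n) (be n) (rr n) z * F (x, z)) @[n --> \oo] -->
    \int[mu]_(z in `]-1, V[) F (x, z).
  apply: (Rintegral_dominated mu mD (g := fun z => `|F (x, z)|)).
  - by move=> n; exact: (intg_measurable mu (Fzi n)).
  - exact: (intg_measurable mu hF).
  - apply: aeW => z; rewrite /= in_itv/= => /andP[z1 z2].
    apply: cvg_near_cst.
    have n1 : \forall n \near \oo, al n + rr n < z.
      have : al n + rr n @[n --> \oo] --> (-1 : R) + 0 by exact: cvgD.
      by rewrite addr0 => /cvgr_lt; apply.
    have n2 : \forall n \near \oo, z < be n by apply: (cvgr_gt V).
    apply: filterS2 n1 n2 => n a1 a2.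
    by rewrite /zeta (stp_out1 (rr0 n) (ltW a1)) (stp_out0 (rr0 n) (ltW a2)) subr0 mul1r.
  - exact: (intg_norm mu hF).
  - by move=> n z _; rewrite normrM ler_piMl.
have eqn n : \int[mu]_(z in `]-1, V[) (zeta (al n) (be n) (rr n) z * F (x, z)) =
    \int[mu]_(z in `]-1, V[) (h z * kern (be n) (rr n) z) -
    \int[mu]_(z in `]-1, V[) (h z * kern (al n) (rr n) z).
  have := hPQ (pickle (p n, q n, s n)); rewrite /PQ pickleK.
  move=> /(_ (rr0 n)) H.
  have {}H := H (proj1 (andP (pP n))).
  have ab : al n <= be n by have := pP n; have := qP n; have := t1 n; lra.
  have bV : be n + rr n < v x by have := qP n; have := sP n; rewrite -/V; lra.
  have {}H := H ab Ix bV.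
  have Di := intgB mu mD (hki (be n) n) (hki (al n) n).
  rewrite -(RintegralB1 mD (hki (be n) n) (hki (al n) n)).
  apply/eqP; rewrite -subr_eq0 -(RintegralB1 mD (Fzi n) Di) -[eqbRHS]H; apply/eqP.
  apply: eq_Rintegral => z _; rewrite dK /F /h /K /=.
  have E (B Kk W Ze D k1 k2 : R) : Ze * (B * Kk + W * D) - (W * Kk * k2 - W * Kk * k1) =
    B * (Kk * Ze) + W * (Kk * (k1 - k2) + Ze * D) by ring.
  exact: E.
have lim2 : \int[mu]_(z in `]-1, V[) (zeta (al n) (be n) (rr n) z * F (x, z)) @[n --> \oo] -->
    h V - h (-1).
  by rewrite (funext eqn); exact: (cvgB limb lima).
have : \int[mu]_(z in `]-1, V[) F (x, z) = h V - h (-1) by exact: (cvg_unique _ limF lim2).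
by rewrite /h /V w_bottom// w_top// mul0r subr0.
Qed.

(** Here [k] is arbitrary up to the bottom and the sides: at the bottom [w] itself vanishes, and
    integration along vertical lines never meets the sides. *)
Lemma green_excess_z (k : R * R -> R) : smooth k ->
  \int[mu2]_(y in Omega v) (b y * k y) + \int[mu2]_(y in Omega v) (w y * 'D_e_z k y) =
  - \int[mu]_(x in itvI) (v x * k (x, v x)).
Proof.
move=> sk; have sk' := smooth_derive (e_z : R * R) sk.
have i1 := intg_smoothM cv v0 vm1 vp1 bi sk.
have i2 := intg_smoothM cv v0 vm1 vp1 wi sk'.
rewrite -(RintegralD_plane mO i1 i2).
have [_ Fi ->] := Rfubini_Omega cv (intgD mu2 mO i1 i2).
have vk : mu.-integrable itvI (EFin \o (fun x => v x * k (x, v x))).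
  apply: (intg_bndM mu mI (v_measurable cv) (M := 1)).
    by move=> x Ix; have := v0 Ix; rewrite ler_norml; lra.
  exact: (smooth_graph_intg cv v0 vm1 vp1).
rewrite -[RHS]mulN1r -RintegralZl//; apply: Rintegral_ae_eq1 => //.
- exact: (intgZ mu mI).
- by apply: (ae_imp (vertical_identity sk)) => x h Ix; rewrite h// mulN1r mulNr.
Qed.

End vertical_integration.

Lemma tangential_arith (R : realType) (A1 A2 I H L W V : R) :
  A1 + I = H -> A2 + I = - L -> W = - A1 -> A2 + W = - - V -> H + L + V = 0.
Proof. lra. Qed.

Lemma excess_x_arith (R : realType) (A1 A2 A3 I H L P Q V : R) :
  A1 + I = H -> A2 + I = - L -> A2 + A3 = - P -> V + (P + Q) = 0 ->
  H + (L + V) = 0 -> A1 = - A3 + Q.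
Proof. lra. Qed.

(** * The tangential derivative on the top, and integration by parts in the horizontal direction *)

Section tangential.
Context {R : realType}.
Notation mu := (@lebesgue_measure R).
Notation mu2 := (mu \x mu)%E.

Definition tensor (f g : R -> R) (y : R * R) : R := f y.1 * g y.2.

Lemma tensorE (f g : R -> R) (x z : R) : tensor f g (x, z) = f x * g z.
Proof. by []. Qed.

Lemma smooth_tensor (f g : R -> R) : smooth f -> smooth g -> smooth (tensor f g).
Proof. by move=> sf sg; apply: smoothM; [exact: smooth_horizontal|exact: smooth_vertical]. Qed.

Lemma derive_tensor_x (f g : R -> R) y : smooth f -> smooth g ->
  'D_e_x (tensor f g) y = tensor ('D_1 f) g y.
Proof.
move=> sf sg; rewrite (derive_mul e_x y (smooth_horizontal sf) (smooth_vertical sg)).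
by rewrite (derive_vertical _ _ sg) (derive_horizontal _ _ sf) /= mulr0 mulr0 add0r mulr1 mulrC.
Qed.

Lemma derive_tensor_z (f g : R -> R) y : smooth f -> smooth g ->
  'D_e_z (tensor f g) y = tensor f ('D_1 g) y.
Proof.
move=> sf sg; rewrite (derive_mul e_z y (smooth_horizontal sf) (smooth_vertical sg)).
by rewrite (derive_vertical _ _ sg) (derive_horizontal _ _ sf) /= mulr0 mulr0 addr0 mulr1.
Qed.

Variable v : R -> R.
Hypothesis cv : {within `[-1, 1], continuous v}.
Hypothesis v0 : forall x, itvI x -> -1 < v x <= 0.
Hypothesis vm1 : v (-1) = 0.
Hypothesis vp1 : v 1 = 0.
Variable v1 : R -> R.
Hypothesis cv1 : {within `[-1, 1], continuous v1}.
Hypothesis dv : forall x, itvI x -> is_derive x 1 v (v1 x).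
Variables (w a b ax q bz : R * R -> R) (h l : R -> R).
Hypothesis cw : {within closure (Omega v), continuous w}.
Hypothesis w_bottom : forall x, itvI x -> w (x, -1) = 0.
Hypothesis w_top : forall x, itvI x -> w (x, v x) = - v x.
Hypothesis wa : forall phi, test_function (Omega v) phi ->
  \int[mu2]_(y in Omega v) (w y * 'D_e_x phi y) = - \int[mu2]_(y in Omega v) (a y * phi y).
Hypothesis wb : forall phi, test_function (Omega v) phi ->
  \int[mu2]_(y in Omega v) (w y * 'D_e_z phi y) = - \int[mu2]_(y in Omega v) (b y * phi y).
Hypothesis Ha : H1_trace v a ax q h.
Hypothesis Hb : H1_trace v b q bz l.

Let mO := measurable_Omega cv.
Let muO := mu2_Omega cv v0.
Let mI := @measurable_itvI R.
Let wi := closure_intg cv v0 vm1 vp1 cw.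

Lemma H1_trace_L2 (f fx fz : R * R -> R) (t : R -> R) : H1_trace v f fx fz t ->
  [/\ Lp_on mu2 (Omega v) 2 f, Lp_on mu2 (Omega v) 2 fx, Lp_on mu2 (Omega v) 2 fz &
      Lp_on mu itvI 2 t].
Proof. by case=> F_ []. Qed.

Lemma H1_green_z (f fx fz : R * R -> R) (t : R -> R) (k : R * R -> R) : H1_trace v f fx fz t ->
  smooth k -> (forall x, k (x, -1) = 0) ->
  \int[mu2]_(y in Omega v) ('D_e_z k y * f y) + \int[mu2]_(y in Omega v) (k y * fz y) =
  \int[mu]_(x in itvI) (k (x, v x) * t x).
Proof.
move=> Hf sk k0.
have G := green_H1_z cv v0 vm1 vp1 Hf (H1_trace_cst cv v0 vm1 vp1 1) sk k0.
have z0 : \int[mu2]_(y in Omega v) (k y * f y * 0) = 0.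
  transitivity (\int[mu2]_(y in Omega v) (0 : R)); last by rewrite Rintegral_cst// mul0r.
  by apply: eq_Rintegral => y _; rewrite mulr0.
rewrite z0 addr0 in G.
have E1 (D : set (R * R)) (F : R * R -> R) :
    \int[mu2]_(y in D) (F y * 1) = \int[mu2]_(y in D) F y.
  by apply: eq_Rintegral => y _; rewrite mulr1.
rewrite -(E1 _ (fun y => 'D_e_z k y * f y)) -(E1 _ (fun y => k y * fz y)) G.
by apply: eq_Rintegral => x _; rewrite mulr1.
Qed.

Lemma H1_green_x (f fx fz : R * R -> R) (t : R -> R) (k : R * R -> R) : H1_trace v f fx fz t ->
  smooth k -> (forall z, k (-1, z) = 0) -> (forall z, k (1, z) = 0) ->
  \int[mu2]_(y in Omega v) ('D_e_x k y * f y) + \int[mu2]_(y in Omega v) (k y * fx y) =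
  - \int[mu]_(x in itvI) (v1 x * k (x, v x) * t x).
Proof.
move=> Hf sk km kp.
have G := green_H1_x cv v0 vm1 vp1 cv1 dv Hf (H1_trace_cst cv v0 vm1 vp1 1) sk km kp.
have z0 : \int[mu2]_(y in Omega v) (k y * f y * 0) = 0.
  transitivity (\int[mu2]_(y in Omega v) (0 : R)); last by rewrite Rintegral_cst// mul0r.
  by apply: eq_Rintegral => y _; rewrite mulr0.
rewrite z0 addr0 in G.
have E1 (D : set (R * R)) (F : R * R -> R) :
    \int[mu2]_(y in D) (F y * 1) = \int[mu2]_(y in D) F y.
  by apply: eq_Rintegral => y _; rewrite mulr1.
rewrite -(E1 _ (fun y => 'D_e_x k y * f y)) -(E1 _ (fun y => k y * fx y)) G.
by congr (- _); apply: eq_Rintegral => x _; rewrite mulr1.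
Qed.

Lemma v_le1 x : itvI x -> `|v x| <= 1.
Proof. by move=> Ix; have := v0 Ix; rewrite ler_norml; lra. Qed.

Lemma RintegralD_I (f g : R -> R) :
  mu.-integrable itvI (EFin \o f) -> mu.-integrable itvI (EFin \o g) ->
  \int[mu]_(x in itvI) (f x + g x) = \int[mu]_(x in itvI) f x + \int[mu]_(x in itvI) g x.
Proof. by move=> fi gi; rewrite RintegralD. Qed.

(** The integrand is the derivative of [v x * k (x, v x)], which vanishes at both endpoints. *)
Lemma graph_int_derive (k : R * R -> R) : smooth k ->
  \int[mu]_(x in itvI) (v1 x * k (x, v x) +
    v x * ('D_e_x k (x, v x) + v1 x * 'D_e_z k (x, v x))) = 0.
Proof.
move=> sk.
have cg (K : R * R -> R) : smooth K -> {within `[-1, 1], continuous (fun x => K (x, v x))}.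
  move=> sK; apply: (continuous_curve (p1 := id)) => //; first exact: smooth_continuous.
  by apply: continuous_subspaceT => ?; exact: cvg_id.
have dG (x : R) : `]-1, 1[%classic x -> is_derive x 1 (fun x => v x * k (x, v x))
   (v1 x * k (x, v x) + v x * ('D_e_x k (x, v x) + v1 x * 'D_e_z k (x, v x))).
  move=> Ix; have dvx := dv Ix.
  have H := is_deriveM dvx (is_derive_curve sk (is_derive_id x 1) dvx).
  apply: (is_derive_eq H); rewrite /GRing.scale/= mul1r.
  move: ('D_e_x k _) ('D_e_z k _) => s t; ring.
have lt11 : -1 < 1 :> R by exact: (lt_trans (ltrN10 R) ltr01).
apply: (etrans (Rintegral_FTC_oo lt11 dG _ _)).
- by move=> x; apply: cvgM; [exact: cv|exact: cg].
- move=> x; apply: cvgD; first by apply: cvgM; [exact: cv1|exact: cg].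
  apply: cvgM; first exact: cv.
  apply: cvgD; first exact: (cg _ (smooth_derive _ sk)).
  by apply: cvgM; [exact: cv1|exact: (cg _ (smooth_derive _ sk))].
by rewrite vm1 vp1 !mul0r subrr.
Qed.

(** This is the differentiated form of [psi = 1] on the top, obtained between traces that are only
    in [L_2]. The Green formulas for [a] in [z] and for [b] in [x] contain the same integral of [q];
    their difference leaves interior terms that reduce to [w] against a mixed derivative of the
    weight and cancel, up to a top term. *)
Lemma tangential_trace : {ae mu, forall x, itvI x -> h x = - (v1 x * (l x + 1))}.
Proof.
have [la _ lq lh] := H1_trace_L2 Ha; have [lb _ _ ll] := H1_trace_L2 Hb.
have [N N0 HN] := v1_bounded cv1.
have hi := L2_intg mu mI (@mu_itvI_fin R) lh.
have li := L2_intg mu mI (@mu_itvI_fin R) ll.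
have onei : mu.-integrable itvI (EFin \o (fun=> 1 : R)).
  by apply: (intg_bnd mu mI (@mu_itvI_fin R) (M := 1)) => // x _; rewrite normr1.
have vl : mu.-integrable itvI (EFin \o (fun x => v1 x * (l x + 1))).
  exact: (intg_bndM mu mI (v1_measurable cv1) HN (intgD mu mI li onei)).
have H : {ae mu, forall x, itvI x -> h x + v1 x * (l x + 1) = 0}; last first.
  by apply: (ae_imp H) => x Hx Ix; apply/eqP; rewrite -subr_eq0 opprK; apply/eqP; exact: Hx.
apply: (du_bois_reymond (@open_itvI R)); first exact: (intgD mu mI).
move=> c r r0 cI.
have [d d0 hd] := depth cv v0 vm1 vp1.
(* Thirds of the least depth leave room for a vertical step that is 0 near the bottom and 1 at all
   points of the top; its derivative is supported in a strip strictly between, so its product with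
   the horizontal kernel is a test function. *)
pose g := stp (-1 + d / 3) (d / 3); have d30 : 0 < d / 3 by rewrite divr_gt0.
have sg : smooth g := smooth_stp _ _.
have sk := smooth_kern c r; have sk' := smooth_derive (1 : R) sk.
have sgk : smooth (kern (-1 + d / 3) (d / 3)) := smooth_kern _ _.
have dg : 'D_1 g = kern (-1 + d / 3) (d / 3) by apply/funext => z; exact: derive_stp.
have g1 x : itvI x -> g (v x) = 1.
  move=> Ix; apply: stp_out1 => //.
  by have := hd x (subset_itv_oo_cc Ix); lra.
have gm1 : g (-1) = 0 by apply: stp_out0 => //; rewrite lerDl ltW.
pose Phi := tensor (kern c r) g.
have sPhi : smooth Phi := smooth_tensor sk sg.
have Phim1 z : Phi (-1, z) = 0.
  by rewrite /Phi /tensor kern_eq0 ?mul0r//= => /cI /itvIE; rewrite ltxx.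
have Phip1 z : Phi (1, z) = 0.
  by rewrite /Phi /tensor kern_eq0 ?mul0r//= => /cI /itvIE; rewrite ltxx andbF.
have Phib x : Phi (x, -1) = 0 by rewrite /Phi /tensor/= gm1 mulr0.
have E1 := H1_green_z Ha sPhi Phib.
have E2 := H1_green_x Hb sPhi Phim1 Phip1.
have tPz : test_function (Omega v) (tensor (kern c r) (kern (-1 + d / 3) (d / 3))).
  apply: (@test_kern_plane _ v (fun y => kern (-1 + d / 3) (d / 3) y.2) c r (-1 + d / 3) (-1 + d / 3 + d / 3)).
  - exact: r0.
  - exact: smooth_vertical.
  - by move=> y [y1|y1]; [rewrite kern_out0// ltW|rewrite kern_out1// ltW].
  - by rewrite ltrDl; exact: d30.
  - move=> x xc; have Ix := cI _ xc; split=> //.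
    by have := hd x (subset_itv_oo_cc Ix); lra.
have E3 := wa tPz.
have sPx : smooth (tensor ('D_1 (kern c r)) g) := smooth_tensor sk' sg.
have E4 := green_excess_z cv v0 vm1 vp1 cw w_bottom w_top lb wb sPx.
have X1 : \int[mu2]_(y in Omega v) ('D_e_z Phi y * a y) =
   \int[mu2]_(y in Omega v) (a y * tensor (kern c r) (kern (-1 + d / 3) (d / 3)) y).
  by apply: eq_Rintegral => y _; rewrite (derive_tensor_z y sk sg) dg mulrC.
have X2 : \int[mu2]_(y in Omega v) ('D_e_x Phi y * b y) =
   \int[mu2]_(y in Omega v) (b y * tensor ('D_1 (kern c r)) g y).
  by apply: eq_Rintegral => y _; rewrite (derive_tensor_x y sk sg) mulrC.
have X3 : \int[mu2]_(y in Omega v) (w y * 'D_e_x (tensor (kern c r) (kern (-1 + d / 3) (d / 3))) y) =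
  \int[mu2]_(y in Omega v) (w y * 'D_e_z (tensor ('D_1 (kern c r)) g) y).
  apply: eq_Rintegral => y _.
  by rewrite (derive_tensor_x y sk sgk) (derive_tensor_z y sk' sg) dg.
(* Integration by parts along the graph moves the derivative from the kernel to [v]. *)
have X4 : \int[mu]_(x in itvI) (v x * tensor ('D_1 (kern c r)) g (x, v x)) =
   - \int[mu]_(x in itvI) (v1 x * kern c r x).
  have sK := smooth_horizontal sk.
  have := graph_int_derive sK.
  have i1 : mu.-integrable itvI (EFin \o (fun x => v1 x * kern c r x)).
    exact: (intg_bndM mu mI (v1_measurable cv1) HN (smooth_graph_intg cv v0 vm1 vp1 sK)).
  have i2 : mu.-integrable itvI (EFin \o (fun x => v x * 'D_1 (kern c r) x)).
    have sK' := smooth_horizontal sk'.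
    apply: (intg_bndM mu mI (v_measurable cv) (M := 1)) (smooth_graph_intg cv v0 vm1 vp1 sK').
    exact: v_le1.
  have RD := RintegralD_I i1 i2.
  move=> H; apply/eqP; rewrite -addr_eq0 addrC; apply/eqP.
  transitivity (\int[mu]_(x in itvI) (v1 x * kern c r x) + \int[mu]_(x in itvI) (v x * 'D_1 (kern c r) x)).
    congr (_ + _); apply: eq_Rintegral => x; rewrite inE => Ix.
    rewrite tensorE (g1 _ Ix) mulr1; reflexivity.
  rewrite -RD -[RHS]H; apply: eq_Rintegral => x _; congr (_ + _ * _).
  rewrite (derive_horizontal _ _ sk) (derive_horizontal _ _ sk) /=.
  by rewrite mulr1 mulr0 mulr0 addr0.
have Y1 : \int[mu]_(x in itvI) (Phi (x, v x) * h x) = \int[mu]_(x in itvI) (kern c r x * h x).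
  by apply: eq_Rintegral => x; rewrite inE => Ix; rewrite /Phi /tensor/= (g1 _ Ix) mulr1.
have Y2 : \int[mu]_(x in itvI) (v1 x * Phi (x, v x) * l x) =
  \int[mu]_(x in itvI) (v1 x * kern c r x * l x).
  by apply: eq_Rintegral => x; rewrite inE => Ix; rewrite /Phi /tensor/= (g1 _ Ix) mulr1.
rewrite X1 Y1 in E1; rewrite X2 Y2 in E2; rewrite X3 in E3; rewrite X4 in E4.
have [M M0 HM] := @kern_bounded R.
have mk : measurable_fun itvI (kern c r) by apply: measurable_funTS; exact: smooth_measurable.
have kb x : itvI x -> `|kern c r x| <= M / r by move=> _; exact: HM.
have j1 := intg_bndM mu mI mk kb hi.
have j2 := intg_bndM mu mI mk kb (intg_bndM mu mI (v1_measurable cv1) HN li).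
have j3 := intg_bndM mu mI mk kb (intg_bndM mu mI (v1_measurable cv1) HN onei).
have j12 := intgD mu mI j1 j2.
transitivity (\int[mu]_(x in itvI) (kern c r x * h x + kern c r x * (v1 x * l x)
   + kern c r x * (v1 x * 1))).
  by apply: eq_Rintegral => x _; ring.
rewrite (RintegralD_I j12 j3) (RintegralD_I j1 j2).
have Z2 : \int[mu]_(x in itvI) (kern c r x * (v1 x * l x)) =
    \int[mu]_(x in itvI) (v1 x * kern c r x * l x).
  by apply: eq_Rintegral => x _; ring.
have Z3 : \int[mu]_(x in itvI) (kern c r x * (v1 x * 1)) =
    \int[mu]_(x in itvI) (v1 x * kern c r x).
  by apply: eq_Rintegral => x _; ring.
rewrite Z2 Z3; exact: (tangential_arith E1 E2 E3 E4).
Qed.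

(** Horizontal sections of the domain may be disconnected, so the integration by parts in [x] takes
    a detour. With a [z]-primitive [K2] of the vertical factor, the formulas for [a] in [z] and [b]
    in [x] share the integral of [q], the vertical formula brings back [w], and the tangential
    relation evaluates the top. *)
Lemma green_excess_x (k1 K2 : R -> R) : smooth k1 -> smooth K2 ->
  k1 (-1) = 0 -> k1 1 = 0 -> K2 (-1) = 0 ->
  \int[mu2]_(y in Omega v) (tensor k1 ('D_1 K2) y * a y) =
  - (\int[mu2]_(y in Omega v) (w y * tensor ('D_1 k1) ('D_1 K2) y)) +
  \int[mu]_(x in itvI) (v x * v1 x * tensor k1 ('D_1 K2) (x, v x)).
Proof.
move=> s1 s2 k1m k1p K2m.
have s1' := smooth_derive (1 : R) s1; have s2' := smooth_derive (1 : R) s2.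
have [la _ lq lh] := H1_trace_L2 Ha; have [lb _ _ ll] := H1_trace_L2 Hb.
have [N N0 HN] := v1_bounded cv1.
have hi := L2_intg mu mI (@mu_itvI_fin R) lh.
have li := L2_intg mu mI (@mu_itvI_fin R) ll.
pose K := tensor k1 K2; have sK : smooth K := smooth_tensor s1 s2.
have Kb x : K (x, -1) = 0 by rewrite /K /tensor/= K2m mulr0.
have Km z : K (-1, z) = 0 by rewrite /K /tensor/= k1m mul0r.
have Kp z : K (1, z) = 0 by rewrite /K /tensor/= k1p mul0r.
have E1 := H1_green_z Ha sK Kb.
have E2 := H1_green_x Hb sK Km Kp.
have sKx : smooth (tensor ('D_1 k1) K2) := smooth_tensor s1' s2.
have E3 := green_excess_z cv v0 vm1 vp1 cw w_bottom w_top lb wb sKx.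
have X1 : \int[mu2]_(y in Omega v) ('D_e_z K y * a y) =
    \int[mu2]_(y in Omega v) (tensor k1 ('D_1 K2) y * a y).
  by apply: eq_Rintegral => y _; rewrite (derive_tensor_z y s1 s2).
have X2 : \int[mu2]_(y in Omega v) ('D_e_x K y * b y) =
    \int[mu2]_(y in Omega v) (b y * tensor ('D_1 k1) K2 y).
  by apply: eq_Rintegral => y _; rewrite (derive_tensor_x y s1 s2) mulrC.
have X3 : \int[mu2]_(y in Omega v) (w y * 'D_e_z (tensor ('D_1 k1) K2) y) =
    \int[mu2]_(y in Omega v) (w y * tensor ('D_1 k1) ('D_1 K2) y).
  by apply: eq_Rintegral => y _; rewrite (derive_tensor_z y s1' s2).
rewrite X1 in E1; rewrite X2 in E2; rewrite X3 in E3.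
have [M M0 HM] := smooth_graph_bounded cv v0 vm1 vp1 sK.
have mK := smooth_graph_measurable cv sK.
have mv1K : measurable_fun itvI (fun x => v1 x * K (x, v x)).
  by apply: measurable_funM => //; exact: v1_measurable.
have bv1K x : itvI x -> `|v1 x * K (x, v x)| <= N * M.
  by move=> Ix; rewrite normrM ler_pM ?HN ?HM.
have bv := v_le1.
have vi (F : R * R -> R) (sF : smooth F) := intg_bndM mu mI (v_measurable cv) bv (smooth_graph_intg cv v0 vm1 vp1 sF).
have v1i (F : R * R -> R) (sF : smooth F) := intg_bndM mu mI (v1_measurable cv1) HN (smooth_graph_intg cv v0 vm1 vp1 sF).
have vv1i (F : R * R -> R) (sF : smooth F) := intg_bndM mu mI (v_measurable cv) bv (v1i F sF).
have sKz : smooth (tensor k1 ('D_1 K2)) := smooth_tensor s1 s2'.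
have E4 : \int[mu]_(x in itvI) (v1 x * K (x, v x)) +
   (\int[mu]_(x in itvI) (v x * tensor ('D_1 k1) K2 (x, v x)) +
    \int[mu]_(x in itvI) (v x * (v1 x * tensor k1 ('D_1 K2) (x, v x)))) = 0.
  rewrite -(RintegralD_I (vi _ sKx) (vv1i _ sKz)) -(RintegralD_I (v1i _ sK) (intgD mu mI (vi _ sKx) (vv1i _ sKz))).
  rewrite -[RHS](graph_int_derive sK); apply: eq_Rintegral => x _.
  by rewrite (derive_tensor_x _ s1 s2) (derive_tensor_z _ s1 s2) (mulrDr (v x)).
have E5 : \int[mu]_(x in itvI) (K (x, v x) * h x) +
   (\int[mu]_(x in itvI) (v1 x * K (x, v x) * l x) + \int[mu]_(x in itvI) (v1 x * K (x, v x))) = 0.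
  have j1 := intg_bndM mu mI mK HM hi; have j2 := intg_bndM mu mI mv1K bv1K li.
  have j3 := v1i _ sK.
  rewrite -(RintegralD_I j2 j3) -(RintegralD_I j1 (intgD mu mI j2 j3)).
  transitivity (\int[mu]_(x in itvI) (0 : R)); last by rewrite Rintegral_cst// mul0r.
  apply: Rintegral_ae_eq1 => //.
  - exact: (intgD mu mI j1 (intgD mu mI j2 j3)).
  - by apply: (intg_bnd mu mI (@mu_itvI_fin R) (M := 0)) => // x _; rewrite normr0.
  - by apply: (ae_imp tangential_trace) => x Hx Ix; rewrite Hx//; ring.
have E6 : \int[mu]_(x in itvI) (v x * v1 x * tensor k1 ('D_1 K2) (x, v x)) =
   \int[mu]_(x in itvI) (v x * (v1 x * tensor k1 ('D_1 K2) (x, v x))).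
  by apply: eq_Rintegral => x _; rewrite mulrA.
rewrite E6.
exact: (excess_x_arith E1 E2 E3 E4 E5).
Qed.

End tangential.

Section dominated_eventually.
Context d (X : measurableType d) (R : realType) (m : {measure set X -> \bar R}).
Variable (D : set X).
Hypothesis mD : measurable D.

Lemma cvg_int_eventually (B : R) (K_ : nat -> X -> R) (K F : X -> R) :
  (forall n, measurable_fun D (K_ n)) -> measurable_fun D K ->
  (forall n x, D x -> `|K_ n x| <= B) ->
  (forall x, D x -> \forall n \near \oo, K_ n x = K x) ->
  m.-integrable D (EFin \o F) ->
  \int[m]_(x in D) (K_ n x * F x) @[n --> \oo] --> \int[m]_(x in D) (K x * F x).
Proof.
move=> mK_ mK KB KK Fi; have mF := intg_measurable m Fi.
apply: (Rintegral_dominated m mD (g := fun x => B * `|F x|)).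
- by move=> n; exact: measurable_funM.
- exact: measurable_funM.
- apply: aeW => x Dx; apply: cvg_near_cst.
  by apply: filterS (KK x Dx) => n ->.
- by apply: (intgZ m mD); exact: (intg_norm m Fi).
- by move=> n x Dx; rewrite normrM ler_wpM2r// KB.
Qed.

End dominated_eventually.
Arguments cvg_int_eventually [d X R] m [D] mD [B K_ K F] _ _ _ _ _.

(** * The flux inequality *)

Section cutoffs.
Context {R : realType}.
Implicit Types (x z k r : R).

(** Widths tending to 0 and never above [1 / 4], which keeps the two transition zones of [cutoff]
    apart. *)
Definition layer (n : nat) : R := 4^-1 * n.+1%:R^-1.

Lemma layer_gt0 n : 0 < layer n.
Proof. by rewrite mulr_gt0// invr_gt0. Qed.

Lemma layer_le n : layer n <= 4^-1.
Proof. by rewrite /layer ler_piMr ?invr_ge0// invf_le1// ler1n. Qed.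

Lemma layer_cvg e : 0 < e -> \forall n \near \oo, layer n < e.
Proof.
move=> e0; have : layer n @[n --> \oo] --> (0 : R).
  rewrite -[X in _ --> X](mulr0 4^-1); apply: cvgM; [exact: cvg_cst|exact: cvg_harmonic].
by move/cvgr_lt; apply.
Qed.

(** It rises over [[-1 + r, -1 + 2 r]] and falls over [[1 - 2 r, 1 - r]], hence is compactly
    supported in the open interval. *)
Definition cutoff r x : R := stp (-1 + r) r x - stp (1 - 2 * r) r x.

Lemma smooth_cutoff r : smooth (cutoff r).
Proof. by apply: smoothB; exact: smooth_stp. Qed.

Lemma derive_cutoff r x : 'D_1 (cutoff r) x = kern (-1 + r) r x - kern (1 - 2 * r) r x.
Proof. by have [_ ->] := is_deriveB (is_derive_stp (-1 + r) r x) (is_derive_stp (1 - 2 * r) r x). Qed.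

Lemma cutoff_m1 r : 0 < r <= 4^-1 -> cutoff r (-1) = 0.
Proof. by move=> /andP[r0 r1]; rewrite /cutoff !stp_out0 ?subrr//; lra. Qed.

Lemma cutoff_p1 r : 0 < r <= 4^-1 -> cutoff r 1 = 0.
Proof. by move=> /andP[r0 r1]; rewrite /cutoff !stp_out1 ?subrr//; lra. Qed.

Lemma cutoff_abs_le1 r x : `|cutoff r x| <= 1.
Proof.
have := stp_ge0 (-1 + r) r x; have := stp_le1 (-1 + r) r x.
have := stp_ge0 (1 - 2 * r) r x; have := stp_le1 (1 - 2 * r) r x.
by rewrite /cutoff ler_norml; lra.
Qed.

Lemma cutoff_ge0 r x : 0 < r <= 4^-1 -> 0 <= cutoff r x.
Proof.
move=> /andP[r0 r1]; rewrite /cutoff.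
have [h|h] := leP x (1 - 2 * r); first by rewrite (stp_out0 r0 h) subr0 stp_ge0.
by rewrite (@stp_out1 _ (-1 + r)) ?subr_ge0 ?stp_le1//; lra.
Qed.

Lemma cutoff_in r x : 0 < r <= 4^-1 -> -1 + 2 * r <= x <= 1 - 2 * r -> cutoff r x = 1.
Proof.
move=> /andP[r0 r1] /andP[x1 x2]; rewrite /cutoff (@stp_out1 _ (-1 + r)) ?(stp_out0 r0 x2) ?subr0//.
by lra.
Qed.

Lemma derive_cutoff_in r x : 0 < r <= 4^-1 -> -1 + 2 * r <= x <= 1 - 2 * r -> 'D_1 (cutoff r) x = 0.
Proof.
move=> /andP[r0 r1] /andP[x1 x2]; rewrite derive_cutoff (@kern_out1 _ (-1 + r)) ?(kern_out0 r0 x2) ?subrr//.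
by lra.
Qed.

Lemma derive_cutoff_bounded : exists2 M, 0 < M & forall r x, 0 < r -> `|'D_1 (cutoff r) x| <= M / r.
Proof.
have [M M0 HM] := @kern_bounded R; exists (2 * M) => [|r x r0]; first by rewrite mulr_gt0.
rewrite derive_cutoff (le_trans (ler_normB _ _))//.
have -> : 2 * M / r = M / r + M / r by rewrite -mulrA mulr_natl mulr2n.
by apply: lerD; exact: HM.
Qed.

Lemma cutoff_eventually x : itvI x ->
  \forall n \near \oo, cutoff (layer n) x = 1 /\ 'D_1 (cutoff (layer n)) x = 0.
Proof.
move=> /itvIE/andP[x1 x2].
have p : 0 < Num.min (1 + x) (1 - x) / 2 by rewrite divr_gt0// lt_min; apply/andP; split; lra.
apply: filterS (layer_cvg p) => n; rewrite ltr_pdivlMr// lt_min => /andP[h1 h2].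
have rn : 0 < layer n <= 4^-1 by rewrite layer_gt0 layer_le.
have xn : -1 + 2 * layer n <= x <= 1 - 2 * layer n by lra.
by rewrite cutoff_in// derive_cutoff_in.
Qed.

(* [ramp2' = ramp], [ramp'' >= 0]: a convex function vanishing on the negative
   half-line together with an explicit primitive. *)
Definition ramp2 x : R := x ^+ 2 * expinv 0 x.
Definition ramp x : R := 2 * hinge x + expinv 0 x.

Lemma smooth_ramp2 : smooth ramp2.
Proof. by apply: smoothM; [apply: smoothX; exact: smooth_id|exact: smooth_expinv]. Qed.

Lemma smooth_ramp : smooth ramp.
Proof. by apply: smoothD; [apply: smoothZ; exact: smooth_hinge|exact: smooth_expinv]. Qed.

Lemma is_derive_ramp2 x : is_derive x 1 ramp2 (ramp x).
Proof.
have d := is_deriveM (is_deriveX 2 (is_derive_id x (1 : R))) (is_derive_expinv 0 x).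
apply: (is_derive_eq d); rewrite /ramp /hinge -(mul_expinv 0 x) -(mul_expinv 1 x) /GRing.scale/=.
rewrite /cst/= mul0r subr0.
transitivity (x ^+ 2 * expinv 2 x + (x * (x * expinv 2 x)) * (2 * x ^+ 1 * 1)) => //.
by ring.
Qed.

Lemma is_derive_ramp x : is_derive x 1 ramp (2 * (expinv 0 x + expinv 1 x) + expinv 2 x).
Proof.
have d := is_deriveD (is_deriveM (is_derive_cst (2 : R) x 1) (is_derive_hinge x)) (is_derive_expinv 0 x).
apply: (is_derive_eq d); rewrite mul0r subr0.
transitivity (2 * (expinv 0 x + expinv 1 x) + hinge x * 0 + expinv 2 x) => //.
by rewrite mulr0 addr0.
Qed.

Lemma derive_ramp x : 'D_1 ramp x = 2 * (expinv 0 x + expinv 1 x) + expinv 2 x.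
Proof. by have [_ ->] := is_derive_ramp x. Qed.

Lemma derive2_ramp x : 'D_1 ('D_1 ramp) x = expinv 4 x.
Proof.
have -> : 'D_1 ramp = fun x => 2 * (expinv 0 x + expinv 1 x) + expinv 2 x.
  by apply/funext => y; exact: derive_ramp.
have d01 := is_deriveD (is_derive_expinv 0 x) (is_derive_expinv 1 x).
have d := is_deriveD (is_deriveM (is_derive_cst (2 : R) x 1) d01) (is_derive_expinv 2 x).
have [_ ->] := d.
transitivity (2 * (expinv 2 x - 0 * expinv 1 x + (expinv 3 x - 1 * expinv 2 x)) +
  (expinv 0 x + expinv 1 x) * 0 + (expinv 4 x - 2 * expinv 3 x)) => //.
by ring.
Qed.

Lemma ramp_ge0 x : 0 <= ramp x.
Proof. by rewrite addr_ge0 ?expinv_ge0// mulr_ge0// hinge_ge0. Qed.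

Lemma ramp_le0 x : x <= 0 -> ramp x = 0.
Proof. by move=> x0; rewrite /ramp hinge_le0// expinv_le0// mulr0 addr0. Qed.

Lemma ramp_homo x y : x <= y -> ramp x <= ramp y.
Proof. by move=> xy; rewrite lerD ?expinv0_homo// ler_pM2l// hinge_homo. Qed.

Lemma ramp1_gt0 : 0 < ramp 1.
Proof. by rewrite ltr_wpDr ?expinv_ge0// mulr_gt0// hinge_gt0. Qed.

Lemma derive_ramp_le0 x : x <= 0 -> 'D_1 ramp x = 0.
Proof. by move=> x0; rewrite derive_ramp !expinv_le0// !addr0 mulr0. Qed.

Lemma derive_ramp_bounded : exists2 M, 0 < M & forall x, x <= 1 -> `|'D_1 ramp x| <= M.
Proof.
have [M M0 HM] := smooth_bounded (smooth_derive (1 : R) smooth_ramp) (@segment_compact R 0 1).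
exists M => // x x1; have [x0|x0] := leP x 0; first by rewrite derive_ramp_le0// normr0 ltW.
by apply: HM; rewrite /= in_itv/= ltW.
Qed.

(** For [s = 1] or [s = -1] this equals 1 at the endpoint [x = s] and falls to 0 at distance [1 / k]
    from it. *)
Definition aff k s x : R := k * (s * x - 1) + 1.

Lemma smooth_affine1 k s : smooth (aff k s).
Proof.
apply: smoothD (smooth_cst _); apply: smoothZ.
by apply: smoothB (smooth_cst _); apply: smoothZ; exact: smooth_id.
Qed.

Lemma is_derive_affine1 k s x : is_derive x 1 (aff k s) (k * s).
Proof.
have d := is_deriveD (is_deriveM (is_derive_cst k x 1)
  (is_deriveB (is_deriveM (is_derive_cst s x 1) (is_derive_id x (1 : R))) (is_derive_cst (1 : R) x 1)))
  (is_derive_cst (1 : R) x 1).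
apply: (is_derive_eq d).
transitivity (k * (s * 1 + x * 0 - 0) + (s * x - 1) * 0 + 0) => //.
by ring.
Qed.

Lemma is_derive_comp_aff (F : R -> R) k s x : smooth F ->
  is_derive x 1 (fun x => F (aff k s x)) ('D_1 F (aff k s x) * (k * s)).
Proof.
move=> sF; have dF : is_derive (aff k s x) 1 F _ := smooth_is_derive _ _ sF.
exact: (is_derive_comp1 dF (smooth_differentiable x (smooth_affine1 k s)) (is_derive_affine1 k s x)).
Qed.

Lemma smooth_comp_aff (F : R -> R) k s : smooth F -> smooth (fun x => F (aff k s x)).
Proof. by move=> sF; exact: (smooth_comp sF (smooth_affine1 k s)). Qed.

(* Concave on the line, zero at -1 and 1, and tending to [ramp 1] inside (-1, 1) as k grows. *)
Definition conc k x : R := ramp 1 - ramp (aff k 1 x) - ramp (aff k (-1) x).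

Lemma smooth_conc k : smooth (conc k).
Proof.
apply: smoothB; last exact: (smooth_comp_aff _ _ smooth_ramp).
by apply: smoothB; [exact: smooth_cst|exact: (smooth_comp_aff _ _ smooth_ramp)].
Qed.

Lemma derive_conc k x :
  'D_1 (conc k) x = k * ('D_1 ramp (aff k (-1) x) - 'D_1 ramp (aff k 1 x)).
Proof.
have d := is_deriveB (is_deriveB (is_derive_cst (ramp 1) x 1) (is_derive_comp_aff k 1 x smooth_ramp))
  (is_derive_comp_aff k (-1) x smooth_ramp).
have [_ ->] := d; move: ('D_1 ramp (aff k 1 x)) ('D_1 ramp (aff k (-1) x)) => p q.
by ring.
Qed.

Lemma derive2_conc_le0 k x : 'D_1 ('D_1 (conc k)) x <= 0.
Proof.
have -> : 'D_1 (conc k) = fun x => k * ('D_1 ramp (aff k (-1) x) - 'D_1 ramp (aff k 1 x)).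
  by apply/funext => y; exact: derive_conc.
have sr := smooth_derive (1 : R) smooth_ramp.
have d := is_deriveM (is_derive_cst k x 1)
  (is_deriveB (is_derive_comp_aff k (-1) x sr) (is_derive_comp_aff k 1 x sr)).
have [_ ->] := d; rewrite !derive2_ramp.
set A := expinv 4 (aff k (-1) x); set B := expinv 4 (aff k 1 x).
have A0 : 0 <= A := expinv_ge0 _ _; have B0 : 0 <= B := expinv_ge0 _ _.
set T := ('D_1 ramp (aff k (-1) x) - 'D_1 ramp (aff k 1 x)).
have -> : k *: (A * (k * -1) - B * (k * 1)) + T *: 0 = - (k ^+ 2 * (A + B)).
  transitivity (k * (A * (k * -1) - B * (k * 1)) + T * 0) => //.
  by ring.
by rewrite oppr_le0 mulr_ge0 ?sqr_ge0// addr_ge0.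
Qed.

Lemma conc_m1 k : 1 <= k -> conc k (-1) = 0.
Proof.
move=> k1; rewrite /conc /aff.
have -> : k * (1 * -1 - 1) + 1 = 1 - 2 * k by ring.
have -> : k * (-1 * -1 - 1) + 1 = 1 by ring.
by rewrite (@ramp_le0 (1 - 2 * k)) ?subr0 ?subrr//; lra.
Qed.

Lemma conc_p1 k : 1 <= k -> conc k 1 = 0.
Proof.
move=> k1; rewrite /conc /aff.
have -> : k * (-1 * 1 - 1) + 1 = 1 - 2 * k by ring.
have -> : k * (1 * 1 - 1) + 1 = 1 by ring.
by rewrite (@ramp_le0 (1 - 2 * k)) ?subr0 ?subrr//; lra.
Qed.

Lemma conc_bounds k x : 1 <= k -> -1 <= x <= 1 -> 0 <= conc k x <= ramp 1.
Proof.
move=> k1 /andP[x1 x2]; rewrite /conc /aff.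
have r1 := ramp_ge0 (k * (1 * x - 1) + 1); have r2 := ramp_ge0 (k * (-1 * x - 1) + 1).
have [x0|x0] := leP 0 x.
  have r3 : ramp (k * (-1 * x - 1) + 1) = 0 by apply: ramp_le0; nra.
  have r4 : ramp (k * (1 * x - 1) + 1) <= ramp 1 by apply: ramp_homo; nra.
  by rewrite r3 in r2 *; lra.
have r3 : ramp (k * (1 * x - 1) + 1) = 0 by apply: ramp_le0; nra.
have r4 : ramp (k * (-1 * x - 1) + 1) <= ramp 1 by apply: ramp_homo; nra.
by rewrite r3 in r1 *; lra.
Qed.

Lemma conc_eventually x : itvI x ->
  \forall n \near \oo, conc n.+1%:R x = ramp 1 /\ 'D_1 (conc n.+1%:R) x = 0.
Proof.
move=> /itvIE/andP[x1 x2].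
have p : 0 < Num.min (1 + x) (1 - x) / 4 by rewrite divr_gt0// lt_min; apply/andP; split; lra.
apply: filterS (layer_cvg p) => n; rewrite /layer ltr_pdivlMr// lt_min.
rewrite mulrAC mulVf// mul1r => /andP[h1 h2].
have n0 : 0 < n.+1%:R :> R by [].
have a1 : aff n.+1%:R 1 x <= 0.
  by rewrite /aff mul1r -opprB mulrN addrC subr_le0 -ler_pdivrMl// mulr1 ltW.
have a2 : aff n.+1%:R (-1) x <= 0.
  by rewrite /aff mulN1r -opprD mulrN addrC subr_le0 -ler_pdivrMl// mulr1 addrC ltW.
split; first by rewrite /conc (ramp_le0 a1) (ramp_le0 a2) !subr0.
by rewrite derive_conc (derive_ramp_le0 a1) (derive_ramp_le0 a2) subrr mulr0.
Qed.

(** The derivative of [conc k] is of order [k], but nonzero only within [1 / k] of an endpoint,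
    where [|y|] is at most [1 / k]; the product is bounded uniformly in [k]. *)
Lemma derive_conc_layer : exists2 M, 0 < M & forall k x y, 1 <= k -> -1 <= x <= 1 ->
  `|y| <= 1 - x -> `|y| <= 1 + x -> `|y * 'D_1 (conc k) x| <= M.
Proof.
have [M M0 HM] := derive_ramp_bounded; exists (2 * M) => [|k x y k1 /andP[x1 x2] y1 y2].
  by rewrite mulr_gt0.
have k0 : 0 < k by lra.
have half (s : R) : `|y| <= 1 - s * x -> 0 <= 1 - s * x -> `|y| * k * `|'D_1 ramp (aff k s x)| <= M.
  move=> ys s0; have [a0|a0] := leP (aff k s x) 0.
    by rewrite derive_ramp_le0// normr0 mulr0 ltW.
  (* Positivity of [aff k s x] says precisely that [1 - s * x] is below [1 / k]. *)
  have yk : `|y| * k <= 1 by move: a0; rewrite /aff; nra.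
  rewrite -[leRHS]mul1r ler_pM ?mulr_ge0 ?(ltW k0)//.
  by apply: HM; rewrite /aff; nra.
have h1 := half 1; have h2 := half (-1).
rewrite mul1r in h1; rewrite mulN1r opprK in h2.
rewrite derive_conc normrM normrM (gtr0_norm k0) mulrA.
have yk0 : 0 <= `|y| * k by rewrite mulr_ge0// ltW.
apply: (le_trans (ler_wpM2l yk0 (ler_normB _ _))); rewrite mulrDr mulr_natl mulr2n.
by apply: lerD; [apply: h2 => //; lra|apply: h1 => //; lra].
Qed.

(* Concave, zero at the bottom z = -1, and constant for z >= -1 + 1 / k. *)
Definition ramp_lift k z : R := ramp 1 - ramp (aff k (-1) z).
Definition ramp_lift_prim k z : R := ramp 1 * z + ramp2 (aff k (-1) z) / k + (ramp 1 - ramp2 1 / k).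

Lemma smooth_ramp_lift k : smooth (ramp_lift k).
Proof. by apply: smoothB; [exact: smooth_cst|exact: (smooth_comp_aff _ _ smooth_ramp)]. Qed.

Lemma smooth_ramp_lift_prim k : smooth (ramp_lift_prim k).
Proof.
apply: smoothD (smooth_cst _); apply: smoothD; first by apply: smoothZ; exact: smooth_id.
by apply: smoothM (smooth_cst _); exact: (smooth_comp_aff _ _ smooth_ramp2).
Qed.

Lemma derive_ramp_lift_prim k z : k != 0 -> 'D_1 (ramp_lift_prim k) z = ramp_lift k z.
Proof.
move=> k0.
have d := is_deriveD (is_deriveD (is_deriveM (is_derive_cst (ramp 1) z 1) (is_derive_id z (1 : R)))
  (is_deriveM (is_derive_comp_aff k (-1) z smooth_ramp2) (is_derive_cst k^-1 z 1)))
  (is_derive_cst (ramp 1 - ramp2 1 / k) z 1).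
have [_ ->] := d; have [_ ->] := is_derive_ramp2 (aff k (-1) z).
rewrite /ramp_lift.
set A := ramp (aff k (-1) z); set T := ramp2 (aff k (-1) z).
transitivity (ramp 1 * 1 + z * 0 + (T * 0 + k^-1 * (A * (k * -1))) + 0) => //.
by field.
Qed.

Lemma ramp_lift_prim_m1 k : k != 0 -> ramp_lift_prim k (-1) = 0.
Proof.
move=> k0; rewrite /ramp_lift_prim /aff.
have -> : k * (-1 * -1 - 1) + 1 = 1 by ring.
by ring.
Qed.

Lemma ramp_lift_m1 k : ramp_lift k (-1) = 0.
Proof.
rewrite /ramp_lift /aff.
have -> : k * (-1 * -1 - 1) + 1 = 1 by ring.
by rewrite subrr.
Qed.

Lemma derive_ramp_lift k z : 'D_1 (ramp_lift k) z = k * 'D_1 ramp (aff k (-1) z).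
Proof.
have d := is_deriveB (is_derive_cst (ramp 1) z 1) (is_derive_comp_aff k (-1) z smooth_ramp).
have [_ ->] := d; move: ('D_1 ramp (aff k (-1) z)) => p; ring.
Qed.

Lemma derive2_ramp_lift_le0 k z : 'D_1 ('D_1 (ramp_lift k)) z <= 0.
Proof.
have -> : 'D_1 (ramp_lift k) = fun z => k * 'D_1 ramp (aff k (-1) z).
  by apply/funext => y; exact: derive_ramp_lift.
have sr := smooth_derive (1 : R) smooth_ramp.
have d := is_deriveM (is_derive_cst k z 1) (is_derive_comp_aff k (-1) z sr).
have [_ ->] := d; rewrite derive2_ramp.
set A := expinv 4 (aff k (-1) z); have A0 : 0 <= A := expinv_ge0 _ _.
set T := 'D_1 ramp _.
have -> : k *: (A * (k * -1)) + T *: 0 = - (k ^+ 2 * A).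
  transitivity (k * (A * (k * -1)) + T * 0) => //.
  by ring.
by rewrite oppr_le0 mulr_ge0 ?sqr_ge0.
Qed.

Lemma ramp_lift_ge0 k z : 0 < k -> -1 <= z -> 0 <= ramp_lift k z.
Proof. by move=> k0 z1; rewrite subr_ge0 ramp_homo// /aff; nra. Qed.

Lemma ramp_lift_top d z : 0 < d -> d <= 1 + z -> ramp_lift d^-1 z = ramp 1 /\ 'D_1 (ramp_lift d^-1) z = 0.
Proof.
move=> d0 dz.
have a0 : aff d^-1 (-1) z <= 0.
  by rewrite /aff mulN1r -opprD mulrN addrC subr_le0 ler_pdivlMl// mulr1 addrC.
by rewrite derive_ramp_lift /ramp_lift (ramp_le0 a0) subr0 (derive_ramp_le0 a0) mulr0.
Qed.

End cutoffs.

Lemma flux_arith (R : realType) (e2 A1 B1 I J S1 S2 V L H : R) :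
  0 <= e2 -> B1 + J = L -> A1 + I = - H -> e2 * I + J = 0 -> B1 + S1 = 0 ->
  A1 = - S2 + V -> S1 <= 0 -> S2 <= 0 -> e2 * V <= L - e2 * H.
Proof.
move=> e0 hL hH hIJ hB hA s1 s2.
have h1 : e2 * S2 <= 0 by rewrite mulr_ge0_le0.
have h2 : e2 * A1 = - (e2 * S2) + e2 * V by rewrite hA; ring.
have h3 : e2 * A1 + e2 * I = - (e2 * H) by rewrite -mulrDr hH mulrN.
lra.
Qed.

(** * Testing the equation with concave cutoffs *)

Section top_flux.
Context {R : realType}.
Notation mu := (@lebesgue_measure R).
Notation mu2 := (mu \x mu)%E.

(** Where the slope of the cutoff is nonzero, [x] is within [2 r] of an endpoint and the linear
    decay gives [|s| <= 2 C r], which cancels the [1 / r] of the slope. *)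
Lemma side_layer_bound (C M r x s : R) : 0 < r <= 4^-1 -> 0 < C ->
  `|s| <= C * (1 - x) -> `|s| <= C * (1 + x) -> `|'D_1 (cutoff r) x| <= M / r ->
  0 <= M -> `|s * 'D_1 (cutoff r) x| <= 2 * C * M.
Proof.
move=> rr C0 s1 s2 cM M0; have /andP[r0 r1] := rr.
have [xin|xout] := boolP (-1 + 2 * r <= x <= 1 - 2 * r).
  by rewrite derive_cutoff_in// mulr0 normr0 !mulr_ge0// ltW.
rewrite normrM; have sr : `|s| <= C * (2 * r).
  move: xout; rewrite negb_and -!ltNge => /orP[h|h].
    by apply: (le_trans s2); rewrite ler_pM2l//; lra.
  by apply: (le_trans s1); rewrite ler_pM2l//; lra.
apply: (le_trans (ler_pM _ _ sr cM)) => //.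
have -> : C * (2 * r) * (M / r) = 2 * C * M by field; rewrite gt_eqF.
by [].
Qed.

Lemma Rintegral_le0 d (X : measurableType d) (m : {measure set X -> \bar R}) (D : set X)
  (f : X -> R) : measurable D -> m.-integrable D (EFin \o f) ->
  (forall x, D x -> f x <= 0) -> \int[m]_(x in D) f x <= 0.
Proof.
move=> mD fi f0.
have : 0 <= \int[m]_(x in D) (-1 * f x); last by rewrite RintegralZl// mulN1r oppr_ge0.
apply: Rintegral_ge0 => x Dx.
by rewrite mulN1r oppr_ge0 f0.
Qed.

Variable v : R -> R.
Hypothesis cv : {within `[-1, 1], continuous v}.
Hypothesis v0 : forall x, itvI x -> -1 < v x <= 0.
Hypothesis vm1 : v (-1) = 0.
Hypothesis vp1 : v 1 = 0.
Variable v1 : R -> R.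
Hypothesis cv1 : {within `[-1, 1], continuous v1}.
Hypothesis dv : forall x, itvI x -> is_derive x 1 v (v1 x).
Variables (w a b ax q bz : R * R -> R) (h l : R -> R).
Hypothesis cw : {within closure (Omega v), continuous w}.
Hypothesis w_bottom : forall x, itvI x -> w (x, -1) = 0.
Hypothesis w_top : forall x, itvI x -> w (x, v x) = - v x.
Hypothesis wa : forall phi, test_function (Omega v) phi ->
  \int[mu2]_(y in Omega v) (w y * 'D_e_x phi y) = - \int[mu2]_(y in Omega v) (a y * phi y).
Hypothesis wb : forall phi, test_function (Omega v) phi ->
  \int[mu2]_(y in Omega v) (w y * 'D_e_z phi y) = - \int[mu2]_(y in Omega v) (b y * phi y).
Hypothesis Ha : H1_trace v a ax q h.
Hypothesis Hb : H1_trace v b q bz l.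
Variable eps : R.
Hypothesis e0 : 0 < eps.
Hypothesis abae : {ae mu2, forall y, Omega v y -> eps ^+ 2 * ax y + bz y = 0}.
Hypothesis w_ge0 : forall y, Omega v y -> 0 <= w y.
Variable C : R.
Hypothesis C0 : 0 < C.
Hypothesis w_sides : forall y, Omega v y -> w y <= C * (1 - y.1) /\ w y <= C * (1 + y.1).

Let mO := measurable_Omega cv.
Let muO := mu2_Omega cv v0.
Let mI := @measurable_itvI R.
Let wi := closure_intg cv v0 vm1 vp1 cw.
Let intO (F : R * R -> R) (sF : smooth F) := smooth_integrable_Omega cv v0 vm1 vp1 sF.

Lemma layer_range n : 0 < (layer n : R) <= 4^-1.
Proof. by rewrite layer_gt0 layer_le. Qed.

Lemma horizontal_measurable (f : R -> R) : smooth f -> measurable_fun (Omega v) (fun y => f y.1).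
Proof. by move=> sf; apply: (smooth_measurable_Omega (v := v)); exact: smooth_horizontal. Qed.

Lemma excess_cut_bound : exists B : R, forall n y, Omega v y ->
  `|w y * 'D_1 (cutoff (layer n)) y.1| <= B.
Proof.
have [M M0 HM] := @derive_cutoff_bounded R.
exists (2 * C * M) => n y Oy; have [h1 h2] := w_sides Oy.
have wn : `|w y| = w y by rewrite ger0_norm// w_ge0.
apply: side_layer_bound => //; rewrite ?wn ?(ltW M0)//.
- exact: layer_range.
- by apply: HM; exact: layer_gt0.
Qed.

Lemma Omega_itvI (y : R * R) : Omega v y -> itvI y.1. Proof. by case. Qed.

(** The derivative of [conc k] does not vanish at the endpoints, so [green_excess_x] is applied
    after multiplication by [cutoff]. As the layers shrink, the extra term, [w] times the slope of
    the cutoff, stays bounded by the barriers and is eventually 0 at each point; dominated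
    convergence removes it. *)
Lemma green_excess_x_conc k d : 1 <= k -> 0 < d ->
  \int[mu2]_(y in Omega v) (tensor ('D_1 (conc k)) (ramp_lift d) y * a y) =
  - (\int[mu2]_(y in Omega v) (w y * tensor ('D_1 ('D_1 (conc k))) (ramp_lift d) y)) +
  \int[mu]_(x in itvI) (v x * v1 x * tensor ('D_1 (conc k)) (ramp_lift d) (x, v x)).
Proof.
move=> k1 d0.
have sX := @smooth_conc R k; have sX' := smooth_derive (1 : R) sX; have sX'' := smooth_derive (1 : R) sX'.
have sL := @smooth_ramp_lift R d; have sK := @smooth_ramp_lift_prim R d.
(* The explicit primitive presents [ramp_lift] as the derivative of a function vanishing at the
   bottom, the form that [green_excess_x] asks of the vertical factor. *)
have dK : 'D_1 (ramp_lift_prim d) = ramp_lift d.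
  by apply/funext => z; apply: derive_ramp_lift_prim; rewrite gt_eqF.
have K0 : ramp_lift_prim d (-1) = 0 by apply: ramp_lift_prim_m1; rewrite gt_eqF.
have [la _ _ _] := H1_trace_L2 Ha.
have ai := L2_intg mu2 mO muO la.
have [N N0 HN] := v1_bounded cv1.
pose k_ n x := cutoff (layer n) x * 'D_1 (conc k) x.
have sk n : smooth (k_ n) by apply: smoothM => //; exact: smooth_cutoff.
have dk n x : 'D_1 (k_ n) x = cutoff (layer n) x * 'D_1 ('D_1 (conc k)) x +
    'D_1 (conc k) x * 'D_1 (cutoff (layer n)) x.
  by have [_ ->] := is_deriveM (smooth_is_derive x 1 (@smooth_cutoff R (layer n))) (smooth_is_derive x 1 sX').
have km n : k_ n (-1) = 0 by rewrite /k_ cutoff_m1 ?mul0r//; exact: layer_range.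
have kp n : k_ n 1 = 0 by rewrite /k_ cutoff_p1 ?mul0r//; exact: layer_range.
have E n := green_excess_x cv v0 vm1 vp1 cv1 dv cw w_bottom w_top wa wb Ha Hb (sk n) sK (km n) (kp n) K0.
rewrite dK in E.
have mcut n : measurable_fun (Omega v) (fun y => cutoff (layer n) y.1).
  by apply: horizontal_measurable; exact: smooth_cutoff.
have mwcut n : measurable_fun (Omega v) (fun y => w y * 'D_1 (cutoff (layer n)) y.1).
  apply: measurable_funM; first exact: (closure_measurable cv cw).
  by apply: (horizontal_measurable (f := 'D_1 (cutoff (layer n)))); apply: smooth_derive; exact: smooth_cutoff.
have sT1 := smooth_tensor sX' sL; have sT2 := smooth_tensor sX'' sL.
have i1 : mu2.-integrable (Omega v) (EFin \o (fun y => tensor ('D_1 (conc k)) (ramp_lift d) y * a y)).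
  apply: (intg_eq mu2 mO (f := fun y => a y * tensor ('D_1 (conc k)) (ramp_lift d) y)) => [y _|].
    by rewrite mulrC.
  exact: (intg_smoothM cv v0 vm1 vp1 ai sT1).
have c1 : \int[mu2]_(y in Omega v) (cutoff (layer n) y.1 * (tensor ('D_1 (conc k)) (ramp_lift d) y * a y))
    @[n --> \oo] --> \int[mu2]_(y in Omega v) (1 * (tensor ('D_1 (conc k)) (ramp_lift d) y * a y)).
  apply: (cvg_int_eventually mu2 mO (B := 1)) i1 => //.
  - by move=> n y _; exact: cutoff_abs_le1.
  - by move=> y Oy; apply: filterS (cutoff_eventually (Omega_itvI Oy)) => n [].
have i2 := intg_smoothM cv v0 vm1 vp1 wi sT2.
have c2 : \int[mu2]_(y in Omega v) (cutoff (layer n) y.1 * (w y * tensor ('D_1 ('D_1 (conc k))) (ramp_lift d) y))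
    @[n --> \oo] --> \int[mu2]_(y in Omega v) (1 * (w y * tensor ('D_1 ('D_1 (conc k))) (ramp_lift d) y)).
  apply: (cvg_int_eventually mu2 mO (B := 1)) i2 => //.
  - by move=> n y _; exact: cutoff_abs_le1.
  - by move=> y Oy; apply: filterS (cutoff_eventually (Omega_itvI Oy)) => n [].
have [B HB] := excess_cut_bound.
have i3 := intO sT1.
have c3 : \int[mu2]_(y in Omega v) ((w y * 'D_1 (cutoff (layer n)) y.1) * tensor ('D_1 (conc k)) (ramp_lift d) y)
    @[n --> \oo] --> \int[mu2]_(y in Omega v) (0 * tensor ('D_1 (conc k)) (ramp_lift d) y).
  apply: (cvg_int_eventually mu2 mO (B := B)) i3 => //.
  - move=> y Oy; apply: filterS (cutoff_eventually (Omega_itvI Oy)) => n [_ ->].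
    by rewrite mulr0.
have i4 : mu.-integrable itvI (EFin \o (fun x => v x * v1 x * tensor ('D_1 (conc k)) (ramp_lift d) (x, v x))).
  apply: (intg_eq mu mI (f := fun x => v x * (v1 x * tensor ('D_1 (conc k)) (ramp_lift d) (x, v x)))) => [x _|].
    by rewrite mulrA.
  apply: (intg_bndM mu mI (v_measurable cv) (fun x Ix => v_le1 v0 Ix)).
  exact: (intg_bndM mu mI (v1_measurable cv1) HN (smooth_graph_intg cv v0 vm1 vp1 sT1)).
have c4 : \int[mu]_(x in itvI) (cutoff (layer n) x * (v x * v1 x * tensor ('D_1 (conc k)) (ramp_lift d) (x, v x)))
    @[n --> \oo] --> \int[mu]_(x in itvI) (1 * (v x * v1 x * tensor ('D_1 (conc k)) (ramp_lift d) (x, v x))).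
  apply: (cvg_int_eventually mu mI (B := 1)) i4 => //.
  - by move=> n; apply: measurable_funTS; apply: smooth_measurable; exact: smooth_cutoff.
  - by move=> n x _; exact: cutoff_abs_le1.
  - by move=> x Ix; apply: filterS (cutoff_eventually Ix) => n [].
have one2 (F : R * R -> R) : \int[mu2]_(y in Omega v) (1 * F y) = \int[mu2]_(y in Omega v) F y.
  by apply: eq_Rintegral => y _; rewrite mul1r.
have one1 (F : R -> R) : \int[mu]_(x in itvI) (1 * F x) = \int[mu]_(x in itvI) F x.
  by apply: eq_Rintegral => y _; rewrite mul1r.
have zero2 (F : R * R -> R) : \int[mu2]_(y in Omega v) (0 * F y) = 0.
  transitivity (\int[mu2]_(y in Omega v) (0 : R)); last by rewrite Rintegral_cst// mul0r.
  by apply: eq_Rintegral => y _; rewrite mul0r.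
rewrite one2 in c1; rewrite one2 in c2; rewrite zero2 in c3; rewrite one1 in c4.
have c5 := cvgD (cvgN (cvgD c2 c3)) c4.
rewrite addr0 in c5.
apply: (cvg_unique _ c1) => //.
set S := (X in X @ \oo); set G := (X in X @ \oo) in c5.
have -> : S = G; last exact: c5.
apply/funext => n; rewrite /S /G.
transitivity (\int[mu2]_(y in Omega v) (tensor (k_ n) (ramp_lift d) y * a y)).
  have EE (p q' r s : R) : p * (q' * r * s) = p * q' * r * s by ring.
  by apply: eq_Rintegral => y _; exact: EE.
apply: (etrans (E n)).
have j1 : mu2.-integrable (Omega v) (EFin \o (fun y => cutoff (layer n) y.1 * (w y * tensor ('D_1 ('D_1 (conc k))) (ramp_lift d) y))).
  exact: (intg_bndM mu2 mO (mcut n) (fun y _ => cutoff_abs_le1 _ _) i2).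
have j2 : mu2.-integrable (Omega v) (EFin \o (fun y => (w y * 'D_1 (cutoff (layer n)) y.1) * tensor ('D_1 (conc k)) (ramp_lift d) y)).
  exact: (intg_bndM mu2 mO (mwcut n) (HB n) i3).
have X1 : \int[mu2]_(y in Omega v) (w y * tensor ('D_1 (k_ n)) (ramp_lift d) y) =
   \int[mu2]_(y in Omega v) (cutoff (layer n) y.1 * (w y * tensor ('D_1 ('D_1 (conc k))) (ramp_lift d) y)) +
   \int[mu2]_(y in Omega v) ((w y * 'D_1 (cutoff (layer n)) y.1) * tensor ('D_1 (conc k)) (ramp_lift d) y).
  rewrite -(RintegralD_plane mO j1 j2); apply: eq_Rintegral => y _.
  rewrite /tensor dk.
  have EE (W c1' x2 x1 c2' L : R) : W * ((c1' * x2 + x1 * c2') * L) = c1' * (W * (x2 * L)) + W * c2' * (x1 * L) by ring.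
  exact: EE.
have X2 : \int[mu]_(x in itvI) (v x * v1 x * tensor (k_ n) (ramp_lift d) (x, v x)) =
  \int[mu]_(x in itvI) (cutoff (layer n) x * (v x * v1 x * tensor ('D_1 (conc k)) (ramp_lift d) (x, v x))).
  have EE (V c1' x1 L : R) : V * (c1' * x1 * L) = c1' * (V * (x1 * L)) by ring.
  by apply: eq_Rintegral => x _; exact: EE.
by rewrite X1 X2.
Qed.

(** Two integrations by parts put all derivatives on [T = conc k (x) ramp_lift (z)]. In the
    interior, [w >= 0] meets [T_zz] and [eps^2 T_xx], both nonpositive since each factor is
    nonnegative and concave; dropping them leaves an inequality between integrals over the top. *)
Lemma top_flux_step k d : 1 <= k -> 0 < d -> (forall x, `[-1, 1]%classic x -> d <= 1 + v x) ->
  eps ^+ 2 * (\int[mu]_(x in itvI) (v x * v1 x * tensor ('D_1 (conc k)) (ramp_lift d^-1) (x, v x))) <=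
  \int[mu]_(x in itvI) (tensor (conc k) (ramp_lift d^-1) (x, v x) * l x) -
  eps ^+ 2 * (\int[mu]_(x in itvI) (v1 x * tensor (conc k) (ramp_lift d^-1) (x, v x) * h x)).
Proof.
move=> k1 d0 hd.
have di0 : 0 < d^-1 by rewrite invr_gt0.
have sX := @smooth_conc R k; have sX' := smooth_derive (1 : R) sX; have sX'' := smooth_derive (1 : R) sX'.
have sL := @smooth_ramp_lift R d^-1; have sL' := smooth_derive (1 : R) sL; have sL'' := smooth_derive (1 : R) sL'.
have [la lax _ _] := H1_trace_L2 Ha; have [lb _ lbz _] := H1_trace_L2 Hb.
have axi := L2_intg mu2 mO muO lax; have bzi := L2_intg mu2 mO muO lbz.
have sT := smooth_tensor sX sL.
have Tb x : tensor (conc k) (ramp_lift d^-1) (x, -1) = 0 by rewrite tensorE ramp_lift_m1 mulr0.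
have Tm z : tensor (conc k) (ramp_lift d^-1) (-1, z) = 0 by rewrite tensorE conc_m1// mul0r.
have Tp z : tensor (conc k) (ramp_lift d^-1) (1, z) = 0 by rewrite tensorE conc_p1// mul0r.
have G1 := H1_green_z cv v0 vm1 vp1 Hb sT Tb.
have G2 := H1_green_x cv v0 vm1 vp1 cv1 dv Ha sT Tm Tp.
have sTz := smooth_tensor sX sL'.
have G4 := green_excess_z cv v0 vm1 vp1 cw w_bottom w_top lb wb sTz.
have G5 := green_excess_x_conc k1 di0.
have X1 : \int[mu2]_(y in Omega v) ('D_e_z (tensor (conc k) (ramp_lift d^-1)) y * b y) =
   \int[mu2]_(y in Omega v) (b y * tensor (conc k) ('D_1 (ramp_lift d^-1)) y).
  by apply: eq_Rintegral => y _; rewrite (derive_tensor_z y sX sL) mulrC.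
have X2 : \int[mu2]_(y in Omega v) ('D_e_x (tensor (conc k) (ramp_lift d^-1)) y * a y) =
   \int[mu2]_(y in Omega v) (tensor ('D_1 (conc k)) (ramp_lift d^-1) y * a y).
  by apply: eq_Rintegral => y _; rewrite (derive_tensor_x y sX sL).
have X4 : \int[mu2]_(y in Omega v) (w y * 'D_e_z (tensor (conc k) ('D_1 (ramp_lift d^-1))) y) =
   \int[mu2]_(y in Omega v) (w y * tensor (conc k) ('D_1 ('D_1 (ramp_lift d^-1))) y).
  by apply: eq_Rintegral => y _; rewrite (derive_tensor_z y sX sL').
(* The lift has slope parameter [d^-1], so it is constant from height [-1 + d] on, hence on the
   whole graph: no vertical derivative of the weight survives on the top. *)
have Y4 : \int[mu]_(x in itvI) (v x * tensor (conc k) ('D_1 (ramp_lift d^-1)) (x, v x)) = 0.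
  transitivity (\int[mu]_(x in itvI) (0 : R)); last by rewrite Rintegral_cst// mul0r.
  apply: eq_Rintegral => x; rewrite inE => Ix.
  have [_ dl] := ramp_lift_top d0 (hd x (subset_itv_oo_cc Ix)).
  by rewrite tensorE dl !mulr0.
rewrite X1 in G1; rewrite X2 in G2; rewrite X4 Y4 oppr0 in G4.
have j1 : mu2.-integrable (Omega v) (EFin \o (fun y => tensor (conc k) (ramp_lift d^-1) y * ax y)).
  apply: (intg_eq mu2 mO (f := fun y => ax y * tensor (conc k) (ramp_lift d^-1) y)) => [y _|]; first by rewrite mulrC.
  exact: (intg_smoothM cv v0 vm1 vp1 axi sT).
have j2 : mu2.-integrable (Omega v) (EFin \o (fun y => tensor (conc k) (ramp_lift d^-1) y * bz y)).
  apply: (intg_eq mu2 mO (f := fun y => bz y * tensor (conc k) (ramp_lift d^-1) y)) => [y _|]; first by rewrite mulrC.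
  exact: (intg_smoothM cv v0 vm1 vp1 bzi sT).
have G3 : eps ^+ 2 * (\int[mu2]_(y in Omega v) (tensor (conc k) (ramp_lift d^-1) y * ax y)) +
    \int[mu2]_(y in Omega v) (tensor (conc k) (ramp_lift d^-1) y * bz y) = 0.
  rewrite -(RintegralZD (eps ^+ 2) mO j1 j2).
  transitivity (\int[mu2]_(y in Omega v) (0 : R)); last by rewrite Rintegral_cst// mul0r.
  apply: Rintegral_ae_eq => //.
  - exact: (intgD mu2 mO (intgZ mu2 mO _ j1) j2).
  - exact: (intO (smooth_cst 0)).
  - apply: (ae_imp2 abae) => y H Oy; move: (H Oy).
    move: (tensor _ _ y) (ax y) (bz y) (eps ^+ 2) => t p r e H'.
    by rewrite mulrCA -mulrDr H' mulr0.
have ranges y : Omega v y -> 0 <= conc k y.1 /\ 0 <= ramp_lift d^-1 y.2.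
  move=> [/itvIE/andP[y1 y2] /andP[y3 y4]]; split.
    have yr : -1 <= y.1 <= 1 by rewrite !ltW.
    by have /andP[] := conc_bounds k1 yr.
  by apply: ramp_lift_ge0 => //; exact: ltW.
have S1 : \int[mu2]_(y in Omega v) (w y * tensor (conc k) ('D_1 ('D_1 (ramp_lift d^-1))) y) <= 0.
  apply: Rintegral_le0 => //.
    exact: (intg_smoothM cv v0 vm1 vp1 wi (smooth_tensor sX sL'')).
  move=> y Oy; have [r1 r2] := ranges y Oy.
  by apply: mulr_ge0_le0; [exact: w_ge0|apply: mulr_ge0_le0 => //; exact: derive2_ramp_lift_le0].
have S2 : \int[mu2]_(y in Omega v) (w y * tensor ('D_1 ('D_1 (conc k))) (ramp_lift d^-1) y) <= 0.
  apply: Rintegral_le0 => //.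
    exact: (intg_smoothM cv v0 vm1 vp1 wi (smooth_tensor sX'' sL)).
  move=> y Oy; have [r1 r2] := ranges y Oy.
  by apply: mulr_ge0_le0; [exact: w_ge0|apply: mulr_le0_ge0 => //; exact: derive2_conc_le0].
exact: (flux_arith (sqr_ge0 eps) G1 G2 G3 G4 G5 S1 S2).
Qed.

(** As [k] grows, [conc k] tends to the constant [ramp 1], which factors out. The left side of the
    inequality carries [v] times the slope of [conc k], which stays bounded and is eventually 0 at
    each point. *)
Lemma top_flux_ge0 : 0 <= \int[mu]_(x in itvI) (l x - eps ^+ 2 * (v1 x * h x)).
Proof.
have [d d0 hd] := depth cv v0 vm1 vp1.
have [N N0 HN] := graph_lipschitz cv vm1 vp1 cv1 dv.
have [N1 N10 HN1] := v1_bounded cv1.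
have [_ _ _ lh] := H1_trace_L2 Ha; have [_ _ _ ll] := H1_trace_L2 Hb.
have hi := L2_intg mu mI (@mu_itvI_fin R) lh.
have li := L2_intg mu mI (@mu_itvI_fin R) ll.
have v1h := intg_bndM mu mI (v1_measurable cv1) HN1 hi.
have Fi := intgB mu mI li (intgZ mu mI (eps ^+ 2) v1h).
pose k_ n : R := n.+1%:R; have k1 n : 1 <= k_ n by rewrite ler1n.
pose P1 : R := ramp 1; have P10 : 0 < P1 := ramp1_gt0.
have top x : itvI x -> ramp_lift d^-1 (v x) = P1.
  by move=> Ix; have [] := ramp_lift_top d0 (hd x (subset_itv_oo_cc Ix)).
have mconc n : measurable_fun itvI (conc (k_ n)).
  by apply: measurable_funTS; apply: smooth_measurable; exact: smooth_conc.
have cbd n x : itvI x -> `|conc (k_ n) x| <= P1.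
  move=> /itvIE/andP[x1 x2]; have xr : -1 <= x <= 1 by rewrite !ltW.
  have /andP[c0 c1] := conc_bounds (k1 n) xr.
  by rewrite ger0_norm.
have c1 : \int[mu]_(x in itvI) (conc (k_ n) x * (l x - eps ^+ 2 * (v1 x * h x))) @[n --> \oo] -->
    \int[mu]_(x in itvI) (P1 * (l x - eps ^+ 2 * (v1 x * h x))).
  apply: (cvg_int_eventually mu mI (B := P1)) Fi => //.
  by move=> x Ix; apply: filterS (conc_eventually Ix) => n [].
have [M M0 HM] := @derive_conc_layer R.
(* Division by the Lipschitz constant [N] turns [v x] into a quantity bounded by the distance to
   either endpoint, as the layer estimate requires. *)
have vbd n x : itvI x -> `|v x * 'D_1 (conc (k_ n)) x| <= N * M.
  move=> Ix; have /itvIE/andP[x1 x2] := Ix.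
  have [g1 g2] := HN x (subset_itv_oo_cc Ix).
  have vn : `|v x| = - v x by have /andP[_ ?] := v0 Ix; rewrite ler0_norm.
  have xr : -1 <= x <= 1 by rewrite !ltW.
  have := HM (k_ n) x (N^-1 * v x) (k1 n) xr.
  rewrite normrM (gtr0_norm (x := N^-1)) ?invr_gt0// vn !ler_pdivrMl//.
  move=> /(_ g1 g2); rewrite -mulrA normrM (gtr0_norm (x := N^-1)) ?invr_gt0//.
  by rewrite ler_pdivrMl.
have v1i : mu.-integrable itvI (EFin \o (fun x => v1 x * P1)).
  apply: (intg_bndM mu mI (v1_measurable cv1) HN1).
  by apply: (intg_bnd mu mI (@mu_itvI_fin R) (M := `|P1|)).
have c2 : \int[mu]_(x in itvI) ((v x * 'D_1 (conc (k_ n)) x) * (v1 x * P1)) @[n --> \oo] -->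
    \int[mu]_(x in itvI) (0 * (v1 x * P1)).
  apply: (cvg_int_eventually mu mI (B := N * M)) v1i => //.
  - move=> n; apply: measurable_funM; first exact: v_measurable.
    by apply: measurable_funTS; apply: smooth_measurable; apply: smooth_derive; exact: smooth_conc.
  - by move=> x Ix; apply: filterS (conc_eventually Ix) => n [_ ->]; rewrite mulr0.
have z0 : \int[mu]_(x in itvI) (0 * (v1 x * P1)) = 0.
  transitivity (\int[mu]_(x in itvI) (0 : R)); last by rewrite Rintegral_cst// mul0r.
  by apply: eq_Rintegral => x _; rewrite mul0r.
rewrite z0 in c2.
have c3 := cvgM (cvg_cst (eps ^+ 2) : _ @[_ --> \oo] --> _) c2.
have c4 := cvgM (cvg_cst P1 : _ @[_ --> \oo] --> _) c1.
have le n : eps ^+ 2 * \int[mu]_(x in itvI) ((v x * 'D_1 (conc (k_ n)) x) * (v1 x * P1)) <=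
    P1 * \int[mu]_(x in itvI) (conc (k_ n) x * (l x - eps ^+ 2 * (v1 x * h x))).
  have := top_flux_step (k1 n) d0 hd.
  have -> : \int[mu]_(x in itvI) (v x * v1 x * tensor ('D_1 (conc (k_ n))) (ramp_lift d^-1) (x, v x)) =
     \int[mu]_(x in itvI) ((v x * 'D_1 (conc (k_ n)) x) * (v1 x * P1)).
    apply: eq_Rintegral => x; rewrite inE => Ix; rewrite tensorE (top x Ix).
    move: ('D_1 (conc (k_ n)) x) => p; ring.
  have cl := intg_bndM mu mI (mconc n) (cbd n) li.
  have ch := intg_bndM mu mI (mconc n) (cbd n) v1h.
  have -> : \int[mu]_(x in itvI) (tensor (conc (k_ n)) (ramp_lift d^-1) (x, v x) * l x) =
      P1 * \int[mu]_(x in itvI) (conc (k_ n) x * l x).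
    rewrite -RintegralZl//; apply: eq_Rintegral => x; rewrite inE => Ix.
    by rewrite tensorE (top x Ix); ring.
  have -> : \int[mu]_(x in itvI) (v1 x * tensor (conc (k_ n)) (ramp_lift d^-1) (x, v x) * h x) =
      P1 * \int[mu]_(x in itvI) (conc (k_ n) x * (v1 x * h x)).
    rewrite -RintegralZl//; apply: eq_Rintegral => x; rewrite inE => Ix.
    by rewrite tensorE (top x Ix); ring.
  have -> : \int[mu]_(x in itvI) (conc (k_ n) x * (l x - eps ^+ 2 * (v1 x * h x))) =
      \int[mu]_(x in itvI) (conc (k_ n) x * l x) - eps ^+ 2 * \int[mu]_(x in itvI) (conc (k_ n) x * (v1 x * h x)).
    rewrite -RintegralZl// -(RintegralB1 mI cl (intgZ mu mI (eps ^+ 2) ch)).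
    by apply: eq_Rintegral => x _; ring.
  by rewrite mulrBr (mulrCA (eps ^+ 2)).
have c3' : eps ^+ 2 * \int[mu]_(x in itvI) ((v x * 'D_1 (conc (k_ n)) x) * (v1 x * P1)) @[n --> \oo] -->
   (0 : R) by move: c3; rewrite mulr0; apply.
have c4' : P1 * \int[mu]_(x in itvI) (conc (k_ n) x * (l x - eps ^+ 2 * (v1 x * h x))) @[n --> \oo] -->
   P1 * \int[mu]_(x in itvI) (P1 * (l x - eps ^+ 2 * (v1 x * h x))) by exact: c4.
have : 0 <= P1 * \int[mu]_(x in itvI) (P1 * (l x - eps ^+ 2 * (v1 x * h x))).
  by apply: (ler_cvg_to c3' c4'); exact: nearW.
by rewrite RintegralZl// pmulr_rge0// pmulr_rge0.
Qed.

End top_flux.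

Lemma rellich_arith (R : realType) (e2 B2 A2 AB P Q S T LL HH HL : R) :
  B2 + P + P = LL -> A2 + Q + Q = HH -> AB + S + Q = - HL -> e2 * S + P = 0 -> 0 <= B2 ->
  2 * (e2 * AB) - e2 * A2 <= LL - e2 * HH - 2 * (e2 * HL).
Proof.
move=> h1 h2 h3 h4 h5.
have k2 : e2 * A2 + e2 * Q + e2 * Q = e2 * HH by rewrite -!mulrDr h2.
have k3 : e2 * AB + e2 * S + e2 * Q = - (e2 * HL) by rewrite -!mulrDr h3 mulrN.
lra.
Qed.

(** * The Rellich inequality *)

Section rellich.
Context {R : realType}.
Notation mu := (@lebesgue_measure R).
Notation mu2 := (mu \x mu)%E.
Variable v : R -> R.
Hypothesis cv : {within `[-1, 1], continuous v}.
Hypothesis v0 : forall x, itvI x -> -1 < v x <= 0.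
Hypothesis vm1 : v (-1) = 0.
Hypothesis vp1 : v 1 = 0.
Variable v1 : R -> R.
Hypothesis cv1 : {within `[-1, 1], continuous v1}.
Hypothesis dv : forall x, itvI x -> is_derive x 1 v (v1 x).
Variables (w a b ax q bz : R * R -> R) (h l : R -> R).
Hypothesis cw : {within closure (Omega v), continuous w}.
Hypothesis w_bottom : forall x, itvI x -> w (x, -1) = 0.
Hypothesis w_top : forall x, itvI x -> w (x, v x) = - v x.
Hypothesis wa : forall phi, test_function (Omega v) phi ->
  \int[mu2]_(y in Omega v) (w y * 'D_e_x phi y) = - \int[mu2]_(y in Omega v) (a y * phi y).
Hypothesis wb : forall phi, test_function (Omega v) phi ->
  \int[mu2]_(y in Omega v) (w y * 'D_e_z phi y) = - \int[mu2]_(y in Omega v) (b y * phi y).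
Hypothesis Ha : H1_trace v a ax q h.
Hypothesis Hb : H1_trace v b q bz l.
Variable eps : R.
Hypothesis e0 : 0 < eps.
Hypothesis abae : {ae mu2, forall y, Omega v y -> eps ^+ 2 * ax y + bz y = 0}.
Hypothesis w_ge0 : forall y, Omega v y -> 0 <= w y.
Variable C : R.
Hypothesis C0 : 0 < C.
Hypothesis w_sides : forall y, Omega v y -> w y <= C * (1 - y.1) /\ w y <= C * (1 + y.1).
Hypothesis w_base : forall y, Omega v y -> w y <= C * (1 + y.2).

Let mO := measurable_Omega cv.
Let muO := mu2_Omega cv v0.
Let mI := @measurable_itvI R.
Let wi := closure_intg cv v0 vm1 vp1 cw.

Lemma vertical_measurable (f : R -> R) : smooth f -> measurable_fun (Omega v) (fun y => f y.2).
Proof. by move=> sf; apply: (smooth_measurable_Omega (v := v)); exact: smooth_vertical. Qed.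

Lemma excess_smooth_L2 (k : R * R -> R) : smooth k ->
  Lp_on mu2 (Omega v) 2 (fun y => w y * k y).
Proof.
move=> sk; have [M M0 HM] := closure_bounded cv v0 vm1 vp1 cw.
apply: (L2_bndM mu2 mO (closure_measurable cv cw) (M := M)).
  by move=> y Oy; apply: HM; exact: subset_closure.
exact: (smooth_L2 cv v0 vm1 vp1).
Qed.

Lemma product_intg (k f g : R * R -> R) : smooth k ->
  Lp_on mu2 (Omega v) 2 f -> Lp_on mu2 (Omega v) 2 g ->
  mu2.-integrable (Omega v) (EFin \o (fun y => k y * f y * g y)).
Proof.
by move=> sk lf lg; apply: (L2_intgM mu2 mO) => //; exact: (L2_smoothM cv v0 vm1 vp1).
Qed.

(** For a smooth approximant of [a], its product with [k] is an admissible test function for [w];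
    then pass to the limit. The right side carries [w] in both terms, which pays for a weight [k]
    concentrated at the bottom. *)
Lemma excess_test_sqr (k : R * R -> R) : test_function (Omega v) k ->
  \int[mu2]_(y in Omega v) (k y * a y * a y) =
  - (\int[mu2]_(y in Omega v) (a y * (w y * 'D_e_x k y))) -
  \int[mu2]_(y in Omega v) (ax y * (w y * k y)).
Proof.
move=> tk; have sk := test_smooth tk; have sk' := smooth_derive (e_x : R * R) sk.
have [F_ [[la lax lq lh] sF [cF cFx _ _]]] := Ha.
have tkF n : test_function (Omega v) (fun y => k y * F_ n y).
  split; first exact: smoothM.
  by have [_ [K cK pK]] := tk; exists K => // y nK; rewrite pK// mul0r.
have sF' n := smooth_derive (e_x : R * R) (sF n).
have lka := L2_smoothM cv v0 vm1 vp1 sk la.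
have lwk := excess_smooth_L2 sk; have lwk' := excess_smooth_L2 sk'.
have lF n : Lp_on mu2 (Omega v) 2 (F_ n) by exact: (smooth_L2 cv v0 vm1 vp1).
have lF' n : Lp_on mu2 (Omega v) 2 ('D_e_x (F_ n)) by exact: (smooth_L2 cv v0 vm1 vp1).
have c1 := cvg2_intM mu2 mO lF la lwk' cF.
have c2 := cvg2_intM mu2 mO lF' lax lwk cFx.
have c3 := cvg2_intM mu2 mO lF la lka cF.
have E n : \int[mu2]_(y in Omega v) (F_ n y * (k y * a y)) =
    - (\int[mu2]_(y in Omega v) (F_ n y * (w y * 'D_e_x k y))) -
    \int[mu2]_(y in Omega v) ('D_e_x (F_ n) y * (w y * k y)).
  have X1 : \int[mu2]_(y in Omega v) (F_ n y * (k y * a y)) =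
      \int[mu2]_(y in Omega v) (a y * (k y * F_ n y)).
    by apply: eq_Rintegral => y _; rewrite mulrA mulrC (mulrC (k y)).
  rewrite X1; apply: oppr_inj; apply: (etrans (esym (wa (tkF n)))).
  rewrite opprB opprK addrC.
  have i1 := L2_intgM mu2 mO (lF n) lwk'; have i2 := L2_intgM mu2 mO (lF' n) lwk.
  rewrite -(RintegralD_plane mO i1 i2); apply: eq_Rintegral => y _.
  rewrite (derive_mul e_x y sk (sF n)).
  move: ('D_e_x (F_ n) y) ('D_e_x k y) => s t; ring.
have c4 := cvgB (cvgN c1) c2.
have -> : \int[mu2]_(y in Omega v) (k y * a y * a y) = \int[mu2]_(y in Omega v) (a y * (k y * a y)).
  by apply: eq_Rintegral => y _; rewrite mulrC.
apply: (cvg_unique _ c3) => //.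
by rewrite (funext E); exact: c4.
Qed.

(** The vertical Green formula is tested with approximants of [a]. In the result [f] is accompanied
    by [v] or [w], whose linear decay at the sides compensates the slope when [f] is the derivative
    of a lateral cutoff. *)
Lemma excess_side_product (f : R -> R) : smooth f ->
  \int[mu2]_(y in Omega v) (f y.1 * a y * b y) =
  - (\int[mu]_(x in itvI) (h x * (v x * f x))) -
  \int[mu2]_(y in Omega v) (q y * (w y * f y.1)).
Proof.
move=> sf; have sk := smooth_horizontal sf.
have [F_ [[la lax lq lh] sF [cF _ cFz ch]]] := Ha.
have [lb _ _ _] := H1_trace_L2 Hb.
have sF' n := smooth_derive (e_z : R * R) (sF n).
have lkb := L2_smoothM cv v0 vm1 vp1 sk lb.
have lwk := excess_smooth_L2 sk.
have lF n : Lp_on mu2 (Omega v) 2 (F_ n) by exact: (smooth_L2 cv v0 vm1 vp1).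
have lF' n : Lp_on mu2 (Omega v) 2 ('D_e_z (F_ n)) by exact: (smooth_L2 cv v0 vm1 vp1).
have lg n : Lp_on mu itvI 2 (fun x => F_ n (x, v x)) by exact: (smooth_graph_L2 cv v0 vm1 vp1).
have lvf : Lp_on mu itvI 2 (fun x => v x * f x).
  apply: (L2_bndM mu mI (v_measurable cv) (fun x Ix => v_le1 v0 Ix)).
  exact: (smooth_graph_L2 cv v0 vm1 vp1 sk).
have c1 := cvg2_intM mu mI lg lh lvf ch.
have c2 := cvg2_intM mu2 mO lF' lq lwk cFz.
have c3 := cvg2_intM mu2 mO lF la lkb cF.
have E n : \int[mu2]_(y in Omega v) (F_ n y * (f y.1 * b y)) =
    - (\int[mu]_(x in itvI) (F_ n (x, v x) * (v x * f x))) -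
    \int[mu2]_(y in Omega v) ('D_e_z (F_ n) y * (w y * f y.1)).
  have sfF := smoothM sk (sF n).
  have G := green_excess_z cv v0 vm1 vp1 cw w_bottom w_top lb wb sfF.
  have X1 : \int[mu2]_(y in Omega v) (b y * (f y.1 * F_ n y)) =
     \int[mu2]_(y in Omega v) (F_ n y * (f y.1 * b y)).
    by apply: eq_Rintegral => y _; ring.
  have X2 : \int[mu2]_(y in Omega v) (w y * 'D_e_z (fun y : R * R => f y.1 * F_ n y) y) =
     \int[mu2]_(y in Omega v) ('D_e_z (F_ n) y * (w y * f y.1)).
    apply: eq_Rintegral => y _; rewrite (derive_mul e_z y sk (sF n)).
    rewrite (derive_horizontal _ _ sf) /= mulr0 mulr0 addr0.
    move: ('D_e_z (F_ n) y) => s; ring.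
  have X3 : \int[mu]_(x in itvI) (v x * (f x * F_ n (x, v x))) =
     \int[mu]_(x in itvI) (F_ n (x, v x) * (v x * f x)).
    by apply: eq_Rintegral => x _; ring.
  rewrite X1 X2 X3 in G; apply/eqP; rewrite eq_sym subr_eq G//.
have c4 := cvgB (cvgN c1) c2.
have -> : \int[mu2]_(y in Omega v) (f y.1 * a y * b y) = \int[mu2]_(y in Omega v) (a y * (f y.1 * b y)).
  by apply: eq_Rintegral => y _; ring.
apply: (cvg_unique _ c3) => //.
by rewrite (funext E); exact: c4.
Qed.

(** The multiplier is the weighted [w_z]. The product formulas for [b b], [a a] and [a b] are
    combined so that the second derivatives cancel through the equation and through the shared mixed
    derivative [q]. Only weight derivatives remain inside, and the term with [Y' b^2], the flux
    through the bottom, is nonnegative and dropped. *)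
Lemma rellich_step (X Y : R -> R) : smooth X -> smooth Y -> X (-1) = 0 -> X 1 = 0 -> Y (-1) = 0 ->
  (forall x, itvI x -> Y (v x) = 1) -> (forall x, 0 <= X x) -> (forall z, 0 <= 'D_1 Y z) ->
  2 * (eps ^+ 2 * \int[mu2]_(y in Omega v) (tensor ('D_1 X) Y y * a y * b y)) -
  eps ^+ 2 * \int[mu2]_(y in Omega v) (tensor X ('D_1 Y) y * a y * a y) <=
  \int[mu]_(x in itvI) (X x * l x * l x) - eps ^+ 2 * \int[mu]_(x in itvI) (X x * h x * h x) -
  2 * (eps ^+ 2 * \int[mu]_(x in itvI) (v1 x * X x * h x * l x)).
Proof.
move=> sX sY Xm Xp Ym Y1 X0 Y0.
have sX' := smooth_derive (1 : R) sX; have sY' := smooth_derive (1 : R) sY.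
have [la lax lq lh] := H1_trace_L2 Ha; have [lb _ lbz ll] := H1_trace_L2 Hb.
have sK := smooth_tensor sX sY.
have Kb x : tensor X Y (x, -1) = 0 by rewrite tensorE Ym mulr0.
have Km z : tensor X Y (-1, z) = 0 by rewrite tensorE Xm mul0r.
have Kp z : tensor X Y (1, z) = 0 by rewrite tensorE Xp mul0r.
have G1 := green_H1_z cv v0 vm1 vp1 Hb Hb sK Kb.
have G2 := green_H1_z cv v0 vm1 vp1 Ha Ha sK Kb.
have G3 := green_H1_x cv v0 vm1 vp1 cv1 dv Ha Hb sK Km Kp.
have dz (f g : R * R -> R) : \int[mu2]_(y in Omega v) ('D_e_z (tensor X Y) y * f y * g y) =
    \int[mu2]_(y in Omega v) (tensor X ('D_1 Y) y * f y * g y).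
  by apply: eq_Rintegral => y _; rewrite (derive_tensor_z y sX sY).
have dx (f g : R * R -> R) : \int[mu2]_(y in Omega v) ('D_e_x (tensor X Y) y * f y * g y) =
    \int[mu2]_(y in Omega v) (tensor ('D_1 X) Y y * f y * g y).
  by apply: eq_Rintegral => y _; rewrite (derive_tensor_x y sX sY).
have comm (f g : R * R -> R) : \int[mu2]_(y in Omega v) (tensor X Y y * f y * g y) =
    \int[mu2]_(y in Omega v) (tensor X Y y * g y * f y).
  by apply: eq_Rintegral => y _; rewrite mulrAC.
have top (f g : R -> R) : \int[mu]_(x in itvI) (tensor X Y (x, v x) * f x * g x) =
    \int[mu]_(x in itvI) (X x * f x * g x).
  by apply: eq_Rintegral => x; rewrite inE => Ix; rewrite tensorE (Y1 x Ix) mulr1.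
have topv (f g : R -> R) : \int[mu]_(x in itvI) (v1 x * tensor X Y (x, v x) * f x * g x) =
    \int[mu]_(x in itvI) (v1 x * X x * f x * g x).
  by apply: eq_Rintegral => x; rewrite inE => Ix; rewrite tensorE (Y1 x Ix) mulr1.
rewrite dz top (comm b bz) in G1; rewrite dz top (comm a q) in G2; rewrite dx topv (comm a q) in G3.
have j1 := product_intg sK lax lb; have j2 := product_intg sK lbz lb.
have G4 : eps ^+ 2 * (\int[mu2]_(y in Omega v) (tensor X Y y * ax y * b y)) +
    \int[mu2]_(y in Omega v) (tensor X Y y * bz y * b y) = 0.
  rewrite -(RintegralZD (eps ^+ 2) mO j1 j2).
  transitivity (\int[mu2]_(y in Omega v) (0 : R)); last by rewrite Rintegral_cst// mul0r.
  apply: Rintegral_ae_eq => //.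
  - exact: (intgD mu2 mO (intgZ mu2 mO _ j1) j2).
  - exact: (smooth_integrable_Omega cv v0 vm1 vp1 (smooth_cst 0)).
  - apply: (ae_imp2 abae) => y H Oy; move: (H Oy).
    move: (tensor X Y y) (ax y) (bz y) (b y) (eps ^+ 2) => t p r s e H'.
    by rewrite mulrA mulrA (mulrC e t) -(mulrA t e p) -mulrDl -mulrDr H' mulr0 mul0r.
have G5 : 0 <= \int[mu2]_(y in Omega v) (tensor X ('D_1 Y) y * b y * b y).
  apply: Rintegral_ge0 => y _; rewrite -mulrA -expr2.
  by apply: mulr_ge0; [exact: mulr_ge0|exact: sqr_ge0].
exact: (rellich_arith (eps ^+ 2) G1 G2 G3 G4 G5).
Qed.

(** On the support of the kernel, of height at most [M / s], the barrier gives [w <= 2 C s]; the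
    product is bounded uniformly in [s]. *)
Lemma excess_base_bound : exists B : R, forall s y, 0 < s -> Omega v y ->
  `|w y * kern (-1 + s) s y.2| <= B.
Proof.
have [M M0 HM] := @kern_bounded R.
exists (2 * C * M) => s y s0 Oy; have [h1 _] := w_sides Oy.
have w1 := w_base Oy; have w0 := w_ge0 Oy.
have B0 : 0 <= 2 * C * M by rewrite !mulr_ge0// ltW.
have [z1|z1] := leP (-1 + s + s) y.2; first by rewrite (kern_out1 s0 z1) mulr0 normr0.
have ws : `|w y| <= C * (2 * s).
  by rewrite ger0_norm//; apply: (le_trans w1); rewrite ler_pM2l//; lra.
rewrite normrM; apply: (le_trans (ler_pM _ _ ws (HM (-1 + s) s y.2 s0))) => //.
have -> : C * (2 * s) * (M / s) = 2 * C * M by field; rewrite gt_eqF.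
by [].
Qed.

(** The vertical step is pushed down to the bottom. There [a] is a tangential derivative of a
    function vanishing on the bottom, and its layer term tends to 0. *)
Lemma rellich_cutoff n :
  2 * (eps ^+ 2 * \int[mu2]_(y in Omega v) ('D_1 (cutoff (layer n)) y.1 * a y * b y)) <=
  \int[mu]_(x in itvI) (cutoff (layer n) x * l x * l x) -
  eps ^+ 2 * \int[mu]_(x in itvI) (cutoff (layer n) x * h x * h x) -
  2 * (eps ^+ 2 * \int[mu]_(x in itvI) (v1 x * cutoff (layer n) x * h x * l x)).
Proof.
have rn : 0 < (layer n : R) <= 4^-1 by exact: layer_range.
have [d d0 hd] := depth cv v0 vm1 vp1.
have [la lax lq lh] := H1_trace_L2 Ha; have [lb _ lbz ll] := H1_trace_L2 Hb.
set X := cutoff (layer n).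
have sX : smooth X := smooth_cutoff _; have sX' := smooth_derive (1 : R) sX.
(* A width of at most a quarter of the least depth [d] keeps the transition zone
   [[-1 + s, -1 + 2 s]] strictly below the graph. *)
pose s_ m : R := d * layer m.
have s0 m : 0 < s_ m by rewrite mulr_gt0// layer_gt0.
have sd m : s_ m + s_ m < d.
  have h1 : s_ m <= d * 4^-1 by rewrite ler_pM2l//; exact: layer_le.
  have h2 : d * 4^-1 + d * 4^-1 < d by move: d0; lra.
  exact: le_lt_trans (lerD h1 h1) h2.
pose Y m := stp (-1 + s_ m) (s_ m).
have sY m : smooth (Y m) := smooth_stp _ _.
have dY m : 'D_1 (Y m) = kern (-1 + s_ m) (s_ m) by apply/funext => z; exact: derive_stp.
have sY' m : smooth (kern (-1 + s_ m) (s_ m)) := smooth_kern _ _.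
have near_s z : -1 < z -> \forall m \near \oo, -1 + s_ m + s_ m <= z.
  move=> z1; have p : 0 < (1 + z) / (2 * d) by rewrite divr_gt0// ?mulr_gt0//; lra.
  apply: filterS (layer_cvg p) => m; rewrite ltr_pdivlMr ?mulr_gt0// /s_ => h1.
  by apply/ltW; move: h1; lra.
have Ym m : Y m (-1) = 0 by apply: stp_out0 => //; rewrite lerDl ltW.
have Y1 m x : itvI x -> Y m (v x) = 1.
  move=> Ix; apply: stp_out1 => //.
  by move: (hd x (subset_itv_oo_cc Ix)) (sd m); lra.
have X0 x : 0 <= X x by exact: cutoff_ge0.
have Y0 m z : 0 <= 'D_1 (Y m) z by rewrite derive_stp; exact: kern_ge0.
have step m := rellich_step sX (sY m) (cutoff_m1 rn) (cutoff_p1 rn) (Ym m) (Y1 m) X0 (Y0 m).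
have tK m : test_function (Omega v) (tensor X (kern (-1 + s_ m) (s_ m))).
  split; first exact: smooth_tensor.
  have [_ [K [cK KI] XK]] : test_function itvI X.
    apply: test_stpB; first exact: layer_gt0.
      by move: rn => /andP[_]; lra.
    move=> x; rewrite /= in_itv/= => /andP[x1 x2]; apply/itvIE.
    by move: rn x1 x2 => /andP[r0 r1]; lra.
  exists (K `*` `[-1 + s_ m, -1 + s_ m + s_ m]%classic); last first.
    move=> [x z] /= /not_andP[nK|nz]; rewrite tensorE; first by rewrite XK ?mul0r.
    by rewrite kern_eq0 ?mulr0.
  split; first by apply: compact_setX => //; exact: segment_compact.
  move=> [x z] [/= /KI Ix]; rewrite in_itv/= => /andP[z1 z2]; split => //=.
  move: (hd x (subset_itv_oo_cc Ix)) (sd m) (s0 m) z1 z2 => h1 h2 h3 h4 h5.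
  by apply/andP; split; lra.
have lwX' : mu2.-integrable (Omega v) (EFin \o (fun y => 'D_1 X y.1 * a y)).
  apply: (intg_eq mu2 mO (f := fun y => a y * 'D_1 X y.1)) => [y _|]; first by rewrite mulrC.
  exact: (intg_smoothM cv v0 vm1 vp1 (L2_intg mu2 mO muO la) (smooth_horizontal sX')).
have lwX : mu2.-integrable (Omega v) (EFin \o (fun y => X y.1 * ax y)).
  apply: (intg_eq mu2 mO (f := fun y => ax y * X y.1)) => [y _|]; first by rewrite mulrC.
  exact: (intg_smoothM cv v0 vm1 vp1 (L2_intg mu2 mO muO lax) (smooth_horizontal sX)).
have [B HB] := excess_base_bound.
have mwk m : measurable_fun (Omega v) (fun y => w y * kern (-1 + s_ m) (s_ m) y.2).
  apply: measurable_funM; first exact: (closure_measurable cv cw).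
  exact: (vertical_measurable (sY' m)).
have van m y : Omega v y -> -1 + s_ m + s_ m <= y.2 -> w y * kern (-1 + s_ m) (s_ m) y.2 = 0.
  by move=> _ hm; rewrite kern_out1// mulr0.
have zero2 (F : R * R -> R) : \int[mu2]_(y in Omega v) (0 * F y) = 0.
  transitivity (\int[mu2]_(y in Omega v) (0 : R)); last by rewrite Rintegral_cst// mul0r.
  by apply: eq_Rintegral => y _; rewrite mul0r.
have lim0 (F : R * R -> R) : mu2.-integrable (Omega v) (EFin \o F) ->
    \int[mu2]_(y in Omega v) ((w y * kern (-1 + s_ m) (s_ m) y.2) * F y) @[m --> \oo] --> (0 : R).
  move=> Fi; rewrite -(zero2 F).
  apply: (cvg_int_eventually mu2 mO (B := B) (K := fun=> 0) mwk _ _ _ Fi).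
  - exact: measurable_cst.
  - by move=> m y Oy; apply: HB.
  - move=> y Oy; have [_ /andP[y1 _]] := Oy.
    by apply: filterS (near_s _ y1) => m hm; exact: van.
(* Written with [excess_test_sqr], both terms contain [w] times the vertical kernel, bounded by the
   bottom barrier and eventually 0 at each point. *)
have A0 : \int[mu2]_(y in Omega v) (tensor X ('D_1 (Y m)) y * a y * a y) @[m --> \oo] --> (0 : R).
  have E m : \int[mu2]_(y in Omega v) (tensor X ('D_1 (Y m)) y * a y * a y) =
      - (\int[mu2]_(y in Omega v) ((w y * kern (-1 + s_ m) (s_ m) y.2) * ('D_1 X y.1 * a y))) -
      \int[mu2]_(y in Omega v) ((w y * kern (-1 + s_ m) (s_ m) y.2) * (X y.1 * ax y)).
    rewrite dY (excess_test_sqr (tK m)); congr (- _ - _); apply: eq_Rintegral => y _.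
      rewrite (derive_tensor_x y sX (sY' m)) /tensor.
      have EE (p q' r s : R) : p * (q' * (r * s)) = q' * s * (r * p) by ring.
      exact: EE.
    rewrite /tensor.
    have EE (p q' r s : R) : p * (q' * (r * s)) = q' * s * (r * p) by ring.
    exact: EE.
  rewrite (funext E).
  have := cvgB (cvgN (lim0 _ lwX')) (lim0 _ lwX).
  by rewrite !oppr0 addr0; apply.
have Fi := product_intg (smooth_horizontal sX') la lb.
have A1 : \int[mu2]_(y in Omega v) (Y m y.2 * ('D_1 X y.1 * a y * b y)) @[m --> \oo] -->
    \int[mu2]_(y in Omega v) (1 * ('D_1 X y.1 * a y * b y)).
  apply: (cvg_int_eventually mu2 mO (B := 1) (K := fun=> 1) _ _ _ _ Fi).
  - by move=> m; exact: (vertical_measurable (sY m)).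
  - exact: measurable_cst.
  - by move=> m y _; rewrite ger0_norm ?stp_ge0// stp_le1.
  - move=> y [_ /andP[y1 _]]; apply: filterS (near_s _ y1) => m hm.
    by rewrite /Y stp_out1.
have A1' : \int[mu2]_(y in Omega v) (tensor ('D_1 X) (Y m) y * a y * b y) @[m --> \oo] -->
    \int[mu2]_(y in Omega v) ('D_1 X y.1 * a y * b y).
  have E m : \int[mu2]_(y in Omega v) (tensor ('D_1 X) (Y m) y * a y * b y) =
      \int[mu2]_(y in Omega v) (Y m y.2 * ('D_1 X y.1 * a y * b y)).
    have EE (p q' r s : R) : p * q' * r * s = q' * (p * r * s) by ring.
    by apply: eq_Rintegral => y _; exact: EE.
  rewrite (funext E).
  have <- : \int[mu2]_(y in Omega v) (1 * ('D_1 X y.1 * a y * b y)) =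
     \int[mu2]_(y in Omega v) ('D_1 X y.1 * a y * b y).
    by apply: eq_Rintegral => y _; rewrite mul1r.
  exact: A1.
have c1 : 2 * (eps ^+ 2 * \int[mu2]_(y in Omega v) (tensor ('D_1 X) (Y m) y * a y * b y)) -
  eps ^+ 2 * \int[mu2]_(y in Omega v) (tensor X ('D_1 (Y m)) y * a y * a y) @[m --> \oo] -->
  2 * (eps ^+ 2 * \int[mu2]_(y in Omega v) ('D_1 X y.1 * a y * b y)) - eps ^+ 2 * 0.
  apply: cvgB; last by apply: cvgM => //; exact: cvg_cst.
  apply: cvgM; first exact: cvg_cst.
  by apply: cvgM => //; exact: cvg_cst.
rewrite mulr0 subr0 in c1.
set T := (X in _ <= X).
have cT : (fun _ : nat => T) m @[m --> \oo] --> T by exact: cvg_cst.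
by apply: (ler_cvg_to c1 cT); exact: nearW.
Qed.

(** The lateral cutoff now tends to 1; the interior term left over is [a b] against its slope, and
    it vanishes in the limit because of the linear decay at the sides. *)
Lemma rellich_top : 0 <= \int[mu]_(x in itvI)
  (l x * l x - eps ^+ 2 * (h x * h x) - 2 * (eps ^+ 2 * (v1 x * h x * l x))).
Proof.
have [N N0 HN] := graph_lipschitz cv vm1 vp1 cv1 dv.
have [N1 N10 HN1] := v1_bounded cv1.
have [la lax lq lh] := H1_trace_L2 Ha; have [lb _ lbz ll] := H1_trace_L2 Hb.
have hi := L2_intg mu mI (@mu_itvI_fin R) lh; have qi := L2_intg mu2 mO muO lq.
have lli := L2_intgM mu mI ll ll; have hhi := L2_intgM mu mI lh lh.
have hli := L2_intgM mu mI (L2_bndM mu mI (v1_measurable cv1) HN1 lh) ll.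
have mX n : measurable_fun itvI (cutoff (layer n)).
  by apply: measurable_funTS; apply: smooth_measurable; exact: smooth_cutoff.
have top (F : R -> R) : mu.-integrable itvI (EFin \o F) ->
    \int[mu]_(x in itvI) (cutoff (layer n) x * F x) @[n --> \oo] --> \int[mu]_(x in itvI) F x.
  move=> Fi; have <- : \int[mu]_(x in itvI) (1 * F x) = \int[mu]_(x in itvI) F x.
    by apply: eq_Rintegral => x _; rewrite mul1r.
  apply: (cvg_int_eventually mu mI (B := 1) (K_ := fun n => cutoff (layer n)) (K := fun=> 1) _ _ _ _ Fi).
  - exact: mX.
  - exact: measurable_cst.
  - by move=> n x _; exact: cutoff_abs_le1.
  - by move=> x Ix; apply: filterS (cutoff_eventually Ix) => n [].
have zero1 (F : R -> R) : \int[mu]_(x in itvI) (0 * F x) = 0.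
  transitivity (\int[mu]_(x in itvI) (0 : R)); last by rewrite Rintegral_cst// mul0r.
  by apply: eq_Rintegral => y _; rewrite mul0r.
have zero2 (F : R * R -> R) : \int[mu2]_(y in Omega v) (0 * F y) = 0.
  transitivity (\int[mu2]_(y in Omega v) (0 : R)); last by rewrite Rintegral_cst// mul0r.
  by apply: eq_Rintegral => y _; rewrite mul0r.
have sX' n : smooth ('D_1 (cutoff (layer n)) : R -> R) := smooth_derive (1 : R) (@smooth_cutoff R (layer n)).
have c1 : \int[mu]_(x in itvI) ((v x * 'D_1 (cutoff (layer n)) x) * h x) @[n --> \oo] --> (0 : R).
  rewrite -(zero1 h); have [M M0 HM] := @derive_cutoff_bounded R.
  apply: (cvg_int_eventually mu mI (B := 2 * N * M) (K := fun=> 0) _ _ _ _ hi).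
  - move=> n; apply: measurable_funM; first exact: v_measurable.
    by apply: measurable_funTS; apply: smooth_measurable; exact: sX'.
  - exact: measurable_cst.
  - move=> n x Ix; have [g1 g2] := HN x (subset_itv_oo_cc Ix).
    have vn : `|v x| = - v x by have /andP[_ ?] := v0 Ix; rewrite ler0_norm.
    apply: side_layer_bound => //; rewrite ?vn ?(ltW M0)//; first exact: layer_range.
    by apply: HM; exact: layer_gt0.
  - by move=> x Ix; apply: filterS (cutoff_eventually Ix) => n [_ ->]; rewrite mulr0.
have [B HB] := excess_cut_bound w_ge0 C0 w_sides.
have c2 : \int[mu2]_(y in Omega v) ((w y * 'D_1 (cutoff (layer n)) y.1) * q y) @[n --> \oo] --> (0 : R).
  rewrite -(zero2 q).
  apply: (cvg_int_eventually mu2 mO (B := B) (K := fun=> 0) _ _ HB _ qi).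
  - move=> n; apply: measurable_funM; first exact: (closure_measurable cv cw).
    exact: (horizontal_measurable (sX' n)).
  - exact: measurable_cst.
  - by move=> y [Iy _]; apply: filterS (cutoff_eventually Iy) => n [_ ->]; rewrite mulr0.
(* Neither [a] nor [b] has a pointwise bound near the sides; [excess_side_product] trades their
   product for [v] and [w], which do decay there. *)
have c3 : \int[mu2]_(y in Omega v) ('D_1 (cutoff (layer n)) y.1 * a y * b y) @[n --> \oo] --> (0 : R).
  have E n : \int[mu2]_(y in Omega v) ('D_1 (cutoff (layer n)) y.1 * a y * b y) =
     - (\int[mu]_(x in itvI) ((v x * 'D_1 (cutoff (layer n)) x) * h x)) -
     \int[mu2]_(y in Omega v) ((w y * 'D_1 (cutoff (layer n)) y.1) * q y).
    rewrite (excess_side_product (sX' n)); congr (- _ - _).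
      by apply: eq_Rintegral => x _; rewrite mulrC.
    by apply: eq_Rintegral => y _; rewrite mulrC.
  rewrite (funext E); have := cvgB (cvgN c1) c2.
  by rewrite !oppr0 addr0; apply.
have c4 : 2 * (eps ^+ 2 * \int[mu2]_(y in Omega v) ('D_1 (cutoff (layer n)) y.1 * a y * b y))
   @[n --> \oo] --> 2 * (eps ^+ 2 * 0).
  apply: cvgM; first exact: cvg_cst.
  by apply: cvgM => //; exact: cvg_cst.
have c5 : \int[mu]_(x in itvI) (cutoff (layer n) x * l x * l x) -
  eps ^+ 2 * \int[mu]_(x in itvI) (cutoff (layer n) x * h x * h x) -
  2 * (eps ^+ 2 * \int[mu]_(x in itvI) (v1 x * cutoff (layer n) x * h x * l x)) @[n --> \oo] -->
  \int[mu]_(x in itvI) (l x * l x) - eps ^+ 2 * \int[mu]_(x in itvI) (h x * h x) -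
  2 * (eps ^+ 2 * \int[mu]_(x in itvI) (v1 x * h x * l x)).
  apply: cvgB; first apply: cvgB.
  - have E n : \int[mu]_(x in itvI) (cutoff (layer n) x * l x * l x) =
      \int[mu]_(x in itvI) (cutoff (layer n) x * (l x * l x)).
      by apply: eq_Rintegral => x _; rewrite mulrA.
    by rewrite (funext E); exact: top.
  - apply: cvgM; first exact: cvg_cst.
    have E n : \int[mu]_(x in itvI) (cutoff (layer n) x * h x * h x) =
      \int[mu]_(x in itvI) (cutoff (layer n) x * (h x * h x)).
      by apply: eq_Rintegral => x _; rewrite mulrA.
    by rewrite (funext E); exact: top.
  - apply: cvgM; first exact: cvg_cst.
    apply: cvgM; first exact: cvg_cst.
    have E n : \int[mu]_(x in itvI) (v1 x * cutoff (layer n) x * h x * l x) =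
      \int[mu]_(x in itvI) (cutoff (layer n) x * (v1 x * h x * l x)).
      by apply: eq_Rintegral => x _; ring.
    by rewrite (funext E); exact: top.
have k1 := intgZ mu mI (eps ^+ 2) hhi; have k2 := intgZ mu mI 2 (intgZ mu mI (eps ^+ 2) hli).
rewrite (RintegralB1 mI (intgB mu mI lli k1) k2) (RintegralB1 mI lli k1).
have E1 : \int[mu]_(x in itvI) (eps ^+ 2 * (h x * h x)) = eps ^+ 2 * \int[mu]_(x in itvI) (h x * h x).
  by rewrite RintegralZl.
have E2 : \int[mu]_(x in itvI) (2 * (eps ^+ 2 * (v1 x * h x * l x))) =
    2 * (eps ^+ 2 * \int[mu]_(x in itvI) (v1 x * h x * l x)).
  by rewrite !RintegralZl//; exact: (intgZ mu mI).
rewrite !mulr0 in c4; rewrite E1 E2.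
by apply: (ler_cvg_to c4 c5); apply: nearW => n; exact: rellich_cutoff.
Qed.

End rellich.

(** * Evolution of the mass *)

Section static_bound.
Context {R : realType}.
Notation mu := (@lebesgue_measure R).
Notation mu2 := (mu \x mu)%E.

Lemma top_gradient_bound (q eps : R) (v : R -> R) (psi : R * R -> R) (hx hz : R -> R) :
  1 <= q -> 0 < eps -> W2 q v -> v (-1) = 0 -> v 1 = 0 ->
  (forall x, itvI x -> -1 < v x <= 0) ->
  elliptic_solution eps v psi -> top_grad_trace v psi hx hz ->
  mu.-integrable itvI (EFin \o (fun x => eps ^+ 2 * hx x ^+ 2 + hz x ^+ 2)) /\
  2 <= \int[mu]_(x in itvI) (eps ^+ 2 * hx x ^+ 2 + hz x ^+ 2).
Proof.
move=> q1 e0 W vm1 vp1 v0 epsi tr.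
have mI := @measurable_itvI R.
have cv : {within `[-1, 1], continuous v} by case: W.
have [v1 [cv1 dv _]] := W2_C1 q1 W.
have [a [b [ax [qq [bz [Ha Hb wa wb abae]]]]]] :=
  excess_H1_traces cv v0 vm1 vp1 cv1 dv epsi tr.
have cw := excess_continuous epsi.
have wbt : forall x, itvI x -> excess psi (x, -1) = 0.
  move=> x Ix; rewrite (excess_bdy cv v0 vm1 vp1 epsi).
  - by rewrite /= subrr mul0r mulr0.
  - by apply: (closure_Omega_vert v0) => //; have /andP[/ltW -> _] := v0 x Ix; rewrite lexx.
  - by move=> [_ /=]; rewrite ltxx.
have wtp : forall x, itvI x -> excess psi (x, v x) = - v x.
  move=> x Ix; have /andP[vx _] := v0 x Ix.
  rewrite (excess_bdy cv v0 vm1 vp1 epsi).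
  - by rewrite /= divff ?mulr1// gt_eqF//; lra.
  - by apply: (closure_Omega_vert v0) => //; rewrite (ltW vx) lexx.
  - by move=> [_ /=]; rewrite ltxx andbF.
have w0 := excess_ge0 cv v0 vm1 vp1 cv1 dv e0 epsi.
have [C C0 HC] := excess_barriers cv v0 vm1 vp1 cv1 dv e0 epsi.
have wsd y : Omega v y -> excess psi y <= C * (1 - y.1) /\ excess psi y <= C * (1 + y.1).
  by move=> /HC[_ ? ?].
have wbs y : Omega v y -> excess psi y <= C * (1 + y.2) by move=> /HC[].
have tang := tangential_trace cv v0 vm1 vp1 cv1 dv cw wbt wtp wa wb Ha Hb.
have flux := top_flux_ge0 cv v0 vm1 vp1 cv1 dv cw wbt wtp wa wb Ha Hb abae w0 C0 wsd.
have rell := rellich_top cv v0 vm1 vp1 cv1 dv cw wbt wtp wa wb Ha Hb abae w0 C0 wsd wbs.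
have [_ _ _ lh] := H1_trace_L2 Ha; have [_ _ _ ll] := H1_trace_L2 Hb.
pose l x := hz x - 1; rewrite -/l in ll.
have [N N0 HN] := v1_bounded cv1.
have hi := L2_intg mu mI (@mu_itvI_fin R) lh; have li := L2_intg mu mI (@mu_itvI_fin R) ll.
have lli := L2_intgM mu mI ll ll; have hhi := L2_intgM mu mI lh lh.
have hli := L2_intgM mu mI (L2_bndM mu mI (v1_measurable cv1) HN lh) ll.
have onei : mu.-integrable itvI (EFin \o (fun=> 1 : R)).
  by apply: (intg_bnd mu mI (@mu_itvI_fin R) (M := 1)) => // x _; rewrite normr1.
(* [Fr] is the integrand of the Rellich inequality and [Ff] that of the flux inequality, both with
   [l = hz - 1]. *)
pose Fr x := l x * l x - eps ^+ 2 * (hx x * hx x) - 2 * (eps ^+ 2 * (v1 x * hx x * l x)).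
pose Ff x := l x - eps ^+ 2 * (v1 x * hx x).
have Fri : mu.-integrable itvI (EFin \o Fr).
  exact: (intgB mu mI (intgB mu mI lli (intgZ mu mI _ hhi)) (intgZ mu mI 2 (intgZ mu mI _ hli))).
have Ffi : mu.-integrable itvI (EFin \o Ff).
  by apply: (intgB mu mI li); apply: (intgZ mu mI); exact: (intg_bndM mu mI (v1_measurable cv1) HN hi).
have Ti : mu.-integrable itvI (EFin \o (fun x => eps ^+ 2 * hx x ^+ 2 + hz x ^+ 2)).
  apply: (intg_eq mu mI (f := fun x => eps ^+ 2 * (hx x * hx x) + ((l x * l x + 2 * l x) + 1))).
    by move=> x _; rewrite /l; ring.
  apply: (intgD mu mI); first exact: (intgZ mu mI _ hhi).
  by apply: (intgD mu mI) onei; apply: (intgD mu mI lli); exact: (intgZ mu mI).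
split=> //.
(* In [Fr + 2 Ff + 1] the terms with [v1] add up to [- 2 eps^2 v1 hx (l + 1)], which the tangential
   relation turns into [2 eps^2 hx^2]; the sum is then the integrand on the left. The constant 1
   integrates to 2, the length of the interval. *)
have -> : \int[mu]_(x in itvI) (eps ^+ 2 * hx x ^+ 2 + hz x ^+ 2) =
    \int[mu]_(x in itvI) (Fr x + (2 * Ff x + 1)).
  apply: Rintegral_ae_eq1 => //.
    by apply: (intgD mu mI Fri); apply: (intgD mu mI) onei; exact: (intgZ mu mI).
  apply: (ae_imp tang) => x Hx Ix; rewrite /Fr /Ff /l (Hx Ix); ring.
have F2 := intgZ mu mI 2 Ffi.
rewrite (RintegralD_I Fri (intgD mu mI F2 onei)) (RintegralD_I F2 onei).
have -> : \int[mu]_(x in itvI) (2 * Ff x) = 2 * \int[mu]_(x in itvI) Ff x by rewrite RintegralZl.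
have -> : \int[mu]_(x in itvI) 1 = 2 by rewrite Rintegral_cst// mul1r [X in fine X]mu_itvI.
by move: rell flux; rewrite -/(Fr _) -/(Ff _); lra.
Qed.

End static_bound.

(** * Differentiation of the mass in time *)

Section evolution.
Context {R : realType}.
Notation mu := (@lebesgue_measure R).
Notation mu2 := (mu \x mu)%E.
Let mI := @measurable_itvI R.

Lemma test_cutoff (r : R) : 0 < r <= 4^-1 -> test_function itvI (cutoff r).
Proof.
move=> /andP[r0 r1]; apply: test_stpB => //; first by lra.
by move=> x; rewrite /= in_itv/= => /andP[x1 x2]; apply/itvIE; lra.
Qed.

(** The weak derivative is tested with cutoffs tending to 1. Their derivative is a difference of two
    kernels of mass 1, one near each endpoint, and each contributes at most [B]. *)
Lemma int_weak_deriv_le (q : R) (f g : R -> R) (B : R) : 1 <= q -> weak_deriv q f g ->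
  0 <= B -> (forall x, itvI x -> `|f x| <= B) -> \int[mu]_(x in itvI) g x <= 2 * B.
Proof.
move=> q1 [lf lg fg] B0 fB.
have fi := Lp_intg mu mI (@mu_itvI_fin R) q1 lf; have gi := Lp_intg mu mI (@mu_itvI_fin R) q1 lg.
have mX n : measurable_fun itvI (cutoff (layer n) : R -> R).
  by apply: measurable_funTS; apply: smooth_measurable; exact: smooth_cutoff.
have c1 : \int[mu]_(x in itvI) (cutoff (layer n) x * g x) @[n --> \oo] --> \int[mu]_(x in itvI) (1 * g x).
  apply: (cvg_int_eventually mu mI (B := 1) (K_ := fun n => cutoff (layer n)) (K := fun=> 1) _ _ _ _ gi).
  - exact: mX.
  - exact: measurable_cst.
  - by move=> n x _; exact: cutoff_abs_le1.
  - by move=> x Ix; apply: filterS (cutoff_eventually Ix) => n [].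
have -> : \int[mu]_(x in itvI) g x = \int[mu]_(x in itvI) (1 * g x).
  by apply: eq_Rintegral => x _; rewrite mul1r.
have cT : (fun _ : nat => 2 * B) m @[m --> \oo] --> 2 * B by exact: cvg_cst.
apply: (ler_cvg_to c1 cT); apply: nearW => n.
have rn : 0 < (layer n : R) <= 4^-1 by exact: layer_range.
have /andP[r0 r1] := rn; set r : R := layer n in rn r0 r1 *.
have -> : \int[mu]_(x in itvI) (cutoff r x * g x) = - \int[mu]_(x in itvI) (f x * 'D_1 (cutoff r) x).
  by rewrite (fg _ (test_cutoff rn)) opprK; apply: eq_Rintegral => x _; rewrite mulrC.
apply: (le_trans (ler_norm _)); rewrite normrN.
have muI := @mu_itvI_fin R.
have k1 := kern_intg (-1 + r) mI muI r0; have k2 := kern_intg (1 - 2 * r) mI muI r0.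
have [M M0 HM] := @derive_cutoff_bounded R.
have sX' := smooth_derive (1 : R) (@smooth_cutoff R r).
have fXi : mu.-integrable itvI (EFin \o (fun x => f x * 'D_1 (cutoff r) x)).
  apply: (intg_eq mu mI (f := fun x => 'D_1 (cutoff r) x * f x)) => [x _|]; first by rewrite mulrC.
  apply: (intg_bndM mu mI _ (fun x _ => HM r x r0)) => //.
  by apply: measurable_funTS; exact: smooth_measurable.
apply: (le_trans (le_normr_Rintegral (mu := mu) mI fXi)).
have bi := intgD mu mI (intgZ mu mI B k1) (intgZ mu mI B k2).
apply: (@le_trans _ _ (\int[mu]_(x in itvI) (B * kern (-1 + r) r x + B * kern (1 - 2 * r) r x))).
  apply: le_Rintegral => //; first exact: (intg_norm mu fXi).
  move=> x Ix; rewrite normrM derive_cutoff -mulrDr ler_pM ?fB//.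
  by apply: (le_trans (ler_normB _ _)); rewrite (ger0_norm (kern_ge0 (-1 + r) x r0)) (ger0_norm (kern_ge0 (1 - 2 * r) x r0)) lexx.
rewrite (RintegralD_I (intgZ mu mI B k1) (intgZ mu mI B k2)).
have Z a : `[a, a + r] `<=` itvI -> mu.-integrable itvI (EFin \o kern a r) ->
    \int[mu]_(x in itvI) (B * kern a r x) = B.
  by move=> aI ki; rewrite RintegralZl// integral_kern_sub// mulr1.
have I1 : `[-1 + r, -1 + r + r] `<=` itvI.
  by move=> x; rewrite /= in_itv/= => /andP[x1 x2]; apply/itvIE; lra.
have I2 : `[1 - 2 * r, 1 - 2 * r + r] `<=` itvI.
  by move=> x; rewrite /= in_itv/= => /andP[x1 x2]; apply/itvIE; lra.
have E1 := Z _ I1 k1; have E2 := Z _ I2 k2.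
have -> : 2 * B = B + B by rewrite mulr_natl mulr2n.
by apply: lerD; [move: E1|move: E2] => /eqP; rewrite eq_le => /andP[].
Qed.

Lemma curvature_flux_bound (eps p : R) : 0 < eps ->
  `|p / Num.sqrt (1 + eps ^+ 2 * p ^+ 2)| <= eps^-1.
Proof.
move=> e0; have s0 : 0 < 1 + eps ^+ 2 * p ^+ 2.
  by rewrite ltr_wpDr// mulr_ge0// sqr_ge0.
have sq0 : 0 < Num.sqrt (1 + eps ^+ 2 * p ^+ 2) by rewrite sqrtr_gt0.
rewrite normrM (gtr0_norm (x := _^-1)) ?invr_gt0// ler_pdivrMr// ler_pdivlMl//.
have -> : eps * `|p| = Num.sqrt ((eps * p) ^+ 2) by rewrite sqrtr_sqr normrM (gtr0_norm e0).
by apply: ler_wsqrtr; rewrite exprMn lerDr.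
Qed.

Variables (q : R) (u ut : R -> R -> R).
Hypothesis q1 : 1 <= q.
Hypothesis dut : derivative_Lq q +oo%E u ut.
Hypothesis Lu : forall t, 0 <= t -> Lp_on mu itvI q (u t).
Hypothesis Lut : forall t, 0 <= t -> Lp_on mu itvI q (ut t).

(** The interval has finite length, so convergence of the difference quotients in [L_q] implies
    convergence in [L_1], hence of their integrals. *)
Lemma is_derive_mass (t : R) : 0 < t ->
  is_derive t 1 (fun s => \int[mu]_(x in itvI) u s x) (\int[mu]_(x in itvI) ut t x).
Proof.
move=> t0; have muI := @mu_itvI_fin R.
have ui s : 0 <= s -> mu.-integrable itvI (EFin \o u s).
  by move=> s0; exact: (Lp_intg mu mI muI q1 (Lu s0)).
have uti : mu.-integrable itvI (EFin \o ut t).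
  by apply: (Lp_intg mu mI muI q1); apply: Lut; exact: ltW.
have TI (s : R) : time_interval (+oo%E : \bar R) s <-> 0 <= s.
  by split => [[]//|s0]; split=> //; exact: ltry.
pose h s x := (u s x - u t x) / (s - t) - ut t x.
(* The solution lives at times [s >= 0] only; extension by 0 makes the quotient measurable for every
   [s] without changing it along the filter. *)
pose h' s x := if 0 <= s then h s x else 0.
have mh s : 0 <= s -> mu.-integrable itvI (EFin \o h s).
  move=> s0; apply: (intg_eq mu mI (f := fun x => (s - t)^-1 * (u s x - u t x) - ut t x)).
    by move=> x _; rewrite /h mulrC.
  apply: (intgB mu mI) uti; apply: (intgZ mu mI); apply: (intgB mu mI); apply: ui => //.
  exact: ltW.
have mh' s : measurable_fun itvI (h' s).
  rewrite /h'; case: (boolP (0 <= s)) => [s0|_]; last exact: measurable_cst.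
  exact: (intg_measurable mu (mh s s0)).
have nh' : norm_on mu itvI q (h' s) @[s --> within (time_interval +oo%E) t^'] --> 0%E.
  have := @dut t (proj2 (TI t) (ltW t0)); apply: cvg_trans; apply: near_eq_cvg.
  have : \forall s \near within (time_interval +oo%E) t^', time_interval +oo%E s.
    exact: withinT.
  by apply: filterS => s /TI s0; rewrite /h' s0.
have FF : Filter (within (time_interval +oo%E) t^') by exact: within_filter.
have key e : 0 < e -> \forall s \near t^', 0 <= s ->
    `|\int[mu]_(x in itvI) ut t x -
      (\int[mu]_(x in itvI) u s x - \int[mu]_(x in itvI) u t x) / (s - t)| <= e.
  move=> e0; have := cvg_norm_on1 mu mI muI q1 mh' nh' e0.
  move=> /(_ FF) H; have H' : \forall s \near t^', time_interval +oo%E s ->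
      \int[mu]_(x in itvI) `|h' s x| <= e := H.
  apply: filterS H' => s Hs s0; have := Hs ((TI s).2 s0); apply: le_trans.
  have -> : \int[mu]_(x in itvI) `|h' s x| = \int[mu]_(x in itvI) `|h s x|.
    by apply: eq_Rintegral => x _; rewrite /h' s0.
  have hE : \int[mu]_(x in itvI) h s x =
      (\int[mu]_(x in itvI) u s x - \int[mu]_(x in itvI) u t x) / (s - t) - \int[mu]_(x in itvI) ut t x.
    have ii := intgB mu mI (ui s s0) (ui t (ltW t0)).
    have Z : \int[mu]_(x in itvI) ((u s x - u t x) / (s - t)) =
        (\int[mu]_(x in itvI) (u s x - u t x)) / (s - t) by rewrite RintegralZr.
    rewrite -(RintegralB1 mI (ui s s0) (ui t (ltW t0))) -Z -RintegralB1//.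
    apply: (intg_eq mu mI (f := fun x => (s - t)^-1 * (u s x - u t x))) => [x _|]; first by rewrite mulrC.
    exact: (intgZ mu mI).
  rewrite distrC -hE; apply: (le_normr_Rintegral (mu := mu)) => //; exact: mh.
have lim : (fun d : R => d^-1 *: ((\int[mu]_(x in itvI) u (d *: 1 + t) x) -
    \int[mu]_(x in itvI) u t x)) @ (0 : R)^' --> \int[mu]_(x in itvI) ut t x.
  apply/cvgrPdist_le => e e0.
  have := key e e0; rewrite !near_withinE => K.
  have sh : (fun d : R => d + t) @ (0 : R) --> t.
    by rewrite -[X in _ --> X]add0r; apply: cvgD; [exact: cvg_id|exact: cvg_cst].
  have K2 := sh _ K; have P2 : \forall d \near (0 : R), 0 < d + t by exact: (cvgr_gt t sh).
  suff : \forall d \near (0 : R), d != 0 -> `|\int[mu]_(x in itvI) ut t x -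
      d^-1 *: (\int[mu]_(x in itvI) u (d *: 1 + t) x - \int[mu]_(x in itvI) u t x)| <= e by exact: id.
  near=> d => d0; have Kd : d + t != t -> 0 <= d + t ->
      `|\int[mu]_(x in itvI) ut t x - (\int[mu]_(x in itvI) u (d + t) x -
         \int[mu]_(x in itvI) u t x) / (d + t - t)| <= e by near: d; exact: K2.
  have Pd : 0 < d + t by near: d; exact: P2.
  have dt : d + t != t by rewrite -subr_eq0 addrK.
  have := Kd dt (ltW Pd); rewrite addrK /GRing.scale/= mulr1 (mulrC d^-1).
  by [].
have cv : cvg ((fun d : R => d^-1 *: ((\int[mu]_(x in itvI) u (d *: 1 + t) x) -
    \int[mu]_(x in itvI) u t x)) @ (0 : R)^') by apply/cvg_ex; exists (\int[mu]_(x in itvI) ut t x).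
by split => //; apply: cvg_lim.
Unshelve. all: end_near. Qed.

End evolution.

Section conclusion.
Context {R : realType}.
Notation mu := (@lebesgue_measure R).

Lemma no_global_solution (q eps lam : R) (u0 : R -> R)
    (u : R -> R -> R) (psi : R -> R * R -> R) :
  2 < q -> 0 < eps -> 1 / eps < lam -> ~ is_solution q eps lam u0 +oo%E u psi.
Proof.
move=> q2 e0 lam_gt sol.
have [S1 [_ [S3 [ut [ux [uxx [[cu [dut cut']] wux _ S4]]]]]]] := sol.
have q1 : 1 <= q by lra.
have mI := @measurable_itvI R; have muI := @mu_itvI_fin R.
have TI s : 0 <= s -> time_interval (+oo%E : \bar R) s by move=> s0; split=> //; exact: ltry.
have Lu t : 0 <= t -> Lp_on mu itvI q (u t) by move=> /TI t0; have [] := cu t t0.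
have Lut t : 0 <= t -> Lp_on mu itvI q (ut t) by move=> /TI t0; have [] := cut' t t0.
have dm := is_derive_mass q1 dut Lu Lut.
pose m t := \int[mu]_(x in itvI) u t x.
have ib : eps^-1 < lam by move: lam_gt; rewrite mul1r.
have lam0 : 0 < lam by apply: lt_trans ib; rewrite invr_gt0.
(* Twice [lam] is the least effect of the top gradient, twice [1 / eps] the largest effect of the
   curvature flux, counted once at each endpoint. *)
pose c := 2 * (lam - eps^-1); have c0 : 0 < c by rewrite mulr_gt0// subr_gt0.
have slope t : 0 < t -> \int[mu]_(x in itvI) ut t x <= - c.
  move=> t0; have tT := TI t (ltW t0).
  have [flux' [hx [hz [wf tr ae]]]] := S4 t t0 tT.
  have [W v0 epsi] := S1 t tT; have [vm vp] := S3 t t0 tT.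
  have [Gi G2] := top_gradient_bound q1 e0 W vm vp v0 epsi tr.
  have B := int_weak_deriv_le q1 wf (ltW (etrans (invr_gt0 eps) e0))
    (fun x _ => curvature_flux_bound (ux t x) e0).
  have [_ lf _] := wf; have fi := Lp_intg mu mI muI q1 lf.
  have -> : \int[mu]_(x in itvI) ut t x =
      \int[mu]_(x in itvI) (flux' x + - lam * (eps ^+ 2 * hx x ^+ 2 + hz x ^+ 2)).
    apply: Rintegral_ae_eq1 => //.
    - exact: (Lp_intg mu mI muI q1 (Lut t (ltW t0))).
    - exact: (intgD mu mI fi (intgZ mu mI _ Gi)).
    - by apply: (ae_imp ae) => x Hx Ix; rewrite -(Hx Ix) addrC subrK.
  rewrite (RintegralD_I fi (intgZ mu mI _ Gi)).
  have -> : \int[mu]_(x in itvI) (- lam * (eps ^+ 2 * hx x ^+ 2 + hz x ^+ 2)) =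
      - lam * \int[mu]_(x in itvI) (eps ^+ 2 * hx x ^+ 2 + hz x ^+ 2) by rewrite RintegralZl.
  set G := \int[mu]_(x in itvI) (eps ^+ 2 * hx x ^+ 2 + hz x ^+ 2) in G2 *.
  have : lam * 2 <= lam * G by rewrite ler_pM2l.
  by rewrite /c; lra.
have mlow t : 0 <= t -> -2 <= m t <= 0.
  move=> t0; have [_ v0 _] := S1 t (TI t t0); have ui := Lp_intg mu mI muI q1 (Lu t t0).
  have ci (k : R) : mu.-integrable itvI (EFin \o (fun=> k)).
    by apply: (intg_bnd mu mI muI (M := `|k|)).
  have Ik (k : R) : \int[mu]_(x in itvI) k = k * 2.
    by rewrite Rintegral_cst// [X in fine X]mu_itvI.
  apply/andP; split.
    have -> : -2 = \int[mu]_(x in itvI) (-1 : R) by rewrite Ik mulN1r.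
    by apply: le_Rintegral => // x /v0/andP[/ltW].
  have -> : 0 = \int[mu]_(x in itvI) (0 : R) by rewrite Ik mul0r.
  by apply: le_Rintegral => // x /v0/andP[].
(* Over a time [3 / c] the mass drops by at least 3, more than the length 2 of the interval
   [[-2, 0]] that confines it. The clock starts at 1 because the equation holds for positive
   times. *)
pose t1 := 1 + 3 / c.
have t11 : 1 < t1 by rewrite ltrDl divr_gt0.
have dm1 (s : R) : s \in `]1, t1[ -> is_derive s 1 m (\int[mu]_(x in itvI) ut s x).
  by rewrite in_itv/= => /andP[s1 _]; apply: dm; apply: lt_trans s1.
have cm : {within `[1, t1], continuous m}.
  apply: derivable_within_continuous => s; rewrite in_itv/= => /andP[s1 _].
  by have [] := dm s (lt_le_trans ltr01 s1).
have [s s1 ms] := MVT t11 dm1 cm.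
have sl : \int[mu]_(x in itvI) ut s x <= - c.
  by apply: slope; move: s1; rewrite in_itv/= => /andP[s1 _]; apply: lt_trans s1.
have /andP[l1 _] := mlow t1 (ltW (lt_trans ltr01 t11)).
have /andP[_ l2] := mlow 1 ler01.
have tc : (t1 - 1) * c = 3 by rewrite /t1 addrAC subrr add0r divfK// gt_eqF.
have : m t1 - m 1 <= - c * (t1 - 1) by rewrite ms ler_wpM2r// subr_ge0 ltW.
rewrite mulNr (mulrC c) tc; lra.
Qed.

End conclusion.

Theorem theorem3 (R : realType) (q eps lam : R) (u0 : R -> R)
    (T : \bar R) (u : R -> R -> R) (psi : R -> R * R -> R) :
  2 < q -> 0 < eps ->
  W2 q u0 -> u0 (-1) = 0 -> u0 1 = 0 ->
  (forall x, itvI x -> -1 < u0 x <= 0) ->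
  1 / eps < lam ->
  is_maximal_solution q eps lam u0 T u psi ->
  (T < +oo)%E.
Proof.
move=> q2 e0 _ _ _ _ lam_gt [_ sol _]; rewrite ltey; apply/eqP => Too.
by rewrite Too in sol; exact: (no_global_solution q2 e0 lam_gt sol).
Qed.
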